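(* For $X,Y>0$ let $$S(X,Y)=\sum_{\substack{1\leq m\leq X\\ m\text{ odd}}}\ \sum_{\substack{1\leq n\leq Y\\ n\text{ odd}}}\left(\frac mn\right),$$ where $\left(\frac mn\right)$ is the Kronecker (Jacobi) symbol. For $\alpha>0$ define $$D(\alpha)=\sqrt\alpha+\alpha-\frac1{i\sqrt\pi}\int_{3/4-i\infty}^{3/4+i\infty}\left(\frac{\alpha}{2\pi}\right)^s\frac{\Gamma\!\left(s-\frac32\right)\sin\!\left(\frac{\pi s}2\right)\zeta(2s-1)}{s}\,ds.$$ Let $\epsilon>0$. Then for all sufficiently large $X,Y$, $$S(X,Y)=\frac2{\pi^2}X^{3/2}D\!\left(\frac YX\right)+O_\epsilon\!\left(XY^{1/4+\epsilon}+YX^{1/4+\epsilon}\right).$$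
   Context: $\zeta$ is the Riemann zeta function and $\Gamma$ the Gamma function. The implied constant depends only on $\epsilon$. *)

(* Defs.v *)
From Stdlib Require Import ZArith Reals Lra.
From Coquelicot Require Import Coquelicot.
From mathcomp Require Import ssreflect ssrfun ssrbool eqtype ssrnat seq div fintype bigop prime.


Definition Cexp (z : C) : C := (exp (Re z) * cos (Im z), exp (Re z) * sin (Im z))%R.

Definition Csin (z : C) : C := ((Cexp (Ci * z) - Cexp (- (Ci * z))) / (2 * Ci))%C.

(** [x ^ s] for real [x > 0], with the real logarithm of [x]. *)
Definition Rcpow (x : R) (s : C) : C := Cexp (s * RtoC (ln x))%C.

(** Euler's integral, for [0 < Re s]. *)
Definition Gamma_int (s : C) : C :=
  RInt_gen (V := C_R_CompleteNormedModule)
    (fun t : R => (Rcpow t (s - 1) * RtoC (exp (- t)))%C)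
    (at_right 0%R) (Rbar_locally p_infty).

(** [s (s + 1) ... (s + k - 1)] *)
Fixpoint Cpochhammer (s : C) (k : nat) : C :=
  match k with
  | O => 1%C
  | S k' => (Cpochhammer s k' * (s + RtoC (INR k')))%C
  end.

(** Analytic continuation of [Gamma_int] to the complement of [{0, -1, -2, ...}]
    through [Gamma (s + k) = s (s + 1) ... (s + k - 1) Gamma s], where [k] is the
    least natural number such that [0 < Re s + k]. *)
Definition Gamma (s : C) : C :=
  let k := Z.to_nat (up (- Re s)) in
  (Gamma_int (s + RtoC (INR k)) / Cpochhammer s k)%C.

(** [\sum_(1 <= n <= N) n ^ (- s) - N ^ (1 - s) / (1 - s)] at [N + 1]. *)
Definition zeta_approx (s : C) (N : nat) : C :=
  (sum_n (fun n => Rcpow (INR n.+1) (- s)) N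
   - Rcpow (INR N.+1) (1 - s) / (1 - s))%C.

(** By Euler-Maclaurin,
    [zeta s = \sum_(1 <= n <= N) n ^ (- s) - N ^ (1 - s) / (1 - s) + O (N ^ (- Re s))].
    The limit exists and is holomorphic for [0 < Re s], [s <> 1], so that there
    it is the analytic continuation of the Dirichlet series, with which it
    agrees for [1 < Re s] (lemma [zeta_Dirichlet]).  In the half-plane
    [Re s <= 0], which is not needed, the value is meaningless. *)
Definition zeta (s : C) : C :=
  Hierarchy.iota (T := C_R_CompleteNormedModule)
    (fun l => filterlim (zeta_approx s) eventually (locally l)).

Lemma Cmod_Rcpow (x : R) (s : C) : Cmod (Rcpow x s) = Rpower x (Re s).
Proof.
rewrite /Rcpow /Cexp /Cmod /Rpower /=.
set a := exp _; set b := (_ + _ * ln x)%R.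
have -> : ((a * cos b) * ((a * cos b) * 1) + (a * sin b) * ((a * sin b) * 1)
   = a ^ 2)%R.
  have := sin2_cos2 b; rewrite /Rsqr => h.
  transitivity (a^2 * (sin b * sin b + cos b * cos b))%R; [ring | rewrite h; ring].
rewrite sqrt_pow2; last by apply: Rlt_le; apply: exp_pos.
by rewrite /a; congr exp; rewrite /Re /=; ring.
Qed.

Lemma C_R_norm (z : C) : norm (z : C_R_NormedModule) = Cmod z.
Proof.
rewrite /norm /= /prod_norm /Cmod /norm /= /abs /= !Rmult_1_r.
by rewrite -!Rabs_mult !Rabs_pos_eq //; apply: Rle_0_sqr.
Qed.

Lemma zeta_Dirichlet (s l : C) : (1 < Re s)%R ->
  is_series (V := C_R_NormedModule) (fun n => Rcpow (INR n.+1) (- s)) l ->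
  zeta s = l.
Proof.
move=> s1 hl.
rewrite /zeta.
refine (iota_filterlim_locally (V := C_R_CompleteNormedModule) (F := eventually) (zeta_approx s) l _).
have h0 : filterlim (fun N => (Rcpow (INR N.+1) (1 - s) / (1 - s))%C) eventually
   (locally (zero : C_R_NormedModule)).
  apply/(filterlim_norm_zero (V := C_R_NormedModule)).
  apply: (filterlim_ext (fun N => Rpower (INR N.+1) (1 - Re s) * / Cmod (1 - s))%R).
    move=> N; rewrite C_R_norm Cmod_div ?Cmod_Rcpow //.
    by move=> /(f_equal Re); rewrite /Re /=; move: s1; rewrite /Re; lra.
  have -> : locally (0 : R) = locally (0 * / Cmod (1 - s))%R by rewrite Rmult_0_l.
  apply: (is_lim_seq_scal_r _ _ 0).
  apply: (is_lim_comp_seq (fun y => exp y) (fun N => (1 - Re s) * ln (INR N.+1))%R m_infty 0).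
  - exact: is_lim_exp_m.
  - by exists 0%N.
  have -> : m_infty = Rbar_mult (1 - Re s)%R p_infty.
    by rewrite /Rbar_mult /Rbar_mult'; case: Rle_dec => // h; exfalso; lra.
  apply: is_lim_seq_scal_l.
  apply: (is_lim_comp_seq _ _ p_infty); first exact: is_lim_ln_p.
    by exists 0%N.
  by apply/(is_lim_seq_incr_1 INR); exact: is_lim_seq_INR.
have -> : l = minus (l : C_R_NormedModule) zero by rewrite /minus opp_zero plus_zero_r.
apply: (filterlim_comp_2 _ _ _ hl (filterlim_comp _ _ _ _ _ _ _ _ h0 (filterlim_opp _))).
exact: filterlim_plus.
Qed.

(** Integral of [f] over the vertical line from [c - i oo] to [c + i oo],
    parametrized by [s = c + i t], [ds = i dt]. *)
Definition vertical_integral (c : R) (f : C -> C) : C :=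
  (Ci * RInt_gen (V := C_R_CompleteNormedModule) (fun t : R => f (c, t))
          (Rbar_locally m_infty) (Rbar_locally p_infty))%C.

Definition D_integrand (alpha : R) (s : C) : C :=
  (Rcpow (alpha / (2 * PI)) s
   * (Gamma (s - 3 / 2) * Csin (RtoC PI * s / 2) * zeta (2 * s - 1) / s))%C.

Definition Dfun (alpha : R) : C :=
  (RtoC (sqrt alpha) + RtoC alpha
   - 1 / (Ci * RtoC (sqrt PI)) * vertical_integral (3 / 4) (D_integrand alpha))%C.

Definition legendre (m p : nat) : Z :=
  if (p %| m)%N then 0%Z
  else if [exists x : 'I_p, x ^ 2 == m %[mod p]]%N then 1%Z else (-1)%Z.

(** For odd [n >= 1] the Kronecker symbol is the Jacobi symbol; the value for
    even [n] is not used. *)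
Definition jacobi (m n : nat) : Z :=
  (\big[Z.mul/1]_(p <- primes n) (legendre m p ^ Z.of_nat (logn p n)))%Z.

Definition floorn (x : R) : nat := Z.to_nat (Int_part x).

Definition S_sum (X Y : R) : Z :=
  \big[Z.add/0%Z]_(1 <= m < (floorn X).+1 | odd m)
    \big[Z.add/0%Z]_(1 <= n < (floorn Y).+1 | odd n) jacobi m n.

(* Main.v *)
(** The symbol [brk m n = \sum_(b ^ 2 | (m, n)) b * (m / b ^ 2 | n / b ^ 2)], from
    which [S] is recovered by Moebius inversion, is up to a unit its own discrete
    Fourier transform modulo [n], because of the Gauss sums.  Transforming the sum
    over [m] gives a sum of [brk k n] over frequencies [k], and reciprocity turns
    it into [brk n q] with [q] the odd part of [k].  The mean of [brk n q] over [n]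
    is nonzero only for square [q], whence the main term; a second transform,
    modulo [q], bounds the rest by phase sums to which the tests of Kusmin-Landau
    and van der Corput apply.  The main term is
    [Mmain X Y = X * sqrt Y / 4 + \sum_l (8 PI l ^ 2)^-1 *
       \int_0^Y sqrt y * WW (2 PI l ^ 2 X / y) dy], with [WW x = 1 + sin x - cos x].

    On the analytic side, rotating Euler's integral writes
    [Gamma (1/4 + i t) * sin (PI s / 2)], [s = 3/4 + i t], as the Fourier transform
    of [exp (v / 4) * sin (exp v + PI / 4)], and the factor
    [1 / (s (s - 3/2)) = - 1 / (9/16 + t ^ 2)] acts as a convolution with
    [exp (- 3/4 |v|)].  Replacing zeta by its approximants, the integral in
    [D alpha] becomes the limit of
    [\sum_(n <= N) n * Phi (alpha / n ^ 2) - \int_0^N y * Phi (alpha / y ^ 2) dy].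
    The sum is the dual part of [4 * Mmain 1 alpha], and the full integral is
    linear in [alpha]; its slope [1] follows from the growth of [Mmain], so
    [D alpha = 4 * Mmain 1 alpha], and homogeneity of [Mmain] concludes. *)
From HB Require Import structures.
Require Import Defs.
From Stdlib Require Import ZArith Reals Lra Lia Psatz.
From Coquelicot Require Import Coquelicot.
From mathcomp Require Import ssreflect ssrfun ssrbool eqtype ssrnat seq path div.
From mathcomp Require Import choice fintype tuple finfun bigop prime binomial finset.
From mathcomp Require Import zify.

Set Implicit Arguments.
Unset Strict Implicit.
Unset Printing Implicit Defensive.

(** Origin of the exponent 1/4: after the transform over [m], the frequency [k] carries an amplitude
    [1 / sin (PI k / n)], which decays too slowly for the phase sums to be added up. The cutoff in
    [m] is therefore averaged over a window of length [D]; this gains a factor [n / (k D)] for large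
    [k] and costs about [Y D], against a remainder of order [Y sqrt X / D], and [D] near [X ^ (1/4)]
    balances the two. The square divisors in [brk] make the transform exact for every odd modulus;
    the Jacobi symbol alone has this property for squarefree moduli only. The resulting bound
    [Y X ^ (1/4 + d) + X Y ^ d] is not symmetric. On the analytic side there is no functional
    equation, no residue and no Stirling formula: for [Y >= X ^ 3] periodicity in [n] alone
    evaluates the double sum of [brk] as about [Y sqrt X / 4], and this fixes the term linear in
    [alpha]. The constant [2 / PI ^ 2] is a quarter of [8 / PI ^ 2], the sum of [mob b / b ^ 2] over
    odd [b]. *)

HB.instance Definition _ := Monoid.isComLaw.Build R 0%R Rplus
 (fun x y z => esym (Rplus_assoc x y z)) Rplus_comm Rplus_0_l.
HB.instance Definition _ := Monoid.isComLaw.Build R 1%R Rmult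
 (fun x y z => esym (Rmult_assoc x y z)) Rmult_comm Rmult_1_l.
HB.instance Definition _ := Monoid.isMulLaw.Build R 0%R Rmult Rmult_0_l Rmult_0_r.
HB.instance Definition _ := Monoid.isAddLaw.Build R Rmult Rplus
 (fun x y z => Rmult_plus_distr_r x y z) (fun x y z => Rmult_plus_distr_l x y z).
HB.instance Definition _ := Monoid.isComLaw.Build C (RtoC 0) Cplus
 Cplus_assoc Cplus_comm Cplus_0_l.
HB.instance Definition _ := Monoid.isComLaw.Build C (RtoC 1) Cmult
 Cmult_assoc Cmult_comm Cmult_1_l.
HB.instance Definition _ := Monoid.isMulLaw.Build C (RtoC 0) Cmult Cmult_0_l Cmult_0_r.
HB.instance Definition _ := Monoid.isAddLaw.Build C Cmult Cplus
 (fun x y z => Cmult_plus_distr_r x y z) (fun x y z => Cmult_plus_distr_l x y z).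

Notation "\sum_ ( i <- r | P ) F" := (\big[Rplus/0%R]_(i <- r | P%B) F%R) : R_scope.
Notation "\sum_ ( i <- r ) F" := (\big[Rplus/0%R]_(i <- r) F%R) : R_scope.
Notation "\sum_ ( m <= i < n | P ) F" := (\big[Rplus/0%R]_(m <= i < n | P%B) F%R) : R_scope.
Notation "\sum_ ( m <= i < n ) F" := (\big[Rplus/0%R]_(m <= i < n) F%R) : R_scope.
Notation "\sum_ ( i <- r | P ) F" := (\big[Cplus/RtoC 0]_(i <- r | P%B) F%C) : C_scope.
Notation "\sum_ ( i <- r ) F" := (\big[Cplus/RtoC 0]_(i <- r) F%C) : C_scope.
Notation "\sum_ ( m <= i < n | P ) F" := (\big[Cplus/RtoC 0]_(m <= i < n | P%B) F%C) : C_scope.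
Notation "\sum_ ( m <= i < n ) F" := (\big[Cplus/RtoC 0]_(m <= i < n) F%C) : C_scope.

Open Scope R_scope.

Ltac lmul := apply: Rmult_le_compat_l; first by lra.

Ltac Ctri := apply: Rle_trans (Cmod_triangle _ _) _.

Ltac Rtri := apply: Rle_trans (Rabs_triang _ _) _.

Ltac RIc := apply: ex_RInt_continuous.

(** * The unit circle and finite sums *)

Definition cis (x : R) : C := (cos x, sin x).

Lemma cisD x y : cis (x + y) = (cis x * cis y)%C.
Proof. by rewrite /cis /Cmult /= cos_plus sin_plus; congr pair; ring. Qed.

Lemma cis0 : cis 0 = RtoC 1.
Proof. by rewrite /cis cos_0 sin_0. Qed.

Lemma cisN x : cis (- x) = Cconj (cis x).
Proof. by rewrite /cis /Cconj cos_neg sin_neg. Qed.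

Lemma Cmod_cis x : Cmod (cis x) = 1.
Proof.
rewrite /Cmod /cis /= !Rmult_1_r.
have := sin2_cos2 x; rewrite /Rsqr Rplus_comm => ->.
exact: sqrt_1.
Qed.

Lemma cisNr x : (cis x * cis (- x))%C = RtoC 1.
Proof. by rewrite -cisD Rplus_opp_r cis0. Qed.

Lemma Cmod_Cconj z : Cmod (Cconj z) = Cmod z.
Proof. by rewrite /Cmod /Cconj /=; congr sqrt; ring. Qed.

Lemma cis_2PI_nat (n : nat) : cis (2 * PI * INR n) = RtoC 1.
Proof.
elim: n => [|n IH]; first by rewrite Rmult_0_r cis0.
rewrite S_INR Rmult_plus_distr_l cisD IH Rmult_1_r.
by rewrite /cis cos_2PI sin_2PI Cmult_1_l.
Qed.

Lemma cis_period x (n : nat) : cis (x + 2 * PI * INR n) = cis x.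
Proof. by rewrite cisD cis_2PI_nat Cmult_1_r. Qed.

Lemma Cmod_sum (I : Type) (r : seq I) (P : pred I) (F : I -> C) :
 Cmod (\big[Cplus/RtoC 0]_(i <- r | P i) F i)
  <= \big[Rplus/0]_(i <- r | P i) Cmod (F i).
Proof.
elim/big_rec2: _ => [|i y x _ H]; first by rewrite Cmod_0; lra.
by Ctri; lra.
Qed.

Lemma Rabs_sum (I : Type) (r : seq I) (P : pred I) (F : I -> R) :
 Rabs (\big[Rplus/0]_(i <- r | P i) F i)
  <= \big[Rplus/0]_(i <- r | P i) Rabs (F i).
Proof.
elim/big_rec2: _ => [|i y x _ H]; first by rewrite Rabs_R0; lra.
by Rtri; lra.
Qed.

Ltac Rsum := apply: Rle_trans (Rabs_sum _ _ _) _.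

Lemma sumR_le (I : eqType) (r : seq I) (P : pred I) (F G : I -> R) :
 (forall i, i \in r -> P i -> F i <= G i) ->
 \big[Rplus/0]_(i <- r | P i) F i <= \big[Rplus/0]_(i <- r | P i) G i.
Proof.
move=> h; rewrite big_seq_cond [X in _ <= X]big_seq_cond.
elim/big_rec2: _ => [|i y x /andP [ir Pi] H]; first by lra.
by have := h i ir Pi; lra.
Qed.

Lemma sumR_ge0 (I : eqType) (r : seq I) (P : pred I) (F : I -> R) :
 (forall i, i \in r -> P i -> 0 <= F i) -> 0 <= \big[Rplus/0]_(i <- r | P i) F i.
Proof.
move=> h; rewrite big_seq_cond.
by elim/big_rec: _ => [|i x /andP [ir Pi] H]; [lra | have := h i ir Pi; lra].
Qed.

Lemma sumR_const (I : Type) (r : seq I) (P : pred I) (c : R) :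
 \big[Rplus/0]_(i <- r | P i) c = INR (count P r) * c.
Proof.
elim: r => [|i r IH]; first by rewrite big_nil /=; ring.
rewrite big_cons IH [count P (i :: r)]/=; case: (P i) => //.
by rewrite (_ : (true + count P r)%N = (count P r).+1) // S_INR; ring.
Qed.

Lemma sumR_nat_const (a b : nat) (c : R) :
 \big[Rplus/0]_(a <= i < b) c = INR (b - a) * c.
Proof. by rewrite sumR_const count_predT size_iota. Qed.

Lemma RtoC_sum (I : Type) (r : seq I) (P : pred I) (F : I -> R) :
 RtoC (\big[Rplus/0]_(i <- r | P i) F i) = \big[Cplus/RtoC 0]_(i <- r | P i) RtoC (F i).
Proof.
elim/big_rec2: _ => // i y x _ <-.
by rewrite RtoC_plus.
Qed.

#[local] Coercion INR : nat >-> R.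

Ltac dcont := apply: ex_derive_continuous; auto_derive.

Ltac pos := by repeat first [ lra | assumption | exact: exp_pos | exact: sqrt_pos | exact: pos_INR | exact: Rabs_pos | exact: Cmod_ge_0 | exact: PI_RGT_0 | apply: sqrt_lt_R0 | apply: Rmult_lt_0_compat | apply: Rmult_le_pos | apply: Rinv_0_lt_compat | apply: Rdiv_lt_0_compat | apply: Rdiv_le_0_compat | apply: Rplus_lt_0_compat | apply: Rplus_le_le_0_compat | apply: Rlt_le ].

Ltac mon := by repeat first [ lra | assumption | pos | apply: Rmult_le_compat_l | apply: Rmult_le_compat_r | apply: Rplus_le_compat | apply: sqrt_le_1_alt | apply: Rinv_le_contravar | apply: Rmult_le_compat | nra ].

(** * Tests of Kusmin-Landau and van der Corput *)

(** This is [tan x >= x] without the division, so it stays true beyond [PI / 2]: the difference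
    vanishes at 0 and has derivative [x sin x]. *)
Lemma sin_ge_x_cos x : 0 <= x <= PI -> x * cos x <= sin x.
Proof.
move=> hx.
have [c [hc1 hc2]] : exists c, (sin x - x * cos x) - (sin 0 - 0 * cos 0) = (c * sin c) * (x - 0) /\ 0 <= c <= x.
 have [c [h1 h2]] := MVT_gen (fun u => sin u - u * cos u) 0 x _
  ltac:(by move=> u _; auto_derive => //; ring)
  ltac:(move=> u _; apply: derivable_continuous_pt; apply: ex_derive_Reals_0; auto_derive => //).
 exists c.
 by move: h1; rewrite /Rmin /Rmax; case: Rle_dec => *; lra.
have hs : 0 <= sin c by apply: sin_ge_0; lra.
have : 0 <= c * sin c * (x - 0) by pos.
by rewrite sin_0 in hc1; lra.
Qed.

Lemma sumC_range_split F a p b : (a <= p)%N -> (p <= b)%N ->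
 (\sum_(a <= j < b) F j = \sum_(a <= j < p) F j + \sum_(p <= j < b) F j)%C.
Proof. by move=> h1 h2; rewrite (big_cat_nat h1 h2). Qed.

Lemma Cmod_sum_cis_le x a b :
 Cmod (\sum_(a <= j < b) cis (x j))%C <= INR (b - a).
Proof.
apply: Rle_trans (Cmod_sum _ _ _) _.
rewrite (eq_bigr (fun=> 1)); last by move=> i _; rewrite Cmod_cis.
by rewrite sumR_nat_const; lra.
Qed.

Definition cot (x : R) : R := cos x / sin x.

Lemma cot_decr x y : 0 < x -> x <= y -> y < PI -> cot y <= cot x.
Proof.
move=> x0 xy yp.
have sx : 0 < sin x by apply: sin_gt_0; lra.
have sy : 0 < sin y by apply: sin_gt_0; lra.
have h : 0 <= sin (y - x) by apply: sin_ge_0; lra.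
rewrite sin_minus in h.
suff : 0 <= cot x - cot y by lra.
have -> : cot x - cot y = (sin y * cos x - cos y * sin x) / (sin x * sin y).
 by rewrite /cot; field; lra.
pos.
Qed.

(** The inverse of [1 - exp (i th)] lies on the vertical line [Re = 1/2] at height
    [cot (th / 2) / 2], so its variation is that of a monotone real function. *)
Lemma cis_sub1_inv d : sin (PI * d) <> 0 ->
 ((1 - cis (2 * PI * d)) * (RtoC (1/2) + Ci * RtoC (cot (PI * d) / 2)) = 1)%C.
Proof.
move=> s0.
rewrite (_ : 2 * PI * d = 2 * (PI * d)); last by lra.
rewrite /cis cos_2a sin_2a /cot; set s := sin _ in s0 *; set c := cos _.
have h : s * s + c * c = 1 by have := sin2_cos2 (PI * d).
have e1 : c * c = 1 - s * s by lra.
apply: injective_projections => /=.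
- have -> : (1 + - (c * c - s * s)) * (1 / 2 + (0 * (c / s / 2) - 1 * 0))
  - (0 + - (2 * s * c)) * (0 + (0 * 0 + 1 * (c / s / 2)))
  = (1 - c * c + s * s) / 2 + c * c by field.
 lra.
-
 by rewrite e1; field.
Qed.

(** With [z j = (z j - z j.+1) * c j], summation by parts leaves two boundary terms of size at most
    [/ (2 sin (PI l))] and a variation of at most [cot (PI l)]; together they are at most
    [cot (PI l / 2)]. *)
Lemma kusmin_landau x l a b :
 0 < l -> l <= 1/2 ->
 (forall j, (a <= j)%N -> (j.+1 < b)%N -> l <= x j.+1 - x j <= 1 - l) ->
 (forall j, (a <= j)%N -> (j.+2 < b)%N -> x j.+1 - x j <= x j.+2 - x j.+1) ->
 Cmod (\sum_(a <= j < b) cis (2 * PI * x j))%C <= 2 / (PI * l).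
Proof.
move=> l0 l2 hd hm.
have pi0 := PI_RGT_0.
have B1 : 1 <= 2 / (PI * l).
 have := PI_4 => pi4.
 apply: (Rmult_le_reg_r (PI * l)); first by nra.
 by rewrite /Rdiv Rmult_assoc Rinv_l; nra.
case: (leqP b a.+1) => hab.
 apply: Rle_trans (Cmod_sum_cis_le _ _ _) _.
 have : (b - a <= 1)%N by lia.
 case: (b - a)%N => [|[|//]] _ /=; lra.
set z := fun j => cis (2 * PI * x j).
set ct := fun j => cot (PI * (x j.+1 - x j)).
set c := fun j => (RtoC (1/2) + Ci * RtoC (ct j / 2))%C.
have sd j : (a <= j)%N -> (j.+1 < b)%N -> 0 < sin (PI * (x j.+1 - x j)).
 by move=> h1 h2; have := hd j h1 h2 => h; apply: sin_gt_0; nra.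
have zc j : (a <= j)%N -> (j.+1 < b)%N -> (z j = (z j - z j.+1) * c j)%C.
 move=> h1 h2.
 have -> : z j.+1 = (z j * cis (2 * PI * (x j.+1 - x j)))%C.
  by rewrite -cisD; congr cis; ring.
 rewrite -{1}[z j]Cmult_1_r -(@cis_sub1_inv (x j.+1 - x j)); last by have := sd j h1 h2; lra.
 by rewrite /c /ct; ring.
(* Abel summation: [c] moves on a line, so its variation telescopes *)
have abel n : (a + n.+1 < b)%N ->
 (\sum_(a <= j < a + n.+1) z j = z a * c a - z (a + n.+1)%N * c (a + n)%N
  + \sum_(a.+1 <= j < a + n.+1) (z j * (c j - c j.-1)))%C.
 elim: n => [|n IH] h.
  rewrite addn1 big_nat1 big_geq // addn0 {1}(zc a) //; ring.
 rewrite addnS big_nat_recr; last by lia.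
 rewrite [X in _ = (_ + X)%C]big_nat_recr; last by lia.
 rewrite IH; last by lia.
 by rewrite !addnS /= {2}(zc _.+1); [ring | lia | lia].
have [n bn] : exists n, b = (a + n.+1).+1 by exists (b - a - 2)%N; lia.
have ctm j : (a.+1 <= j)%N -> (j < a + n.+1)%N -> ct j <= ct j.-1.
 move=> h1 h2; have hj : j = j.-1.+1 by lia.
 have := hd j ltac:(lia) ltac:(lia).
 have := hd j.-1 ltac:(lia) ltac:(lia).
 have := hm j.-1 ltac:(lia) ltac:(lia).
 rewrite /ct -!hj => k1 k2 k3.
 by apply: cot_decr; nra.
have tele m : (m <= n)%N -> \big[Rplus/0]_(a.+1 <= j < a + m.+1) Cmod (z j * (c j - c j.-1))%C
 <= (ct a - ct (a + m)%N) / 2.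
 elim: m => [|m IH] hmn.
  by rewrite addn1 big_geq // addn0; lra.
 rewrite addnS big_nat_recr /=; last by lia.
 have := IH ltac:(lia) => {}IH.
 have -> : Cmod (z (a + m.+1)%N * (c (a + m.+1)%N - c (a + m.+1).-1))%C
  = (ct (a + m)%N - ct (a + m.+1)%N) / 2.
  rewrite Cmod_mult Cmod_cis addnS.
  have -> : (c (a + m).+1 - c (a + m)%N)%C = (Ci * RtoC (- ((ct (a + m)%N - ct (a + m).+1) / 2)))%C.
   rewrite /c RtoC_opp (_ : (ct _ - ct _.+1) / 2 = ct (a + m)%N / 2 - ct (a + m).+1 / 2); last by lra.
   by rewrite RtoC_minus; ring.
  rewrite Cmod_mult Cmod_R Rabs_Ropp Rabs_pos_eq.
   by rewrite /Cmod /= (_ : _ + _ = 1) ?sqrt_1; ring.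
  by have := ctm (a + m).+1 ltac:(lia) ltac:(lia); rewrite /=; lra.
 lra.
have sl : 0 < sin (PI * l) by apply: sin_gt_0; nra.
have sdl j : (a <= j)%N -> (j.+1 < b)%N -> sin (PI * l) <= sin (PI * (x j.+1 - x j)).
 move=> h1 h2; have h := hd j h1 h2.
 have hd0 : sin (PI * (x j.+1 - x j)) - sin (PI * l) =
  2 * cos (PI * ((x j.+1 - x j) + l) / 2) * sin (PI * ((x j.+1 - x j) - l) / 2).
  by rewrite form4; congr (_ * cos _ * sin _); field.
 have : 0 <= cos (PI * ((x j.+1 - x j) + l) / 2) by apply: cos_ge_0; nra.
 have : 0 <= sin (PI * ((x j.+1 - x j) - l) / 2) by apply: sin_ge_0; nra.
 nra.
have ctl j : (a <= j)%N -> (j.+1 < b)%N -> - cot (PI * l) <= ct j <= cot (PI * l).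
 move=> h1 h2; have h := hd j h1 h2; split.
  have -> : - cot (PI * l) = cot (PI - PI * l).
   by rewrite /cot sin_minus cos_minus sin_PI cos_PI; field; lra.
  by apply: cot_decr; nra.
 by apply: cot_decr; nra.
have Cc j : (a <= j)%N -> (j.+1 < b)%N -> Cmod (c j) <= / (2 * sin (PI * l)).
 move=> h1 h2.
 apply: (Rle_trans _ (/ (2 * sin (PI * (x j.+1 - x j))))).
  have := sd j h1 h2; set s := sin _ => s0.
  apply: Req_le; rewrite /Cmod /c /ct /cot -/s /=.
  rewrite -(sqrt_pow2 (/ _)); last by pos.
  congr sqrt; have := sin2_cos2 _; rewrite /Rsqr => hsc.
  transitivity ((s * s + cos (PI * (x j.+1 - x j)) * cos (PI * (x j.+1 - x j))) / (4 * s * s)).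
   by field; lra.
  by rewrite hsc; field; lra.
 apply: Rinv_le_contravar; first by lra.
 by have := sdl j h1 h2; lra.
have C1c j : (a <= j)%N -> (j.+1 < b)%N -> Cmod (1 - c j)%C <= / (2 * sin (PI * l)).
 rewrite (_ : (1 - c j)%C = Cconj (c j)) ?Cmod_Cconj; first exact: Cc.
 apply: injective_projections; rewrite /=; field.
rewrite bn big_nat_recr /=; last by lia.
rewrite (abel n); last by lia.
set E := (\sum_(a.+1 <= j < a + n.+1) _)%C.
have -> : (z a * c a - z (a + n.+1)%N * c (a + n)%N + E + z (a + n.+1)%N
 = z a * c a + z (a + n.+1)%N * (1 - c (a + n)%N) + E)%C by ring.
Ctri.
have hE : Cmod E <= cot (PI * l).
 apply: Rle_trans (Cmod_sum _ _ _) _.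
 have := tele n (leqnn _).
 have := ctl a ltac:(lia) ltac:(lia).
 have := ctl (a + n)%N ltac:(lia) ltac:(lia); lra.
have h3 := Cmod_triangle (z a * c a)%C (z (a + n.+1)%N * (1 - c (a + n)%N))%C.
rewrite !Cmod_mult !Cmod_cis in h3.
have h4 := Cc a ltac:(lia) ltac:(lia).
have h5 := C1c (a + n)%N ltac:(lia) ltac:(lia).
have h6 : cot (PI * l) + 2 * / (2 * sin (PI * l)) <= 2 / (PI * l); last by lra.
(* (cos + 1)/sin = cot of the half angle, and tan y >= y *)
set y := PI * l / 2.
have sy : 0 < sin y by apply: sin_gt_0; rewrite /y; nra.
have cy : 0 < cos y by apply: cos_gt_0; rewrite /y; nra.
have hy : 2 * sin y * cos y = sin (PI * l) by rewrite -sin_2a; congr sin; rewrite /y; field.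
have hy2 : cos (PI * l) = 2 * cos y * cos y - 1 by rewrite -cos_2a_cos; congr cos; rewrite /y; field.
have -> : cot (PI * l) + 2 * / (2 * sin (PI * l)) = cos y / sin y.
 by rewrite /cot hy2 -hy; field; lra.
have -> : 2 / (PI * l) = 1 / y by rewrite /y; field; nra.
have y0 : 0 < y by pos.
apply: (Rmult_le_reg_r (y * sin y)); first by nra.
have -> : cos y / sin y * (y * sin y) = y * cos y by field; lra.
have -> : 1 / y * (y * sin y) = sin y by field; lra.
by apply: sin_ge_x_cos; rewrite /y; nra.
Qed.

Lemma monotone_cut d t a b : (a <= b)%N ->
 (forall j, (a <= j)%N -> (j.+1 < b)%N -> d j <= d j.+1) ->
 exists p, [/\ (a <= p <= b)%N, forall j, (a <= j < p)%N -> d j < t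
  & forall j, (p <= j < b)%N -> t <= d j].
Proof.
move=> hab; rewrite -(subnKC hab); elim: (b - a)%N => [|n IH] hm.
 by exists a; split => [|j|j]; lia.
have [|p [h1 h2 h3]] := IH; first by move=> j h1 h2; apply: hm; lia.
case: (leqP (a + n) p) => hp.
 case: (Rlt_dec (d p) t) => ht.
  exists p.+1; split; [lia | | by move=> j; lia].
  by move=> j hj; case: (ltnP j p) => hjp; [apply: h2; lia | rewrite (_ : j = p); [|lia]].
 exists p; split; [lia | exact: h2 |].
 by move=> j hj; rewrite (_ : j = p); [lra | lia].
exists p; split; [lia | exact: h2 |].
move=> j hj; case: (ltnP j (a + n)) => hjn; first by apply: h3; lia.
have ej : j = (a + n).-1.+1 by lia.
rewrite ej; apply: Rle_trans (hm _ _ _); [apply: h3; lia | lia | lia].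
Qed.

Lemma spaced_count d lam mu p q : 0 < lam -> 0 <= mu ->
 (forall j, (p <= j)%N -> (j.+1 < q)%N -> lam <= d j.+1 - d j) ->
 (forall i j, (p <= i < q)%N -> (p <= j < q)%N -> d j - d i <= mu) ->
 INR (q - p) <= mu / lam + 1.
Proof.
move=> l0 m0 hs hd.
have hm : 0 <= mu / lam by pos.
case: (leqP q p) => hpq; first by rewrite (_ : (q - p)%N = 0%N) /=; [lra | lia].
have h i : (p + i < q)%N -> d p + i * lam <= d (p + i)%N.
 elim: i => [|i IH] hi; first by rewrite addn0 /=; lra.
 have := IH ltac:(lia); have := hs (p + i)%N ltac:(lia) ltac:(lia).
 by rewrite addnS S_INR; lra.
have h1 := h (q - p).-1 ltac:(lia).
have h2 := hd p (p + (q - p).-1)%N ltac:(lia) ltac:(lia).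
have -> : (q - p)%N = (q - p).-1.+1 by lia.
rewrite S_INR; suff : INR (q - p).-1 <= mu / lam by lra.
apply: (Rmult_le_reg_r lam) => //.
by rewrite Rmult_assoc Rinv_l; lra.
Qed.

Lemma cis_2PI_Z (m : Z) : cis (2 * PI * IZR m) = RtoC 1.
Proof.
have h n : cis (2 * PI * IZR (Z.of_nat n)) = RtoC 1 by rewrite -INR_IZR_INZ cis_2PI_nat.
case: (Z_le_gt_dec 0 m) => hm; first by rewrite -(Z2Nat.id m).
rewrite (_ : 2 * PI * IZR m = - (2 * PI * IZR (Z.of_nat (Z.to_nat (- m))))).
 by rewrite cisN h; apply: injective_projections; rewrite /=; ring.
by rewrite Z2Nat.id ?opp_IZR; [ring | lia].
Qed.

(** The unit interval is cut at distance [mu = sqrt lam] from its ends. The two outer pieces hold at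
    most [/ mu + 1] terms each, because the differences are spaced by [lam]; the middle piece costs
    [2 / (PI mu)] by [kusmin_landau]. This [mu] balances the two costs. For [lam > 1/4] there are at
    most five terms. *)
Lemma vdc_block x (m : Z) lam a b : (a <= b)%N -> 0 < lam ->
 (forall j, (a <= j < b)%N -> IZR m <= x j.+1 - x j < IZR m + 1) ->
 (forall j, (a <= j)%N -> (j.+1 < b)%N -> lam <= (x j.+2 - x j.+1) - (x j.+1 - x j)) ->
 Cmod (\sum_(a <= j < b) cis (2 * PI * x j))%C <= 4 / sqrt lam + 5.
Proof.
move=> hab l0 hd hs.
have sl : 0 < sqrt lam by pos.
have sl2 : sqrt lam * sqrt lam = lam by apply: sqrt_sqrt; lra.
have isl : 0 < / sqrt lam by pos.
set d := fun j => x j.+1 - x j.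
have hs' : forall j, (a <= j)%N -> (j.+1 < b)%N -> lam <= d j.+1 - d j by [].
case: (Rle_dec lam (1/4)) => hl; last first.
 apply: Rle_trans (Cmod_sum_cis_le _ _ _) _.
 apply: Rle_trans (@spaced_count d lam 1 a b l0 ltac:(lra) hs' _) _.
  by move=> i j hi hj; have := hd i hi; have := hd j hj; rewrite /d; lra.
 have : 1 / lam <= 4; last by lra.
 by apply: (Rmult_le_reg_r lam) => //; rewrite /Rdiv Rmult_1_l Rinv_l; lra.
set mu := sqrt lam.
have mu2 : mu <= 1/2 by rewrite /mu; nra.
have dm j : (a <= j)%N -> (j.+1 < b)%N -> d j <= d j.+1.
 by move=> h1 h2; have := hs' j h1 h2; lra.
have [p [hp1 hp2 hp3]] := @monotone_cut d (IZR m + mu) a b hab dm.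
have [|q [hq1 hq2 hq3]] := @monotone_cut d (IZR m + 1 - mu) p b ltac:(lia).
 by move=> j h1 h2; apply: dm; lia.
rewrite (@sumC_range_split _ a p b) ?(@sumC_range_split _ p q b); try lia.
Ctri.
have muE : mu / lam = / mu by rewrite -sl2 /mu; field; lra.
have A1 : Cmod (\sum_(a <= j < p) cis (2 * PI * x j))%C <= / mu + 1.
 apply: Rle_trans (Cmod_sum_cis_le _ _ _) _.
 rewrite -muE; apply: (@spaced_count d) => //; first by pos.
  by move=> j h1 h2; apply: hs'; lia.
 move=> i j hi hj; have := hd i ltac:(lia); have := hp2 j ltac:(lia); rewrite /d; lra.
have A3 : Cmod (\sum_(q <= j < b) cis (2 * PI * x j))%C <= / mu + 1.
 apply: Rle_trans (Cmod_sum_cis_le _ _ _) _.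
 rewrite -muE; apply: (@spaced_count d) => //; first by pos.
  by move=> j h1 h2; apply: hs'; lia.
 move=> i j hi hj; have := hd j ltac:(lia); have := hq3 i ltac:(lia); rewrite /d; lra.
have A2 : Cmod (\sum_(p <= j < q) cis (2 * PI * x j))%C <= 2 / (PI * mu).
 (* Removing the integer slope [m] leaves the terms unchanged and brings the differences into
    [[mu, 1 - mu]]. *)
 rewrite (eq_bigr (fun j => cis (2 * PI * (x j - IZR m * j)))); last first.
  move=> j _; rewrite -[LHS]Cmult_1_r -(cis_2PI_Z (- m * Z.of_nat j)) -cisD.
  by congr cis; rewrite mult_IZR opp_IZR -INR_IZR_INZ; ring.
 apply: (@kusmin_landau _) => //.
 - move=> j h1 h2; have := hp3 j ltac:(lia); have := hq2 j ltac:(lia).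
  by rewrite /d S_INR; lra.
 - move=> j h1 h2; have := dm j ltac:(lia) ltac:(lia).
  by rewrite /d !S_INR; lra.
have A4 : 2 / (PI * mu) <= / mu.
 have pi2 : 2 < PI by have := PI2_1; lra.
 apply: (Rmult_le_reg_r (PI * mu)); first by pos.
 have -> : 2 / (PI * mu) * (PI * mu) = 2 by field; rewrite /mu; lra.
 have -> : / mu * (PI * mu) = PI by field; rewrite /mu; lra.
 lra.
have := Cmod_triangle (\sum_(p <= j < q) cis (2 * PI * x j))%C (\sum_(q <= j < b) cis (2 * PI * x j))%C.
have imu : 0 < / mu := isl.
lra.
Qed.

Lemma vdc_blocks x lam b K : 0 < lam ->
 forall (m : Z) (a : nat), (a <= b)%N ->
 (forall j, (a <= j < b)%N -> IZR m <= x j.+1 - x j < IZR m + INR K) ->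
 (forall j, (a <= j)%N -> (j.+1 < b)%N -> lam <= (x j.+2 - x j.+1) - (x j.+1 - x j)) ->
 Cmod (\sum_(a <= j < b) cis (2 * PI * x j))%C <= K * (4 / sqrt lam + 5).
Proof.
move=> l0; elim: K => [|K IH] m a hab hd hs.
 case: (leqP b a) => h; first by rewrite big_geq // Cmod_0 /=; lra.
 by have := hd a ltac:(lia); rewrite /=; lra.
set d := fun j => x j.+1 - x j.
have dm j : (a <= j)%N -> (j.+1 < b)%N -> d j <= d j.+1.
 by move=> h1 h2; have := hs j h1 h2; rewrite /d; lra.
have [p [hp1 hp2 hp3]] := @monotone_cut d (IZR m + 1) a b hab dm.
rewrite (@sumC_range_split _ a p b); try lia.
Ctri.
have h1 : Cmod (\sum_(a <= j < p) cis (2 * PI * x j))%C <= 4 / sqrt lam + 5.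
 apply: (@vdc_block x m) => //; first by lia.
  by move=> j hj; have := hd j ltac:(lia); have := hp2 j hj; rewrite /d; lra.
 by move=> j h1 h2; apply: hs; lia.
have h2 : Cmod (\sum_(p <= j < b) cis (2 * PI * x j))%C <= K * (4 / sqrt lam + 5).
 apply: (IH (m + 1)%Z); first by lia.
  move=> j hj; have := hd j ltac:(lia); have := hp3 j hj.
  by rewrite /d plus_IZR S_INR; lra.
 by move=> j h2 h3; apply: hs; lia.
by rewrite S_INR; lra.
Qed.

Lemma vdc_second_difference x lam V a b : 0 < lam -> 0 <= V ->
 (forall i j, (a <= i < b)%N -> (a <= j < b)%N -> (x j.+1 - x j) - (x i.+1 - x i) <= V) ->
 (forall j, (a <= j)%N -> (j.+1 < b)%N -> lam <= (x j.+2 - x j.+1) - (x j.+1 - x j)) ->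
 Cmod (\sum_(a <= j < b) cis (2 * PI * x j))%C <= (V + 3) * (4 / sqrt lam + 5).
Proof.
move=> l0 V0 hV hs.
have c0 : 0 < 4 / sqrt lam + 5.
 pos.
case: (leqP b a) => hab; first by rewrite big_geq // Cmod_0; nra.
set m := Int_part (x a.+1 - x a).
(* The differences start in [[m, m + 1)] and increase by at most [V], so this many unit intervals
   contain them. *)
set K := Z.to_nat (Int_part V + 2).
have [m1 m2] := base_Int_part (x a.+1 - x a).
have [V1 V2] := base_Int_part V.
have iV : (0 <= Int_part V)%Z.
 have /lt_IZR : IZR (-1) < IZR (Int_part V) by lra.
 lia.
have KE : INR K = IZR (Int_part V) + 2.
 by rewrite INR_IZR_INZ Z2Nat.id ?plus_IZR //; lia.
apply: Rle_trans (@vdc_blocks x lam b K l0 m a ltac:(lia) _ hs) _; last by nra.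
move=> j hj.
have := hV a j ltac:(lia) hj.
have : x a.+1 - x a <= x j.+1 - x j.
 have : (a <= j)%N by lia.
 elim: j hj => [|j IH] hj haj; first by rewrite (_ : a = 0%N); [lra | lia].
 case: (leqP a j) => haj'; last by rewrite (_ : a = j.+1); [lra | lia].
 by have := IH ltac:(lia) haj'; have := hs j haj' ltac:(lia); lra.
by rewrite -/m in m1 m2; lra.
Qed.

Lemma sum_abel F w a b : (a < b)%N ->
 (\sum_(a <= j < b) (F j * RtoC (w j)) =
 RtoC (w b.-1) * \sum_(a <= j < b) F j
 + \sum_(a <= i < b.-1) (RtoC (w i - w i.+1)%R * \sum_(a <= j < i.+1) F j))%C.
Proof.
move=> hab; have -> : b = (a + (b - a).-1).+1 by lia.
elim: _.-1 => [|n IH]; first by rewrite addn0 /= !big_nat1 big_geq //; ring.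
rewrite addnS big_nat_recr; last by lia.
rewrite IH [X in _ = (_ * X + _)%C]big_nat_recr; last by lia.
rewrite [X in _ = (_ + X)%C]big_nat_recr /=; last by lia.
by rewrite RtoC_minus; ring.
Qed.

(** The factor 2 is the last weight plus the total variation. Both directions of monotonicity are
    allowed because the amplitudes to come are products of a decreasing and an increasing weight. *)
Lemma abel_mono F w B W a b : 0 <= B -> 0 <= W ->
 (forall i, (a <= i <= b)%N -> Cmod (\sum_(a <= j < i) F j)%C <= B) ->
 (forall j, (a <= j < b)%N -> 0 <= w j <= W) ->
 (forall j, (a <= j)%N -> (j.+1 < b)%N -> w j.+1 <= w j) \/
 (forall j, (a <= j)%N -> (j.+1 < b)%N -> w j <= w j.+1) ->
 Cmod (\sum_(a <= j < b) (F j * RtoC (w j)))%C <= 2 * W * B.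
Proof.
move=> B0 W0 hF hw hm.
case: (leqP b a) => hab; first by rewrite big_geq // Cmod_0; nra.
rewrite sum_abel //.
Ctri.
rewrite Cmod_mult Cmod_R Rabs_pos_eq; last by have := hw b.-1 ltac:(lia); lra.
have h1 := hF b ltac:(lia).
have hb := hw b.-1 ltac:(lia).
have ha := hw a ltac:(lia).
have h2 : Cmod (\sum_(a <= i < b.-1) (RtoC (w i - w i.+1)%R * \sum_(a <= j < i.+1) F j))%C
  <= B * Rabs (w a - w b.-1).
 apply: Rle_trans (Cmod_sum _ _ _) _.
 apply: (Rle_trans _ _).
  apply: sumR_le => i; rewrite mem_index_iota => hi _.
  rewrite Cmod_mult Cmod_R Rmult_comm; apply: Rmult_le_compat_r; first exact: Rabs_pos.
  by apply: hF; lia.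
 rewrite -big_distrr; apply: Rmult_le_compat_l => //.
 have tel n : (a + n <= b.-1)%N -> \big[Rplus/0]_(a <= i < a + n) Rabs (w i - w i.+1)
  <= Rabs (w a - w (a + n)%N) /\ ((w (a + n)%N <= w a /\ (forall j, (a <= j)%N -> (j.+1 < b)%N -> w j.+1 <= w j))
    \/ (w a <= w (a + n)%N /\ (forall j, (a <= j)%N -> (j.+1 < b)%N -> w j <= w j.+1))).
  elim: n => [|n IH] hn.
   rewrite addn0 big_geq //; split; first exact: Rabs_pos.
   by case: hm => hm; [left | right]; split => //; lra.
  have [{}IH [[k1 k2]|[k1 k2]]] := IH ltac:(lia); rewrite addnS big_nat_recr /=; try lia.
   have := k2 (a + n)%N ltac:(lia) ltac:(lia) => k3.
   split; last by left; split => //; lra.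
   move: IH; rewrite !Rabs_pos_eq; lra.
  have := k2 (a + n)%N ltac:(lia) ltac:(lia) => k3.
  split; last by right; split => //; lra.
  move: IH; rewrite -(Rabs_Ropp _) -(Rabs_Ropp (w a - w _.+1)) -(Rabs_Ropp (w _ - w _.+1)).
  rewrite !Rabs_pos_eq; lra.
 by have [] := tel (b.-1 - a)%N ltac:(lia); rewrite subnKC; [|lia].
have : w b.-1 + Rabs (w a - w b.-1) <= 2 * W.
 by rewrite /Rabs; case: Rcase_abs => *; lra.
nra.
Qed.

(** * Jacobi symbols and Gauss sums *)

HB.instance Definition _ := Monoid.isComLaw.Build Z 1%Z Z.mul
 Z.mul_assoc Z.mul_comm Z.mul_1_l.

(** * Legendre symbols *)

Definition qres (m p : nat) : bool := [exists x : 'I_p, x ^ 2 == m %[mod p]]%N.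

Lemma qresP m p : (0 < p)%N -> reflect (exists x, x ^ 2 = m %[mod p]) (qres m p)%N.
Proof.
move=> p0; apply: (iffP existsP) => [[x /eqP h]|[x h]]; first by exists x.
by exists (Ordinal (ltn_pmod x p0)) => /=; rewrite modnXm h.
Qed.

Lemma legendreE m p :
 legendre m p = if (p %| m)%N then 0%Z else if qres m p then 1%Z else (-1)%Z.
Proof. pos. Qed.

Lemma legendre_mod m p : legendre (m %% p) p = legendre m p.
Proof.
rewrite !legendreE /dvdn modn_mod.
suff -> : qres (m %% p) p = qres m p by [].
by apply: eq_existsb => x; rewrite modn_mod.
Qed.

Lemma legendre_cases m p : [\/ legendre m p = 0%Z, legendre m p = 1%Z | legendre m p = (-1)%Z].
Proof.
by rewrite /legendre; case: ifP => _; [constructor 1|case: ifP => _; [constructor 2|constructor 3]].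
Qed.

Lemma legendre_eq0 m p : (legendre m p = 0%Z) <-> (p %| m)%N.
Proof. by rewrite /legendre; case: ifP => // _; case: ifP. Qed.

Lemma legendre_sq x p : prime p -> ~~ (p %| x)%N -> legendre (x ^ 2) p = 1%Z.
Proof.
move=> pp px; rewrite legendreE Euclid_dvdX // (negbTE px).
by case: qresP => //; [exact: prime_gt0 | case; exists x].
Qed.

Lemma sqr_eq_mod p x y : prime p -> (0 < x < p)%N -> (0 < y < p)%N ->
 x ^ 2 = y ^ 2 %[mod p] -> x = y \/ (x + y = p)%N.
Proof.
move=> pp; wlog hxy : x y / (y <= x)%N.
 move=> h hx hy e; case: (leqP y x) => ?; first exact: h.
 by have lra := h y x ltac:(lia) hy hx _; lia.
move=> hx hy /eqP; rewrite eqn_mod_dvd; last by rewrite leq_exp2r.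
rewrite subn_sqr Euclid_dvdM // => /orP [] /dvdnP [k hk].
 case: k hk => ?; first by lia.
 lia.
case: k hk => [|[|k]]; [lia | lia |].
lia.
Qed.

Lemma perm_iota0 (s : seq nat) n : uniq s -> size s = n ->
 (forall x, x \in s -> (x < n)%N) -> perm_eq s (iota 0 n).
Proof.
move=> us ss hs; apply: uniq_perm => //; first exact: iota_uniq.
apply: (uniq_min_size us _ _).2 => [x /hs|]; first by rewrite mem_iota.
by rewrite size_iota ss.
Qed.

Lemma cancel_mod p a x y : coprime a p -> (a * x = a * y %[mod p])%N -> (x = y %[mod p])%N.
Proof.
move=> ap; wlog hxy : x y / (y <= x)%N.
 by move=> h; case: (leqP y x) => [?|/ltnW ?]; [apply: h | move=> e; apply/esym/h].
move=> /eqP; rewrite eqn_mod_dvd ?leq_mul2l ?hxy ?orbT // -mulnBr Gauss_dvdr; last by rewrite coprime_sym.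
by rewrite -eqn_mod_dvd // => /eqP.
Qed.

Lemma eqmodM p a b c d : (a = c %[mod p])%N -> (b = d %[mod p])%N -> (a * b = c * d %[mod p])%N.
Proof. by move=> h1 h2; rewrite -modnMm h1 h2 modnMm. Qed.

(** One root is kept from each pair [x], [p - x], so for an odd prime the list has no repetition and
    consists of the nonzero quadratic residues. *)
Definition half_squares (p : nat) : seq nat := [seq (x ^ 2 %% p)%N | x <- iota 1 p./2].

Lemma mem_half p x : odd p -> (x \in iota 1 p./2) = ((0 < x) && (x + x < p))%N.
Proof. rewrite mem_iota; lia. Qed.

Lemma uniq_half_squares p a : prime p -> odd p -> ~~ (p %| a)%N ->
 uniq [seq (a * x ^ 2 %% p)%N | x <- iota 1 p./2].
Proof.
move=> pp op pa; rewrite map_inj_in_uniq ?iota_uniq // => x y.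
rewrite !mem_half // => hx hy /cancel_mod h.
have {h} h := h ltac:(by rewrite coprime_sym prime_coprime).
by case: (@sqr_eq_mod p x y pp ltac:(lia) ltac:(lia) h) => //; lia.
Qed.

Lemma half_squares_res p r : prime p -> odd p -> (0 < r < p)%N ->
 (r \in half_squares p) = qres r p.
Proof.
move=> pp op hr; apply/mapP/qresP; first by lia.
 by move=> [x _ ->]; exists x; rewrite modn_mod.
move=> [x hx]; have p0 := prime_gt0 pp.
have xp : (0 < x %% p)%N.
 rewrite lt0n; apply/negP => /eqP h0.
 by move: hx; rewrite -modnXm h0 mod0n modn_small; lia.
have hx' : ((x %% p) ^ 2 = r %[mod p]) by rewrite modnXm.
case: (ltnP (x %% p + x %% p) p) => h.
 exists (x %% p); first by rewrite mem_half // xp.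
 by rewrite hx' modn_small; case/andP: hr.
exists (p - x %% p)%N; first by rewrite mem_half; lia.
rewrite -[in LHS](modn_small (proj2 (andP hr))) -hx'.
have e : (p = x %% p + (p - x %% p))%N by lia.
set u := (x %% p) in e *; set v := (p - u)%N in e *.
apply/eqP; case: (leqP v u) => huv.
 by rewrite eqn_mod_dvd ?leq_exp2r // subn_sqr -e dvdn_mull.
by rewrite eq_sym eqn_mod_dvd ?leq_exp2r ?(ltnW huv) // subn_sqr addnC -e dvdn_mull.
Qed.

(** The residues and their multiples by the nonresidue [a] are two disjoint lists of [(p - 1) / 2]
    classes, so with 0 they exhaust the classes modulo [p]. As [b] is not a residue, it is [a] times
    a square. *)
Lemma qres_nonres p a b : prime p -> odd p -> ~~ (p %| a)%N -> ~~ (p %| b)%N ->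
 ~~ qres a p -> ~~ qres b p -> qres (a * b) p.
Proof.
move=> pp op pa pb na nb; have p0 := prime_gt0 pp.
set s1 := half_squares p; set s2 := [seq (a * x ^ 2 %% p) | x <- iota 1 p./2].
have u1 : uniq s1.
 have := @uniq_half_squares p 1 pp op; rewrite /s1 /half_squares.
 under eq_map => x do rewrite mul1n.
 by apply; rewrite dvdn1; apply/eqP => e; rewrite e in pp.
have hx x : x \in iota 1 p./2 -> ~~ (p %| x).
 by rewrite mem_half // => h; apply/negP => /dvdn_leq; lia.
have h1 x : x \in s1 -> (0 < x < p)%N.
 move=> /mapP [y /hx hy ->]; rewrite ltn_pmod // andbT lt0n.
 by rewrite -/(dvdn p (y ^ 2)) Euclid_dvdX // andbT.
have h2 x : x \in s2 -> (0 < x < p)%N.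
 move=> /mapP [y /hx hy ->]; rewrite ltn_pmod // andbT lt0n.
 by rewrite -/(dvdn p (a * y ^ 2)) Euclid_dvdM // Euclid_dvdX // andbT negb_or pa.
have dis : ~~ has (mem s1) s2.
 apply/hasPn => x hs2; apply/negP => /= hs1.
 move: hs1 (h1 x hs1); rewrite /s1 => hs1 hxp; move: hs1; rewrite half_squares_res // => /(qresP _ p0) [z hz].
 move/mapP: hs2 => [y /hx hy ex].
 move/negP: na; apply; apply/(qresP _ p0).
 have [u hu] : exists u, (u * y = 1 %[mod p]).
  have [|u v h _] := @egcdnP y p; first by rewrite lt0n; apply: contra hy => /eqP ->.
  have g1 : gcdn y p = 1%N by apply/eqP; rewrite -/(coprime y p) coprime_sym prime_coprime.
  by exists u; rewrite h g1 modnMDl.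
 exists (u * z)%N; rewrite expnMn -modnMmr hz ex modn_mod modnMmr mulnCA -expnMn -modnMmr -modnXm hu.
 by rewrite modnXm exp1n modnMmr muln1.
have us : uniq (0%N :: s1 ++ s2).
 rewrite /= cat_uniq u1 dis uniq_half_squares //= mem_cat negb_or andbT.
 by apply/andP; split; apply/negP; [move/h1 | move/h2].
have ps := @perm_iota0 _ p us.
have sz : size (0%N :: s1 ++ s2) = p.
 by rewrite /= size_cat !size_map !size_iota addnn; have := odd_double_half p; rewrite op.
have := perm_mem (ps sz _) (b %% p); rewrite mem_iota ltn_pmod // in_cons mem_cat.
have bm : (0 < b %% p < p)%N by lia.
have -> : (b %% p \in s1) = false.
 rewrite half_squares_res //; apply/negbTE; apply: contra nb => /(qresP _ p0) [z hz].
 by apply/(qresP _ p0); exists z; rewrite hz modn_mod.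
rewrite (_ : (b %% p == 0)%N = false); last by lia.
move=> hb; have {hb} : (b %% p \in s2).
 by apply: hb => x; rewrite in_cons mem_cat => /or3P [/eqP ->|/h1|/h2]; lia.
move=> /mapP [y _ hb]; apply/(qresP _ p0); exists (a * y)%N.
by rewrite expnMn -mulnA; apply: eqmodM.
Qed.

Lemma inv_mod p c : (0 < c)%N -> coprime c p -> exists u, (u * c = 1 %[mod p])%N.
Proof.
move=> c0 /eqP g1; have [u v h _] := @egcdnP c p c0.
by exists u; rewrite h g1 modnMDl.
Qed.

Lemma qres_div p a b : prime p -> ~~ (p %| a)%N -> qres a p -> qres (a * b) p -> qres b p.
Proof.
move=> pp pa; have p0 := prime_gt0 pp.
move/(qresP _ p0) => [x hx] /(qresP _ p0) [z hz]; apply/(qresP _ p0).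
have px : ~~ (p %| x).
 apply: contra pa => h; rewrite /dvdn -hx -/(dvdn p _).
 by rewrite Euclid_dvdX // h.
have [w hw] : exists w, (w * x = 1 %[mod p]).
 apply: inv_mod; first by rewrite lt0n; apply: contra px => /eqP ->.
 by rewrite coprime_sym prime_coprime.
exists (w * z)%N; rewrite expnMn.
have -> : (w ^ 2 * z ^ 2 = w ^ 2 * (x ^ 2 * b) %[mod p]).
 by apply: eqmodM => //; rewrite hz; apply: eqmodM => //.
rewrite mulnA -expnMn -modnMml -modnXm hw modnXm modnMml mul1n //.
Qed.

Lemma legendreM p a b : prime p -> odd p ->
 legendre (a * b) p = (legendre a p * legendre b p)%Z.
Proof.
move=> pp op; rewrite !legendreE Euclid_dvdM //; have p0 := prime_gt0 pp.
case: (boolP (p %| a)) => pa //=; case: (boolP (p %| b)) => pb /=; first by lia.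
case: (boolP (qres a p)) => ra; case: (boolP (qres b p)) => rb.
- have -> // : qres (a * b) p.
 move/(qresP _ p0): ra => [x hx]; move/(qresP _ p0): rb => [y hy].
 by apply/(qresP _ p0); exists (x * y)%N; rewrite expnMn -modnMm hx hy modnMm.
- rewrite (_ : qres _ p = false) //; apply/negbTE; apply: contra rb.
 exact: qres_div.
- rewrite (_ : qres _ p = false) //; apply/negbTE; apply: contra ra.
 by rewrite mulnC; apply: qres_div.
- by rewrite qres_nonres.
Qed.

(** * Jacobi symbols, carried from primes to odd moduli *)

Lemma odd_prime_ind (P : nat -> Prop) : P 1%N ->
 (forall p n, prime p -> odd p -> odd n -> P n -> P (p * n)%N) ->
 forall n, odd n -> P n.
Proof.
move=> P1 Ps n; elim: n {-2}n (leqnn n) => [|N IH] n hn on; first by lia.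
case: (leqP n 1) => h1; first by have -> : n = 1%N by case: n on h1 {hn} => [|[]].
have pp := pdiv_prime h1; have := divnK (pdiv_dvd n); rewrite mulnC => e.
have [op oq] : odd (pdiv n) /\ odd (n %/ pdiv n) by move: on; rewrite -{1}e oddM => /andP.
rewrite -e; apply: Ps => //; apply: IH => //.
have := prime_gt1 pp; have : (0 < n %/ pdiv n)%N by lia.
lia.
Qed.

(** A range of primes common to several moduli lets the products be compared factor by factor. *)
Lemma jacobi_wide m n N : (0 < n)%N -> (n < N)%N ->
 jacobi m n = \big[Z.mul/1%Z]_(0 <= p < N | prime p) (legendre m p ^ Z.of_nat (logn p n))%Z.
Proof.
move=> n0 nN.
rewrite [RHS](bigID (fun p => p \in primes n)) [X in (_ = _ * X)%Z]big1 ?Z.mul_1_r; last first.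
 move=> p /andP [pp]; rewrite mem_primes pp n0 => h.
 by rewrite lognE pp n0 (negbTE h).
rewrite -[RHS]big_filter; apply: perm_big; apply: uniq_perm; rewrite ?primes_uniq ?filter_uniq ?iota_uniq //.
move=> p; rewrite mem_filter mem_index_iota.
apply/idP/idP => [h|/andP [/andP [] //]].
rewrite h; move: h; rewrite mem_primes => /and3P [-> _ /dvdn_leq]; lia.
Qed.

Lemma jacobi_1r m : jacobi m 1 = 1%Z.
Proof. by rewrite /jacobi big_nil. Qed.

Lemma jacobiMr m a b : (0 < a)%N -> (0 < b)%N -> jacobi m (a * b) = (jacobi m a * jacobi m b)%Z.
Proof.
move=> a0 b0; have ab0 : (0 < a * b)%N by lia.
rewrite (@jacobi_wide m _ (a * b).+1) // (@jacobi_wide m a (a * b).+1) ?(@jacobi_wide m b (a * b).+1); try nia.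
rewrite -big_split /=; apply: eq_bigr => p pp.
by rewrite lognM // Nat2Z.inj_add Z.pow_add_r; lia.
Qed.

Lemma jacobi_prime m p : prime p -> jacobi m p = legendre m p.
Proof.
by move=> pp; rewrite /jacobi primes_prime // big_seq1 logn_prime // eqxx Z.pow_1_r.
Qed.

Lemma jacobi_modl m m' n : (m = m' %[mod n])%N -> jacobi m n = jacobi m' n.
Proof.
move=> h; rewrite /jacobi big_seq [RHS]big_seq; apply: eq_bigr => p.
rewrite mem_primes => /and3P [_ _ pn].
by rewrite -legendre_mod -(modn_dvdm m pn) h modn_dvdm // legendre_mod.
Qed.

Lemma odd_gt0' n : odd n -> (0 < n)%N.
Proof. lia. Qed.

Lemma jacobiMl a b n : odd n -> jacobi (a * b) n = (jacobi a n * jacobi b n)%Z.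
Proof.
elim/odd_prime_ind: n / => [|p n pp op on IH]; first by rewrite !jacobi_1r.
have p0 := prime_gt0 pp; have n0 := odd_gt0' on.
by rewrite !(jacobiMr _ p0 n0) !(jacobi_prime _ pp) legendreM // IH; ring.
Qed.

Lemma jacobi_1l n : odd n -> jacobi 1 n = 1%Z.
Proof.
elim/odd_prime_ind: n / => [|p n pp op on IH]; first by rewrite !jacobi_1r.
rewrite jacobiMr ?odd_gt0' // jacobi_prime // IH.
by rewrite -(exp1n 2) legendre_sq; case: p pp {op} => [|[]].
Qed.

Lemma jacobi_coprime m n : odd n ->
 (coprime m n /\ (jacobi m n = 1%Z \/ jacobi m n = (-1)%Z)) \/ (~~ coprime m n /\ jacobi m n = 0%Z).
Proof.
elim/odd_prime_ind: n / => [|p n pp op on IH]; first by rewrite jacobi_1r coprimen1; auto.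
rewrite jacobiMr ?odd_gt0' // jacobi_prime // coprimeMr (coprime_sym m p) prime_coprime //.
case: (boolP (p %| m)) => hp /=.
 by right; move/legendre_eq0: hp => ->.
case: IH => [[-> h]|[/negbTE -> ->]]; last by lia.
have : legendre m p <> 0%Z by move/legendre_eq0; rewrite (negbTE hp).
case: (legendre_cases m p) => -> //; case: h => ->; auto.
Qed.

(** * Additive characters and quadratic Gauss sums *)

Definition ez (n k : nat) : C := cis (2 * PI * (INR k / INR n)).

Lemma INR_gt0 n : (0 < n)%N -> 0 < INR n.
Proof. by move=> h; apply: lt_0_INR; lia. Qed.

Lemma INRM a b : INR (a * b)%N = a * INR b.
Proof. exact: mult_INR. Qed.

Lemma INRD a b : INR (a + b)%N = a + INR b.
Proof. exact: plus_INR. Qed.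

Lemma INRB a b : (b <= a)%N -> INR (a - b)%N = a - INR b.
Proof. by move=> h; apply: minus_INR; lia. Qed.

Lemma leqINR a b : (a <= b)%N -> a <= INR b.
Proof. by move=> h; apply: le_INR; lia. Qed.

Lemma leq_INR a b : INR a <= INR b -> (a <= b)%N.
Proof. by move=> h; have := INR_le _ _ h; lia. Qed.

Lemma ltnINR a b : (a < b)%N -> a < INR b.
Proof. by move=> h; apply: lt_INR; lia. Qed.

Lemma ezD n a b : ez n (a + b) = (ez n a * ez n b)%C.
Proof. by rewrite /ez -cisD INRD; congr cis; rewrite /Rdiv; ring. Qed.

Lemma ez0 n : ez n 0 = RtoC 1.
Proof. by rewrite /ez /Rdiv Rmult_0_l Rmult_0_r cis0. Qed.

Lemma ez_mult n k : (0 < n)%N -> ez n (k * n) = RtoC 1.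
Proof.
move=> /INR_gt0 n0; rewrite /ez INRM (_ : 2 * PI * _ = 2 * PI * k) ?cis_2PI_nat //.
by field; lra.
Qed.

Lemma ez_mod n k : (0 < n)%N -> ez n (k %% n) = ez n k.
Proof. by move=> n0; rewrite {2}(divn_eq k n) ezD ez_mult // Cmult_1_l. Qed.

Lemma ez_eqmod n k l : (0 < n)%N -> (k = l %[mod n])%N -> ez n k = ez n l.
Proof. by move=> n0 h; rewrite -(ez_mod k n0) h ez_mod. Qed.

Lemma ez_scale n k d : (0 < n)%N -> (0 < d)%N -> ez (d * n) (d * k) = ez n k.
Proof.
move=> /INR_gt0 n0 /INR_gt0 d0; rewrite /ez !INRM; congr cis; field; lra.
Qed.

(** Frequencies are natural numbers, so [- k] is represented by [n.-1 * k]. *)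
Lemma ez_conj n k : (0 < n)%N -> Cconj (ez n k) = ez n (n.-1 * k).
Proof.
move=> n0.
have e : (ez n k * Cconj (ez n k))%C = RtoC 1 by rewrite /ez -cisN cisNr.
have e2 : (ez n (n.-1 * k) * ez n k)%C = RtoC 1.
 by rewrite -ezD addnC -mulSn prednK // mulnC ez_mult.
by rewrite -[LHS]Cmult_1_l -e2 -Cmult_assoc e Cmult_1_r.
Qed.

Lemma sumC_const n c : (\sum_(0 <= i < n) c = RtoC n * c)%C.
Proof.
elim: n => [|n IH]; first by rewrite big_geq //= Cmult_0_l.
by rewrite big_nat_recr //= IH -/(INR n.+1) S_INR RtoC_plus; ring.
Qed.

Lemma ez_eq1 n k : (0 < n)%N -> ez n k = RtoC 1 -> (n %| k)%N.
Proof.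
move=> n0; rewrite -(ez_mod k n0) /dvdn; have hk := ltn_pmod k n0; set r := (k %% n) in hk *.
rewrite /ez => -[hc _]; case: (posnP r) => // r0.
have n1 := INR_gt0 n0; have r1 := INR_gt0 r0.
have hrn : r < n by apply: lt_INR; lia.
have hq : 0 < r / n < 1.
 split; first exact: Rdiv_lt_0_compat.
 by apply: (Rmult_lt_reg_r n) => //; rewrite Rmult_assoc Rinv_l; lra.
have pi0 := PI_RGT_0.
have hs : 0 < sin (PI * (r / n)) by apply: sin_gt_0; nra.
move: hc; rewrite (_ : 2 * PI * _ = 2 * (PI * (r / n))); last by lra.
by rewrite cos_2a_sin; nra.
Qed.

Lemma Cmult_eq0r (z w : C) : z <> 0 -> (z * w)%C = 0 -> w = 0.
Proof.
move=> z0 e; transitivity (/ z * (z * w))%C; first by field.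
by rewrite e; ring.
Qed.

Lemma sum_ez n k : (0 < n)%N ->
 (\sum_(0 <= a < n) ez n (a * k) = if (n %| k)%N then RtoC n else RtoC 0)%C.
Proof.
move=> n0; case: (boolP (n %| k)) => hk.
 rewrite (eq_bigr (fun=> RtoC 1)) ?sumC_const ?Cmult_1_r //.
 move=> a _; move: hk => /dvdnP [q ->]; by rewrite mulnA ez_mult.
have h m : ((ez n k - 1) * \sum_(0 <= a < m) ez n (a * k) = ez n (m * k) - 1)%C.
 elim: m => [|m IH]; first by rewrite big_geq // ez0; ring.
 rewrite big_nat_recr //= Cmult_plus_distr_l IH mulSn ezD; ring.
have nz : (ez n k - 1)%C <> 0.
 move=> e; have /(ez_eq1 n0) : ez n k = RtoC 1 by transitivity (ez n k - 1 + 1)%C; [ring | rewrite e; ring].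
 lia.
have := h n; rewrite mulnC ez_mult // => hn.
have hn0 : ((ez n k - 1) * \sum_(0 <= a < n) ez n (a * k) = 0)%C by rewrite hn; ring.
exact: (Cmult_eq0r nz hn0).
Qed.

Lemma sum_reindex n (s : seq nat) F : (0 < n)%N ->
 (forall a, F (a %% n)%N = F a) -> size s = n -> uniq [seq (a %% n)%N | a <- s] ->
 (\sum_(a <- s) F a = \sum_(0 <= a < n) F a)%C.
Proof.
transitivity (\sum_(a <- [seq (a %% n) | a <- s]) F a)%C.
 by rewrite big_map; apply: eq_bigr => a _.
apply: perm_big; rewrite /index_iota subn0; apply: perm_iota0 => //; first by rewrite size_map.
by move=> x /mapP [y _ ->]; rewrite ltn_pmod.
Qed.

Lemma sum_affine n u c F : (0 < n)%N -> coprime u n ->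
 (forall a, F (a %% n)%N = F a) ->
 (\sum_(0 <= a < n) F (u * a + c)%N = \sum_(0 <= a < n) F a)%C.
Proof.
move=> n0 un pF.
rewrite -[RHS](@sum_reindex n [seq (u * a + c)%N | a <- iota 0 n]) ?size_map ?size_iota //.
 by rewrite big_map /index_iota subn0.
rewrite -map_comp map_inj_in_uniq ?iota_uniq // => x y; rewrite !mem_iota => hx hy /eqP.
by rewrite eqn_modDr => /eqP /cancel_mod => /(_ un); rewrite !modn_small.
Qed.

Lemma sum_crt m n F : (0 < m)%N -> (0 < n)%N -> coprime m n ->
 (forall a, F (a %% (m * n))%N = F a) ->
 (\sum_(0 <= a < m * n) F a = \sum_(0 <= x < m) \sum_(0 <= y < n) F (x * n + y * m)%N)%C.
Proof.
move=> m0 n0 mn pF; have mn0 : (0 < m * n)%N by lia.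
rewrite -(@sum_reindex _ [seq (x * n + y * m)%N | x <- iota 0 m, y <- iota 0 n]) ?size_allpairs ?size_iota //.
 rewrite big_allpairs_dep /index_iota !subn0; exact: eq_bigr.
rewrite map_allpairs; apply: allpairs_uniq; rewrite ?iota_uniq //.
move=> [x y] [x' y'] /allpairsP [[a b] [/= ha hb [-> ->]]] /allpairsP [[a' b'] [/= ha' hb' [-> ->]]] /= e.
move: ha hb ha' hb'; rewrite !mem_iota => ha hb ha' hb'.
have e1 : (a * n = a' * n %[mod m]).
 have := f_equal (fun z => z %% m) e; rewrite !(modn_dvdm _ (dvdn_mulr n (dvdnn m))).
 by rewrite ![(_ + _ * m)%N]addnC !modnMDl.
have e2 : (b * m = b' * m %[mod n]).
 have := f_equal (fun z => z %% n) e; rewrite !(modn_dvdm _ (dvdn_mull m (dvdnn n))).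
 by rewrite !modnMDl.
move: e1 e2; rewrite ![(_ * n)%N]mulnC ![(_ * m)%N]mulnC => /cancel_mod h1 /cancel_mod h2.
have := h2 mn; have := h1 ltac:(by rewrite coprime_sym).
by rewrite !modn_small // => -> ->.
Qed.

Definition chi (n a : nat) : C := RtoC (IZR (jacobi a n)).
Definition gsum (n : nat) : C := (\sum_(0 <= x < n) ez n (x ^ 2))%C.

Lemma chi_mod n a : chi n (a %% n) = chi n a.
Proof. by rewrite /chi (@jacobi_modl _ a) // modn_mod. Qed.

Lemma chiM n a b : odd n -> chi n (a * b) = (chi n a * chi n b)%C.
Proof. by move=> on; rewrite /chi jacobiMl // mult_IZR RtoC_mult. Qed.

Lemma chi_mul m n a : (0 < m)%N -> (0 < n)%N -> chi (m * n) a = (chi m a * chi n a)%C.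
Proof. by move=> m0 n0; rewrite /chi jacobiMr // mult_IZR RtoC_mult. Qed.

Lemma chi_sq n a : odd n -> coprime a n -> (chi n a * chi n a)%C = RtoC 1.
Proof.
move=> on ha; rewrite -RtoC_mult -mult_IZR.
case: (@jacobi_coprime a n on) => [[_ [->|->]]|[/negP //]] /=; by [].
Qed.

Lemma chi_ncoprime n a : odd n -> ~~ coprime a n -> chi n a = RtoC 0.
Proof.
move=> on /negP ha; rewrite /chi.
by case: (@jacobi_coprime a n on) => [[//]|[_ ->]].
Qed.

Lemma gsum_mod n a x : (0 < n)%N -> ez n (a * (x %% n) ^ 2) = ez n (a * x ^ 2).
Proof. by move=> n0; apply: ez_eqmod => //; rewrite -modnMmr modnXm modnMmr. Qed.

Lemma sumC_conj (I : Type) (r : seq I) (P : pred I) (F : I -> C) :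
 Cconj (\big[Cplus/RtoC 0]_(i <- r | P i) F i) = \big[Cplus/RtoC 0]_(i <- r | P i) Cconj (F i).
Proof.
elim/big_rec2: _ => [|i y x _ <-]; first by rewrite /Cconj Ropp_0.
by rewrite /Cconj /Cplus /=; congr pair; ring.
Qed.

(** After the substitution [x = u + y] the sum over [y] of the cross term [2 u y] vanishes unless
    [n] divides [2 u], that is, [n] being odd, unless [u = 0]. *)
Lemma gsum_norm n : odd n -> (gsum n * Cconj (gsum n))%C = RtoC n.
Proof.
move=> on; have n0 := odd_gt0' on.
rewrite sumC_conj big_distrr.
transitivity (\sum_(0 <= y < n) \sum_(0 <= u < n) (ez n (u ^ 2) * ez n (y * (2 * u))))%C.
 apply: eq_bigr => y _; rewrite /gsum -(@sum_affine n 1 y) ?coprime1n //; last first.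
  by move=> a; have := @gsum_mod n 1 a n0; rewrite !mul1n.
 rewrite big_distrl /=; apply: eq_bigr => u _.
 have c : (ez n (y ^ 2) * Cconj (ez n (y ^ 2)))%C = RtoC 1 by rewrite /ez -cisN cisNr.
 rewrite mul1n sqrnD (ezD n _) (ezD n _).
 transitivity (ez n (u ^ 2) * ((ez n (y ^ 2) * Cconj (ez n (y ^ 2))) * (ez n (2 * (u * y)))))%C; first by ring.
 by rewrite c Cmult_1_l; congr (_ * ez n _)%C; lia.
rewrite exchange_big /=.
rewrite (eq_bigr (fun u => ez n (u ^ 2) * (if (n %| 2 * u) then RtoC n else RtoC 0))%C); last first.
 by move=> u _; rewrite -big_distrr sum_ez.
rewrite big_ltn // dvdn0 ez0 big_nat big1 ?Cplus_0_r ?Cmult_1_l //.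
move=> u hu; rewrite Gauss_dvdr; last by rewrite coprimen2.
by case/andP: hu => h1 h2; rewrite gtnNdvd // Cmult_0_r.
Qed.

(** A class [r] has [1 + chi p r] square roots modulo [p]: one if [r = 0], and the two roots [x] and
    [p - x] if [r] is a nonzero residue. *)
Lemma sum_squares_prime p F : prime p -> odd p ->
 (forall a, F (a %% p)%N = F a) ->
 (\sum_(0 <= x < p) F (x ^ 2)%N = \sum_(0 <= r < p) ((1 + chi p r) * F r))%C.
Proof.
move=> pp op pF; have p0 := prime_gt0 pp.
set h := p./2.
have chi0 : chi p 0 = RtoC 0.
 by apply: chi_ncoprime => //; rewrite coprime_sym prime_coprime // dvdn0.
have L : (\sum_(1 <= x < h.+1) F (x ^ 2)%N = \sum_(1 <= r < p | qres r p) F r)%C.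
 transitivity (\sum_(r <- half_squares p) F r)%C.
  rewrite big_map /index_iota subn1; apply: eq_bigr => x _; by pos.
 rewrite -[RHS]big_filter; apply: perm_big; apply: uniq_perm.
 - have := @uniq_half_squares p 1 pp op.
  under eq_map => x do rewrite mul1n.
  by apply; rewrite dvdn1; apply/eqP => e; rewrite e in pp.
 - by rewrite filter_uniq // iota_uniq.
 move=> r; rewrite mem_filter mem_index_iota; case: (boolP (0 < r < p)%N) => hr.
  by rewrite half_squares_res // andbT.
 rewrite andbF; apply/negbTE; apply: contra hr => /mapP [x hx ->].
 rewrite ltn_pmod // andbT lt0n -/(dvdn p _) Euclid_dvdX // andbT.
 by apply/negP => /dvdn_leq; move: hx; rewrite mem_half; lia.
rewrite big_ltn // [in RHS]big_ltn // chi0 Cplus_0_r Cmult_1_l; congr (_ + _)%C.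
have -> : (\sum_(1 <= x < p) F (x ^ 2)%N = \sum_(1 <= x < h.+1) F (x ^ 2)%N + \sum_(1 <= x < h.+1) F (x ^ 2)%N)%C.
 rewrite (@sumC_range_split _ 1 h.+1 p); try lia; congr (_ + _)%C.
 rewrite big_nat_rev -{1}add1n big_addn (_ : (p - h = h.+1)%N); last by lia.
 apply: eq_big_nat => x hx; rewrite -pF -[RHS]pF; congr F.
 set y := (_ - _)%N; have e : (y + x)%N = p by lia.
 apply/eqP; case: (leqP y x) => hxy.
  lia.
 by rewrite eqn_mod_dvd ?leq_exp2r ?(ltnW hxy) // subn_sqr e dvdn_mull.
rewrite L -big_split big_mkcond; apply: eq_big_nat => r hr.
rewrite /chi jacobi_prime // legendreE gtnNdvd; [|lia|lia].
case: (qres r p) => /=; first by ring.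
ring.
Qed.

Lemma sum_chi_prime p : prime p -> odd p -> (\sum_(0 <= a < p) chi p a)%C = RtoC 0.
Proof.
move=> pp op; have := @sum_squares_prime p (fun=> RtoC 1) pp op (fun _ => erefl).
rewrite [X in _ = X -> _](eq_bigr (fun r => 1 + chi p r)%C); last by move=> i _; ring.
rewrite big_split => h.
set A := (\sum_(0 <= _ < p) 1)%C in h; set B := (\sum_(0 <= a < p) chi p a)%C in h *.
by transitivity (A + B - A)%C; [ring | rewrite -h; ring].
Qed.

Lemma gauss_prime p k : prime p -> odd p ->
 (\sum_(0 <= a < p) (chi p a * ez p (a * k)) = chi p k * gsum p)%C.
Proof.
move=> pp op; have p0 := prime_gt0 pp.
case: (boolP (p %| k)) => hk.
 rewrite (@chi_ncoprime p k op) ?Cmult_0_l; last by rewrite coprime_sym prime_coprime // hk.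
 rewrite (eq_bigr (chi p)) ?sum_chi_prime // => a.
 by move: hk => /dvdnP [q ->]; rewrite mulnA ez_mult // Cmult_1_r.
have ck : coprime k p by rewrite coprime_sym prime_coprime.
have G1 : gsum p = (\sum_(0 <= a < p) (chi p a * ez p a))%C.
 rewrite /gsum (@sum_squares_prime p (ez p)) // => [|a]; last by rewrite ez_mod.
 rewrite (eq_bigr (fun r => ez p (r * 1) + chi p r * ez p r)%C); last by move=> i _; rewrite muln1; ring.
 rewrite big_split /= sum_ez // dvdn1 (_ : (p == 1)%N = false) ?Cplus_0_l //.
 lia.
rewrite G1 -(@sum_affine p k 0 (fun a => chi p a * ez p a)%C) //; last first.
 by move=> a; rewrite chi_mod ez_mod.
rewrite big_distrr /=; apply: eq_bigr => a _.
by rewrite addn0 chiM // Cmult_assoc Cmult_assoc chi_sq // Cmult_1_l mulnC.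
Qed.

Lemma gsum_twist p a : prime p -> odd p -> ~~ (p %| a)%N ->
 (\sum_(0 <= x < p) ez p (a * x ^ 2) = chi p a * gsum p)%C.
Proof.
move=> pp op pa; have p0 := prime_gt0 pp.
rewrite (@sum_squares_prime p (fun x => ez p (a * x))) //; last first.
 by move=> x; apply: ez_eqmod => //; rewrite modnMmr.
rewrite (eq_bigr (fun r => ez p (r * a) + chi p r * ez p (r * a))%C); last first.
 by move=> i _; rewrite (mulnC a); ring.
by rewrite big_split /= sum_ez // (negbTE pa) Cplus_0_l gauss_prime.
Qed.

Lemma gsum_mul m n : (0 < m)%N -> (0 < n)%N -> coprime m n ->
 (gsum (m * n) = (\sum_(0 <= x < m) ez m (n * x ^ 2)) * (\sum_(0 <= y < n) ez n (m * y ^ 2)))%C.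
Proof.
move=> m0 n0 mn; have mn0 : (0 < m * n)%N by lia.
rewrite /gsum (@sum_crt m n _) //; last first.
 by move=> a; have := @gsum_mod _ 1 a mn0; rewrite !mul1n.
rewrite big_distrl; apply: eq_bigr => x _; rewrite big_distrr /=; apply: eq_bigr => y _.
rewrite -(@ez_scale m _ n) // -(@ez_scale n _ m) // [(n * m)%N]mulnC -ezD.
apply: ez_eqmod => //; rewrite sqrnD (_ : (2 * _ = 2 * (x * y) * (m * n))%N); last by lia.
by rewrite addnC modnMDl; congr (_ %% _); lia.
Qed.

Definition eps4 (n : nat) : C := if (n %% 4 == 1)%N then RtoC 1 else Ci.

Lemma odd_mod4 n : odd n -> ((n %% 4 = 1)%N \/ (n %% 4 = 3)%N).
Proof. lia. Qed.

(** * The sign of the Gauss sum *)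

Lemma Re_Im_le z : - (sqrt 2 * Cmod z) <= Re z + Im z.
Proof.
have h1 : (Re z + Im z) ^ 2 <= (sqrt 2 * Cmod z) ^ 2.
 rewrite Rpow_mult_distr (pow2_sqrt 2); last by lra.
 rewrite pow2_sqrt /Re /Im; last by nra.
 by have := Rle_0_sqr (fst z - snd z); rewrite /Rsqr; lra.
have h0 : 0 <= sqrt 2 * Cmod z by pos.
nra.
Qed.

(** The terms [exp (PI i s ^ 2 / (2 n))] have period [2 n] in [s], and their phases increase slowly
    from 0, which permits a lower bound of the sum. *)
Definition theta4 (n s : nat) : C := cis (2 * PI * (INR (s ^ 2) / INR (4 * n))).

Lemma theta4_ez n s : theta4 n s = ez (4 * n) (s ^ 2).
Proof. pos. Qed.

Lemma theta4_mod n s : (0 < n)%N -> theta4 n (s %% (2 * n)) = theta4 n s.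
Proof.
move=> n0; apply: ez_eqmod; first by lia.
rewrite {2}(divn_eq s (2 * n)) sqrnD; set q := (s %/ _); set r := (s %% _).
rewrite (_ : (_ ^ 2 + r ^ 2 + 2 * _ = (q ^ 2 * n + q * r) * (4 * n) + r ^ 2)%N); last by lia.
by rewrite modnMDl.
Qed.

Lemma sumC_even_odd F n :
 (\sum_(0 <= s < 2 * n) F s = \sum_(0 <= x < n) F (2 * x)%N + \sum_(0 <= x < n) F (2 * x + 1)%N)%C.
Proof.
elim: n => [|n IH]; first by rewrite !big_geq // Cplus_0_l.
rewrite mulnS !addSn add0n !big_nat_recr //= IH addn1; ring.
Qed.

(** Even [s = 2 x] give [gsum n]; odd [s], written [2 x + n], give the same terms times the constant
    [exp (PI i n / 2)]. *)
Lemma theta4_sum n : odd n ->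
 (\sum_(0 <= s < 2 * n) theta4 n s = gsum n * (1 + cis (PI / 2 * n)))%C.
Proof.
move=> on; have n0 := odd_gt0' on.
have nR := INR_gt0 n0.
rewrite sumC_even_odd Cmult_plus_distr_l Cmult_1_r; congr (_ + _)%C.
 apply: eq_bigr => x _; rewrite theta4_ez expnMn; exact: ez_scale.
rewrite -(@sum_affine n 1 n./2 _) ?coprime1n //; last first.
 move=> a; rewrite -theta4_mod // -[RHS]theta4_mod //.
 by rewrite {2}(divn_eq a n) mulnDr -addnA mulnCA modnMDl.
rewrite big_distrl; apply: eq_bigr => x _.
rewrite (_ : (2 * _ + 1 = 2 * x + n)%N); last by lia.
rewrite theta4_ez sqrnD (ezD _ _) (ezD _ _) expnMn (@ez_scale n _ 4) // -!Cmult_assoc; congr (_ * _)%C.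
rewrite (_ : (2 * _ = x * (4 * n))%N) ?ez_mult ?Cmult_1_r; [|lia|lia].
by rewrite /ez INRM expnS expn1 INRM; congr cis; rewrite /=; field; lra.
Qed.

Lemma cos_sin_ge1 x : 0 <= x <= PI / 2 -> 1 <= cos x + sin x.
Proof.
move=> hx; have c0 : 0 <= cos x by apply: cos_ge_0; lra.
have s0 : 0 <= sin x by apply: sin_ge_0; lra.
have := sin2_cos2 x; rewrite /Rsqr; nra.
Qed.

Lemma cos_sin_ge0 x : 0 <= x <= 3 * PI / 4 -> 0 <= cos x + sin x.
Proof.
move=> hx.
have h : cos (PI / 4 - x) = (cos x + sin x) * / sqrt 2.
 by rewrite cos_minus cos_PI4 sin_PI4; field; apply: Rgt_not_eq; apply: sqrt_lt_R0; lra.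
have h2 : 0 <= cos (PI / 4 - x) by apply: cos_ge_0; lra.
have s2 : 0 < sqrt 2 by pos.
have -> : cos x + sin x = cos (PI / 4 - x) * sqrt 2 by rewrite h; field; lra.
nra.
Qed.

Lemma RI_sum (I : Type) (r : seq I) (P : pred I) (F : I -> C) :
 Re (\big[Cplus/RtoC 0]_(i <- r | P i) F i) + Im (\big[Cplus/RtoC 0]_(i <- r | P i) F i)
 = \sum_(i <- r | P i) (Re (F i) + Im (F i)).
Proof. by elim/big_rec2: _ => [|i y x _ <-]; rewrite /Re /Im /=; ring. Qed.

Lemma cis_quarter n : odd n -> cis (PI / 2 * n) = if (n %% 4 == 1)%N then Ci else (- Ci)%C.
Proof.
move=> on.
have -> : PI / 2 * n = PI / 2 * INR (n %% 4) + 2 * PI * INR (n %/ 4).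
 by rewrite {1}(divn_eq n 4) INRD INRM //=; lra.
rewrite cis_period; have [->|->] := odd_mod4 on; rewrite /=.
 by rewrite Rmult_1_r /cis cos_PI2 sin_PI2.
rewrite (_ : PI / 2 * _ = 3 * (PI / 2)); last by lra.
rewrite /cis cos_3PI2 sin_3PI2 /Copp /=; congr pair; ring.
Qed.

(** If [gsum n] is [eps4 n * sqrt n] up to sign, then [Re + Im] of this sum is [2 sqrt n] up to the
    same sign, so the strict bound decides the sign. The terms [s] and [2 n - s] agree. Those with
    [s ^ 2 < n] contribute at least 1 each, those with [s ^ 2 < 3 n / 2] are nonnegative, and the
    rest is a Kusmin-Landau sum. *)
Lemma theta4_lower n : odd n -> (1 < n)%N ->
 - (2 * sqrt n) < Re (\sum_(0 <= s < 2 * n) theta4 n s)%C + Im (\sum_(0 <= s < 2 * n) theta4 n s)%C.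
Proof.
move=> on n1; have n0 := odd_gt0' on; have nR := INR_gt0 n0.
have pi3 : 3 < PI by have := PI2_3_2; lra.
set L := fun z : C => Re z + Im z.
have LD z w : L (z + w)%C = L z + L w by rewrite /L /Re /Im /=; ring.
set W := (\sum_(1 <= s < n) theta4 n s)%C.
have split2 : (\sum_(0 <= s < 2 * n) theta4 n s = theta4 n 0 + theta4 n n + (W + W))%C.
 rewrite (@sumC_range_split _ 0 1 _) ?(@sumC_range_split _ 1 n (2 * n)) ?(@sumC_range_split _ n n.+1 (2 * n)) ?big_nat1; try lia.
 have -> : (\sum_(n.+1 <= s < 2 * n) theta4 n s = W)%C.
  rewrite big_nat_rev -{1}add1n big_addn (_ : (2 * n - n = n)%N); last by lia.
  apply: eq_big_nat => s hs; rewrite -theta4_mod //.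
  set y := (_ - _)%N; have e : (y + s = 2 * n)%N by lia.
  rewrite theta4_mod //; apply: ez_eqmod; first by lia.
  have ys : (s <= y)%N by lia.
  apply/eqP; rewrite eqn_mod_dvd ?leq_exp2r // subn_sqr e.
  have -> : ((y - s) * (2 * n) = (n - s) * (4 * n))%N by nia.
  exact: dvdn_mull.
 by rewrite -/W; ring.
rewrite split2 -/(L _) !LD.
have -> : L (theta4 n 0) = 1.
 by rewrite /theta4 /Rdiv Rmult_0_l Rmult_0_r cis0 /L /=; ring.
have Ln : -1 <= L (theta4 n n).
 have -> : theta4 n n = cis (PI / 2 * n).
  rewrite /theta4 expnS expn1 !INRM; congr cis; rewrite (_ : INR 4 = 4); last by rewrite /=; ring.
  by field; lra.
 by rewrite cis_quarter //; case: ifP => _; rewrite /L /=; lra.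
have ph s : 2 * PI * (INR (s ^ 2) / INR (4 * n)) = PI / 2 * (INR (s ^ 2) / n).
 by rewrite INRM (_ : INR 4 = 4); [field; lra | rewrite /=; ring].
have dmono j : (1 <= j)%N -> (j.+1 < n)%N -> INR (j ^ 2) <= INR (j.+1 ^ 2).
 by move=> _ _; apply: leqINR; rewrite leq_exp2r.
have [p [hp1 hp2 hp3]] := @monotone_cut _ n 1 n n0 dmono.
have [q [hq1 hq2 hq3]] := @monotone_cut (fun s => INR (s ^ 2)) (3 / 2 * n) p n ltac:(lia)
 ltac:(move=> j h1 h2; apply: dmono; lia).
have sq0 : 0 < sqrt n by pos.
have sq2 : sqrt n * sqrt n = n by apply: sqrt_sqrt; lra.
have fr s c : INR (s ^ 2) < c * n -> 0 <= INR (s ^ 2) / n <= c.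
 split; first by pos.
 by apply: (Rmult_le_reg_r n) => //; rewrite Rmult_assoc Rinv_l; lra.
rewrite /W (@sumC_range_split _ 1 p n) ?(@sumC_range_split _ p q n); try lia.
rewrite !LD.
have W1 : sqrt n - 1 <= L (\sum_(1 <= s < p) theta4 n s)%C.
 rewrite /L RI_sum; apply: (Rle_trans _ (\sum_(1 <= s < p) 1)).
  rewrite sumR_nat_const INRB; last by lia.
  suff : sqrt n <= p by rewrite /=; lra.
  have pp : n <= p * INR p.
   rewrite -INRM; case: (ltnP p n) => hpn; last by apply: leqINR; nia.
   by have := hp3 p ltac:(lia).
  by have := pos_INR p; nra.
 apply: sumR_le => s; rewrite mem_index_iota => hs _.
 rewrite /theta4 ph; apply: cos_sin_ge1.
 by have := fr s 1 ltac:(have := hp2 s hs; lra); nra.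
have W2 : 0 <= L (\sum_(p <= s < q) theta4 n s)%C.
 rewrite /L RI_sum; apply: sumR_ge0 => s; rewrite mem_index_iota => hs _.
 rewrite /theta4 ph; apply: cos_sin_ge0.
 by have := fr s (3/2) ltac:(have := hq2 s hs; lra); nra.
case: (leqP n q) => hqn.
 have -> : (\sum_(q <= s < n) theta4 n s)%C = RtoC 0 by rewrite big_geq.
 have -> : L (RtoC 0) = 0 by rewrite /L /Re /Im /=; ring.
 have : 1 <= sqrt n.
  have n2 := leqINR n1; rewrite /= in n2; nra.
 lra.
have hq := hq3 q ltac:(lia); rewrite expnS expn1 INRM in hq.
have n5 : (5 <= n)%N.
 have hh : (3 * n <= 2 * (q * q))%N.
  by apply: leq_INR; rewrite (INRM 3) (INRM 2) INRM /=; lra.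
 by case: (n) on n1 hqn hh => [|[|[|[|[|m]]]]] //; case: (q) => [|[|[|]]].
have q0 : 0 < q by apply: INR_gt0; lia.
have K1 : Cmod (\sum_(q <= s < n) theta4 n s)%C <= 2 / (PI * (q / (2 * n))).
 apply: (@kusmin_landau _).
 - pos.
 - apply: (Rmult_le_reg_r (2 * n)); first by lra.
  rewrite Rmult_assoc Rinv_l; last by lra.
  by have := leqINR (ltnW hqn); lra.
 - move=> j h1 h2.
  have -> : INR (j.+1 ^ 2) / INR (4 * n) - INR (j ^ 2) / INR (4 * n) = (2 * j + 1) / (4 * n).
   by rewrite !expnS !muln1 !INRM S_INR (_ : INR 4 = 4); [field; lra | rewrite /=; ring].
  have hj1 := leqINR h1; have := leqINR h2; rewrite !S_INR => hj2.
  split; apply: (Rmult_le_reg_r (4 * n)); try lra.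
   have -> : q / (2 * n) * (4 * n) = 2 * q by field; lra.
   have -> : (2 * j + 1) / (4 * n) * (4 * n) = 2 * j + 1 by field; lra.
   lra.
  have -> : (2 * j + 1) / (4 * n) * (4 * n) = 2 * j + 1 by field; lra.
  have -> : (1 - q / (2 * n)) * (4 * n) = 4 * n - 2 * q by field; lra.
  lra.
 - move=> j h1 h2.
  rewrite !expnS !muln1 !INRM (_ : INR 4 = 4) ?S_INR; last by rewrite /=; ring.
  apply: (Rmult_le_reg_r (4 * n)); first by lra.
  rewrite !Rmult_minus_distr_r !Rmult_assoc Rinv_l; lra.
have K2 := Re_Im_le (\sum_(q <= s < n) theta4 n s)%C; rewrite -/(L _) in K2.
have s2 : 0 < sqrt 2 by pos.
have s22 : sqrt 2 * sqrt 2 = 2 by apply: sqrt_sqrt; lra.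
(* From [q ^ 2 >= 3 n / 2] and [PI > 3]: the number [4 sqrt 2 / (3 sqrt (3/2))] is about 1.5396. *)
have K3 : sqrt 2 * (2 / (PI * (q / (2 * n)))) <= 154 / 100 * sqrt n.
 set A := sqrt 2 * _.
 have A2 : A * A <= 154 / 100 * sqrt n * (154 / 100 * sqrt n).
  have -> : A * A = 32 * n * n / (PI * PI * (q * q)).
   by rewrite /A -[32](_ : sqrt 2 * sqrt 2 * 16 = 32); [field; lra | lra].
  have pq : 0 < PI * PI * (q * q) by pos.
  apply: (Rmult_le_reg_r (PI * PI * (q * q))) => //.
  rewrite /Rdiv Rmult_assoc Rinv_l; last by lra.
  have : 9 * (3 / 2 * n) <= PI * PI * (q * q) by mon.
  nra.
 nra.
(* The bounds so far add up to at least [- (1.08 sqrt n + 2)], which exceeds [- 2 sqrt n] once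
   [sqrt n > 2.18]; [n >= 5] is enough. *)
have K4 : 0 < 46 / 100 * sqrt n - 1.
 have : 5 <= n by have := leqINR n5; rewrite /=; lra.
 nra.
nra.
Qed.

Lemma gsum_sign n s : odd n -> (1 < n)%N -> (s = 1 \/ s = -1) ->
 gsum n = (RtoC s * (eps4 n * RtoC (sqrt n)))%C -> s = 1.
Proof.
move=> on n1 [//|->] hg.
have := theta4_lower on n1; rewrite theta4_sum // hg cis_quarter // /eps4.
by case: ifP => _; rewrite /=; lra.
Qed.

(** * The symbol at -1 *)

Lemma complement_step h m : (m < h)%N ->
 ((h + h) * (h - m) = (h - m.+1) * (h + h).+1 + (h + m).+1)%N.
Proof.
move=> hm; have [u ->] : exists u, h = (u + m.+1)%N by exists (h - m.+1)%N; rewrite subnK.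
rewrite (_ : (u + m.+1 - m = u.+1)%N); last by lia.
lia.
Qed.

(** Here [h + h] plays the role of -1. For [m = h] this reads [(p - 1)! = (-1) ^ h * h! ^ 2] modulo
    [p = 2 h + 1], so for even [h] Wilson's theorem exhibits [h!] as a square root of -1. *)
Lemma fact_half_mod h m : (m <= h)%N ->
 ((h + m)`! * (h - m)`! = (h + h) ^ m * h`! ^ 2 %[mod (h + h).+1])%N.
Proof.
elim: m => [|m IH] hm; first by rewrite addn0 subn0 mul1n.
have e : (h - m = (h - m.+1).+1)%N by rewrite subnS prednK // subn_gt0.
rewrite addnS expnS.
have -> : ((h + m).+1 * (h + m)`! * (h - m.+1)`! = ((h + h) * (h - m)) * ((h + m)`! * (h - m.+1)`!) %[mod (h + h).+1]).
 rewrite -mulnA; apply: eqmodM => //.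
 by rewrite complement_step // modnMDl.
rewrite -mulnA -[in RHS]mulnA; apply: eqmodM => //.
by rewrite mulnCA e -factS -e; apply: IH; apply: ltnW.
Qed.

Lemma m1_pow_even q m : (q ^ (2 * m) = 1 %[mod q.+1])%N.
Proof.
rewrite expnM -modnXm (_ : (q ^ 2 = 1 %[mod q.+1])) ?modnXm ?exp1n //.
case: q => // q; have -> : (q.+1 ^ 2 = q * q.+2 + 1)%N by lia.
by rewrite modnMDl.
Qed.

Lemma qres_m1 p : prime p -> odd p -> qres p.-1 p = (p %% 4 == 1)%N.
Proof.
move=> pp op; have p0 := prime_gt0 pp; have p1 := prime_gt1 pp.
have [h ph] : exists h, p = (h + h).+1.
 by exists p./2; rewrite -{1}(odd_double_half p) op addnn.
have pq : p.-1 = (h + h)%N by lia.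
have h4 : (p %% 4 == 1)%N = ~~ odd h by lia.
have par : h = (2 * h./2 + odd h)%N by lia.
rewrite h4; case: (boolP (odd h)) => oh /=; last first.
 rewrite (negbTE oh) addn0 in par.
 apply/(qresP _ p0); exists h`!.
 have H := @fact_half_mod h h (leqnn h); rewrite subnn muln1 in H.
 have E := m1_pow_even _ h./2; rewrite -par in E.
 have -> : (h`! ^ 2 = p.-1`! %[mod p]).
  by rewrite ph H -modnMml E modnMml mul1n.
 have := Wilson p1; rewrite pp => /esym hW.
 apply/eqP; rewrite -(eqn_modDr 1) !addn1 prednK // modnn; exact: hW.
rewrite oh addn1 in par.
apply/negbTE/negP => /(qresP _ p0) [x hx].
have f := fermat_little x pp.
have e : (x ^ p = x * p.-1 %[mod p]).
 rewrite {1}ph expnS; apply: eqmodM => //.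
 have E := m1_pow_even p.-1 h./2; rewrite prednK // in E.
 by rewrite addnn -mul2n expnM -modnXm hx modnXm {1}par expnSr -modnMml E modnMml mul1n.
have px : (p %| x * (p - 2)).
 have : (x * p.-1 = x * 1 %[mod p]) by rewrite -e muln1.
 move/eqP; rewrite eqn_mod_dvd; last by rewrite leq_mul2l -subn1 subn_gt0 p1 orbT.
 by rewrite -mulnBr -subn1 -subnDA.
have p3 : (2 < p)%N by clear - op p1; lia.
move: px; rewrite Euclid_dvdM // => /orP [px|/dvdn_leq]; last by clear - p3; lia.
move: hx; rewrite -modnXm (eqP px) mod0n => /esym/eqP; rewrite -/(dvdn p p.-1) => /dvdn_leq.
lia.
Qed.

Lemma jacobi_m1_prime p : prime p -> odd p -> jacobi p.-1 p = if (p %% 4 == 1)%N then 1%Z else (-1)%Z.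
Proof.
move=> pp op; have p1 := prime_gt1 pp.
by rewrite jacobi_prime // legendreE qres_m1 // gtnNdvd; lia.
Qed.

Lemma chi_m1_prime p : prime p -> odd p -> chi p p.-1 = RtoC (if (p %% 4 == 1)%N then 1 else -1).
Proof. by move=> pp op; rewrite /chi jacobi_m1_prime //; case: ifP. Qed.

Lemma sqrt_INR_sq n : sqrt (INR n) * sqrt n = INR n.
Proof. by apply: sqrt_sqrt; apply: pos_INR. Qed.

Lemma sq_eq_pm g x : g * g = x * x -> exists2 s : R, (s = 1 \/ s = -1) & g = s * x.
Proof.
move=> h; have /Rmult_integral [h1|h1] : (g - x) * (g + x) = 0 by lra.
 by exists 1; lra.
by exists (-1); lra.
Qed.

(** Conjugation multiplies the sum by [chi p p.-1], so it is real or purely imaginary according to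
    [p] modulo 4; [gsum_norm] gives its size and [gsum_sign] its sign. *)
Lemma gsum_prime p : prime p -> odd p -> gsum p = (eps4 p * RtoC (sqrt p))%C.
Proof.
move=> pp op; have p0 := prime_gt0 pp; have p1 := prime_gt1 pp.
have hc : Cconj (gsum p) = (chi p p.-1 * gsum p)%C.
 rewrite -gsum_twist //; last by apply/negP => /dvdn_leq; lia.
 by rewrite sumC_conj; apply: eq_bigr => x _; rewrite ez_conj.
have hn := gsum_norm op.
have [s hs hg] : exists2 s : R, (s = 1 \/ s = -1) & gsum p = (s * (eps4 p * (sqrt p)))%C.
 move: hc hn; rewrite chi_m1_prime // /eps4; case: (gsum p) => a b; case: ifP => _ hc hn.
  have b0 : b = 0 by move: hc; rewrite /Cconj => -[_]; lra.
  have [|s hs ha] := @sq_eq_pm a (sqrt p).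
   by move: hn; rewrite sqrt_INR_sq b0 => -[]; lra.
  by exists s => //; rewrite ha b0; apply: injective_projections => /=; ring.
 have a0 : a = 0 by move: hc; rewrite /Cconj => -[]; lra.
 have [|s hs ha] := @sq_eq_pm b (sqrt p).
  by move: hn; rewrite sqrt_INR_sq a0 => -[]; lra.
 by exists s => //; rewrite ha a0; apply: injective_projections => /=; ring.
by rewrite hg (gsum_sign op p1 hs hg) Cmult_1_l.
Qed.

(** * Quadratic reciprocity and the symbol at 2 *)

Definition rsgn (m n : nat) : Z := if ((m %% 4 == 3) && (n %% 4 == 3))%N then (-1)%Z else 1%Z.

Lemma eps4M m n : odd m -> odd n ->
 (eps4 (m * n) * RtoC (IZR (rsgn m n)) = eps4 m * eps4 n)%C.
Proof.
move=> om on; rewrite /eps4 /rsgn -modnMm.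
by case: (odd_mod4 om) => ->; case: (odd_mod4 on) => -> /=; apply: injective_projections => /=; ring.
Qed.

Lemma rsgnC m n : rsgn m n = rsgn n m.
Proof. by rewrite /rsgn andbC. Qed.

Lemma rsgnMr m a b : odd m -> odd a -> odd b -> rsgn m (a * b) = (rsgn m a * rsgn m b)%Z.
Proof.
move=> om oa ob; rewrite /rsgn -modnMm.
by case: (odd_mod4 om) => ->; case: (odd_mod4 oa) => ->; case: (odd_mod4 ob) => ->.
Qed.

Lemma rsgn_sq m n : (rsgn m n * rsgn m n = 1)%Z.
Proof. by rewrite /rsgn; case: ifP. Qed.

(** [gsum (p * q)] splits by the Chinese remainder theorem into twisted sums for [p] and [q]. The
    product has the shape required by [gsum_sign], which covers composite moduli too; that its sign
    is positive is the reciprocity law. *)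
Lemma recip_prime p q : prime p -> odd p -> prime q -> odd q -> p <> q ->
 jacobi p q = (rsgn p q * jacobi q p)%Z.
Proof.
move=> pp op pq oq pnq; have p0 := prime_gt0 pp; have q0 := prime_gt0 pq.
have p1 := prime_gt1 pp; have q1 := prime_gt1 pq.
have cpq : coprime p q by rewrite prime_coprime // dvdn_prime2 //; apply/eqP.
have hpq : ~~ (p %| q) by rewrite -prime_coprime.
have hqp : ~~ (q %| p) by rewrite -prime_coprime // coprime_sym.
have G := gsum_mul p0 q0 cpq.
rewrite (gsum_twist pp op hpq) (gsum_twist pq oq hqp) (gsum_prime pp op) (gsum_prime pq oq) in G.
set c := (jacobi p q * jacobi q p * rsgn p q)%Z.
have cJ1 := @jacobi_coprime p q oq; have cJ2 := @jacobi_coprime q p op.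
have J1 : jacobi p q = 1%Z \/ jacobi p q = (-1)%Z by case: cJ1 => [[_ //]|[/negP //]].
have J2 : jacobi q p = 1%Z \/ jacobi q p = (-1)%Z by case: cJ2 => [[_ //]|[/negP []]]; rewrite coprime_sym.
have R1 : rsgn p q = 1%Z \/ rsgn p q = (-1)%Z by rewrite /rsgn; case: ifP; auto.
have c1 : IZR c = 1 \/ IZR c = -1.
 by rewrite /c; case: J1 => ->; case: J2 => ->; case: R1 => ->; auto.
have hG : gsum (p * q) = (RtoC (IZR c) * (eps4 (p * q) * (sqrt (INR (p * q)))))%C.
 rewrite G INRM sqrt_mult; [|exact: pos_INR|exact: pos_INR].
 rewrite RtoC_mult /chi /c !mult_IZR !RtoC_mult.
 transitivity (RtoC (IZR (jacobi q p)) * RtoC (IZR (jacobi p q)) * (eps4 p * eps4 q) * (sqrt p) * (sqrt q))%C; first by ring.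
 by rewrite -eps4M //; ring.
have := gsum_sign _ _ c1 hG; rewrite oddM op oq => /(_ isT); have -> : (1 < p * q)%N by nia.
move=> /(_ isT) /eq_IZR; rewrite /c.
by case: J1 => ->; case: J2 => ->; case: R1 => ->.
Qed.

Lemma jacobi_recip m n : odd m -> odd n -> jacobi m n = (rsgn m n * jacobi n m)%Z.
Proof.
have base p n' : prime p -> odd p -> odd n' -> jacobi p n' = (rsgn p n' * jacobi n' p)%Z.
 move=> pp op; elim/odd_prime_ind: n' / => [|q n' pq oq on' IH].
  by rewrite jacobi_1r jacobi_1l // /rsgn andbF.
 rewrite (jacobiMr _ (prime_gt0 pq) (odd_gt0' on')) (rsgnMr op oq on') (jacobiMl _ _ op) IH.
 case: (eqVneq p q) => [<-|/eqP pq'].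
  have -> : jacobi p p = 0%Z.
   by rewrite jacobi_prime //; apply/legendre_eq0.
  lia.
 by rewrite (recip_prime pp op pq oq pq'); ring.
move=> om on; move: om; elim/odd_prime_ind: m / => [|p m pp op om IH].
 by rewrite jacobi_1r jacobi_1l.
rewrite (jacobiMl _ _ on) (jacobiMr _ (prime_gt0 pp) (odd_gt0' om)) rsgnC (rsgnMr on op om) (base p n pp op on) (rsgnC n p) (rsgnC n m).
lia.
Qed.

Lemma jacobi_m1 n : odd n -> jacobi n.-1 n = if (n %% 4 == 1)%N then 1%Z else (-1)%Z.
Proof.
elim/odd_prime_ind: n / => [|p n pp op on IH]; first by rewrite jacobi_1r.
have p0 := prime_gt0 pp; have n0 := odd_gt0' on.
rewrite jacobiMr // (@jacobi_modl _.-1 p.-1 p); last first.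
 by rewrite (_ : _.-1 = n.-1 * p + p.-1)%N ?modnMDl; nia.
rewrite (@jacobi_modl _.-1 n.-1 n); last first.
 by rewrite (_ : _.-1 = p.-1 * n + n.-1)%N ?modnMDl; nia.
rewrite IH jacobi_m1_prime //.
by rewrite -modnMm; case: (odd_mod4 op) => ->; case: (odd_mod4 on) => ->.
Qed.

(** Since [n] and [n.+2] are not both 3 modulo 4, reciprocity gives
    [(2 | n) = (n.+2 | n) = (n | n.+2)], and [n] is [2 * n.+1] modulo [n.+2]. *)
Lemma jacobi_2_step n : odd n -> jacobi 2 n.+2 = (jacobi n.+1 n.+2 * jacobi 2 n)%Z.
Proof.
move=> on; have on2 : odd n.+2 by lia.
have -> : jacobi 2 n = jacobi n n.+2.
 rewrite (@jacobi_modl 2 n.+2 n); last by rewrite (_ : n.+2 = n + 2)%N ?modnDl // addn2.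
 rewrite jacobi_recip //.
 by rewrite /rsgn; case: ifP => //; lia.
rewrite (@jacobi_modl n (n.+1 * 2) n.+2); last by rewrite (_ : (n.+1 * 2 = n.+2 + n)%N) ?modnDl; lia.
rewrite jacobiMl //.
have := @jacobi_m1 n.+2 on2; rewrite /= => ->.
by case: ifP => _; ring.
Qed.

Lemma jacobi_2 n : odd n -> jacobi 2 n = if (n %% 8 == 1)%N || (n %% 8 == 7)%N then 1%Z else (-1)%Z.
Proof.
move=> on; have -> : n = (2 * n./2 + 1)%N by lia.
elim: (n./2) => [|k IH]; first by rewrite jacobi_1r.
rewrite mulnS (_ : (2 + 2 * k + 1 = (2 * k + 1).+2)%N); last by lia.
rewrite jacobi_2_step; last by lia.
have := @jacobi_m1 _.+2; rewrite /= => ->; last by lia.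
rewrite IH; case: ifP => h1; case: ifP => h2; case: ifP => h3; lia.
Qed.

(** * The self-dual symbol *)

Definition mob (n : nat) : R := \big[Rmult/1]_(p <- primes n) (if (logn p n == 1)%N then -1 else 0).

Lemma mob1 : mob 1 = 1.
Proof. by rewrite /mob big_nil. Qed.

Lemma mob_le1 n : Rabs (mob n) <= 1.
Proof.
rewrite /mob; elim/big_rec: _ => [|p x _ hx]; first by rewrite Rabs_R1; lra.
rewrite Rabs_mult; case: ifP => _; rewrite ?Rabs_R0 ?Rabs_Ropp ?Rabs_R1; nra.
Qed.

Lemma mob_primeM p d : prime p -> (0 < d)%N -> ~~ (p %| d)%N -> mob (p * d) = - mob d.
Proof.
move=> pp d0 pd; have p0 := prime_gt0 pp; rewrite /mob.
have hp : perm_eq (primes (p * d)) (p :: primes d).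
 apply: uniq_perm; rewrite ?primes_uniq //=.
  by rewrite primes_uniq andbT mem_primes pp d0.
 by move=> q; rewrite primesM // primes_prime // inE.
rewrite (perm_big _ hp) big_cons.
rewrite lognM // logn_prime // eqxx (_ : logn p d = 0%N) /=; last by rewrite lognE pp d0 (negbTE pd).
rewrite (_ : \big[Rmult/1]_(j <- primes d) _ = mob d); first by rewrite /mob; ring.
rewrite big_seq [RHS]big_seq; apply: eq_bigr => q hq.
rewrite lognM // logn_prime // (_ : (q == p) = false) //.
by apply: contraNF pd => /eqP <-; move: hq; rewrite mem_primes => /and3P [].
Qed.

Lemma mob_primeM0 p d : prime p -> (0 < d)%N -> (p %| d)%N -> mob (p * d) = 0.
Proof.
move=> pp d0 pd; have p0 := prime_gt0 pp; rewrite /mob (big_rem p) /=; last by rewrite mem_primes pp muln_gt0 p0 d0 dvdn_mulr.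
rewrite lognM // logn_prime // eqxx.
have : (0 < logn p d)%N by rewrite logn_gt0 mem_primes pp d0 pd.
by case: (logn p d) => // k _; rewrite Rmult_0_l.
Qed.

(** For a prime [p] dividing [n], the divisors [d] prime to [p] cancel against [p * d], and the
    multiples of [p ^ 2] vanish. *)
Lemma sum_mob n : (0 < n)%N ->
 \sum_(d <- divisors n) mob d = if (n == 1)%N then 1 else 0.
Proof.
move=> n0; case: eqP => [->|n1]; first by rewrite big_seq1 mob1.
have pp : prime (pdiv n) by apply: pdiv_prime; lia.
set p := pdiv n in pp *; have pn : (p %| n) := pdiv_dvd n.
have p0 := prime_gt0 pp.
have q0 : (0 < n %/ p)%N by lia.
have e : n = (p * (n %/ p))%N by lia.
rewrite (bigID (fun d => p %| d)) /=.
have -> : \sum_(d <- divisors n | (p %| d)) mob d = \sum_(d <- [seq (p * x)%N | x <- divisors (n %/ p)]) mob d.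
 rewrite -big_filter; apply: perm_big; apply: uniq_perm.
 - by rewrite filter_uniq // divisors_uniq.
 - by rewrite map_inj_uniq ?divisors_uniq // => x y /eqP; rewrite eqn_pmul2l // => /eqP.
 move=> d; rewrite mem_filter -dvdn_divisors //; apply/andP/mapP.
  move=> [/dvdnP [x hx] dn]; exists x; last by lia.
  by rewrite -dvdn_divisors // -(@dvdn_pmul2l p) // -e mulnC -hx.
 move=> [x]; rewrite -dvdn_divisors // => hx ->; rewrite dvdn_mulr //.
 by rewrite {1}e dvdn_pmul2l.
rewrite big_map (bigID (fun d => p %| d)) /=.
rewrite big_seq_cond big1; last first.
 move=> d /andP [hd pd]; apply: mob_primeM0 => //; move: hd; rewrite -dvdn_divisors // => /dvdn_gt0; exact.
have -> : \sum_(d <- divisors (n %/ p) | ~~ (p %| d)) mob (p * d) =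
 - \sum_(d <- divisors (n %/ p) | ~~ (p %| d)) mob d.
 rewrite (_ : forall x, - x = -1 * x); last by move=> x; ring.
 rewrite big_distrr /= big_seq_cond [RHS]big_seq_cond; apply: eq_bigr => d /andP [hd pd].
 rewrite mob_primeM //; first by lra.
 by move: hd; rewrite -dvdn_divisors // => /dvdn_gt0; exact.
have -> : \sum_(d <- divisors n | ~~ (p %| d)) mob d = \sum_(d <- divisors (n %/ p) | ~~ (p %| d)) mob d.
 rewrite -[LHS]big_filter -[RHS]big_filter; apply: perm_big; apply: uniq_perm; rewrite ?filter_uniq ?divisors_uniq //.
 move=> d; rewrite !mem_filter -!dvdn_divisors //.
 case: (boolP (p %| d)) => //= pd.
 by rewrite {1}e Gauss_dvdr // coprime_sym prime_coprime.
lra.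
Qed.

Definition brk (m n : nat) : R :=
 \big[Rplus/0]_(1 <= b < n.+1 | (b ^ 2 %| m)%N && (b ^ 2 %| n)%N)
  (INR b * IZR (jacobi (m %/ b ^ 2) (n %/ b ^ 2))).

(** The majorant of [brk]. It depends on its arguments through common square divisors only, so units
    and complements modulo [n] leave it unchanged, and on average it is at most a harmonic sum. *)
Definition brkabs (m n : nat) : R :=
 \big[Rplus/0]_(1 <= b < n.+1 | (b ^ 2 %| m)%N && (b ^ 2 %| n)%N) INR b.

Lemma brk_le m n : odd n -> Rabs (brk m n) <= brkabs m n.
Proof.
move=> on; Rsum; apply: sumR_le => b _ /andP [_ hb].
rewrite Rabs_mult Rabs_pos_eq; last exact: pos_INR.
have := pos_INR b.
have on' : odd (n %/ b ^ 2) by move: on; rewrite -{1}(divnK hb) oddM => /andP [].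
case: (@jacobi_coprime (m %/ b ^ 2) _ on') => [[_ [->|->]]|[_ ->]]; rewrite ?Rabs_R0 ?Rabs_Ropp ?Rabs_R1; lra.
Qed.

Lemma sq_dvd_le b n : (0 < n)%N -> (b ^ 2 %| n)%N -> (b <= n)%N.
Proof. by move=> n0 /(dvdn_leq n0); nia. Qed.

Lemma sumR_widen (P : pred nat) F a b N : (b <= N)%N ->
 (forall i, P i -> (a <= i)%N -> (i < b)%N) ->
 \sum_(a <= i < b | P i) F i = \sum_(a <= i < N | P i) F i.
Proof.
move=> bN h; case: (leqP a b) => ab; last first.
 rewrite big_geq; last by lia.
 by rewrite big_nat_cond big1 // => i /andP [/andP [h1 h2] hP]; have := h i hP h1; lia.
rewrite [RHS](big_cat_nat ab bN) [X in _ = _ + X]big_nat_cond [X in _ = _ + X]big1 ?Rplus_0_r //.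
by move=> i /andP [/andP [h1 h2] hP]; have := h i hP ltac:(lia); lia.
Qed.

Lemma brk_wide m n N : (0 < n)%N -> (n < N)%N ->
 brk m n = \sum_(1 <= b < N | (b ^ 2 %| m)%N && (b ^ 2 %| n)%N)
  (b * IZR (jacobi (m %/ b ^ 2) (n %/ b ^ 2))).
Proof.
move=> n0 nN; apply: sumR_widen => // i /andP [_ h] _.
by have := sq_dvd_le n0 h.
Qed.

Lemma mod4_divsq b n : odd n -> (b ^ 2 %| n)%N -> ((n %/ b ^ 2) %% 4 = n %% 4)%N.
Proof.
move=> on hb; have := divnK hb; set q := (n %/ _) => e.
have [oq ob] : odd q /\ odd b by move: on; rewrite -e oddM oddX => /andP.
lia.
Qed.

(** An odd square is 1 modulo 4, so removing the divisor [b ^ 2] does not affect the sign of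
    reciprocity. *)
Lemma brk_recip m n : odd m -> odd n -> brk m n = IZR (rsgn m n) * brk n m.
Proof.
move=> om on.
rewrite (@brk_wide m n (m + n).+1) ?(@brk_wide n m (m + n).+1) ?big_distrr //=; try lia.
apply: eq_big => [b|b /andP [h1 h2]]; first by lia.
have o1 : odd (m %/ b ^ 2) by move: om; rewrite -{1}(divnK h1) oddM => /andP [].
have o2 : odd (n %/ b ^ 2) by move: on; rewrite -{1}(divnK h2) oddM => /andP [].
rewrite jacobi_recip // mult_IZR (_ : rsgn _ _ = rsgn m n); first by lra.
by rewrite /rsgn !mod4_divsq.
Qed.

Lemma jacobi_0l n : odd n -> jacobi 0 n = if (n == 1)%N then 1%Z else 0%Z.
Proof.
move=> on; case: eqP => [->|n1]; first by rewrite jacobi_1r.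
by case: (@jacobi_coprime 0 n on) => [[]|[]] //; rewrite /coprime gcd0n; move/eqP.
Qed.

Lemma brk0_sq b : odd b -> brk 0 (b ^ 2) = INR b.
Proof.
move=> ob; have b0 := odd_gt0' ob; have b20 : (0 < b ^ 2)%N by lia.
have hb : (b < (b ^ 2).+1)%N by lia.
rewrite /brk big_mkcond (bigD1_seq b) /=; [|by rewrite mem_index_iota b0|exact: iota_uniq].
rewrite dvdn0 dvdnn divnn b20 jacobi_1r Rmult_1_r big1 ?Rplus_0_r // => c cb.
case: ifP => // /andP [_ hc].
have oc : odd (b ^ 2 %/ c ^ 2).
 have : odd (b ^ 2) by lia.
 by rewrite -{1}(divnK hc) oddM => /andP [].
rewrite div0n jacobi_0l // (_ : (b ^ 2 %/ c ^ 2 == 1)%N = false) ?Rmult_0_r //.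
apply: contraNF cb => /eqP h; move: (divnK hc); rewrite h mul1n => /eqP.
by rewrite eqn_exp2r.
Qed.

Lemma brk0_nsq n : odd n -> (forall b, (b ^ 2)%N <> n) -> brk 0 n = 0.
Proof.
move=> on hn; rewrite /brk big1 // => b /andP [_ hb].
have o : odd (n %/ b ^ 2) by move: on; rewrite -{1}(divnK hb) oddM => /andP [].
rewrite div0n jacobi_0l // (_ : (n %/ b ^ 2 == 1)%N = false) ?Rmult_0_r //.
by apply/eqP => h; apply: (hn b); rewrite -[RHS](divnK hb) h mul1n.
Qed.

Lemma coprime_sq_dvd u b m : coprime u b -> (b ^ 2 %| u * m)%N = (b ^ 2 %| m)%N.
Proof. by move=> h; rewrite Gauss_dvdr // coprime_sym coprimeXr. Qed.

Lemma brk_mull u m n : odd n -> coprime u n -> brk (u * m) n = IZR (jacobi u n) * brk m n.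
Proof.
move=> on un; rewrite big_distrr /=.
have cb b : (b ^ 2 %| n) -> coprime u b.
 move=> h; apply: coprime_dvdr un; apply: dvdn_trans h; exact: dvdn_exp.
apply: eq_big => [b|b /andP [h1 h2]].
 by case: (boolP (b ^ 2 %| n)) => h; rewrite ?andbF // coprime_sq_dvd // cb.
have h3 := divnK h2; set q := (n %/ _) in h3 *.
have [oq ob] : odd q /\ odd b by move: on; rewrite -h3 oddM oddX => /andP.
rewrite coprime_sq_dvd ?cb // in h1; rewrite -muln_divA // jacobiMl // mult_IZR.
have -> : jacobi u n = jacobi u q.
 rewrite -h3 jacobiMr ?odd_gt0' ?oddM ?ob // jacobiMr ?odd_gt0' //.
 by case: (@jacobi_coprime u b ob) => [[_ [->|->]]|[]]; [ring | ring | rewrite cb].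
lra.
Qed.

Lemma brk_modl m m' n : (m = m' %[mod n])%N -> brk m n = brk m' n.
Proof.
move=> h.
have hd b : (b ^ 2 %| n) -> (b ^ 2 %| m) = (b ^ 2 %| m').
 by move=> hb; rewrite /dvdn -(modn_dvdm m hb) h modn_dvdm.
apply: eq_big => [b|b /andP [h1 h2]].
 by case: (boolP (b ^ 2 %| n)) => hb; rewrite ?andbF // hd.
congr (_ * IZR _); apply: jacobi_modl.
case: (posnP b) => [->|b0]; first by pos.
have b20 : (0 < b ^ 2)%N by lia.
apply/eqP; rewrite -(eqn_pmul2r b20) !muln_modl !divnK //; last by rewrite -hd.
lia.
Qed.

(** * The discrete Fourier transform of [brk] *)

Definition sqfree (r : nat) : Prop := forall b, (b ^ 2 %| r)%N -> b = 1%N.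

Lemma sqfree_decomp n : odd n -> exists r s, [/\ n = (r * s ^ 2)%N, sqfree r, odd r & odd s].
Proof.
elim: n {-2}n (leqnn n) => [|N IH] n hn on; first by lia.
have n0 := odd_gt0' on.
case: (boolP (has (fun b => (b ^ 2 %| n)) (iota 2 n))) => [/hasP [b]|/hasPn hb].
 rewrite mem_iota => hb hd; have e := divnK hd.
 have [oq ob] : odd (n %/ b ^ 2) /\ odd b by move: on; rewrite -{1}e oddM oddX => /andP.
 have [|r [s [h1 h2 h3 h4]]] := IH _ _ oq.
  have : (n %/ b ^ 2 < n)%N by apply: ltn_Pdiv => //; lra || nia.
  lia.
 exists r, (s * b)%N; split => //; last by lia.
 lia.
exists n, 1%N; split => //; first by lia.
move=> b hd; have := sq_dvd_le n0 hd => bn.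
case: (ltnP b 2) => b2.
 lia.
by have := hb b; rewrite mem_iota hd => /(_ ltac:(lia)).
Qed.

Lemma sqfree_primeM p n : prime p -> sqfree (p * n) -> sqfree n /\ coprime p n.
Proof.
move=> pp h; split; first by move=> b hb; apply: h; apply: dvdn_mull.
rewrite prime_coprime //; apply/negP => pn.
have : p = 1%N by apply: h; rewrite dvdn_pmul2l ?prime_gt0.
by move=> e; rewrite e in pp.
Qed.

(** In the step from [n] to [p * n] the factor [chi p n * chi n p] is the reciprocity sign, which is
    exactly what [eps4] lacks to be multiplicative. *)
Lemma gauss_sqfree r k : odd r -> sqfree r ->
 (\sum_(0 <= a < r) (chi r a * ez r (a * k)) = chi r k * (eps4 r * RtoC (sqrt r)))%C.
Proof.
move=> or; elim/odd_prime_ind: r / or => [|p n pp op on IH] hs.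
 by rewrite big_nat1 ez0 /chi !jacobi_1r /eps4 /= sqrt_1; ring.
have [sn cpn] := sqfree_primeM pp hs.
have p0 := prime_gt0 pp; have n0 := odd_gt0' on; have pn0 : (0 < p * n)%N by lia.
rewrite (@sum_crt p n _) //; last first.
 by move=> a; rewrite chi_mod; congr (_ * _)%C; apply: ez_eqmod => //; rewrite modnMml.
transitivity ((chi p n * chi n p) * ((\sum_(0 <= x < p) (chi p x * ez p (x * k))) * (\sum_(0 <= y < n) (chi n y * ez n (y * k)))))%C.
 rewrite big_distrl big_distrr; apply: eq_bigr => x _; rewrite big_distrr big_distrr /=; apply: eq_bigr => y _.
 rewrite chi_mul //.
 have -> : chi p (x * n + y * p) = (chi p x * chi p n)%C.
  by rewrite -chi_mod addnC modnMDl chi_mod chiM.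
 have -> : chi n (x * n + y * p) = (chi n y * chi n p)%C.
  by rewrite -chi_mod modnMDl chi_mod chiM.
 have -> : ez (p * n) ((x * n + y * p) * k) = (ez p (x * k) * ez n (y * k))%C.
  rewrite mulnDl ezD -(@ez_scale p _ n) // -(@ez_scale n _ p) //.
  by congr (ez _ _ * ez _ _)%C; lia.
 ring.
rewrite gauss_prime // gsum_prime // IH //.
have J : (chi p n * chi n p = RtoC (IZR (rsgn p n)))%C.
 rewrite /chi (jacobi_recip op on) -RtoC_mult -mult_IZR.
 rewrite (_ : (jacobi n p * _ = rsgn p n * (jacobi n p * jacobi n p))%Z); last by lia.
 case: (@jacobi_coprime n p op) => [[_ [->|->]]|[]]; rewrite ?Z.mul_1_r //.
 by rewrite coprime_sym cpn.
have E := eps4M op on.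
have R2 : (RtoC (IZR (rsgn p n)) * RtoC (IZR (rsgn p n)) = 1)%C.
 by rewrite -RtoC_mult -mult_IZR rsgn_sq.
rewrite J chi_mul // INRM sqrt_mult; [|exact: pos_INR|exact: pos_INR]; rewrite RtoC_mult.
transitivity (chi p k * chi n k * (RtoC (IZR (rsgn p n)) * (eps4 p * eps4 n)) * ((sqrt p) * (sqrt n)))%C; first by ring.
rewrite -E (_ : (RtoC _ * _ = eps4 (p * n) * (RtoC (IZR (rsgn p n)) * RtoC (IZR (rsgn p n))))%C); last by ring.
by rewrite R2; ring.
Qed.

Lemma sum_euclid F r t :
 (\sum_(0 <= a < r * t) F a = \sum_(0 <= y < t) \sum_(0 <= x < r) F (x + r * y)%N)%C.
Proof.
elim: t => [|t IH]; first by rewrite muln0 !big_geq.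
rewrite mulnS addnC (@sumC_range_split _ 0 (r * t)); [|lia|lia].
rewrite IH big_nat_recr //=.
by rewrite -{1}(add0n (r * t)%N) big_addn addKn.
Qed.

(** With [a = x + r y] the sum over [y] detects whether [t] divides [k], and what remains is the sum
    modulo [r] at frequency [k / t]. *)
Lemma gauss_sqfree_mult r t k : odd r -> sqfree r -> (0 < t)%N ->
 (\sum_(0 <= a < r * t) (chi r a * ez (r * t) (a * k)) =
 if (t %| k)%N then RtoC t * chi r (k %/ t) * (eps4 r * RtoC (sqrt r)) else 0)%C.
Proof.
move=> or sr t0; have r0 := odd_gt0' or.
rewrite sum_euclid exchange_big.
rewrite (eq_bigr (fun x => chi r x * ez (r * t) (x * k) * (if (t %| k) then RtoC t else RtoC 0))%C); last first.
 move=> x _; rewrite -sum_ez // big_distrr /=; apply: eq_bigr => y _.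
 rewrite -chi_mod addnC mulnC modnMDl chi_mod -Cmult_assoc; congr (_ * _)%C.
 by rewrite mulnDl ezD -(@ez_scale t _ r) // Cmult_comm; congr (ez _ _ * ez _ _)%C; lia.
case: (boolP (t %| k)) => tk; last by rewrite -big_distrl /= Cmult_0_r.
rewrite -big_distrl -(Cmult_assoc _) Cmult_comm -gauss_sqfree //; congr (_ * _)%C.
apply: eq_bigr => x _.
by rewrite -(@ez_scale r _ t) // (mulnC t r); rewrite mulnCA (mulnC t) divnK.
Qed.

Lemma sum_multiples F m N : (0 < m)%N ->
 (\sum_(0 <= a < m * N | (m %| a)%N) F a = \sum_(0 <= a < N) F (m * a)%N)%C.
Proof.
move=> m0; rewrite big_mkcond sum_euclid; apply: eq_bigr => y _.
rewrite big_ltn // dvdn_mulr // big_nat big1 ?Cplus_0_r // => x hx.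
by rewrite dvdn_addl ?dvdn_mulr // gtnNdvd; case/andP: hx.
Qed.

Lemma sum_div_div (T : Type) (idx : T) (op : Monoid.com_law idx) (F : nat -> T) s b : (0 < s)%N -> (b %| s)%N ->
 \big[op/idx]_(d <- divisors (s %/ b)) F d = \big[op/idx]_(d <- divisors s | (b * d %| s)%N) F d.
Proof.
move=> s0 bs; rewrite -[RHS]big_filter; apply: perm_big; apply: uniq_perm; rewrite ?filter_uniq ?divisors_uniq //.
have sb0 : (0 < s %/ b)%N by lia.
move=> d; rewrite mem_filter -!dvdn_divisors // dvdn_divRL // mulnC.
apply/idP/andP => [h|[]] //; split => //; apply: dvdn_trans h; exact: dvdn_mull.
Qed.

Lemma sum_div_swap (T : Type) (idx : T) (op : Monoid.com_law idx) (F : nat -> nat -> T) s : (0 < s)%N ->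
 \big[op/idx]_(b <- divisors s) \big[op/idx]_(d <- divisors (s %/ b)) F b d =
 \big[op/idx]_(d <- divisors s) \big[op/idx]_(b <- divisors (s %/ d)) F b d.
Proof.
transitivity (\big[op/idx]_(b <- divisors s) \big[op/idx]_(d <- divisors s) (if (b * d %| s) then F b d else idx)).
 rewrite big_seq [RHS]big_seq; apply: eq_bigr => b; rewrite -dvdn_divisors // => bs.
 by rewrite sum_div_div // big_mkcond.
rewrite exchange_big big_seq [RHS]big_seq; apply: eq_bigr => d; rewrite -dvdn_divisors // => ds.
by rewrite sum_div_div // -big_mkcond; apply: eq_bigl => b; rewrite mulnC.
Qed.

Lemma sum_div_inv (T : Type) (idx : T) (op : Monoid.com_law idx) (F : nat -> T) s : (0 < s)%N ->
 \big[op/idx]_(b <- divisors s) F b = \big[op/idx]_(b <- divisors s) F (s %/ b)%N.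
Proof.
move=> s0; rewrite -[RHS](big_map _ xpredT F); apply: perm_big; apply: uniq_perm; rewrite ?divisors_uniq //.
 rewrite map_inj_in_uniq ?divisors_uniq // => x y; rewrite -!dvdn_divisors // => hx hy e.
 have := divnK hx; have := divnK hy; rewrite e => h1 h2.
 have q0 : (0 < s %/ y)%N by lia.
 by apply/eqP; rewrite -(eqn_pmul2l q0) h1 h2.
move=> d; rewrite -dvdn_divisors //; apply/idP/mapP => [h|[x]].
 exists (s %/ d); first by rewrite -dvdn_divisors // dvdn_div.
 by rewrite divnA // mulKn.
by rewrite -dvdn_divisors // => hx ->; rewrite dvdn_div.
Qed.

Lemma coprime_mob x y : (0 < y)%N ->
 (if coprime x y then 1 else 0) = \sum_(d <- divisors y | (d %| x)%N) mob d.
Proof.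
move=> y0; have g0 : (0 < gcdn x y)%N by rewrite gcdn_gt0 y0 orbT.
rewrite -(sum_mob g0) -[RHS]big_filter; apply: perm_big; apply: uniq_perm; rewrite ?filter_uniq ?divisors_uniq //.
by move=> d; rewrite mem_filter -!dvdn_divisors // dvdn_gcd.
Qed.

Lemma sq_dvd_sqfree r s b : sqfree r -> (0 < s)%N -> (b ^ 2 %| r * s ^ 2)%N = (b %| s)%N.
Proof.
move=> sr s0; apply/idP/idP => [h|h]; last by apply: dvdn_mull; rewrite dvdn_exp2r.
have g0 : (0 < gcdn b s)%N by rewrite gcdn_gt0 s0 orbT.
set g := gcdn b s in g0 *.
have eb : b = (b %/ g * g)%N by rewrite divnK // dvdn_gcdl.
have es : s = (s %/ g * g)%N by rewrite divnK // dvdn_gcdr.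
have cop : coprime (b %/ g) (s %/ g).
 rewrite /coprime -(eqn_pmul2r g0) mul1n muln_gcdl -eb -es; exact: eqxx.
have : ((b %/ g) ^ 2 %| r).
 move: h; rewrite {1}eb {1}es !expnMn mulnA dvdn_pmul2r ?expn_gt0 ?g0 // Gauss_dvdl //.
 by rewrite coprimeXl // coprimeXr.
by move/sr => e1; rewrite eb e1 mul1n dvdn_gcdr.
Qed.

(** For [n = r s ^ 2] the admissible [b] are divisors of [s], and [(a / b ^ 2 | (s / b) ^ 2)] is the
    indicator of coprimality with [s / b], expanded by [mob] over the divisors [d]. *)
Lemma brk_expand r s a : odd r -> odd s -> sqfree r ->
 RtoC (brk a (r * s ^ 2)) =
 (\sum_(d <- divisors s) \sum_(b <- divisors (s %/ d) | (b ^ 2 * d %| a)%N)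
  (RtoC (mob d) * chi r d * (RtoC b * chi r (a %/ (b ^ 2 * d)))))%C.
Proof.
move=> or os sr; have s0 := odd_gt0' os; have r0 := odd_gt0' or.
have n0 : (0 < r * s ^ 2)%N by lia.
have sd0 b : (b %| s) -> (0 < s %/ b)%N by lia.
have -> : brk a (r * s ^ 2) = \sum_(b <- divisors s) \sum_(d <- divisors (s %/ b))
 (if (b ^ 2 * d %| a) then b * IZR (jacobi (a %/ b ^ 2) r) * mob d else 0).
 transitivity (\sum_(b <- divisors s | (b ^ 2 %| a)) (b * IZR (jacobi (a %/ b ^ 2) (r * s ^ 2 %/ b ^ 2)))).
  rewrite -[LHS]big_filter -[RHS]big_filter; apply: perm_big; apply: uniq_perm; rewrite ?filter_uniq ?divisors_uniq ?iota_uniq //.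
  move=> b; rewrite !mem_filter mem_index_iota -dvdn_divisors // sq_dvd_sqfree //.
  case: (b ^ 2 %| a) => //=; case: (boolP (b %| s)) => //= h.
  by rewrite (dvdn_gt0 s0 h) ltnS; apply: sq_dvd_le => //; rewrite sq_dvd_sqfree.
 rewrite big_mkcond big_seq [RHS]big_seq; apply: eq_bigr => b; rewrite -dvdn_divisors // => bs.
 have b20 : (0 < b ^ 2)%N by lia.
 case: (boolP (b ^ 2 %| a)) => ha; last first.
  rewrite big1 // => d; case: ifP => // h; move/negP: ha; case; apply: dvdn_trans h; exact: dvdn_mulr.
 have oq : odd (s %/ b) by move: os; rewrite -{1}(divnK bs) oddM => /andP [].
 have -> : (r * s ^ 2 %/ b ^ 2 = r * (s %/ b) ^ 2)%N.
  by rewrite -{1}(divnK bs) expnMn mulnA mulnK.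
 rewrite jacobiMr ?expn_gt0 ?sd0 // mult_IZR.
 have -> : IZR (jacobi (a %/ b ^ 2) ((s %/ b) ^ 2)) = if coprime (a %/ b ^ 2) (s %/ b) then 1 else 0.
  rewrite jacobiMr ?sd0 //.
  by case: (@jacobi_coprime (a %/ b ^ 2) _ oq) => [[-> [->|->]]|[/negbTE -> ->]].
 rewrite coprime_mob ?sd0 // -Rmult_assoc big_distrr big_mkcond; apply: eq_bigr => d _.
 by rewrite dvdn_divRL // mulnC.
rewrite sum_div_swap // RtoC_sum big_seq [RHS]big_seq; apply: eq_bigr => d; rewrite // => ds.
rewrite RtoC_sum [RHS]big_mkcond; apply: eq_bigr => b _.
case: ifP => // h; rewrite !RtoC_mult.
have -> : (a %/ b ^ 2 = d * (a %/ (b ^ 2 * d)))%N.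
 case: (posnP b) => [->|b0]; first by lia.
 by rewrite -{1}(divnK h) (mulnC (b ^ 2)%N) mulnA mulnK ?expn_gt0 ?b0 // mulnC.
by rewrite -/(chi r _) chiM //; ring.
Qed.

(* Self-duality is the symmetry b <-> e of the factorizations s = b d e. *)
Lemma brk_dft n k : odd n ->
 (\sum_(0 <= a < n) (RtoC (brk a n) * ez n (a * k)) = eps4 n * RtoC (sqrt n) * RtoC (brk k n))%C.
Proof.
move=> on; have [r [s [en sr or os]]] := sqfree_decomp on; rewrite en in on *.
have s0 := odd_gt0' os.
have -> : eps4 (r * s ^ 2) = eps4 r.
 have h := @mod4_divsq s _ on (dvdn_mull r (dvdnn _)).
 by rewrite /eps4 -h mulnK // expn_gt0 s0.
have -> : sqrt (INR (r * s ^ 2)) = sqrt r * INR s.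
 rewrite INRM sqrt_mult; [|exact: pos_INR|exact: pos_INR].
 by rewrite INRM sqrt_square //; apply: pos_INR.
rewrite brk_expand // big_distrr.
transitivity (\sum_(0 <= a < r * s ^ 2) \sum_(d <- divisors s) \sum_(b <- divisors (s %/ d) | (b ^ 2 * d %| a))
  ((mob d) * chi r d * (b * chi r (a %/ (b ^ 2 * d))) * ez (r * s ^ 2) (a * k)))%C.
 apply: eq_bigr => a _; rewrite brk_expand // big_distrl; apply: eq_bigr => d _; rewrite big_distrl.
 pos.
rewrite exchange_big big_seq [RHS]big_seq; apply: eq_bigr => d; rewrite -dvdn_divisors // => ds.
have sd0 : (0 < s %/ d)%N by lia.
under eq_bigr do rewrite big_mkcond /=.
rewrite exchange_big big_distrr /= [RHS]big_mkcond [RHS]sum_div_inv //.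
rewrite big_seq [RHS]big_seq; apply: eq_bigr => b; rewrite -dvdn_divisors // => bs.
set e := (s %/ d %/ b).
have es : s = (b * d * e)%N by lia.
have m0 : (0 < b ^ 2 * d)%N by lia.
have t0 : (0 < e ^ 2 * d)%N by lia.
have en' : (r * s ^ 2 = b ^ 2 * d * (r * (e ^ 2 * d)))%N by lia.
rewrite -big_mkcond en' sum_multiples //.
transitivity ((mob d) * chi r d * b * \sum_(0 <= a < r * (e ^ 2 * d)) (chi r a * ez (r * (e ^ 2 * d)) (a * k)))%C.
 have rt0 : (0 < r * (e ^ 2 * d))%N by lia.
 rewrite big_distrr /=; apply: eq_bigr => a _.
 by rewrite mulKn // -[(b ^ 2 * d * a * k)%N]mulnA ez_scale //; ring.
rewrite gauss_sqfree_mult //; case: ifP => h; last by rewrite Cmult_0_r.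
have -> : INR s = b * d * e by rewrite {1}es !INRM.
rewrite INRM !RtoC_mult (_ : INR (e ^ 2) = e * e); last by rewrite INRM.
by rewrite RtoC_mult; ring.
Qed.

(** * Summation over odd arguments *)

Lemma INR2 : INR 2 = 2.
Proof. pos. Qed.

Lemma sumC_fold F n : odd n ->
 (\sum_(1 <= k < n) F k = \sum_(1 <= k < n./2.+1) (F k + F (n - k)%N))%C.
Proof.
move=> on; have := odd_double_half n; set h := n./2 => hn.
rewrite big_split (@sumC_range_split _ 1 h.+1 n); [|lia|lia]; congr (_ + _)%C.
rewrite big_nat_rev -{1}add1n big_addn (_ : (n - h = h.+1)%N); last by lia.
by apply: eq_big_nat => k hk; congr F; lia.
Qed.

Lemma cis_PI k : cis (PI * INR k) = RtoC ((-1) ^ k).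
Proof.
elim: k => [|k IH]; first by rewrite Rmult_0_r cis0.
rewrite S_INR Rmult_plus_distr_l cisD IH Rmult_1_r /cis cos_PI sin_PI [_ ^ k.+1]/= RtoC_mult.
by rewrite (_ : (-1, 0) = RtoC (-1)) //; ring.
Qed.

Lemma pow_m1_sq k : (-1) ^ k * (-1) ^ k = 1.
Proof. by rewrite -Rpow_mult_distr (_ : -1 * -1 = 1) ?pow1; ring. Qed.

Lemma pow_m1_odd k : odd k -> (-1) ^ k = -1.
Proof.
move=> ok; rewrite -(odd_double_half k) ok add1n /= -addnn pow_add pow_m1_sq; ring.
Qed.

Lemma jacobi_half n : odd n -> jacobi (n.+1./2) n = jacobi 2 n.
Proof.
move=> on; have h2 : (2 * n.+1./2 = n.+1)%N by lia.
have : jacobi (2 * n.+1./2) n = 1%Z.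
 by rewrite h2 (@jacobi_modl n.+1 1) ?jacobi_1l // -addn1 modnDl.
rewrite jacobiMl //.
have := @jacobi_coprime (n.+1./2) n on.
lia.
Qed.

Lemma cis_odd_half n k m : odd n -> odd m ->
 ez n (n.+1./2 * k * m) = (RtoC ((-1) ^ k) * cis (PI * k / n * m))%C.
Proof.
move=> on om; have n0 := INR_gt0 (odd_gt0' on).
have h2 : (2 * n.+1./2 = n.+1)%N by lia.
have h2R : 2 * INR n.+1./2 = n + 1 by have := f_equal INR h2; rewrite INRM INR2 S_INR.
rewrite -[(-1) ^ k]Rmult_1_r -(pow1 k) -Rpow_mult_distr.
have -> : ((-1) * 1) ^ k = (-1) ^ (k * m).
 rewrite Rmult_1_r mulnC Rfunctions.pow_mult (pow_m1_odd om) //.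
rewrite -cis_PI -cisD; congr cis; rewrite !INRM.
have -> : INR n.+1./2 = (n + 1) / 2 by lra.
field; lra.
Qed.

(** The variable is halved modulo [n], [(n + 1) / 2] being the inverse of 2. For odd [m] this gives,
    up to [(-1) ^ k], the phases [PI k m / n] with [0 <= k < n], so that the sum over [m = 2 j + 1]
    is the geometric sum of [geom_cis]. *)
Lemma brk_odd_dft n m : odd n -> odd m ->
 (eps4 n * RtoC (sqrt n) * RtoC (brk m n) =
 RtoC (IZR (jacobi 2 n)) * \sum_(0 <= k < n) (RtoC ((-1) ^ k * brk k n) * cis (PI * k / n * m)))%C.
Proof.
move=> on om; have n0 := odd_gt0' on.
have h2 : (2 * n.+1./2 = n.+1)%N by lia.
have cop : coprime n.+1./2 n.
 apply: (@coprime_dvdl _ n.+1); first by apply/dvdnP; exists 2%N.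
 exact: coprimeSn.
rewrite -brk_dft // -(@sum_affine n n.+1./2 0 _) //; last first.
 move=> a; congr (RtoC _ * _)%C; first by apply: brk_modl; rewrite modn_mod.
 by apply: ez_eqmod => //; rewrite modnMml.
rewrite big_distrr /=; apply: eq_bigr => k _; rewrite addn0 brk_mull // jacobi_half // cis_odd_half //.
rewrite !RtoC_mult; ring.
Qed.

Lemma geom_cis th J : sin th <> 0 ->
 (\sum_(0 <= j < J) cis (th * INR (2 * j + 1)) = (cis (2 * J * th) - 1) / (2 * Ci * RtoC (sin th)))%C.
Proof.
move=> s0.
have nz : (2 * Ci * (sin th))%C <> 0.
 by rewrite /Cmult => -[]; lra.
have e : (cis th * cis th - 1 = 2 * Ci * (sin th) * cis th)%C.
 have := sin2_cos2 th; rewrite /Rsqr => h.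
 by apply: injective_projections; rewrite /=; nra.
move: nz e; set dd := (2 * Ci * RtoC _)%C => nz e.
elim: J => [|J IH]; first by rewrite big_geq // (_ : 2 * INR 0 * th = 0) ?cis0; [field | rewrite /=; ring].
rewrite big_nat_recr //= IH.
have -> : cis (th * INR (2 * J + 1)) = (cis (2 * J * th) * cis th)%C.
 by rewrite -cisD; congr cis; rewrite INRD INRM /=; ring.
have -> : cis (2 * J.+1 * th) = (cis (2 * J * th) * (cis th * cis th))%C.
 by rewrite -!cisD; congr cis; rewrite S_INR; ring.
have -> : (cis th * cis th = dd * cis th + 1)%C by rewrite -e; ring.
by field.
Qed.

(** What is left of the geometric sums at [k] and [n - k] taken together: [brk] is even or odd under
    this reflection according to [n] modulo 4. *)
Definition osc (J n : nat) (th : R) : R :=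
 if (n %% 4 == 1)%N then sin (2 * INR J * th) else 1 - cos (2 * INR J * th).

Lemma brk_compl k n : odd n -> (k <= n)%N ->
 brk (n - k) n = (if (n %% 4 == 1)%N then 1 else -1) * brk k n.
Proof.
move=> on kn; have n0 := odd_gt0' on.
rewrite (@brk_modl _ (n.-1 * k) n).
 rewrite brk_mull //; last by rewrite -(prednK n0) coprimenS.
 by rewrite jacobi_m1 //; case: ifP.
apply/eqP; rewrite -(eqn_modDr k) subnK // -{2}(mul1n k) -mulnDl addn1 prednK // modnn eq_sym.
exact: dvdn_mulr.
Qed.

Lemma brk0_cases n : odd n -> (exists2 b, odd b & n = (b ^ 2)%N) \/ brk 0 n = 0.
Proof.
move=> on; have n0 := odd_gt0' on.
case: (boolP (has (fun b => b ^ 2 == n)%N (iota 0 n.+1))) => [/hasP [b _ /eqP hb]|/hasPn hb].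
 by left; exists b => //; move: on; rewrite -hb oddX.
right; apply: (brk0_nsq on) => b e; have := hb b; rewrite mem_iota => h.
have : (b < n.+1)%N by rewrite ltnS; apply: sq_dvd_le => //; rewrite e.
lia.
Qed.

Lemma brk0_eps n : odd n -> (eps4 n * RtoC (brk 0 n) = RtoC (brk 0 n))%C.
Proof.
move=> on; case: (brk0_cases on) => [[b ob hb]|->]; last by ring.
have h8 : (n %% 4 = 1)%N by lia.
by rewrite /eps4 h8 Cmult_1_l.
Qed.

Lemma brk_sum_odd n J : odd n ->
 \sum_(0 <= j < J) brk (2 * j + 1) n =
 J * (brk 0 n / sqrt n) + IZR (jacobi 2 n) / sqrt n *
 \sum_(1 <= k < n./2.+1)
   ((-1) ^ k * brk k n * (osc J n (PI * k / n) / sin (PI * k / n))).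
Proof.
move=> on; have n0 := odd_gt0' on; have nR := INR_gt0 n0.
have sq0 : 0 < sqrt n by pos.
have pi0 := PI_RGT_0.
set A := \sum_(0 <= j < J) _; set B := \sum_(1 <= k < _) _.
set q := IZR _.
have main : (eps4 n * (sqrt n) * RtoC A = q * (RtoC (J * brk 0 n) + eps4 n * RtoC B))%C.
 rewrite RtoC_sum big_distrr /=.
 rewrite (eq_bigr (fun j => q * \sum_(0 <= k < n) (RtoC ((-1) ^ k * brk k n) * cis (PI * k / n * INR (2 * j + 1))))%C); last first.
  by move=> j _; rewrite brk_odd_dft // addn1 /= mul2n odd_double.
 rewrite -big_distrr; congr (_ * _)%C; rewrite exchange_big big_ltn //; congr (_ + _)%C.
  transitivity (\sum_(0 <= j < J) (brk 0 n))%C; last by rewrite sumC_const RtoC_mult.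
  apply: eq_bigr => j _; rewrite Rmult_1_l (_ : PI * INR 0 / n * _ = 0) ?cis0 ?Cmult_1_r //.
  by rewrite [INR 0]/=; lra.
 rewrite sumC_fold // RtoC_sum big_distrr; apply: eq_big_nat => k hk.
 set th := PI * k / INR n.
 have k1 : 1 <= k by have := @leqINR 1 k ltac:(lia).
 have kn : 2 * k < n by rewrite -(INRM 2); apply: ltnINR; lia.
 have th0 : 0 < th < PI.
  split; first by pos.
  by apply: (Rmult_lt_reg_r n) => //; rewrite Rmult_assoc Rinv_l; nra.
 have s0 : sin th <> 0 by apply: Rgt_not_eq; apply: sin_gt_0; lra.
 rewrite -!big_distrr geom_cis // (_ : PI * INR _ / n = PI - th); last first.
  by rewrite /th INRB; [field; lra | lia].
 rewrite geom_cis; last by rewrite sin_minus sin_PI cos_PI; lra.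
 have -> : cis (2 * J * (PI - th)) = Cconj (cis (2 * J * th)).
  rewrite -cisN (_ : 2 * J * _ = - (2 * J * th) + 2 * PI * J) ?cis_period; ring.
 have -> : sin (PI - th) = sin th by rewrite sin_minus sin_PI cos_PI; ring.
 have -> : (-1) ^ (n - k) = - (-1) ^ k.
  have : (-1) ^ (n - k) * (-1) ^ k = -1 by rewrite -pow_add plusE subnK ?pow_m1_odd //; lia.
  have := pow_m1_sq k; nra.
 rewrite brk_compl //; last by lia.
 rewrite /osc /eps4; case: ifP => _; apply: injective_projections; rewrite /=; field; lra.
(* The frequency 0 counts only if [n] is a square, and then [(2 | n) = 1] and [eps4 n = 1]. *)
have J0 : (q * RtoC (J * brk 0 n) = eps4 n * RtoC (J * brk 0 n))%C.
 rewrite !RtoC_mult; case: (brk0_cases on) => [[b ob hb]|->]; last by ring.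
 have -> : q = 1 by rewrite /q hb expnS expn1 jacobiMr ?odd_gt0' //; case: (@jacobi_coprime 2 b ob) => [[_ [->|->]]|[/negP []]] //; rewrite coprime2n.
 have h8 : (n %% 4 = 1)%N by lia.
 by rewrite /eps4 h8.
have e0 : eps4 n <> 0 by rewrite /eps4; case: ifP => _ []; lra.
have : (eps4 n * ((sqrt n) * RtoC A - (RtoC (J * brk 0 n) + q * RtoC B)) = 0)%C.
 transitivity (eps4 n * (sqrt n) * RtoC A - eps4 n * RtoC (J * brk 0 n) - eps4 n * q * RtoC B)%C; first by ring.
 by rewrite main -J0; ring.
move/(Cmult_eq0r e0); rewrite -!RtoC_mult -!RtoC_plus -RtoC_minus => -[h].
apply: (Rmult_eq_reg_l (sqrt n)); last by lra.
transitivity (J * brk 0 n + q * B); first by lra.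
by field; lra.
Qed.

(** * Phase sums *)

Definition harm (N : nat) : R := \big[Rplus/0]_(1 <= b < N.+1) / INR b.

Lemma harm_mono M N : (M <= N)%N -> harm M <= harm N.
Proof.
move=> h; rewrite /harm (@big_cat_nat _ _ _ M.+1 1 N.+1) //=.
rewrite -[X in X <= _]Rplus_0_r; apply: Rplus_le_compat_l; apply: sumR_ge0 => b; rewrite mem_index_iota => hb _.
by apply/Rlt_le/Rinv_0_lt_compat/INR_gt0; lia.
Qed.

Lemma harm_ge1 N : (0 < N)%N -> 1 <= harm N.
Proof.
move=> h; apply: (Rle_trans _ (harm 1)); last exact: harm_mono.
by rewrite /harm big_nat1 /=; lra.
Qed.

Lemma harm_ge0 N : 0 <= harm N.
Proof. by have := @harm_mono 0 N (leq0n _); rewrite {1}/harm big_geq. Qed.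

Lemma sumR_multiples G m H : (0 < m)%N ->
 \sum_(1 <= h < H.+1 | (m %| h)%N) G h = \sum_(1 <= h < (H %/ m).+1) G (m * h)%N.
Proof.
move=> m0; rewrite -[LHS]big_filter -(big_map (muln m) xpredT G); apply: perm_big; apply: uniq_perm.
- by rewrite filter_uniq // iota_uniq.
- by rewrite map_inj_uniq ?iota_uniq // => x y /eqP; rewrite eqn_pmul2l // => /eqP.
move=> h; rewrite mem_filter mem_index_iota; apply/idP/mapP => [/andP [/dvdnP [x ->] hx]|[x]].
 exists x; last by lia.
 rewrite mem_index_iota; move: hx; rewrite !ltnS muln_gt0 => /andP [/andP [-> _] hx].
 by rewrite leq_divRL.
rewrite mem_index_iota ltnS => /andP [x0 hx] ->; rewrite dvdn_mulr // muln_gt0 m0 x0.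
by move: hx; rewrite leq_divRL // mulnC.
Qed.

Lemma brkabs_sum F H n :
 \sum_(1 <= h < H.+1) (brkabs h n * F h) =
 \sum_(1 <= b < n.+1 | (b ^ 2 %| n)%N) (b * \sum_(1 <= h < (H %/ b ^ 2).+1) F (b ^ 2 * h)%N).
Proof.
under eq_bigr do rewrite big_distrl /= big_mkcond /=.
rewrite exchange_big [RHS]big_mkcond big_nat [RHS]big_nat; apply: eq_bigr => b hb.
case: (b ^ 2 %| n); last by rewrite big1 // => h; rewrite andbF.
rewrite -sumR_multiples; last by lia.
by rewrite big_distrr [RHS]big_mkcond; apply: eq_bigr => h _; rewrite andbT.
Qed.

Lemma brkabs_sum_le H n : \sum_(1 <= h < H.+1) brkabs h n <= H * harm n.
Proof.
rewrite (eq_bigr (fun h => brkabs h n * 1)); last by move=> h _; ring.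
rewrite brkabs_sum big_distrr /= big_mkcond.
apply: sumR_le => b; rewrite mem_index_iota => hb _.
have b0 : 0 < b by apply: INR_gt0; lia.
have ib := Rinv_0_lt_compat _ b0; have H0 := pos_INR H.
case: ifP => _; last by nra.
rewrite sumR_nat_const subn1 /=.
have h1 : INR (H %/ b ^ 2) * (b * b) <= INR H.
 by rewrite -!INRM; apply: leqINR; exact: leq_trunc_div.
apply: (Rmult_le_reg_r b) => //.
have -> : H * / b * b = H by field; lra.
lra.
Qed.

Lemma brkabs_sum_inv_le H n :
 \sum_(1 <= h < H.+1) (brkabs h n * / h) <= harm n * harm H.
Proof.
rewrite brkabs_sum big_distrl /= big_mkcond.
apply: sumR_le => b; rewrite mem_index_iota => hb.
have b0 : 0 < b by apply: INR_gt0; lia.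
have ib := Rinv_0_lt_compat _ b0; have H0 := harm_ge0 H.
case: ifP => _; last by nra.
have -> : \sum_(1 <= h < (H %/ b ^ 2).+1) / INR (b ^ 2 * h) = / (b * b) * harm (H %/ b ^ 2).
 rewrite big_distrr /=; apply: eq_big_nat => h hh.
 have h0 : 0 < h by apply: INR_gt0; lia.
 by rewrite INRM expnS expn1 INRM; field; lra.
have hm : harm (H %/ b ^ 2) <= harm H by apply: harm_mono; exact: leq_div.
have -> : b * (/ (b * b) * harm (H %/ b ^ 2)) = / b * harm (H %/ b ^ 2) by field; lra.
nra.
Qed.

Lemma brkabs_mull v h q : coprime v q -> brkabs (v * h) q = brkabs h q.
Proof.
move=> vq; apply: eq_bigl => b.
case: (boolP (b ^ 2 %| q)) => hb; rewrite ?andbF // coprime_sq_dvd //.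
apply: coprime_dvdr vq; apply: dvdn_trans hb; exact: dvdn_exp.
Qed.

Lemma brkabs_eqmod h h' q : (h = h' %[mod q])%N -> brkabs h q = brkabs h' q.
Proof.
move=> e; apply: eq_bigl => b.
case: (boolP (b ^ 2 %| q)) => hb; rewrite ?andbF //.
by rewrite /dvdn -(modn_dvdm h hb) e modn_dvdm.
Qed.

Lemma brkabs_ge0 h q : 0 <= brkabs h q.
Proof. by apply: sumR_ge0 => b _ _; apply: pos_INR. Qed.

Lemma brkabs_compl h q : odd q -> (h <= q)%N -> brkabs (q - h) q = brkabs h q.
Proof.
move=> oq hq; apply: eq_bigl => b.
case: (boolP (b ^ 2 %| q)) => hb; rewrite ?andbF //.
by rewrite dvdn_subr.
Qed.

(* The linear phase [f u] added to [al / (8u+c)]: first and second differences are explicit. *)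
Lemma hyper_diff al c u : (0 < c)%N ->
 let n := INR (8 * u + c) in
 al / INR (8 * u.+1 + c) - al / INR (8 * u + c) = - (8 * al / (n * (n + 8))) /\
 (al / INR (8 * u.+2 + c) - al / INR (8 * u.+1 + c)) - (al / INR (8 * u.+1 + c) - al / INR (8 * u + c))
  = 128 * al / (n * (n + 8) * (n + 16)).
Proof.
move=> c0 n; have n0 : 0 < n by apply: INR_gt0; lia.
have e1 : INR (8 * u.+1 + c) = n + 8 by rewrite /n !INRD !INRM (S_INR u) /=; ring.
have e2 : INR (8 * u.+2 + c) = n + 16 by rewrite /n !INRD !INRM (S_INR u.+1) (S_INR u) /=; ring.
by rewrite e1 e2 -/n; split; field; lra.
Qed.

Section PhaseSums.

Variables (al NR : R) (c u1 u2 : nat).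
Hypotheses (al0 : 0 <= al) (N1 : 1 <= NR) (c0 : (0 < c)%N).
Hypothesis range : forall u, (u1 <= u < u2)%N -> NR <= INR (8 * u + c) <= 2 * NR.

Lemma hyper_bounds u : (u1 <= u < u2)%N ->
 0 <= 8 * al / (INR (8 * u + c) * (INR (8 * u + c) + 8)) <= 8 * al / (NR * NR).
Proof.
move=> hu; have := range hu.
split; first by pos.
mon.
Qed.

(** The slope [th] is at distance [h] from an integer, and the hyperbolic phase shifts it by at most
    [8 al / NR ^ 2 <= h / 2]; so [kusmin_landau] applies with [h / 2]. *)
Lemma phase_kl x th h :
 (forall u, x u = th * INR u + al / INR (8 * u + c)) ->
 0 < h <= 1 / 2 -> 16 * al / (NR * NR) <= h -> (th = h \/ th = 1 - h) ->
 Cmod (\sum_(u1 <= u < u2) cis (2 * PI * x u))%C <= 2 / h.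
Proof.
move=> hx hh ha hth.
have pi2 : 2 < PI by have := PI2_1; lra.
apply: (Rle_trans _ (2 / (PI * (h / 2)))); last first.
 mon.
have d u : x u.+1 - x u = th - 8 * al / (INR (8 * u + c) * (INR (8 * u + c) + 8)).
 by have [e _] := hyper_diff al u c0; rewrite !hx (S_INR u); lra.
apply: (@kusmin_landau x); try lra.
- move=> u k1 k2; rewrite d; have := @hyper_bounds u ltac:(lia).
 lra.
- move=> u k1 k2; have [e1 e2] := hyper_diff al u c0.
 have := range (u := u) ltac:(lia); set n := INR (8 * u + c) in e2 *.
 move=> hn; have : 0 <= 128 * al / (n * (n + 8) * (n + 16)).
  pos.
 by rewrite !hx (S_INR u.+1) (S_INR u) -/n; lra.
Qed.

Lemma phase_vdc x th : 0 < al ->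
 (forall u, x u = th * INR u + al / INR (8 * u + c)) ->
 Cmod (\sum_(u1 <= u < u2) cis (2 * PI * x u))%C
  <= (8 * al / (NR * NR) + 3) * (4 / sqrt (al / (3 * (NR * NR * NR))) + 5).
Proof.
move=> al1 hx.
have N3 : 0 < 3 * (NR * NR * NR).
 nra.
have d u : x u.+1 - x u = th - 8 * al / (INR (8 * u + c) * (INR (8 * u + c) + 8)).
 by have [e _] := hyper_diff al u c0; rewrite !hx (S_INR u); lra.
apply: vdc_second_difference.
- exact: Rdiv_lt_0_compat.
- pos.
- by move=> i j hi hj; rewrite !d; have := hyper_bounds hi; have := hyper_bounds hj; lra.
move=> u k1 k2; have [e1 e2] := hyper_diff al u c0.
have hn := range (u := u) ltac:(lia); rewrite !hx (S_INR u.+1) (S_INR u).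
suff : al / (3 * (NR * NR * NR)) <= 128 * al / (INR (8 * u + c) * (INR (8 * u + c) + 8) * (INR (8 * u + c) + 16)) by lra.
move: hn; set n := INR _ => hn.
have -> : 128 * al / (n * (n + 8) * (n + 16)) = al * (128 / (n * (n + 8) * (n + 16))) by lra.
lmul.
have p1 : n * (n + 8) <= 20 * (NR * NR) by nra.
(* From [n <= 2 NR] and [NR >= 1]: the three factors are at most [2 NR], [10 NR] and [18 NR], and
   [128 / 360 >= 1 / 3]. *)
have p2 : n * (n + 8) * (n + 16) <= 360 * (NR * NR * NR).
 nra.
have p3 : 0 < n * (n + 8) * (n + 16) by nra.
apply: (Rmult_le_reg_r (n * (n + 8) * (n + 16) * (3 * (NR * NR * NR)))); first by nra.
have -> : / (3 * (NR * NR * NR)) * (n * (n + 8) * (n + 16) * (3 * (NR * NR * NR))) = n * (n + 8) * (n + 16) by field; lra.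
have -> : 128 / (n * (n + 8) * (n + 16)) * (n * (n + 8) * (n + 16) * (3 * (NR * NR * NR))) = 384 * (NR * NR * NR) by field; nra.
lra.
Qed.

End PhaseSums.

(** * Phase sums weighted by [brk] *)

Lemma sumR_affine n u c F : (0 < n)%N -> coprime u n ->
 (forall a, F (a %% n)%N = F a) ->
 \sum_(0 <= a < n) F (u * a + c)%N = \sum_(0 <= a < n) F a.
Proof.
move=> n0 un pF; apply: RtoC_inj; rewrite !RtoC_sum.
exact: (@sum_affine n u c _ n0 un (fun a => f_equal RtoC (pF a))).
Qed.

Lemma sumR_fold F n : odd n ->
 \sum_(1 <= k < n) F k = \sum_(1 <= k < n./2.+1) (F k + F (n - k)%N).
Proof.
move=> on; apply: RtoC_inj; rewrite !RtoC_sum (@sumC_fold _ n on).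
by apply: eq_bigr => k _; rewrite RtoC_plus.
Qed.

(** The mean of [brk] over a period [q] of its first argument ([brk_total]): for odd [q] it is 1 if
    [q] is a square and 0 otherwise ([sqind_issq]). *)
Definition sqind (q : nat) : R := brk 0 q / sqrt (INR q).

Lemma sqrt_INR_gt0 q : (0 < q)%N -> 0 < sqrt q.
Proof. by move=> h; apply: sqrt_lt_R0; apply: INR_gt0. Qed.

Lemma brk_sub_mean m q : odd q ->
 (eps4 q * RtoC (sqrt q) * RtoC (brk m q - sqind q) =
  \sum_(1 <= h < q) (RtoC (brk h q) * ez q (h * m)))%C.
Proof.
move=> oq; have q0 := odd_gt0' oq; have sq := sqrt_INR_gt0 q0.
have D := brk_dft m oq; rewrite big_ltn // ez0 in D.
have E : (eps4 q * (sqrt q) * (sqind q) = (brk 0 q))%C.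
 rewrite -[RHS]brk0_eps // -Cmult_assoc -RtoC_mult; congr (_ * RtoC _)%C.
 by rewrite /sqind; field; lra.
rewrite RtoC_minus (_ : (eps4 q * RtoC _ * _ =
 eps4 q * (sqrt q) * (brk m q) - eps4 q * (sqrt q) * (sqind q))%C); last by ring.
by rewrite E -D; ring.
Qed.

Lemma Cmod_eps4 q : Cmod (eps4 q) = 1.
Proof. by rewrite /eps4; case: ifP => _; rewrite /Cmod /= (_ : _ + _ = 1) ?sqrt_1; ring. Qed.

Lemma Cmod_ez n k : Cmod (ez n k) = 1.
Proof. exact: Cmod_cis. Qed.

(** The transform modulo [q] puts the frequency [8 h] on the variable [u]. Replacing [h] by [h / 8]
    modulo [q] restores [h] without changing [brkabs], and [h] is then paired with [q - h]. *)
Lemma brk_phase_reduce q c u1 u2 ph : odd q ->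
 sqrt q * Cmod (\sum_(u1 <= u < u2) (RtoC (brk (8 * u + c) q - sqind q) * cis (ph u)))%C <=
 \sum_(1 <= h < q./2.+1) (brkabs h q *
  (Cmod (\sum_(u1 <= u < u2) (ez q (h * u) * cis (ph u)))%C +
   Cmod (\sum_(u1 <= u < u2) (ez q ((q - h) * u) * cis (ph u)))%C)).
Proof.
move=> oq; have q0 := odd_gt0' oq; have sq := sqrt_INR_gt0 q0.
set P := fun h => Cmod (\sum_(u1 <= u < u2) (ez q (h * u) * cis (ph u)))%C.
set G := fun h => brkabs h q * P (8 * h)%N.
have Pmod h h' : (h = h' %[mod q]) -> P h = P h'.
 move=> e; congr Cmod; apply: eq_bigr => u _; congr (_ * _)%C.
 by apply: ez_eqmod => //; rewrite -modnMml e modnMml.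
have c8 : coprime 8 q by rewrite (_ : 8%N = (2 ^ 3)%N) // coprimeXl // coprime2n.
have [v hv] : exists v, (v * 8 = 1 %[mod q]) by apply: inv_mod.
have cv : coprime v q.
 have : coprime (v * 8) q by rewrite -coprime_modl hv coprime_modl coprime1n.
 by rewrite coprimeMl => /andP [].
have step1 : sqrt q * Cmod (\sum_(u1 <= u < u2) (RtoC (brk (8 * u + c) q - sqind q) * cis (ph u)))%C
 <= \sum_(1 <= h < q) G h.
 rewrite -{1}(Rabs_pos_eq (sqrt q)); last by lra.
 rewrite -Cmod_R -Cmod_mult -[X in X <= _]Rmult_1_l -(Cmod_eps4 q) -Cmod_mult Cmult_assoc big_distrr /=.
 rewrite (eq_bigr (fun u => \sum_(1 <= h < q) ((brk h q) * ez q (h * c) * (ez q (8 * h * u) * cis (ph u))))%C); last first.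
  move=> u _; rewrite Cmult_assoc brk_sub_mean // big_distrl /=; apply: eq_bigr => h _.
  rewrite mulnDr ezD (_ : (h * _ = 8 * h * u)%N); last by lia.
  ring.
 rewrite exchange_big; apply: Rle_trans (Cmod_sum _ _ _) _; apply: sumR_le => h _ _.
 rewrite -big_distrr !Cmod_mult Cmod_ez Rmult_1_r Cmod_R; apply: Rmult_le_compat_r; first exact: Cmod_ge_0.
 exact: brk_le.
apply: Rle_trans step1 _.
have e0 : \sum_(1 <= h < q) G h = \sum_(1 <= h < q) (brkabs h q * P h).
 have Gp a : G (a %% q) = G a.
  by rewrite /G (@brkabs_eqmod _ a) ?modn_mod //; congr (_ * _); apply: Pmod; rewrite modnMmr.
 have h := @sumR_affine q v 0 G q0 cv Gp.
 rewrite big_ltn // [X in _ = X]big_ltn // muln0 addn0 in h.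
 suff : \sum_(1 <= i < q) G (v * i + 0)%N = \sum_(1 <= h < q) (brkabs h q * P h) by lra.
 apply: eq_bigr => i _; rewrite addn0 /G brkabs_mull //; congr (_ * _); apply: Pmod.
 by rewrite mulnA -modnMml (mulnC 8%N) hv modnMml mul1n.
rewrite e0 sumR_fold //; apply: Req_le; apply: eq_big_nat => h hh.
have hq : (h <= q)%N by lia.
by rewrite brkabs_compl // Rmult_plus_distr_l.
Qed.

(** On the left, the proportion of frequencies out of reach of Kusmin-Landau times the count [V + 3]
    of unit intervals in [vdc_second_difference]. *)
Lemma min_vdc x : 0 <= x -> Rmin 1 (16 * x) * (8 * x + 3) <= 56 * x.
Proof. rewrite /Rmin; case: Rle_dec => h; nra. Qed.

Lemma vdc_simplify al NR : 0 < al -> 1 <= NR ->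
 al / (NR * NR) * (4 / sqrt (al / (3 * (NR * NR * NR))) + 5) <= 7 * sqrt (al / NR) + 5 * (al / (NR * NR)).
Proof.
move=> a0 N1.
set L := al / (3 * _).
have L0 : 0 < L by pos.
have sL := sqrt_lt_R0 _ L0.
set s := sqrt (al / NR).
have s0 : 0 <= s by pos.
have s2 : s * s = al / NR by apply: sqrt_sqrt; apply: Rdiv_le_0_compat; lra.
set w := al / _.
suff : w * (4 / sqrt L) <= 7 * s by lra.
set y := w * _.
have y2 : y * y = 48 * (al / NR).
 have -> : y * y = 16 * (w * w) / (sqrt L * sqrt L) by rewrite /y; field; lra.
 by rewrite sqrt_sqrt ?/L ?/w; [field; lra | rewrite -/L; lra].
nra.
Qed.

(** Frequencies with [h / q >= 16 al / NR ^ 2] are treated by [phase_kl], and their bounds [q / h],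
    weighted by [brkabs], sum to harmonic factors. The others number at most [H] and are treated by
    [phase_vdc]. *)
Lemma brk_phase_bound q c u1 u2 al NR : odd q -> 0 <= al -> 1 <= NR -> (0 < c)%N ->
 (forall u, (u1 <= u < u2)%N -> NR <= INR (8 * u + c) <= 2 * NR) ->
 Cmod (\sum_(u1 <= u < u2) (RtoC (brk (8 * u + c) q - sqind q) * cis (2 * PI * (al / INR (8 * u + c)))))%C <=
 sqrt q * (harm q * harm q) * (784 * sqrt (al / NR) + 560 * (al / (NR * NR)) + 4).
Proof.
move=> oq al0 N1 c0 range; have q0 := odd_gt0' oq; have sq := sqrt_INR_gt0 q0.
have qR := INR_gt0 q0.
have hq1 := harm_ge1 q0.
set x := al / (NR * NR).
have x0 : 0 <= x by pos.
(* For [al = 0] every frequency is within reach of Kusmin-Landau, whence the value 0. *)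
set VD := match Rlt_dec 0 al with
 | left _ => (8 * x + 3) * (4 / sqrt (al / (3 * (NR * NR * NR))) + 5) | right _ => 0 end.
have VD0 : 0 <= VD.
 rewrite /VD; case: Rlt_dec => ?; last by lra.
 pos.
set H := Z.to_nat (Int_part (Rmin 1 (16 * x) * q)).
have z0 : 0 <= Rmin 1 (16 * x) * INR q.
 by apply: Rmult_le_pos; [apply: Rmin_glb; lra | lra].
have [I1 I2] := base_Int_part (Rmin 1 (16 * x) * q).
have I0 : (0 <= Int_part (Rmin 1 (16 * x) * q))%Z.
 have /lt_IZR : IZR (-1) < IZR (Int_part (Rmin 1 (16 * x) * q)) by lra.
 lia.
have HE : INR H = IZR (Int_part (Rmin 1 (16 * x) * INR q)) by rewrite /H INR_IZR_INZ Z2Nat.id.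
have one h y : (0 < h)%N -> (h <= q./2)%N ->
 (y = h / q \/ y = 1 - h / q) ->
 Cmod (\sum_(u1 <= u < u2) cis (2 * PI * (y * u + al / INR (8 * u + c))))%C
  <= 2 * q * / h + (if (h <= H)%N then VD else 0).
 move=> h0 hh hy; have hR := INR_gt0 h0.
 have hq2 : 2 * h <= INR q.
  by rewrite -INR2 -INRM; apply: leqINR; lia.
 have f0 : 0 <= 2 * q * / h by pos.
 have f1 : 0 < h / q <= 1 / 2.
  split; first exact: Rdiv_lt_0_compat.
  by apply: (Rmult_le_reg_r q) => //; rewrite Rmult_assoc Rinv_l; lra.
 case: (Rle_dec (16 * al / (NR * NR)) (h / q)) => hk.
  apply: Rle_trans (@phase_kl al NR c u1 u2 al0 N1 c0 range _ y _ (fun u => erefl) f1 hk hy) _.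
  have -> : 2 / (h / q) = 2 * q * / h by field; lra.
  by case: ifP => _; lra.
 have a1 : 0 < al.
  apply: Rnot_le_lt => a1; apply: hk; have -> : al = 0 by lra.
  lra.
 have hH : (h <= H)%N.
  apply: leq_INR; rewrite HE.
  have hlt : h <= Rmin 1 (16 * x) * INR q.
   have -> : INR h = INR h / INR q * INR q by field; lra.
   apply: Rmult_le_compat_r; first by lra.
   apply: Rmin_glb; first by lra.
   by rewrite (_ : 16 * (al / _) = 16 * al / (NR * NR)); lra.
  have /lt_IZR hz : IZR (Z.of_nat h - 1) < IZR (Int_part (Rmin 1 (16 * x) * q)).
   by rewrite minus_IZR -INR_IZR_INZ; lra.
  by rewrite INR_IZR_INZ; apply: IZR_le; lia.
 rewrite hH.
 have V := @phase_vdc al NR c u1 u2 al0 N1 c0 range _ y a1 (fun u => erefl).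
 rewrite /VD; case: Rlt_dec => // _.
 rewrite (_ : 8 * al / _ = 8 * x) in V; last by rewrite /x; lra.
 lra.
have red := @brk_phase_reduce q c u1 u2 (fun u => 2 * PI * (al / INR (8 * u + c))) oq.
apply: (Rmult_le_reg_l (sqrt q)) => //; apply: Rle_trans red _.
apply: (Rle_trans _ (\big[Rplus/0]_(1 <= h < q./2.+1) (brkabs h q * (4 * INR q * / INR h + (if (h <= H)%N then 2 * VD else 0))))).
 apply: sumR_le => h; rewrite mem_index_iota => hh _; apply: Rmult_le_compat_l; first exact: brkabs_ge0.
 have hqq : (h <= q)%N by lia.
 have b1 := one h _ ltac:(lia) ltac:(lia) ltac:(by left).
 have b2 := one h _ ltac:(lia) ltac:(lia) ltac:(by right).
 rewrite (eq_bigr (fun u => cis (2 * PI * (h / q * INR u + al / INR (8 * u + c))))); last first.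
  by move=> u _; rewrite -cisD; congr cis; rewrite INRM; field; split; [apply: Rgt_not_eq; apply: INR_gt0; lia | lra].
 rewrite [X in _ + Cmod X](eq_bigr (fun u => cis (2 * PI * ((1 - h / q) * INR u + al / INR (8 * u + c))))); last first.
  by move=> u _; rewrite -cisD; congr cis; rewrite INRM INRB //; field; split; [apply: Rgt_not_eq; apply: INR_gt0; lia | lra].
 by move: b1 b2; case: ifP => _; lra.
rewrite (eq_bigr (fun h => 4 * q * (brkabs h q * / h) + brkabs h q * (if (h <= H)%N then 2 * VD else 0))); last by move=> h _; ring.
rewrite big_split -big_distrr /=.
have p1 : 4 * q * \sum_(1 <= h < q./2.+1) (brkabs h q * / h) <= 4 * q * (harm q * harm q).
 lmul.
 apply: Rle_trans (brkabs_sum_inv_le _ _) _; lmul.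
 by apply: harm_mono; lia.
have p2 : \sum_(1 <= h < q./2.+1) (brkabs h q * (if (h <= H)%N then 2 * VD else 0)) <= 2 * VD * (H * harm q).
 apply: (Rle_trans _ (\sum_(1 <= h < H.+1) (brkabs h q * (2 * VD)))); last first.
  by rewrite -big_distrl /= Rmult_comm; apply: Rmult_le_compat_l; [lra | exact: brkabs_sum_le].
 apply: (Rle_trans _ (\sum_(1 <= h < (q./2 + H).+1) _)).
  rewrite [X in _ <= X](@big_cat_nat _ _ _ q./2.+1) //=; last by lia.
  rewrite -[X in X <= _]Rplus_0_r; apply: Rplus_le_compat_l; apply: sumR_ge0 => h _ _.
  by apply: Rmult_le_pos; [exact: brkabs_ge0 | case: ifP => _; lra].
 rewrite (@big_cat_nat _ _ _ H.+1) //=; last by lia.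
 rewrite [X in _ + X]big_nat [X in _ + X]big1 ?Rplus_0_r; last first.
  by move=> h /andP [h1 _]; rewrite leqNgt h1 Rmult_0_r.
 apply: Req_le; apply: eq_big_nat => h /andP [_ h1]; by rewrite -ltnS h1.
have p3 : VD * H <= q * (56 * (7 * sqrt (al / NR) + 5 * x)).
 rewrite /VD; case: Rlt_dec => [a1|na]; last first.
  have := sqrt_pos (al / NR); nra.
 have VS := vdc_simplify a1 N1.
 set E := 4 / sqrt _ + 5 in VS *.
 have E0 : 0 <= E by pos.
 apply: (Rle_trans _ (_ * E * (Rmin 1 (16 * x) * q))).
  mon.
 have m := min_vdc x0.
 have -> : (8 * x + 3) * E * (Rmin 1 (16 * x) * q) = q * (Rmin 1 (16 * x) * (8 * x + 3) * E) by lra.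
 lmul.
 apply: (Rle_trans _ (56 * x * E)); first by nra.
 by rewrite Rmult_assoc; apply: Rmult_le_compat_l; pos.
have sqq := sqrt_INR_sq q.
have -> : sqrt q * (sqrt q * (harm q * harm q) * (784 * sqrt (al / NR) + 560 * x + 4)) =
 q * (harm q * harm q) * (784 * sqrt (al / NR) + 560 * x + 4) by nra.
have p4 : 2 * VD * (H * harm q) <= q * (784 * sqrt (al / NR) + 560 * x) * (harm q * harm q).
 have -> : 2 * VD * (H * harm q) = 2 * (VD * H) * harm q by lra.
 mon.
lra.
Qed.

Lemma sin_ge_half x : 0 <= x <= PI / 2 -> x / 2 <= sin x.
Proof.
move=> hx.
have h := @sin_ge_x_cos (x / 2) ltac:(lra).
have c0 : 0 <= cos x by apply: cos_ge_0; lra.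
have c1 : 0 <= cos (x / 2) by apply: cos_ge_0; lra.
have -> : sin x = 2 * sin (x / 2) * cos (x / 2) by rewrite -sin_2a; congr sin; field.
have e : cos x = 2 * cos (x / 2) * cos (x / 2) - 1 by rewrite -cos_2a_cos; congr cos; field.
nra.
Qed.

(** * Amplitudes and the averaged cutoff *)

Definition ang (k n : nat) : R := PI * INR k / INR n.

Lemma ang_range k n : (0 < k)%N -> (2 * k <= n)%N -> 0 < ang k n <= PI / 2.
Proof.
move=> k0 kn; have kR := INR_gt0 k0; have pi0 := PI_RGT_0.
have nR : 0 < n by apply: INR_gt0; lia.
have := leqINR kn; rewrite INRM INR2 => h.
split; first by pos.
apply: (Rmult_le_reg_r n) => //.
have -> : PI * k / n * n = PI * k by field; lra.
nra.
Qed.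

Lemma sin_ang_gt0 k n : (0 < k)%N -> (2 * k <= n)%N -> 0 < sin (ang k n).
Proof.
move=> k0 kn; have := ang_range k0 kn; have := PI_RGT_0 => *; apply: sin_gt_0; lra.
Qed.

Lemma inv_sin_ang k n : (0 < k)%N -> (2 * k <= n)%N -> / sin (ang k n) <= n / INR k.
Proof.
move=> k0 kn; have kR := INR_gt0 k0.
have nR : 0 < n by apply: INR_gt0; lia.
have ra := ang_range k0 kn.
have h := @sin_ge_half (ang k n) ltac:(lra).
have pi2 : 2 < PI by have := PI2_1; lra.
have -> : n / k = / (k / n) by field; lra.
apply: Rinv_le_contravar; first exact: Rdiv_lt_0_compat.
apply: Rle_trans h; rewrite /ang.
have : 0 < k / n by pos.
nra.
Qed.

Definition phaseB (q : nat) (al NR : R) : R :=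
 sqrt (INR q) * (harm q * harm q) * (784 * sqrt (al / NR) + 560 * (al / (NR * NR)) + 4).

Lemma phaseB_ge0 q al NR : 0 <= al -> 1 <= NR -> 0 <= phaseB q al NR.
Proof.
move=> al0 N1; have h := harm_ge0 q.
pos.
Qed.

Lemma phaseB_mono q al al' NR : 0 <= al <= al' -> 1 <= NR -> phaseB q al NR <= phaseB q al' NR.
Proof.
move=> al0 N1; have h := harm_ge0 q.
mon.
Qed.

(** For [p = 1] the amplitude of the frequency [k] in [brk_sum_odd]; for [p = 2] the one left by
    averaging the cutoff, which produces a second factor [1 / sin]. *)
Definition amp (p k n : nat) : R := / sqrt (INR n) * (/ sin (ang k n)) ^ p.

(** Two partial summations, against the decreasing weight [1 / sqrt n] and the increasing weight
    [(1 / sin) ^ p]; each costs a factor 2. *)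
Lemma amp_phase_bound p q k c u1 u2 N A : odd q -> (0 < k)%N -> (0 < N)%N -> 0 <= A -> (0 < c)%N ->
 (forall u, (u1 <= u < u2)%N -> (N <= 8 * u + c <= 2 * N)%N /\ (2 * k <= 8 * u + c)%N) ->
 Cmod (\sum_(u1 <= u < u2) (RtoC (brk (8 * u + c) q - sqind q) * cis (A * ang k (8 * u + c)) * RtoC (amp p k (8 * u + c))))%C <=
 4 * / sqrt N * (2 * N / k) ^ p * phaseB q (A * k / 2) N.
Proof.
move=> oq k0 N0 A0 c0 range.
have NR1 : 1 <= N by have := @leqINR 1 N N0.
have kR := INR_gt0 k0; have sN := sqrt_INR_gt0 N0.
have al0 : 0 <= A * k / 2 by nra.
have B0 := phaseB_ge0 q al0 NR1.
have isN : 0 < / sqrt N by pos.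
have nk0 : 0 <= 2 * N / k by pos.
have pw0 : 0 <= (2 * N / k) ^ p by apply: pow_le.
pose F u := (RtoC (brk (8 * u + c) q - sqind q) * cis (A * ang k (8 * u + c)))%C.
have b1 i : (u1 <= i <= u2)%N -> Cmod (\sum_(u1 <= u < i) F u)%C <= phaseB q (A * k / 2) N.
 move=> hi.
 have rg u : (u1 <= u < i)%N -> N <= INR (8 * u + c) <= 2 * INR N.
  move=> hu; have [/andP [r1 r2] _] := range u ltac:(lia).
  by rewrite -INR2 -INRM; split; apply: leqINR.
 have := @brk_phase_bound q c u1 i _ N oq al0 NR1 c0 rg.
 rewrite (eq_big_nat _ _ (F2 := F)) // => u hu; congr (_ * cis _)%C.
 by rewrite /ang; lra.
have b2 i : (u1 <= i <= u2)%N -> Cmod (\sum_(u1 <= u < i) (F u * RtoC (/ sqrt (INR (8 * u + c)))))%C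
  <= 2 * / sqrt N * phaseB q (A * k / 2) N.
 move=> hi; apply: abel_mono => //; first by lra.
 - by move=> i' hi'; apply: b1; lia.
 - move=> u hu; have [/andP [r1 r2] _] := range u ltac:(lia).
  have s1 : sqrt N <= sqrt (INR (8 * u + c)) by apply: sqrt_le_1_alt; apply: leqINR.
  by split; mon.
 left => u h1 h2; apply: Rinv_le_contravar; first by apply: sqrt_INR_gt0; lia.
 by apply: sqrt_le_1_alt; apply: leqINR; lia.
rewrite (eq_bigr (fun u => F u * RtoC (/ sqrt (INR (8 * u + c))) * RtoC ((/ sin (ang k (8 * u + c))) ^ p))%C); last first.
 by move=> u _; rewrite RtoC_mult /F; ring.
have -> : 4 * / sqrt N * (2 * N / k) ^ p * phaseB q (A * k / 2) N =
 2 * (2 * N / k) ^ p * (2 * / sqrt N * phaseB q (A * k / 2) N) by lra.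
apply: abel_mono => //; first by nra.
- move=> u hu; have [/andP [r1 r2] r3] := range u hu.
 have s0 := sin_ang_gt0 k0 r3; have is0 := Rinv_0_lt_compat _ s0.
 split; first by apply: pow_le; lra.
 apply: pow_incr; split; first by lra.
 apply: Rle_trans (inv_sin_ang k0 r3) _; apply: Rmult_le_compat_r; first by nra.
 by rewrite -INR2 -INRM; apply: leqINR.
right => u h1 h2; have [_ r3] := range u ltac:(lia); have [_ r4] := range u.+1 ltac:(lia).
have s0 := sin_ang_gt0 k0 r3; have s1 := sin_ang_gt0 k0 r4.
apply: pow_incr; split; first by pos.
apply: Rinv_le_contravar => //.
have [a1 a2] := ang_range k0 r3; have [a3 a4] := ang_range k0 r4.
apply: sin_incr_1; try lra.
apply: Rmult_le_compat_l; first by nra.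
by apply: Rinv_le_contravar; [apply: INR_gt0; lia | apply: leqINR; lia].
Qed.

Definition avgE (J D : nat) (th : R) : C :=
 (RtoC (/ INR D) * \sum_(0 <= d < D) cis (2 * INR (J + d) * th))%C.

(** A geometric sum in [d]: averaging over [D] cutoffs gains [1 / D] at the price of
    [1 / sin th]. *)
Lemma avgE_closed J D th : (0 < J)%N -> (0 < D)%N -> sin th <> 0 ->
 avgE J D th = (RtoC (/ (2 * D) * / sin th) * (- Ci) * (cis (INR (2 * J + 2 * D - 1) * th) - cis (INR (2 * J - 1) * th)))%C.
Proof.
move=> J0 D0 s0; have DR := INR_gt0 D0.
have iv : (/ (2 * Ci * (sin th)))%C = (0, - / (2 * sin th)).
 by apply: injective_projections; rewrite /=; field.
have g : (\sum_(0 <= d < D) cis (2 * INR (J + d) * th) = cis (INR (2 * J - 1) * th) * \sum_(0 <= d < D) cis (th * INR (2 * d + 1)))%C.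
 rewrite big_distrr /=; apply: eq_bigr => d _; rewrite -cisD; congr cis.
 rewrite INRB; last by lia.
 by rewrite (INRM 2 J) (INRD (2 * d)) (INRM 2 d) INRD /=; ring.
have e : cis (INR (2 * J + 2 * D - 1) * th) = (cis (INR (2 * J - 1) * th) * cis (2 * D * th))%C.
 rewrite -cisD; congr cis; rewrite ?INRB; [|lia|lia].
 by rewrite (INRD _) (INRM 2 D) /=; ring.
rewrite /avgE g geom_cis // e /Cdiv iv.
have -> : (0, - / (2 * sin th)) = (RtoC (/ 2 * / sin th) * (- Ci))%C.
 by apply: injective_projections; rewrite /=; field.
rewrite (_ : / (2 * D) * / sin th = / D * (/ 2 * / sin th)); last by field; lra.
by rewrite (RtoC_mult (/ D)); ring.
Qed.

Definition Zsum (J D q k c u1 u2 : nat) : C :=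
 (\sum_(u1 <= u < u2) (RtoC (brk (8 * u + c) q - sqind q) * avgE J D (ang k (8 * u + c)) * RtoC (amp 1 k (8 * u + c))))%C.

Lemma Zsum_bound1 J D q k c u1 u2 N : odd q -> (0 < k)%N -> (0 < N)%N -> (0 < D)%N -> (0 < c)%N ->
 (forall u, (u1 <= u < u2)%N -> (N <= 8 * u + c <= 2 * N)%N /\ (2 * k <= 8 * u + c)%N) ->
 Cmod (Zsum J D q k c u1 u2) <=
 4 * / sqrt N * (2 * N / k) * phaseB q (INR (J + D) * k) N.
Proof.
move=> oq k0 N0 D0 c0 range; have DR := INR_gt0 D0.
have NR1 : 1 <= N by have := @leqINR 1 N N0.
have kR := INR_gt0 k0.
have isN : 0 < / sqrt N by pos.
have nk0 : 0 <= 2 * N / k by pos.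
have -> : Zsum J D q k c u1 u2 = (RtoC (/ D) * \sum_(0 <= d < D)
 \sum_(u1 <= u < u2) (RtoC (brk (8 * u + c) q - sqind q) * cis (2 * INR (J + d) * ang k (8 * u + c)) * (amp 1 k (8 * u + c))))%C.
 rewrite exchange_big big_distrr; apply: eq_bigr => u _.
 rewrite /avgE [in RHS]big_distrr big_distrr big_distrr big_distrl /=.
 by apply: eq_bigr => i _; ring.
rewrite Cmod_mult Cmod_R Rabs_pos_eq; last by pos.
set B := _ * phaseB _ _ _.
apply: (Rle_trans _ (/ D * (D * B))); last by rewrite -Rmult_assoc Rinv_l; lra.
apply: Rmult_le_compat_l; first by pos.
apply: Rle_trans (Cmod_sum _ _ _) _.
apply: (Rle_trans _ (\sum_(0 <= d < D) B)); last by rewrite sumR_nat_const subn0; lra.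
apply: sumR_le => d; rewrite mem_index_iota => hd _.
have A0 : 0 <= 2 * INR (J + d) by pos.
apply: Rle_trans (@amp_phase_bound 1 q k c u1 u2 N _ oq k0 N0 A0 c0 range) _.
rewrite pow_1; apply: Rmult_le_compat_l; first by nra.
apply: phaseB_mono => //.
have h2 : INR (J + d) <= INR (J + D) by apply: leqINR; lia.
nra.
Qed.

(** Uses the closed form of the average. It differs from [Zsum_bound1] by the factor [2 N / (k D)],
    a gain once [k D] exceeds [2 N]. *)
Lemma Zsum_bound2 J D q k c u1 u2 N : odd q -> (0 < k)%N -> (0 < N)%N -> (0 < J)%N -> (0 < D)%N -> (0 < c)%N ->
 (forall u, (u1 <= u < u2)%N -> (N <= 8 * u + c <= 2 * N)%N /\ (2 * k <= 8 * u + c)%N) ->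
 Cmod (Zsum J D q k c u1 u2) <=
 4 * / sqrt N * (2 * N / k) ^ 2 * / D * phaseB q (INR (J + D) * k) N.
Proof.
move=> oq k0 N0 J0 D0 c0 range; have DR := INR_gt0 D0.
have NR1 : 1 <= N by have := @leqINR 1 N N0.
have kR := INR_gt0 k0.
have iD : 0 < / D by pos.
pose Q A := (\sum_(u1 <= u < u2) (RtoC (brk (8 * u + c) q - sqind q) * cis (A * ang k (8 * u + c)) * (amp 2 k (8 * u + c))))%C.
have -> : Zsum J D q k c u1 u2 = (RtoC (/ (2 * D)) * (- Ci) * (Q (INR (2 * J + 2 * D - 1)) - Q (INR (2 * J - 1))))%C.
 rewrite /Cminus (_ : (- \sum_(u1 <= u < u2) _ = RtoC (-1) * \sum_(u1 <= u < u2) (RtoC (brk (8 * u + c) q - sqind q) * cis (INR (2 * J - 1) * ang k (8 * u + c)) * (amp 2 k (8 * u + c))))%C); last first.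
  ring.
 rewrite big_distrr -big_split big_distrr /=; apply: eq_big_nat => u hu.
 have [_ r3] := range u hu; have s0 := sin_ang_gt0 k0 r3.
 rewrite avgE_closed //; last by lra.
 by rewrite !RtoC_mult; ring.
rewrite !Cmod_mult Cmod_opp (_ : Cmod Ci = 1); last by rewrite /Cmod /= (_ : _ + _ = 1) ?sqrt_1; ring.
have i2D : / (2 * D) = / 2 * / D by field; lra.
rewrite Cmod_R Rabs_pos_eq; last by lra.
have one A : 0 <= A <= 2 * INR (J + D) ->
 Cmod (Q A) <= 4 * / sqrt N * (2 * N / k) ^ 2 * phaseB q (INR (J + D) * k) N.
 move=> hA; apply: Rle_trans (@amp_phase_bound 2 q k c u1 u2 N A oq k0 N0 (proj1 hA) c0 range) _.
 apply: Rmult_le_compat_l; first by pos.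
 by apply: phaseB_mono => //; nra.
have o1 := one (INR (2 * J + 2 * D - 1)) ltac:(split; [exact: pos_INR | rewrite -INR2 -INRM; apply: leqINR; lia]).
have o2 := one (INR (2 * J - 1)) ltac:(split; [exact: pos_INR | rewrite -INR2 -INRM; apply: leqINR; lia]).
have tr := Cmod_triangle (Q (INR (2 * J + 2 * D - 1))) (- Q (INR (2 * J - 1)))%C.
rewrite Cmod_opp in tr.
rewrite /Cminus.
nra.
Qed.

(** * Summation over dyadic blocks and frequencies *)

Definition oddp (k : nat) : nat := (k %/ 2 ^ logn 2 k)%N.

Lemma oddpE k : (0 < k)%N -> k = (2 ^ logn 2 k * oddp k)%N.
Proof. by move=> k0; rewrite mulnC divnK // pfactor_dvdnn. Qed.

Lemma odd_oddp k : (0 < k)%N -> odd (oddp k).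
Proof.
move=> k0; rewrite -[odd _]negbK -dvdn2; apply/negP => h.
have : (2 ^ (logn 2 k).+1 %| k) by rewrite {2}(oddpE k0) expnSr dvdn_pmul2l // expn_gt0.
by rewrite pfactor_dvdn // ltnn.
Qed.

Lemma oddp_le k : (oddp k <= k)%N.
Proof. exact: leq_div. Qed.

(** A majorant of the smaller of the two bounds for [Zsum] on a block [[N, 2 N]]; the gain
    [2 N / (k D)] is kept only on the term with [sqrt a]. *)
Definition blockB (a D h N k : R) : R :=
 8 * (h * h) * (1568 * sqrt a * N / (k * D) + 560 * (a / N) + 4 * (N / k)).

Lemma phaseB_le q k N a : (0 < q <= k)%N -> (k <= N)%N -> 0 <= a ->
 4 * / sqrt N * (2 * N / k) * phaseB q (a * k) N <=
 8 * (harm N * harm N) * (784 * sqrt a + 560 * (a / N) + 4 * (N / k)).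
Proof.
move=> /andP [q0 qk] kN a0.
have kR : 0 < k by apply: INR_gt0; lia.
have NR : 0 < N by apply: INR_gt0; lia.
have kNR := leqINR kN.
set sk := sqrt k; set sN := sqrt N; set sa := sqrt a.
have sk0 : 0 < sk by pos.
have sN0 : 0 < sN by pos.
have sk2 : sk * sk = k by apply: sqrt_sqrt; lra.
have sN2 : sN * sN = N by apply: sqrt_sqrt; lra.
have skN : sk <= sN by nra.
have sq1 : sqrt q <= sk by apply: sqrt_le_1_alt; apply: leqINR.
have hq : harm q <= harm N by apply: harm_mono; lia.
have hq0 := harm_ge0 q.
have e1 : sqrt (a * k / N) = sa * sk / sN.
 by rewrite sqrt_div_alt // sqrt_mult_alt.
rewrite /phaseB e1.
set E := 784 * _ + _ + _.
apply: (Rle_trans _ (4 * / sN * _ * (sk * (harm N * harm N) * E))).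
 mon.
have -> : 4 * / sN * (2 * N / k) * (sk * (harm N * harm N) * E) =
 8 * (harm N * harm N) * (sN / sk * E).
 by rewrite -sN2 -sk2; field; lra.
apply: Rmult_le_compat_l; first by nra.
have -> : sN / sk * E = 784 * sa + 560 * (a / N) * (sk / sN) + 4 * (sN / sk).
 by rewrite /E -sN2 -sk2; field; lra.
have r1 : sk / sN <= 1.
 by apply: (Rmult_le_reg_r sN) => //; rewrite Rmult_assoc Rinv_l; lra.
have r2 : sN / sk <= N / INR k.
 have -> : N / k = (sN / sk) * (sN / sk) by rewrite -sN2 -sk2; field; lra.
 have : 1 <= sN / sk by apply: (Rmult_le_reg_r sk) => //; rewrite Rmult_assoc Rinv_l; lra.
 nra.
have r3 : 0 <= a / N by pos.
nra.
Qed.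

Lemma phaseB_le2 q k N D a : (0 < q <= k)%N -> (k <= N)%N -> 0 <= a -> (0 < D)%N ->
 4 * / sqrt N * (2 * N / k) ^ 2 * / D * phaseB q (a * k) N <=
 2 * N / (k * D) * (8 * (harm N * harm N) * (784 * sqrt a + 560 * (a / N) + 4 * (N / k))).
Proof.
move=> hq kN a0 D0.
have kR : 0 < k by apply: INR_gt0; lia.
have NR : 0 < N by apply: INR_gt0; lia.
have DR := INR_gt0 D0.
have -> : 4 * / sqrt N * (2 * N / k) ^ 2 * / D * phaseB q (a * k) N =
 2 * N / (k * D) * (4 * / sqrt N * (2 * N / k) * phaseB q (a * k) N).
 have sN : 0 < sqrt N by pos.
 by field; lra.
apply: Rmult_le_compat_l; last exact: phaseB_le.
pos.
Qed.

(** The case [D = 1] admits [J = 0], where [avgE] is the constant 1 of [1 - cos]; there [k <= N]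
    makes the first bound sufficient. *)
Lemma Zsum_bound J D q k c u1 u2 N : odd q -> (q <= k)%N -> (0 < k)%N -> (k <= N)%N -> (0 < D)%N -> (0 < c)%N ->
 ((0 < J)%N \/ D = 1%N) ->
 (forall u, (u1 <= u < u2)%N -> (N <= 8 * u + c <= 2 * N)%N /\ (2 * k <= 8 * u + c)%N) ->
 Cmod (Zsum J D q k c u1 u2) <= blockB (INR (J + D)) D (harm N) N k.
Proof.
move=> oq qk k0 kN D0 c0 hJ range; have q0 := odd_gt0' oq.
have N0 : (0 < N)%N by lia.
have kR := INR_gt0 k0; have kNR := leqINR kN.
have a0 := pos_INR (J + D); have sa0 := sqrt_pos (INR (J + D)).
set a := INR _ in a0 sa0 *.
have r3 : 0 <= a / N by pos.
have r4 : 0 <= N / k by pos.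
have hh : 0 <= 8 * (harm N * harm N) by nra.
have e1 : 1568 * sqrt a * N / (k * D) = 784 * sqrt a * (2 * N / (k * D)) by lra.
have b1 := @Zsum_bound1 J D q k c u1 u2 N oq k0 N0 D0 c0 range.
have f1 := @phaseB_le q k N a ltac:(by rewrite q0) kN a0.
rewrite /blockB e1.
case: (Rle_dec 1 (2 * N / (k * D))) => hk.
 apply: Rle_trans b1 _; apply: Rle_trans f1 _; apply: Rmult_le_compat_l => //.
 nra.
case: hJ => [J0|D1]; last first.
 exfalso; apply: hk; rewrite D1 Rmult_1_r.
 by apply: (Rmult_le_reg_r k) => //; rewrite Rmult_assoc Rinv_l; lra.
have b2 := @Zsum_bound2 J D q k c u1 u2 N oq k0 N0 J0 D0 c0 range.
have f2 := @phaseB_le2 q k N D a ltac:(by rewrite q0) kN a0 D0.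
apply: Rle_trans b2 _; apply: Rle_trans f2 _.
set t := 2 * N / _ in hk *.
have -> : t * (8 * (harm N * harm N) * (784 * sqrt a + 560 * (a / N) + 4 * (N / k))) =
 8 * (harm N * harm N) * (784 * sqrt a * t + 560 * (a / N) * t + 4 * (N / k) * t) by lra.
apply: Rmult_le_compat_l => //.
nra.
Qed.

(** The least [u] with [8 u + c >= t], for [c <= 7]. *)
Definition Uc (c t : nat) : nat := ((t + 7 - c) %/ 8)%N.

Lemma UcP c t u : (c <= 7)%N -> (u < Uc c t)%N = (8 * u + c < t)%N.
Proof. rewrite /Uc; lia. Qed.

Lemma Uc_mono c s t : (s <= t)%N -> (Uc c s <= Uc c t)%N.
Proof. rewrite /Uc; lia. Qed.

Definition Zfull (J D k c t : nat) : C := Zsum J D (oddp k) k c (Uc c (2 * k).+1) (Uc c t).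

Lemma blockB_ge0 a D h N k : 0 <= a -> 0 < D -> 0 <= h -> 0 < N -> 0 < k -> 0 <= blockB a D h N k.
Proof.
move=> a0 D0 h0 N0 k0.
pos.
Qed.

(** Only [n > 2 k] occur, so the blocks with [2 ^ i <= k] are empty. *)
Lemma Zfull_dyadic J D k c : (0 < k)%N -> (0 < D)%N -> (0 < c <= 7)%N -> ((0 < J)%N \/ D = 1%N) ->
 forall I t, (t <= 2 ^ I)%N ->
 Cmod (Zfull J D k c t) <= \sum_(0 <= i < I | (k < 2 ^ i)%N)
  blockB (INR (J + D)) D (harm (2 ^ i)) (INR (2 ^ i)) k.
Proof.
move=> k0 D0 /andP [c0 c7] hJ.
have kR := INR_gt0 k0; have DR := INR_gt0 D0; have a0 := pos_INR _.
have bp i : 0 <= blockB (INR (J + D)) D (harm (2 ^ i)) (INR (2 ^ i)) k.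
 by apply: blockB_ge0 => //; [exact: harm_ge0 | apply: INR_gt0; rewrite expn_gt0].
elim=> [|I IH] t ht.
 rewrite big_geq // /Zfull /Zsum big_geq ?Cmod_0; first by lra.
 by apply: Uc_mono; lia.
rewrite big_mkcond big_nat_recr //= -big_mkcond /=.
case: (leqP t (2 ^ I)) => htI.
 by have := IH t htI; have := bp I; case: ifP => _; lra.
case: (leqP _ k) => hkI.
 rewrite /Zfull /Zsum big_geq ?Cmod_0; last first.
  by apply: Uc_mono; move: ht hkI; rewrite expnS; lia.
 rewrite Rplus_0_r; exact: sumR_ge0.
set m := maxn (2 ^ I) (2 * k).+1.
have h1 : (Uc c (2 * k).+1 <= Uc c m)%N by apply: Uc_mono; exact: leq_maxr.
case: (leqP t m) => htm.
 rewrite /Zfull /Zsum big_geq ?Cmod_0; last by apply: Uc_mono; lia.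
 by apply: Rplus_le_le_0_compat => //; apply: sumR_ge0.
have h2 : (Uc c m <= Uc c t)%N by apply: Uc_mono; exact: ltnW.
rewrite /Zfull /Zsum (@sumC_range_split _ _ (Uc c m)) //; Ctri.
apply: Rplus_le_compat.
 have [e|e] : (m = 2 ^ I)%N \/ (m = (2 * k).+1) by lia.
  by rewrite e; apply: IH.
 by rewrite e big_geq // Cmod_0; apply: sumR_ge0.
apply: (@Zsum_bound J D _ k c) => //; [exact: odd_oddp | exact: oddp_le | exact: ltnW |].
move=> u /andP [hu1 hu2]; rewrite UcP // in hu2.
have hu1' : (m <= 8 * u + c)%N by rewrite leqNgt -UcP // -leqNgt.
by move: hu1' hu2 ht; rewrite expnS; lia.
Qed.

Lemma blockB_sum a D N : 0 <= a -> 0 < D -> (0 < N)%N ->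
 \sum_(1 <= k < N) blockB a D (harm N) N k <=
 13000 * (harm N * harm N * harm N) * (sqrt a * N / D + a + N).
Proof.
move=> a0 D0 N0; have NR := INR_gt0 N0; have h1 := harm_ge1 N0.
set h := harm N in h1 *.
rewrite (eq_bigr (fun k => 8 * (h * h) * ((1568 * sqrt a * INR N / D + 4 * INR N) * / INR k + 560 * (a / INR N)))); last first.
 move=> k _; rewrite /blockB; case: (posnP k) => [->|k0].
  rewrite /Rdiv !Rmult_0_l !Rinv_0; ring.
 by have kR := INR_gt0 k0; field; lra.
rewrite -big_distrr big_split -big_distrr /= sumR_nat_const.
have s1 : \sum_(1 <= k < N) / k <= h by rewrite -{1}(prednK N0); apply: harm_mono; exact: leq_pred.
have s2 : INR (N - 1) * (560 * (a / N)) <= 560 * a.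
 have : INR (N - 1) <= N by apply: leqINR; lia.
 have -> : 560 * a = N * (560 * (a / N)) by field; lra.
 mon.
set X := 1568 * sqrt a * N / D.
have X0 : 0 <= X by pos.
apply: (Rle_trans _ (8 * _ * ((X + 4 * N) * h + 560 * a * h))).
 by apply: Rmult_le_compat_l; nra.
have XE : X = 1568 * (sqrt a * N / D) by rewrite /X; lra.
have h3 : 0 <= h * h * h by nra.
nra.
Qed.

(** The sum over [k] at fixed block is [blockB_sum]; over the blocks the terms proportional to
    [2 ^ i] form a geometric series, and the constant term [J + D] is repeated [I] times. *)
Lemma Zfull_sum J D c t I K : (0 < D)%N -> (0 < c <= 7)%N -> ((0 < J)%N \/ D = 1%N) -> (t <= 2 ^ I)%N ->
 \sum_(1 <= k < K) Cmod (Zfull J D k c t) <=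
 13000 * (harm (2 ^ I) * harm (2 ^ I) * harm (2 ^ I)) *
  (sqrt (INR (J + D)) * INR (2 ^ I) / D + I * INR (J + D) + INR (2 ^ I)).
Proof.
move=> D0 hc hJ ht; have DR := INR_gt0 D0; have a0 := pos_INR (J + D); have sa0 := sqrt_pos _.
set a := INR _ in a0 sa0 *; set h := harm _.
apply: (Rle_trans _ (\sum_(1 <= k < K) \sum_(0 <= i < I | _) blockB a D _ _ k)).
 by apply: sumR_le => k; rewrite mem_index_iota => /andP [k0 _] _; apply: Zfull_dyadic.
under eq_bigr do rewrite big_mkcond /=.
rewrite exchange_big.
have one i : \sum_(1 <= k < K) (if (k < 2 ^ i)%N then blockB a D (harm (2 ^ i)) (INR (2 ^ i)) k else 0)
 <= 13000 * (harm (2 ^ i) * harm (2 ^ i) * harm (2 ^ i)) * (sqrt a * INR (2 ^ i) / D + a + INR (2 ^ i)).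
 apply: Rle_trans (blockB_sum a0 DR _); last by lia.
 have p0 : (1 <= 2 ^ i)%N by lia.
 apply: (Rle_trans _ (\sum_(1 <= k < maxn K _) (if _ then blockB a D (harm _) (INR (2 ^ i)) k else 0))).
  case: (leqP K 1) => hK.
   rewrite big_geq //; apply: sumR_ge0 => k; rewrite mem_index_iota => hk _; case: ifP => _; last by lra.
   by apply: blockB_ge0 => //; [exact: harm_ge0 | exact: INR_gt0 | apply: INR_gt0; lia].
  rewrite [X in _ <= X](@big_cat_nat _ _ _ K); [|by apply: ltnW|exact: leq_maxl].
  rewrite -[X in X <= _]Rplus_0_r; apply: Rplus_le_compat_l; apply: sumR_ge0 => k; rewrite mem_index_iota => hk _; case: ifP => _; last by lra.
  by apply: blockB_ge0 => //; [exact: harm_ge0 | exact: INR_gt0 | apply: INR_gt0; lia].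
 rewrite (@big_cat_nat _ _ _ (2 ^ i)) /=; [|by []|exact: leq_maxr].
 rewrite [X in _ + X]big_nat [X in _ + X]big1 ?Rplus_0_r; last by move=> k /andP [hk _]; rewrite ltnNge hk.
 by apply: Req_le; apply: eq_big_nat => k /andP [_ ->].
apply: (Rle_trans _ (\sum_(0 <= i < I) (13000 * (h * h * h) * (sqrt a / D * INR (2 ^ i) + a + INR (2 ^ i))))).
 apply: sumR_le => i; rewrite mem_index_iota => hi _; apply: Rle_trans (one i) _.
 have hm : harm (2 ^ i) <= h by apply: harm_mono; rewrite leq_exp2l; lia.
 have h0 := harm_ge0 (2 ^ i).
 mon.
rewrite -big_distrr; apply: Rmult_le_compat_l.
 by have h0 := harm_ge0 (2 ^ I); pos.
have geo : \sum_(0 <= i < I) INR (2 ^ i) <= INR (2 ^ I).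
 elim: (I) => [|n IH]; first by rewrite big_geq // /=; lra.
 by rewrite big_nat_recr //= expnS INRM INR2; lra.
rewrite !big_split -big_distrr /= sumR_nat_const subn0.
have q0 : 0 <= sqrt a / D by pos.
nra.
Qed.

(** * Residue classes modulo 8 *)

Definition cls : seq nat := [:: 1; 3; 5; 7]%N.

Lemma sum_classes f s t : (s <= t)%N ->
 \sum_(s <= n < t | odd n) f n =
 \sum_(c <- cls) \sum_(Uc c s <= u < Uc c t) f (8 * u + c)%N.
Proof.
move=> st; rewrite -(subnKC st); elim: (t - s)%N => [|m IH].
 by rewrite addn0 big_geq // big1 // => c; rewrite big_geq.
rewrite addnS big_mkcond big_nat_recr; last by lia.
rewrite -big_mkcond IH; set t' := (s + m)%N.
have st' : (s <= t')%N by lia.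
have stp c : (c \in cls) -> \sum_(Uc c s <= u < Uc c t'.+1) f (8 * u + c)%N =
 \sum_(Uc c s <= u < Uc c t') f (8 * u + c)%N + (if (t' %% 8 == c) then f t' else 0).
 move=> hc; have c7 : (c <= 7)%N by move: hc; rewrite !inE => /or4P [] /eqP ->.
 case: (boolP (t' %% 8 == c)) => e.
  have e1 : Uc c t'.+1 = (Uc c t').+1 by rewrite /Uc; lia.
  rewrite e1 big_nat_recr; last exact: Uc_mono.
  by congr (_ + f _); rewrite /Uc; lia.
 have -> : Uc c t'.+1 = Uc c t' by rewrite /Uc; lia.
 lra.
rewrite !big_cons !big_nil !stp //.
have : (t' %% 8 < 8)%N by lia.
have -> : odd t' = odd (t' %% 8) by lia.
by case: (t' %% 8) => [|[|[|[|[|[|[|[|]]]]]]]] //= _; ring.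
Qed.

(** With [k] outside, [n] runs beyond [2 k] over a class modulo 8: there all signs are constant and
    the inner sum is a phase sum in [u]. *)
Lemma sum_swap_half (f : nat -> nat -> R) Y :
 \sum_(1 <= n < Y.+1 | odd n) \sum_(1 <= k < n./2.+1) f k n =
 \sum_(1 <= k < Y.+1) \sum_(c <- cls) \sum_(Uc c (2 * k).+1 <= u < Uc c Y.+1) f k (8 * u + c)%N.
Proof.
transitivity (\sum_(1 <= n < Y.+1) \sum_(1 <= k < Y.+1) (if odd n && (2 * k < n)%N then f k n else 0)).
 rewrite big_mkcond; apply: eq_big_nat => n hn; case: (boolP (odd n)) => on /=; last by rewrite big1.
 rewrite -big_mkcond -(@sumR_widen _ _ 1 n./2.+1 Y.+1).
 - rewrite [RHS]big_mkcond; apply: eq_big_nat => k hk; rewrite ifT //.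
  lia.
 - lia.
 - lia.
rewrite exchange_big; apply: eq_big_nat => k hk.
case: (leqP (2 * k).+1 Y.+1) => hkY.
 rewrite -sum_classes // [RHS]big_mkcond /=.
 rewrite (@big_cat_nat _ _ _ (2 * k).+1) //= big_nat big1 ?Rplus_0_l; last first.
  by move=> n hn; rewrite ifF //; lia.
 by apply: eq_big_nat => n /andP [hn _]; rewrite hn andbT.
rewrite big_nat big1; last by move=> n hn; rewrite ifF //; lia.
by rewrite big1 // => c; rewrite big_geq //; apply: Uc_mono; exact: ltnW.
Qed.

(** Collects the signs: [(-1) ^ k] and one [(2 | n)] from the halving in [brk_odd_dft], one
    [(2 | n)] for each factor 2 of [k], and the reciprocity sign of its odd part. All depend on [n]
    through its class modulo 8. *)
Definition sgk (k c : nat) : R :=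
 (-1) ^ k * IZR (jacobi 2 c) ^ (logn 2 k).+1 * IZR (rsgn (oddp k) c).

Lemma class_odd c u : c \in cls -> odd (8 * u + c).
Proof. by rewrite !inE oddD oddM => /or4P [] /eqP ->. Qed.

Lemma jacobi_2_class c u : c \in cls -> jacobi 2 (8 * u + c) = jacobi 2 c.
Proof.
move=> hc; have oc := class_odd 0 hc.
rewrite !jacobi_2 ?class_odd //; have -> : ((8 * u + c) %% 8 = c %% 8) by lia.
pos.
Qed.

Lemma class_mod4 c u : ((8 * u + c) %% 4 = c %% 4)%N.
Proof. lia. Qed.

Lemma brk_class k c u : (0 < k)%N -> c \in cls ->
 IZR (jacobi 2 (8 * u + c)) * ((-1) ^ k * brk k (8 * u + c)) = sgk k c * brk (8 * u + c) (oddp k).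
Proof.
move=> k0 hc; have on := class_odd u hc; set n := (8 * u + c)%N in on *.
have e : brk k n = IZR (jacobi 2 n) ^ logn 2 k * (IZR (rsgn (oddp k) n) * brk n (oddp k)).
 rewrite -brk_recip //; last exact: odd_oddp.
 rewrite {1}(oddpE k0); elim: (logn 2 k) => [|j IH]; first by rewrite mul1n; ring.
 rewrite expnS -mulnA brk_mull //; last by rewrite coprime2n.
 by rewrite IH /=; ring.
have r : rsgn (oddp k) n = rsgn (oddp k) c by rewrite /rsgn /n class_mod4.
have j2 : jacobi 2 n = jacobi 2 c by exact: jacobi_2_class.
by rewrite e r j2 /sgk /=; ring.
Qed.

Lemma sgk_abs k c : c \in cls -> Rabs (sgk k c) = 1.
Proof.
move=> hc; have oc := class_odd 0 hc.
have a1 m : Rabs ((-1) ^ m) = 1 by rewrite -RPow_abs Rabs_Ropp Rabs_R1 pow1.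
rewrite !Rabs_mult a1 -RPow_abs.
have -> : Rabs (IZR (jacobi 2 c)) = 1 by rewrite jacobi_2 //; case: ifP => _; rewrite ?Rabs_Ropp Rabs_R1.
have -> : Rabs (IZR (rsgn (oddp k) c)) = 1 by rewrite /rsgn; case: ifP => _; rewrite ?Rabs_Ropp Rabs_R1.
by rewrite pow1; ring.
Qed.

(** The double sum of [brk] that replaces the one of [jacobi], with the first [J] odd numbers as
    rows. *)
Definition Tsum (J Y : nat) : R :=
 \big[Rplus/0]_(1 <= n < Y.+1 | odd n) \big[Rplus/0]_(0 <= j < J) brk (2 * j + 1) n.

Definition SQ (Y : nat) : R := \big[Rplus/0]_(1 <= n < Y.+1 | odd n) sqind n.

(** For [g = brk] this is the contribution of the nonzero frequencies ([Tsum_formula]); for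
    [g = sqind] it is their mean part, the source of [Mdual]. *)
Definition Msum (g : nat -> nat -> R) (J Y : nat) : R :=
 \big[Rplus/0]_(1 <= k < Y.+1) \big[Rplus/0]_(c <- cls)
  (sgk k c * \big[Rplus/0]_(Uc c (2 * k).+1 <= u < Uc c Y.+1)
   (g (8 * u + c)%N (oddp k) * (amp 1 k (8 * u + c) * osc J c (ang k (8 * u + c))))).

Lemma osc_class J c u th : osc J (8 * u + c) th = osc J c th.
Proof. by rewrite /osc class_mod4. Qed.

Lemma Tsum_formula J Y : Tsum J Y = J * SQ Y + Msum brk J Y.
Proof.
rewrite /Tsum (eq_bigr (fun n => J * sqind n + \sum_(1 <= k < n./2.+1)
 (IZR (jacobi 2 n) * ((-1) ^ k * brk k n) * (amp 1 k n * osc J n (ang k n))))); last first.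
 move=> n on; rewrite brk_sum_odd //; congr (_ + _); rewrite big_distrr /=; apply: eq_bigr => k _.
 by rewrite /amp /ang /Rdiv; ring.
rewrite big_split -big_distrr; congr (_ + _); rewrite sum_swap_half.
apply: eq_big_nat => k /andP [k0 _]; rewrite big_seq [RHS]big_seq; apply: eq_bigr => c hc.
rewrite big_distrr /=; apply: eq_bigr => u _.
by rewrite brk_class // osc_class; ring.
Qed.

Lemma Msum_add (g1 g2 : nat -> nat -> R) J Y :
 Msum (fun n q => g1 n q + g2 n q) J Y = Msum g1 J Y + Msum g2 J Y.
Proof.
rewrite -big_split; apply: eq_bigr => k _; rewrite -big_split /=; apply: eq_bigr => c _.
rewrite -Rmult_plus_distr_l -big_split /=; congr (_ * _); apply: eq_bigr => u _; ring.
Qed.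

Definition avgR (D : nat) (f : nat -> R) : R := / INR D * \big[Rplus/0]_(0 <= d < D) f d.

Definition oscavg (J D c : nat) (th : R) : R :=
 if (c %% 4 == 1)%N then Im (avgE J D th) else 1 - Re (avgE J D th).

Lemma Re_sum (I : Type) (r : seq I) (P : pred I) (F : I -> C) :
 Re (\big[Cplus/RtoC 0]_(i <- r | P i) F i) = \sum_(i <- r | P i) Re (F i).
Proof. by elim/big_rec2: _ => [|i y x _ <-]. Qed.

Lemma Im_sum (I : Type) (r : seq I) (P : pred I) (F : I -> C) :
 Im (\big[Cplus/RtoC 0]_(i <- r | P i) F i) = \sum_(i <- r | P i) Im (F i).
Proof. by elim/big_rec2: _ => [|i y x _ <-]. Qed.

Lemma Re_RtoC_mult x z : Re (RtoC x * z)%C = x * Re z.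
Proof. by rewrite /Re /=; ring. Qed.

Lemma Re_mid x y z : Re (RtoC x * z * RtoC y)%C = x * Re z * y.
Proof. by rewrite /Re /=; ring. Qed.

Lemma Im_RtoC_mult x z : Im (RtoC x * z)%C = x * Im z.
Proof. by rewrite /Im /=; ring. Qed.

Lemma sumRB (I : Type) (r : seq I) (P : pred I) (F G : I -> R) :
 \sum_(i <- r | P i) (F i - G i) = \sum_(i <- r | P i) F i - \sum_(i <- r | P i) G i.
Proof. by elim/big_rec3: _ => [|i x y z _ ->]; ring. Qed.

Lemma oscavgE J D c th : (0 < D)%N -> avgR D (fun d => osc (J + d) c th) = oscavg J D c th.
Proof.
move=> D0; have DR := INR_gt0 D0; rewrite /avgR /oscavg Im_RtoC_mult Re_RtoC_mult Im_sum Re_sum /osc.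
case: ifP => _ //.
rewrite sumRB sumR_nat_const subn0 Rmult_1_r Rmult_minus_distr_l Rinv_l; last by lra.
pos.
Qed.

Lemma avgR_add D f g : avgR D (fun d => f d + g d) = avgR D f + avgR D g.
Proof. by rewrite /avgR big_split /=; ring. Qed.

Lemma avgR_sum (I : Type) (r : seq I) (P : pred I) D (F : nat -> I -> R) :
 avgR D (fun d => \sum_(i <- r | P i) F d i) = \sum_(i <- r | P i) avgR D (F^~ i).
Proof. by rewrite /avgR exchange_big big_distrr. Qed.

Lemma avgR_scal D x F : avgR D (fun d => x * F d) = x * avgR D F.
Proof. by rewrite /avgR -big_distrr /=; ring. Qed.

Lemma eq_avgR D f g : (forall d, f d = g d) -> avgR D f = avgR D g.
Proof. by move=> h; congr (_ * _); apply: eq_bigr. Qed.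

Lemma Msum_avg (g : nat -> nat -> R) J D Y : (0 < D)%N ->
 avgR D (fun d => Msum g (J + d) Y) =
 \sum_(1 <= k < Y.+1) \sum_(c <- cls)
  (sgk k c * \sum_(Uc c (2 * k).+1 <= u < Uc c Y.+1)
   (g (8 * u + c)%N (oddp k) * (amp 1 k (8 * u + c) * oscavg J D c (ang k (8 * u + c))))).
Proof.
move=> D0; rewrite avgR_sum; apply: eq_bigr => k _; rewrite avgR_sum; apply: eq_bigr => c _.
rewrite avgR_scal avgR_sum; congr (_ * _); apply: eq_bigr => u _.
by rewrite !avgR_scal oscavgE.
Qed.

Lemma avgE01 th : avgE 0 1 th = RtoC 1.
Proof.
by rewrite /avgE big_nat1 Rmult_0_r Rmult_0_l cis0 Rinv_1; ring.
Qed.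

Lemma Rabs_Im_le z : Rabs (Im z) <= Cmod z.
Proof. by have := Rmax_Cmod z; have := Rmax_r (Rabs (fst z)) (Rabs (snd z)); rewrite /Im; lra. Qed.

Lemma Rabs_Re_le z : Rabs (Re z) <= Cmod z.
Proof. by have := Rmax_Cmod z; have := Rmax_l (Rabs (fst z)) (Rabs (snd z)); rewrite /Re; lra. Qed.

(** The fluctuating part [brk - sqind] is a combination of sums [Zfull], the constant of [1 - cos]
    being the case [J = 0], [D = 1]. The four classes turn 13000 into 52000. *)
Lemma Tavg_error J D Y I : (0 < J)%N -> (0 < D)%N -> (Y < 2 ^ I)%N ->
 Rabs (avgR D (fun d => Tsum (J + d) Y) - avgR D (fun d => INR (J + d) * SQ Y + Msum (fun _ q => sqind q) (J + d) Y)) <=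
 52000 * (harm (2 ^ I) * harm (2 ^ I) * harm (2 ^ I)) *
  (sqrt (INR (J + D)) * INR (2 ^ I) / D + I * INR (J + D) + 4 * INR (2 ^ I)).
Proof.
move=> J0 D0 hY.
have -> : avgR D (fun d => Tsum (J + d) Y) - avgR D (fun d => INR (J + d) * SQ Y + Msum (fun _ q => sqind q) (J + d) Y)
 = avgR D (fun d => Msum (fun n q => brk n q - sqind q) (J + d) Y).
 have -> : avgR D (fun d => Tsum (J + d) Y) = avgR D (fun d => (INR (J + d) * SQ Y + Msum (fun _ q => sqind q) (J + d) Y) + Msum (fun n q => brk n q - sqind q) (J + d) Y).
  apply: eq_avgR => d; rewrite Tsum_formula Rplus_assoc -Msum_add; congr (_ + _).
  apply: eq_bigr => k _; apply: eq_bigr => c _; congr (_ * _); apply: eq_bigr => u _; ring.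
 by rewrite avgR_add; ring.
rewrite Msum_avg //.
set hh := harm _ * harm _ * harm _.
have hh0 : 0 <= hh by have h0 := harm_ge0 _; apply: Rmult_le_pos => //; apply: Rmult_le_pos.
apply: (Rle_trans _ (\sum_(1 <= k < Y.+1) \sum_(c <- cls) (Cmod (Zfull J D k c Y.+1) + Cmod (Zfull 0 1 k c Y.+1)))).
 Rsum; apply: sumR_le => k; rewrite mem_index_iota => /andP [k0 _] _.
 Rsum; apply: sumR_le => c hc _.
 rewrite Rabs_mult sgk_abs // /oscavg; case: (c %% 4 == 1)%N.
  have -> : \sum_(Uc c (2 * k).+1 <= u < Uc c Y.+1) ((brk (8 * u + c) (oddp k) - sqind (oddp k)) * (amp 1 k (8 * u + c) * Im (avgE J D (ang k (8 * u + c))))) = Im (Zfull J D k c Y.+1).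
   rewrite Im_sum; apply: eq_bigr => u _.
   by rewrite Cmult_comm Im_RtoC_mult Im_RtoC_mult; ring.
  by have := Rabs_Im_le (Zfull J D k c Y.+1); have := Cmod_ge_0 (Zfull 0 1 k c Y.+1); lra.
 have -> : \sum_(Uc c (2 * k).+1 <= u < Uc c Y.+1) ((brk (8 * u + c) (oddp k) - sqind (oddp k)) * (amp 1 k (8 * u + c) * (1 - Re (avgE J D (ang k (8 * u + c)))))) = Re (Zfull 0 1 k c Y.+1) - Re (Zfull J D k c Y.+1).
  rewrite !Re_sum -sumRB; apply: eq_bigr => u _.
  by rewrite !Re_mid avgE01 (_ : Re (RtoC 1) = 1) //; ring.
 have := Rabs_Re_le (Zfull J D k c Y.+1); have := Rabs_Re_le (Zfull 0 1 k c Y.+1).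
 have := Rabs_triang (Re (Zfull 0 1 k c Y.+1)) (- Re (Zfull J D k c Y.+1)); rewrite Rabs_Ropp /Rminus; lra.
rewrite exchange_big /=.
set B := sqrt _ * INR _ / D + I * INR _ + 4 * INR _.
have one c : c \in cls -> \sum_(1 <= k < Y.+1) (Cmod (Zfull J D k c Y.+1) + Cmod (Zfull 0 1 k c Y.+1)) <= 13000 * hh * B.
 move=> hc; have c7 : (0 < c <= 7)%N by move: hc; rewrite !inE => /or4P [] /eqP ->.
 rewrite big_split /=.
 have z1 := @Zfull_sum J D c Y.+1 I Y.+1 D0 c7 ltac:(by left) hY.
 have z2 := @Zfull_sum 0 1 c Y.+1 I Y.+1 ltac:(by []) c7 ltac:(by right) hY.
 rewrite -/hh in z1 z2.
 have e1 : sqrt (INR (0 + 1)) * INR (2 ^ I) / INR 1 = INR (2 ^ I) by rewrite /= sqrt_1; field.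
 rewrite e1 (_ : INR (0 + 1) = 1) // in z2.
 have II : I <= INR (2 ^ I) by apply: leqINR; apply: ltnW; exact: ltn_expl.
 have -> : 13000 * hh * B = 13000 * hh * (sqrt (INR (J + D)) * INR (2 ^ I) / D + I * INR (J + D) + INR (2 ^ I)) + 13000 * hh * (3 * INR (2 ^ I)) by rewrite /B; ring.
 nra.
rewrite !big_cons big_nil.
have o1 := one 1%N isT; have o3 := one 3%N isT; have o5 := one 5%N isT; have o7 := one 7%N isT.
lra.
Qed.

(** * Main term *)

Lemma sin_lipschitz x y : Rabs (sin x - sin y) <= Rabs (x - y).
Proof.
have [c [_ ->]] := MVT_gen sin y x cos (fun u _ => is_derive_sin u)
 (fun u _ => derivable_continuous_pt _ _ (derivable_pt_sin u)).
rewrite Rabs_mult; have := Rabs_pos (x - y); have := COS_bound c => hc.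
have : Rabs (cos c) <= 1 by apply: Rabs_le.
nra.
Qed.

Lemma cos_lipschitz x y : Rabs (cos x - cos y) <= Rabs (x - y).
Proof.
have [c [_ ->]] := MVT_gen cos y x _ (fun u _ => is_derive_cos u)
 (fun u _ => derivable_continuous_pt _ _ (derivable_pt_cos u)).
rewrite Rabs_mult Rabs_Ropp; have := Rabs_pos (x - y); have := SIN_bound c => hc.
have : Rabs (sin c) <= 1 by apply: Rabs_le.
nra.
Qed.

(** A common frame for [sin], [1 - cos] and their sum [WW]; the constants 3 and 2 are those of
    [WW]. *)
Definition tame (W : R -> R) : Prop :=
 [/\ forall x, Rabs (W x) <= 3, forall x y, Rabs (W x - W y) <= 2 * Rabs (x - y) & forall x, continuous W x].

Definition psi (c : nat) (x : R) : R := if (c %% 4 == 1)%N then sin x else 1 - cos x.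

Lemma tame_sin : tame sin.
Proof.
split=> [x|x y|x]; last exact: continuous_sin.
 by have := SIN_bound x => h; apply: Rabs_le; lra.
by have := sin_lipschitz x y; have := Rabs_pos (x - y); lra.
Qed.

Lemma tame_1cos : tame (fun x => 1 - cos x).
Proof.
split=> [x|x y|x].
- by have := COS_bound x => h; apply: Rabs_le; lra.
- have := cos_lipschitz y x; rewrite (Rabs_minus_sym y x) (_ : 1 - cos x - _ = cos y - cos x); last by lra.
 by have := Rabs_pos (x - y); lra.
by apply: (continuous_minus _ cos); [exact: continuous_const | exact: continuous_cos].
Qed.

Lemma tame_psi c : tame (psi c).
Proof. by rewrite /psi; case: (c %% 4 == 1)%N; [exact: tame_sin | exact: tame_1cos]. Qed.

Definition WW (x : R) : R := 1 + sin x - cos x.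

Lemma tame_WW : tame WW.
Proof.
split=> [x|x y|x]; rewrite /WW.
- by have := COS_bound x; have := SIN_bound x => h1 h2; apply: Rabs_le; lra.
- rewrite (_ : 1 + sin x - cos x - _ = (sin x - sin y) - (cos x - cos y)); last by lra.
 have := Rabs_triang (sin x - sin y) (- (cos x - cos y)); rewrite Rabs_Ropp.
 by have := sin_lipschitz x y; have := cos_lipschitz x y; rewrite /Rminus; lra.
apply: (continuous_minus _ cos); last exact: continuous_cos.
by apply: (continuous_plus _ sin); [exact: continuous_const | exact: continuous_sin].
Qed.

(** The smooth profile of [amp * osc]: with [1 / ang] in place of [1 / sin], the amplitude
    [1 / (sqrt n * sin (PI k / n))] becomes [sqrt n / (PI k)], and the phase has the form
    [A / n]. *)
Definition rad (W : R -> R) (A y : R) : R := sqrt y * W (A / y).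

Lemma rad_continuous W A y : tame W -> 0 < y -> continuous (rad W A) y.
Proof.
move=> [_ _ cW] y0; apply: (continuous_mult sqrt _).
 by apply: continuous_sqrt.
apply: (continuous_comp _ W); last exact: cW.
apply: (continuous_mult _ Rinv); first exact: continuous_const.
by apply: continuous_Rinv; lra.
Qed.

Lemma sqrt_diff_le n y : 0 < n -> n <= y -> sqrt y - sqrt n <= (y - n) / (2 * sqrt n).
Proof.
move=> n0 ny; have sn := sqrt_lt_R0 _ n0.
have n2 : sqrt n * sqrt n = n by apply: sqrt_sqrt; lra.
have y2 : sqrt y * sqrt y = y by apply: sqrt_sqrt; lra.
apply: (Rmult_le_reg_r (2 * sqrt n)); first by lra.
have -> : (y - n) / (2 * sqrt n) * (2 * sqrt n) = y - n by field; lra.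
nra.
Qed.

Lemma rad_step W A n y : tame W -> 0 <= A -> 1 <= n -> n <= y <= n + 8 ->
 Rabs (rad W A y - rad W A n) <= 12 / sqrt n + 16 * A / (n * sqrt n).
Proof.
move=> [bW lW cW] A0 n1 hy.
have sn : 0 < sqrt n by pos.
have n2 : sqrt n * sqrt n = n by apply: sqrt_sqrt; lra.
have sy : sqrt n <= sqrt y by mon.
have sd := @sqrt_diff_le n y ltac:(lra) ltac:(lra).
have -> : sqrt y * W (A / y) - sqrt n * W (A / n) = (sqrt y - sqrt n) * W (A / y) + sqrt n * (W (A / y) - W (A / n)) by lra.
Rtri; apply: Rplus_le_compat; rewrite Rabs_mult.
 rewrite (Rabs_pos_eq _); last by lra.
 have s4 : sqrt y - sqrt n <= 4 / sqrt n.
  apply: Rle_trans sd _; have -> : 4 / sqrt n = 8 / (2 * sqrt n) by field; lra.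
  mon.
 have := bW (A / y).
 nra.
rewrite (Rabs_pos_eq _); last by lra.
have d : Rabs (A / y - A / n) <= 8 * A / (n * n).
 have -> : A / y - A / n = - (A * (y - n) / (y * n)) by field; lra.
 rewrite Rabs_Ropp Rabs_pos_eq; last by pos.
 apply: (Rle_trans _ (A * 8 / _)).
  mon.
 mon.
have l := lW (A / y) (A / n).
apply: (Rle_trans _ (sqrt n * (2 * (8 * A / (n * n))))); first by nra.
have -> : sqrt n * (2 * (8 * A / (n * n))) = 16 * A * (sqrt n / (n * n)) by lra.
have -> : 16 * A / (n * sqrt n) = 16 * A * (sqrt n / (n * (sqrt n * sqrt n))) by field; lra.
mon.
Qed.

Lemma rad_step_int W A n : tame W -> 0 <= A -> 1 <= n ->
 Rabs (8 * rad W A n - RInt (rad W A) n (n + 8)) <= 96 / sqrt n + 128 * A / (n * sqrt n).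
Proof.
move=> tW A0 n1.
have ex : ex_RInt (rad W A) n (n + 8).
 RIc => z; rewrite Rmin_left; try lra.
 by move=> hz; apply: rad_continuous => //; lra.
have e : RInt (rad W A) n (n + 8) - 8 * rad W A n = RInt (fun y => rad W A y - rad W A n) n (n + 8).
 rewrite (RInt_minus _ _) //; last exact: ex_RInt_const.
 by rewrite RInt_const /minus /plus /opp /scal /= /mult /=; ring.
rewrite Rabs_minus_sym e.
have -> : 96 / sqrt n + 128 * A / (n * sqrt n) = (n + 8 - n) * (12 / sqrt n + 16 * A / (n * sqrt n)) by lra.
apply: abs_RInt_le_const; first by lra.
 by apply: ex_RInt_minus => //; exact: ex_RInt_const.
by move=> y hy; apply: rad_step.
Qed.

Lemma inv_sqrt_tele n : 1 <= n -> / sqrt n <= (sqrt (n + 8) - sqrt n) / 2.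
Proof.
move=> n1; have sn : 0 < sqrt n by pos.
have n2 : sqrt n * sqrt n = n by apply: sqrt_sqrt; lra.
have s8 : sqrt (n + 8) * sqrt (n + 8) = n + 8 by apply: sqrt_sqrt; lra.
have p8 : 0 <= sqrt (n + 8) by pos.
have h3 : sqrt (n + 8) <= 3 * sqrt n by nra.
apply: (Rmult_le_reg_r (sqrt n)) => //; rewrite Rinv_l; last by lra.
nra.
Qed.

Lemma inv_sqrt3_tele n : 1 <= n -> / (n * sqrt n) <= 4 * (/ sqrt n - / sqrt (n + 8)).
Proof.
move=> n1; have sn : 0 < sqrt n by pos.
have n2 : sqrt n * sqrt n = n by apply: sqrt_sqrt; lra.
have s8 : sqrt (n + 8) * sqrt (n + 8) = n + 8 by apply: sqrt_sqrt; lra.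
have p8 : 0 < sqrt (n + 8) by pos.
have h3 : sqrt (n + 8) <= 3 * sqrt n by nra.
have h4 : sqrt n <= sqrt (n + 8) by nra.
set a := sqrt n in sn n2 h3 h4 *; set b := sqrt _ in s8 p8 h3 h4 *.
rewrite -n2; have -> : 4 * (/ a - / b) = 4 * ((b - a) / (a * b)) by field; lra.
apply: (Rmult_le_reg_r (a * a * a * b)); first by pos.
have -> : / (a * a * a) * (a * a * a * b) = b by field; lra.
have -> : 4 * ((b - a) / (a * b)) * (a * a * a * b) = 4 * (b - a) * (a * a) by field; lra.
nra.
Qed.

(** Each step of length 8 costs [96 / sqrt n + 128 A / n ^ (3/2)], which is majorized by telescoping
    differences of [sqrt] and of [1 / sqrt]. *)
Lemma rad_class_sum W A c u1 u2 : tame W -> 0 <= A -> (0 < c)%N -> (u1 <= u2)%N ->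
 Rabs (8 * \sum_(u1 <= u < u2) rad W A (INR (8 * u + c)) - RInt (rad W A) (INR (8 * u1 + c)) (INR (8 * u2 + c)))
 <= 48 * sqrt (INR (8 * u2 + c)) + 512 * A * / sqrt (INR (8 * u1 + c)).
Proof.
move=> tW A0 c0 u12.
have n1 u : 1 <= INR (8 * u + c) by have := @leqINR 1 (8 * u + c) ltac:(lia).
have nS u : INR (8 * u.+1 + c) = INR (8 * u + c) + 8.
 by rewrite !INRD !INRM (S_INR u) /=; ring.
have exr a b : ex_RInt (rad W A) (INR (8 * a + c)) (INR (8 * b + c)).
 RIc => z hz; apply: rad_continuous => //.
 have := n1 a; have := n1 b; have := Rmin_glb_lt (INR (8 * a + c)) (INR (8 * b + c)) 0; lra.
have main m : Rabs (8 * \sum_(u1 <= u < u1 + m) rad W A (INR (8 * u + c)) - RInt (rad W A) (INR (8 * u1 + c)) (INR (8 * (u1 + m) + c)))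
 <= 48 * (sqrt (INR (8 * (u1 + m) + c)) - sqrt (INR (8 * u1 + c))) + 512 * A * (/ sqrt (INR (8 * u1 + c)) - / sqrt (INR (8 * (u1 + m) + c))).
 elim: m => [|m IH].
  rewrite addn0 big_geq // RInt_point Rmult_0_r !Rminus_diag_eq // Rabs_R0; lra.
 rewrite addnS nS big_nat_recr; last by lia.
 rewrite -(RInt_Chasles _ _ (INR (8 * (u1 + m) + c))) //; last by rewrite -nS.
 set s := \sum_(_ <= _ < _) _ in IH *; set i1 := RInt _ _ _ in IH *.
 have st := rad_step_int tW A0 (n1 (u1 + m)%N).
 set r := rad W A _ in st *; set i2 := RInt _ _ _ in st *.
 have t1 := inv_sqrt_tele (n1 (u1 + m)%N); have t2 := inv_sqrt3_tele (n1 (u1 + m)%N).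
 have -> : 8 * (s + r) - (i1 + i2) = (8 * s - i1) + (8 * r - i2) by lra.
 Rtri.
 nra.
have := main (u2 - u1)%N; rewrite subnKC // => h.
have s1 := sqrt_pos (INR (8 * u1 + c)).
have i2 : 0 <= / sqrt (INR (8 * u2 + c)) by apply/Rlt_le/Rinv_0_lt_compat/sqrt_lt_R0; have := n1 u2; lra.
nra.
Qed.

Lemma inv_sin_sub x : 0 < x <= PI / 2 -> 0 <= / sin x - / x <= x.
Proof.
move=> hx.
have s1 := sin_lt_x x _.
have s2 := @sin_ge_half x ltac:(lra).
have s3 := @sin_ge_x_cos x ltac:(lra).
have s4 : 1 - cos x <= x * x / 2.
 have e : cos x = 1 - 2 * sin (x / 2) * sin (x / 2) by rewrite -cos_2a_sin; congr cos; field.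
 have a1 : 0 < sin (x / 2) by apply: sin_gt_0; lra.
 have a2 := sin_lt_x (x / 2) ltac:(lra).
 nra.
have -> : / sin x - / x = (x - sin x) / (x * sin x) by field; lra.
have p0 : 0 < x * sin x by nra.
split; first by pos.
apply: (Rmult_le_reg_r (x * sin x)) => //.
have -> : (x - sin x) / (x * sin x) * (x * sin x) = x - sin x by field; lra.
nra.
Qed.

Lemma inv_sqrt3_sum c u1 u2 : (0 < c)%N -> (u1 <= u2)%N ->
 \sum_(u1 <= u < u2) / (INR (8 * u + c) * sqrt (INR (8 * u + c))) <= 4 * / sqrt (INR (8 * u1 + c)).
Proof.
move=> c0 u12.
have n1 u : 1 <= INR (8 * u + c) by have := @leqINR 1 (8 * u + c) ltac:(lia).
have nS u : INR (8 * u.+1 + c) = INR (8 * u + c) + 8.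
 by rewrite !INRD !INRM (S_INR u) /=; ring.
have main m : \sum_(u1 <= u < u1 + m) / (INR (8 * u + c) * sqrt (INR (8 * u + c)))
 <= 4 * (/ sqrt (INR (8 * u1 + c)) - / sqrt (INR (8 * (u1 + m) + c))).
 elim: m => [|m IH]; first by rewrite addn0 big_geq //; lra.
 rewrite addnS nS big_nat_recr /=; last by lia.
 by have t2 := inv_sqrt3_tele (n1 (u1 + m)%N); lra.
have := main (u2 - u1)%N; rewrite subnKC // => h.
have i2 : 0 <= / sqrt (INR (8 * u2 + c)) by apply/Rlt_le/Rinv_0_lt_compat/sqrt_lt_R0; have := n1 u2; lra.
lra.
Qed.

Lemma osc_psi J c k n : osc J c (ang k n) = psi c (2 * J * PI * k / n).
Proof. by rewrite /osc /psi (_ : 2 * J * (PI * k / n) = 2 * J * PI * k / n); rewrite /Rdiv; ring. Qed.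

Definition Gsum (J c k Y : nat) : R :=
 \big[Rplus/0]_(Uc c (2 * k).+1 <= u < Uc c Y.+1) (amp 1 k (8 * u + c) * osc J c (ang k (8 * u + c))).

Definition errK (J k Y : nat) : R :=
 50 * sqrt (INR k) + 40 * (sqrt (INR Y) / INR k) + 200 * (INR J / sqrt (INR k)).

Lemma rad_bound W A y : tame W -> Rabs (rad W A y) <= 3 * sqrt y.
Proof.
move=> [bW _ _]; rewrite Rabs_mult Rabs_pos_eq; last exact: sqrt_pos.
by have := bW (A / y); have := sqrt_pos y; nra.
Qed.

Lemma rad_ex_RInt W A a b : tame W -> 0 < a -> 0 < b -> ex_RInt (rad W A) a b.
Proof.
move=> tW a0 b0; RIc => z hz; apply: rad_continuous => //.
by have := Rmin_glb_lt a b 0 a0 b0; lra.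
Qed.

Lemma rad_int_short W A a b : tame W -> 0 < a -> a <= b ->
 Rabs (RInt (rad W A) a b) <= (b - a) * (3 * sqrt b).
Proof.
move=> tW a0 ab; apply: abs_RInt_le_const => //; first by apply: rad_ex_RInt => //; lra.
move=> t ht; apply: Rle_trans (rad_bound A t tW) _.
mon.
Qed.

(** Three replacements: [1 / sin] by [1 / ang], the sum over the class by an integral, and the end
    points by [2 k] and [Y]. *)
Lemma Gsum_int J c k Y : (0 < k)%N -> (2 * k <= Y)%N -> c \in cls ->
 Rabs (Gsum J c k Y - / (8 * (PI * k)) * RInt (rad (psi c) (2 * J * PI * k)) (2 * k) Y) <= errK J k Y.
Proof.
move=> k0 kY hc.
have c0 : (0 < c)%N by move: hc; rewrite !inE => /or4P [] /eqP ->.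
have c7 : (c <= 7)%N by move: hc; rewrite !inE => /or4P [] /eqP ->.
have tW := tame_psi c; set W := psi c in tW *; set A := 2 * J * PI * INR k.
have pi3 : 3 < PI by have := PI2_3_2; lra.
have pi4 := PI_4.
have JR := pos_INR J.
have k1 : 1 <= k by have := @leqINR 1 k k0.
have A0 : 0 <= A by pos.
set u1 := Uc c (2 * k).+1; set u2 := Uc c Y.+1.
have u12 : (u1 <= u2)%N by apply: Uc_mono.
have a1 : (2 * k < 8 * u1 + c <= 2 * k + 8)%N by rewrite /u1 /Uc; lia.
have a2 : (Y < 8 * u2 + c <= Y + 8)%N by rewrite /u2 /Uc; lia.
have Y2 : 2 * k <= Y by rewrite -INR2 -INRM; apply: leqINR.
set n1 := INR (8 * u1 + c); set n2 := INR (8 * u2 + c).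
have b1 : 2 * k <= n1 <= 2 * k + 8.
 case/andP: a1 => /ltnW /leqINR x1 /leqINR x2; rewrite -/n1 in x1 x2.
 by move: x1 x2; rewrite INRD INRM /=; lra.
have b2 : Y <= n2 <= Y + 8.
 case/andP: a2 => /ltnW /leqINR x1 /leqINR x2; rewrite -/n2 in x1 x2.
 by move: x1 x2; rewrite INRD /=; lra.
have n12 : n1 <= n2 by apply: leqINR; rewrite leq_add2r leq_mul2l.
have sk : 0 < sqrt k by pos.
have sk2 : sqrt k * sqrt k = k by apply: sqrt_sqrt; lra.
have sY : 0 < sqrt Y by pos.
have sY2 : sqrt Y * sqrt Y = Y by apply: sqrt_sqrt; lra.
have sn2 : sqrt n2 <= 3 * sqrt Y.
 have e : sqrt n2 * sqrt n2 = n2 by apply: sqrt_sqrt; lra.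
 nra.
have isn1 : / sqrt n1 <= / sqrt k.
 mon.
have part1 : Rabs (Gsum J c k Y - / (PI * k) * \sum_(u1 <= u < u2) rad W A (INR (8 * u + c))) <= 50 * sqrt k.
 rewrite big_distrr -sumRB; Rsum.
 apply: (Rle_trans _ (\sum_(u1 <= u < u2) (3 * PI * k * / (INR (8 * u + c) * sqrt (INR (8 * u + c)))))).
  apply: sumR_le => u; rewrite mem_index_iota => /andP [hu1 hu2] _.
  have r3 : (2 * k <= 8 * u + c)%N by lia.
  have nn : 1 <= INR (8 * u + c) by have := @leqINR 1 (8 * u + c) ltac:(lia).
  have [x0 x1] := ang_range k0 r3.
  have iss := @inv_sin_sub (ang k (8 * u + c)) ltac:(lra).
  rewrite osc_psi /amp pow_1.
  set n := INR _ in nn *.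
  have sn : 0 < sqrt n by pos.
  have sn2' : sqrt n * sqrt n = n by apply: sqrt_sqrt; lra.
  have ia : / ang k (8 * u + c) = n / (PI * k) by rewrite /ang -/n; field; lra.
  have -> : / sqrt n * / sin (ang k (8 * u + c)) * W (A / n) - / (PI * k) * (sqrt n * W (A / n))
   = / sqrt n * (/ sin (ang k (8 * u + c)) - / ang k (8 * u + c)) * W (A / n).
   rewrite ia.
   have -> : n / (PI * k) = sqrt n * sqrt n / (PI * k) by nra.
   by field; repeat split; try lra; apply: Rgt_not_eq; apply: sin_gt_0; lra.
  have [bW _ _] := tW.
  rewrite !Rabs_mult (Rabs_pos_eq _); last by pos.
  rewrite (Rabs_pos_eq _); last by lra.
  apply: (Rle_trans _ (/ sqrt n * ang k (8 * u + c) * 3)).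
   mon.
  by rewrite /ang -/n; apply: Req_le; field; lra.
 rewrite -big_distrr /=; have t := inv_sqrt3_sum c0 u12; rewrite -/n1 in t.
 apply: (Rle_trans _ (3 * PI * k * (4 * / sqrt k))).
  mon.
 have -> : 3 * PI * k * (4 * / sqrt k) = 12 * PI * sqrt k by rewrite -{1}sk2; field; lra.
 nra.
have isk : 0 < / sqrt k by pos.
have ipk : 0 < / (8 * (PI * k)) by pos.
set S := \sum_(u1 <= u < u2) rad W A _ in part1 *.
have part2 : Rabs (/ (PI * k) * S - / (8 * (PI * k)) * RInt (rad W A) n1 n2) <= 6 * (sqrt Y / k) + 128 * (J / sqrt k).
 have -> : / (PI * k) * S - / (8 * (PI * k)) * RInt (rad W A) n1 n2 = / (8 * (PI * k)) * (8 * S - RInt (rad W A) n1 n2) by field; lra.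
 rewrite Rabs_mult Rabs_pos_eq; last by lra.
 have r := @rad_class_sum W A c u1 u2 tW A0 c0 u12; rewrite -/n1 -/n2 -/S in r.
 apply: (Rle_trans _ (/ _ * (144 * sqrt Y + 512 * A * / sqrt k))).
  mon.
 have -> : / (8 * (PI * k)) * (144 * sqrt Y + 512 * A * / sqrt k) = 18 / PI * (sqrt Y / k) + 128 * (J / sqrt k).
  by rewrite /A; field; lra.
 apply: Rplus_le_compat_r; apply: Rmult_le_compat_r; first by pos.
 by apply: (Rmult_le_reg_r PI); [lra | rewrite /Rdiv Rmult_assoc Rinv_l; lra].
have part3 : Rabs (/ (8 * (PI * k)) * RInt (rad W A) n1 n2 - / (8 * (PI * k)) * RInt (rad W A) (2 * k) Y) <= 6 * (sqrt Y / k).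
 rewrite -Rmult_minus_distr_l Rabs_mult Rabs_pos_eq; last by lra.
 have ex1 := @rad_ex_RInt W A (2 * k) n1 tW ltac:(lra) ltac:(lra).
 have ex2 := @rad_ex_RInt W A n1 Y tW ltac:(lra) ltac:(lra).
 have ex3 := @rad_ex_RInt W A Y n2 tW ltac:(lra) ltac:(lra).
 have e : RInt (rad W A) n1 n2 - RInt (rad W A) (2 * k) Y = RInt (rad W A) Y n2 - RInt (rad W A) (2 * k) n1.
  rewrite -(RInt_Chasles _ n1 Y n2 ex2 ex3) -(RInt_Chasles _ _ n1 Y ex1 ex2) /plus /=; ring.
 have i1 := @rad_int_short W A (2 * k) n1 tW ltac:(lra) ltac:(lra).
 have i2 := @rad_int_short W A Y n2 tW ltac:(lra) ltac:(lra).
 have s12 : sqrt n1 <= sqrt n2 by mon.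
 have h : Rabs (RInt (rad W A) n1 n2 - RInt (rad W A) (2 * k) Y) <= 144 * sqrt Y.
  rewrite e; have := Rabs_triang (RInt (rad W A) Y n2) (- RInt (rad W A) (2 * k) n1); rewrite Rabs_Ropp /Rminus.
  nra.
 apply: (Rle_trans _ (/ (8 * (PI * k)) * (144 * sqrt Y))); first by nra.
 have -> : / (8 * (PI * k)) * (144 * sqrt Y) = 18 / PI * (sqrt Y / k) by field; lra.
 apply: Rmult_le_compat_r; first by pos.
 by apply: (Rmult_le_reg_r PI); [lra | rewrite /Rdiv Rmult_assoc Rinv_l; lra].
have p4 : 0 <= sqrt Y / k by pos.
have p5 : 0 <= J / sqrt k by nra.
rewrite /errK.
set G := Gsum J c k Y in part1 *; set P := / _ * S in part1 part2.
set Q := / _ * RInt _ n1 n2 in part2 part3.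
set V := / _ * RInt _ _ Y in part3 *.
have -> : G - V = (G - P) + (P - Q) + (Q - V) by lra.
have t1 := Rabs_triang ((G - P) + (P - Q)) (Q - V); have t2 := Rabs_triang (G - P) (P - Q).
lra.
Qed.

(** * Frequencies whose odd part is a square *)

Definition issq (q : nat) : bool := has (fun b => b ^ 2 == q)%N (iota 0 q.+1).

Lemma issqP q : reflect (exists b, q = (b ^ 2)%N) (issq q).
Proof.
apply: (iffP hasP) => [[b _ /eqP <-]|[b ->]]; first by exists b.
exists b => //; rewrite mem_iota.
nia.
Qed.

Lemma sqind_issq q : odd q -> sqind q = if issq q then 1 else 0.
Proof.
move=> oq; rewrite /sqind; case: issqP => [[b e]|h].
 have ob : odd b by move: oq; rewrite e oddX.
 have bR := INR_gt0 (odd_gt0' ob).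
 by rewrite e brk0_sq // INRM sqrt_square; [field; lra | lra].
rewrite brk0_nsq //; first by lra.
by move=> b e; apply: h; exists b.
Qed.

Lemma oddp_unique j q : odd q -> logn 2 (2 ^ j * q) = j /\ oddp (2 ^ j * q) = q.
Proof.
move=> oq; have q0 := odd_gt0' oq.
have l : logn 2 (2 ^ j * q) = j.
 by rewrite lognM ?expn_gt0 // pfactorK // lognE q0 dvdn2 oq addn0.
by split => //; rewrite /oddp l mulKn // expn_gt0.
Qed.

Lemma oddp_sq l : (0 < l)%N -> logn 2 (l ^ 2) = (2 * logn 2 l)%N /\ oddp (l ^ 2) = (oddp l ^ 2)%N.
Proof.
move=> l0; rewrite {1 3}(oddpE l0) expnMn -expnM (mulnC _ 2%N).
by apply: oddp_unique; rewrite oddX odd_oddp.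
Qed.

Lemma oddp_2sq l : (0 < l)%N -> logn 2 (2 * l ^ 2) = (2 * logn 2 l).+1 /\ oddp (2 * l ^ 2) = (oddp l ^ 2)%N.
Proof.
move=> l0; rewrite {1 3}(oddpE l0) expnMn -expnM (mulnC _ 2%N) mulnA -expnS.
by apply: oddp_unique; rewrite oddX odd_oddp.
Qed.

(** The odd part of [k] is a square exactly when [k] is [l ^ 2] or [2 l ^ 2], according to the
    parity of the exponent of 2. *)
Lemma sum_sq_reindex f Y :
 \sum_(1 <= k < Y.+1) (sqind (oddp k) * f k) =
 \sum_(1 <= l < Y.+1 | (l ^ 2 <= Y)%N) f (l ^ 2)%N +
 \sum_(1 <= l < Y.+1 | (2 * l ^ 2 <= Y)%N) f (2 * l ^ 2)%N.
Proof.
transitivity (\sum_(1 <= k < Y.+1 | issq (oddp k)) f k).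
 rewrite [RHS]big_mkcond; apply: eq_big_nat => k /andP [k0 _].
 by rewrite sqind_issq ?odd_oddp //; case: ifP => _; ring.
rewrite -[X in X + _]big_filter -[X in _ + X]big_filter -(big_map _ xpredT f) -(big_map (fun l => 2 * l ^ 2)%N xpredT f) -big_cat -[LHS]big_filter.
have le_sq l : (l <= l ^ 2)%N by case: l => // l; nia.
have inj2 : injective (fun l => l ^ 2)%N by move=> x y /eqP; rewrite eqn_exp2r // => /eqP.
apply: perm_big; apply: uniq_perm.
- by rewrite filter_uniq // iota_uniq.
- rewrite cat_uniq !map_inj_uniq ?filter_uniq ?iota_uniq //=; last by move=> x y /eqP; rewrite eqn_pmul2l // => /eqP /inj2.
 rewrite andbT; apply/hasPn => k /mapP [l]; rewrite mem_filter mem_index_iota => /and3P [_ l0 _] ->.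
 apply/negP => /mapP [m]; rewrite mem_filter mem_index_iota => /and3P [_ m0 _] e.
 have [h1 _] := oddp_2sq l0; have [h2 _] := oddp_sq m0.
 by move: h1; rewrite e; lia.
move=> k; rewrite mem_filter mem_index_iota mem_cat.
apply/idP/orP => [/and3P [/issqP [b hb] k0 hk]|[]].
- have ek := oddpE k0; rewrite hb in ek.
 have ej := odd_double_half (logn 2 k); rewrite -mul2n in ej.
 case: (boolP (odd (logn 2 k))) => oj; rewrite ?oj ?(negbTE oj) in ej.
  have e : k = (2 * (2 ^ (logn 2 k)./2 * b) ^ 2)%N.
   move: ek ej; set h := (_./2); set j := logn 2 k => -> <-.
   by rewrite expnMn -expnM (mulnC h 2%N) mulnA -expnS.
  right; apply/mapP; exists (2 ^ (logn 2 k)./2 * b)%N => //.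
  set x := (_ * b)%N in e *; rewrite mem_filter mem_index_iota.
  have := le_sq x.
  lia.
 left; apply/mapP.
 have e : k = ((2 ^ (logn 2 k)./2 * b) ^ 2)%N.
  move: ek ej; set h := (_./2); set j := logn 2 k => -> <-.
  by rewrite expnMn -expnM (mulnC h 2%N).
 exists (2 ^ (logn 2 k)./2 * b)%N => //.
 set x := (_ * b)%N in e *; rewrite mem_filter mem_index_iota.
 have := le_sq x.
 lia.
- move=> /mapP [l]; rewrite mem_filter mem_index_iota => /and3P [h l0 _] ->.
 have [_ ->] := oddp_sq l0; rewrite ltnS h andbT expn_gt0 l0 andbT.
 by apply/issqP; exists (oddp l).
move=> /mapP [l]; rewrite mem_filter mem_index_iota => /and3P [h l0 _] ->.
have [_ ->] := oddp_2sq l0; rewrite ltnS h andbT muln_gt0 expn_gt0 l0 andbT.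
by apply/issqP; exists (oddp l).
Qed.

Lemma Msum_sqind J Y : Msum (fun _ q => sqind q) J Y =
 \sum_(1 <= k < Y.+1) (sqind (oddp k) * \sum_(c <- cls) (sgk k c * Gsum J c k Y)).
Proof.
apply: eq_bigr => k _; rewrite big_distrr; apply: eq_bigr => c _.
by rewrite -big_distrr /= /Gsum; ring.
Qed.

Lemma Gsum_empty J c k Y : (Y < 2 * k)%N -> Gsum J c k Y = 0.
Proof. by move=> h; rewrite /Gsum big_geq //; apply: Uc_mono; lia. Qed.

Lemma rsgn_sq1 b c : odd b -> rsgn (b ^ 2) c = 1%Z.
Proof. by move=> ob; rewrite /rsgn -modnXm; case: (odd_mod4 ob) => ->. Qed.

Lemma errK_ge0 J k Y : (0 < k)%N -> 0 <= errK J k Y.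
Proof.
move=> k0; have kR := INR_gt0 k0.
pos.
Qed.

(** For [k = l ^ 2] the sign is, up to a constant, an odd power of [(2 | c)]: it is opposite on 1
    and 5, and on 3 and 7, while the main terms depend on [c] modulo 4 only. *)
Lemma square_cancel J l Y : (0 < l)%N ->
 Rabs (\sum_(c <- cls) (sgk (l ^ 2) c * Gsum J c (l ^ 2) Y)) <= 4 * errK J (l ^ 2) Y.
Proof.
move=> l0; have k0 : (0 < l ^ 2)%N by lia.
have E0 := errK_ge0 J Y k0.
have ol := odd_oddp l0.
have [h1 h2] := oddp_sq l0.
have sg c : sgk (l ^ 2) c = (-1) ^ (l ^ 2) * IZR (jacobi 2 c) ^ (2 * logn 2 l).+1.
 by rewrite /sgk h1 h2 rsgn_sq1 // Rmult_1_r.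
have m1 : (-1) ^ (2 * logn 2 l).+1 = -1 by apply: pow_m1_odd; rewrite /= mul2n odd_double.
have e1 : IZR (jacobi 2 1) ^ (2 * logn 2 l).+1 = 1 by rewrite jacobi_2 //= pow1 Rmult_1_l.
have e7 : IZR (jacobi 2 7) ^ (2 * logn 2 l).+1 = 1 by rewrite jacobi_2 //= pow1 Rmult_1_l.
have e3 : IZR (jacobi 2 3) ^ (2 * logn 2 l).+1 = -1 by rewrite jacobi_2.
have e5 : IZR (jacobi 2 5) ^ (2 * logn 2 l).+1 = -1 by rewrite jacobi_2.
rewrite !big_cons big_nil !sg e1 e3 e5 e7.
set s := (-1) ^ _.
have s1 : Rabs s = 1 by rewrite /s -RPow_abs Rabs_Ropp Rabs_R1 pow1.
set G := fun c => Gsum J c (l ^ 2) Y.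
have -> : s * 1 * Gsum J 1 (l ^ 2) Y + (s * -1 * Gsum J 3 (l ^ 2) Y + (s * -1 * Gsum J 5 (l ^ 2) Y + (s * 1 * Gsum J 7 (l ^ 2) Y + 0)))
 = s * ((G 1%N - G 5%N) + (G 7%N - G 3%N)) by rewrite /G; ring.
rewrite Rabs_mult s1 Rmult_1_l.
case: (leqP (2 * l ^ 2) Y) => hk; last by rewrite /G !Gsum_empty // !Rminus_0_r Rplus_0_r Rabs_R0; lra.
have g c := @Gsum_int J c _ Y k0 hk.
have g1 := g 1%N isT; have g3 := g 3%N isT; have g5 := g 5%N isT; have g7 := g 7%N isT.
rewrite -/(G 1%N) in g1; rewrite -/(G 3%N) in g3; rewrite -/(G 5%N) in g5; rewrite -/(G 7%N) in g7.
rewrite (_ : psi 5 = psi 1) in g5; rewrite (_ : psi 7 = psi 3) // in g7.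
move: g1 g3 g5 g7 => /Rabs_le_between g1 /Rabs_le_between g3 /Rabs_le_between g5 /Rabs_le_between g7.
by apply: Rabs_le; lra.
Qed.

Lemma rad_WW A y : rad WW A y = rad (psi 1) A y + rad (psi 3) A y.
Proof. by rewrite /rad /WW /psi /=; ring. Qed.

(** For [k = 2 l ^ 2] all signs are positive; the classes 1 and 5 give [sin], the classes 3 and 7
    give [1 - cos], in total twice [WW]. *)
Lemma two_square_main J l Y : (0 < l)%N -> (4 * l ^ 2 <= Y)%N ->
 Rabs (\sum_(c <- cls) (sgk (2 * l ^ 2) c * Gsum J c (2 * l ^ 2) Y)
  - / (8 * PI * INR (l ^ 2)) * RInt (rad WW (2 * PI * INR (l ^ 2) * (2 * J))) (4 * INR (l ^ 2)) Y) <= 4 * errK J (2 * l ^ 2) Y.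
Proof.
move=> l0 hk; have k0 : (0 < 2 * l ^ 2)%N by lia.
have ol := odd_oddp l0; have [h1 h2] := oddp_2sq l0.
have lR : 0 < INR (l ^ 2) by apply: INR_gt0; rewrite expn_gt0 l0.
have pi0 := PI_RGT_0.
have sg c : c \in cls -> sgk (2 * l ^ 2) c = 1.
 move=> hc; rewrite /sgk h1 h2 rsgn_sq1 // Rmult_1_r mul2n -addnn pow_add pow_m1_sq Rmult_1_l.
 have -> : (2 * logn 2 l).+2 = (2 * (logn 2 l).+1)%N by lia.
 rewrite Rfunctions.pow_mult.
 have -> : IZR (jacobi 2 c) ^ 2 = 1.
  have oc := class_odd 0 hc.
  by rewrite jacobi_2 //; case: ifP => _ /=; ring.
 exact: pow1.
rewrite !big_cons big_nil !sg //.
have hk2 : (2 * (2 * l ^ 2) <= Y)%N by lia.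
have g c := @Gsum_int J c _ Y k0 hk2.
have g1 := g 1%N isT; have g3 := g 3%N isT; have g5 := g 5%N isT; have g7 := g 7%N isT.
have eA : 2 * J * PI * INR (2 * l ^ 2) = 2 * PI * INR (l ^ 2) * (2 * J) by rewrite INRM INR2; ring.
have eB : 2 * INR (2 * l ^ 2) = 4 * INR (l ^ 2) by rewrite INRM INR2; ring.
rewrite eA eB in g1 g3 g5 g7; set A := 2 * PI * INR _ * _ in g1 g3 g5 g7 *.
have Y4 : 4 * INR (l ^ 2) <= Y by have := leqINR hk; rewrite INRM /=; lra.
have e : RInt (rad WW A) (4 * INR (l ^ 2)) Y = RInt (rad (psi 1) A) (4 * INR (l ^ 2)) Y + RInt (rad (psi 3) A) (4 * INR (l ^ 2)) Y.
 rewrite (RInt_ext _ (fun y => plus (rad (psi 1) A y) (rad (psi 3) A y))); last by move=> y _; rewrite rad_WW.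
 rewrite RInt_plus //; apply: rad_ex_RInt; try lra; exact: tame_psi.
rewrite e; move: g1 g3 g5 g7; set r1 := RInt _ _ _; set r3 := RInt _ _ _.
have -> : / (8 * PI * INR (l ^ 2)) * (r1 + r3) = 2 * (/ (8 * (PI * INR (2 * l ^ 2))) * r1) + 2 * (/ (8 * (PI * INR (2 * l ^ 2))) * r3).
 by rewrite INRM INR2; field; lra.
move=> /Rabs_le_between g1 /Rabs_le_between g3 /Rabs_le_between g5 /Rabs_le_between g7.
by apply: Rabs_le; lra.
Qed.

#[local] Arguments INR : simpl never.

Lemma INR1 : INR 1 = 1.
Proof. pos. Qed.

(** * The series [Mdual] *)

Lemma rad_continuous_all W A y : tame W -> continuous (rad W A) y.
Proof.
move=> tW; case: (Rlt_le_dec 0 y) => y0; first exact: rad_continuous.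
apply/filterlim_locally => eps.
have h0 : rad W A y = 0 by rewrite /rad sqrt_neg_0 // Rmult_0_l.
case: (Rle_lt_or_eq_dec _ _ y0) => y1.
 have ny : 0 < - y by lra.
 exists (mkposreal _ ny) => z; rewrite /ball /= /AbsRing_ball /abs /minus /plus /opp /= => /Rabs_lt_between hz.
 by rewrite h0 /rad sqrt_neg_0 ?Rmult_0_l ?Ropp_0 ?Rplus_0_r ?Rabs_R0; [exact: cond_pos | lra].
have e0 := cond_pos eps; have e2 : 0 < eps * eps / 9 by nra.
exists (mkposreal _ e2) => z; rewrite /ball /= /AbsRing_ball /abs /minus /plus /opp /= h0 y1 Ropp_0 !Rplus_0_r => hz.
apply: Rle_lt_trans (rad_bound A z tW) _.
have : sqrt z < eps / 3; last by lra.
apply: (Rle_lt_trans _ _); first by apply: sqrt_le_1_alt; exact: Rle_abs.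
rewrite -(sqrt_square (eps / 3)); last by lra.
by apply: sqrt_lt_1_alt; split; pos.
Qed.

Lemma rad_ex W A a b : tame W -> ex_RInt (rad W A) a b.
Proof. by move=> tW; RIc => z _; apply: rad_continuous_all. Qed.

Lemma rad_int_le W A a b : tame W -> a <= b ->
 Rabs (RInt (rad W A) a b) <= (b - a) * (3 * sqrt b).
Proof.
move=> tW ab; apply: abs_RInt_le_const => //; first exact: rad_ex.
move=> t ht; apply: Rle_trans (rad_bound A t tW) _.
mon.
Qed.

Lemma is_derive_sqrt_pos y : 0 < y -> is_derive sqrt y (/ (2 * sqrt y)).
Proof. by move=> y0; apply/is_derive_Reals; apply: derivable_pt_lim_sqrt. Qed.

Lemma sqrt_primitive c a b : 0 < a -> a <= b -> is_RInt (fun y => c / sqrt y) a b (2 * c * (sqrt b - sqrt a)).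
Proof.
move=> a0 ab.
have -> : 2 * c * (sqrt b - sqrt a) = minus (2 * c * sqrt b) (2 * c * sqrt a) by rewrite /minus /plus /opp /=; ring.
apply: (is_RInt_derive (fun y => 2 * c * sqrt y)) => x; rewrite Rmin_left // => hx.
 have sx : 0 < sqrt x by pos.
 have -> : c / sqrt x = 2 * c * (/ (2 * sqrt x)) by field; lra.
 by apply: is_derive_scal; apply: is_derive_sqrt_pos; lra.
apply: (continuous_mult _ _); first exact: continuous_const.
apply: (continuous_comp sqrt Rinv); first exact: continuous_sqrt.
by apply: continuous_Rinv; apply: Rgt_not_eq; apply: sqrt_lt_R0; lra.
Qed.

(** The integrands differ by at most [2 |A - A'| / sqrt y]. A short initial interval, where [rad]
    itself is small, is cut off to keep away from the singularity at 0. *)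
Lemma rad_int_diff W A A' Y : tame W -> 0 <= Y ->
 Rabs (RInt (rad W A) 0 Y - RInt (rad W A') 0 Y) <= 4 * Rabs (A - A') * sqrt Y.
Proof.
move=> tW Y0; apply: le_epsilon => eps e0.
pose d := Rmin 1 (Rmin (eps / 6) Y).
case: (Rle_lt_or_eq_dec _ _ Y0) => [Y1|<-]; last first.
 by rewrite !RInt_point Rminus_diag_eq // Rabs_R0 sqrt_0; lra.
have d0 : 0 < d by rewrite /d; do 2 (apply: Rmin_glb_lt; try lra).
have d1 : d <= 1 by exact: Rmin_l.
have d2 : d <= eps / 6 by rewrite /d; apply: Rle_trans (Rmin_r _ _) (Rmin_l _ _).
have d3 : d <= Y by rewrite /d; apply: Rle_trans (Rmin_r _ _) (Rmin_r _ _).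
rewrite -(RInt_Chasles _ 0 d Y (rad_ex _ _ _ tW) (rad_ex _ _ _ tW)).
rewrite -(RInt_Chasles _ 0 d Y (rad_ex _ _ _ tW) (rad_ex _ _ _ tW)).
rewrite /plus /=.
have s1 : sqrt d <= 1 by rewrite -sqrt_1; apply: sqrt_le_1_alt.
have sd0 := sqrt_pos d.
have i1 := @rad_int_le W A 0 d tW ltac:(lra); have i2 := @rad_int_le W A' 0 d tW ltac:(lra).
have i3 : Rabs (RInt (rad W A) d Y - RInt (rad W A') d Y) <= 4 * Rabs (A - A') * sqrt Y.
 have -> : RInt (rad W A) d Y - RInt (rad W A') d Y = RInt (fun y => minus (rad W A y) (rad W A' y)) d Y.
  by rewrite RInt_minus //; exact: rad_ex.
 apply: (Rle_trans _ (2 * (2 * Rabs (A - A')) * (sqrt Y - sqrt d))); last by have := Rabs_pos (A - A'); nra.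
 apply: (norm_RInt_le (fun y => minus (rad W A y) (rad W A' y)) _ d Y) => //; last 1 first.
 - exact: sqrt_primitive.
 - move=> y hy; rewrite /norm /= /abs /minus /plus /= /rad.
  have y0 : 0 < y by lra.
  have sy := sqrt_lt_R0 _ y0; have sy2 : sqrt y * sqrt y = y by apply: sqrt_sqrt; lra.
  rewrite (_ : sqrt y * W _ + - _ = sqrt y * (W (A / y) - W (A' / y))); last by lra.
  rewrite Rabs_mult (Rabs_pos_eq _); last by lra.
  have [_ lW _] := tW; have := lW (A / y) (A' / y).
  have -> : A / y - A' / y = (A - A') / y by lra.
  rewrite Rabs_div; last by lra.
  rewrite (Rabs_pos_eq y); last by lra.
  move=> h; apply: (Rle_trans _ (sqrt y * (2 * (Rabs (A - A') / y)))); first by nra.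
  by rewrite -{2}sy2; apply: Req_le; field; lra.
 by apply: (RInt_correct _); apply: ex_RInt_minus; exact: rad_ex.
move: i1 i2 i3 => /Rabs_le_between i1 /Rabs_le_between i2 /Rabs_le_between i3; apply: Rabs_le.
nra.
Qed.

Lemma sum_n_big a n : sum_n a n = \sum_(0 <= l < n.+1) a l.
Proof.
elim: n => [|n IH]; first by rewrite sum_O big_nat1.
by rewrite sum_Sn IH [RHS]big_nat_recr.
Qed.

Lemma INR_S1 n : 0 < INR n.+1.
Proof. exact: INR_gt0. Qed.

Lemma inv_sq_tele L m : (0 < L)%N ->
 \sum_(L <= l < L + m) (/ (l.+1 * l.+1)) <= / L - / INR (L + m).
Proof.
move=> L0; elim: m => [|m IH]; first by rewrite addn0 big_geq //; lra.
rewrite addnS big_nat_recr /=; last by lia.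
have p : 0 < INR (L + m) by apply: INR_gt0; rewrite addn_gt0 L0.
rewrite (S_INR _).
suff : / ((INR (L + m) + 1) * (INR (L + m) + 1)) <= / INR (L + m) - / (INR (L + m) + 1) by lra.
have -> : / INR (L + m) - / (INR (L + m) + 1) = / (INR (L + m) * (INR (L + m) + 1)) by field; lra.
mon.
Qed.

Lemma big_nat_split f a b c : (a <= b)%N -> (b <= c)%N ->
 \sum_(a <= l < c) f l = \sum_(a <= l < b) f l + \sum_(b <= l < c) f l.
Proof. by move=> ab bc; rewrite (@big_cat_nat _ _ _ b a c). Qed.

Lemma inv_sq_series_tail a Q : 0 <= Q ->
 (forall l, Rabs (a l) <= Q / (l.+1 * l.+1)) ->
 ex_series a /\ forall L, (0 < L)%N -> Rabs (Series a - \sum_(0 <= l < L) a l) <= Q / INR L.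
Proof.
move=> Q0 h.
have fin L m : (0 < L)%N -> \sum_(L <= l < L + m) Rabs (a l) <= Q / INR L.
 move=> L0; apply: (Rle_trans _ (Q * \sum_(L <= l < L + m) (/ (l.+1 * l.+1)))).
  by rewrite big_distrr; apply: sumR_le => l _ _.
 apply: Rmult_le_compat_l => //; have := inv_sq_tele m L0.
 have : 0 < / INR (L + m) by apply/Rinv_0_lt_compat/INR_gt0; rewrite addn_gt0 L0.
 lra.
have ex : ex_series a.
 apply: ex_series_Rabs; apply: ex_finite_lim_seq_incr => [n|].
  by rewrite sum_Sn /plus /=; have := Rabs_pos (a n.+1); lra.
 move=> n; rewrite sum_n_big (big_nat_split _ (leq0n 1) (ltn0Sn n)).
 by have := fin 1%N n (ltn0Sn 0); rewrite add1n; instantiate (1 := \sum_(0 <= l < 1) Rabs (a l) + Q / INR 1); lra.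
split=> // L L0.
have lm : is_lim_seq (fun n => Rabs (sum_n a n - \sum_(0 <= l < L) a l)) (Rabs (Series a - \sum_(0 <= l < L) a l)).
 apply: (is_lim_seq_abs _ (Rbar.Finite _)); apply: is_lim_seq_minus'; last exact: is_lim_seq_const.
 exact: Series_correct.
have := @is_lim_seq_le_loc _ _ _ _ _ lm (is_lim_seq_const _); apply.
exists L => n /leP hn; rewrite sum_n_big (big_nat_split a (leq0n L)); last by lia.
rewrite (_ : _ + _ - _ = \sum_(L <= l < n.+1) a l); last by lra.
Rsum.
by have := fin L (n.+1 - L)%N L0; rewrite subnKC //; apply: leq_trans hn _.
Qed.

Lemma nat_ceil x : 0 <= x -> exists L : nat, x < L <= x + 1.
Proof.
move=> x0; have [h1 h2] := archimed x.
have u0 : (0 <= up x)%Z by apply: le_IZR; lra.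
by exists (Z.to_nat (up x)); rewrite INR_IZR_INZ Z2Nat.id //; lra.
Qed.

(** The two bounds are used on either side of their crossover, at [l] near [sqrt (Q / P)]. *)
Lemma series_min_bound a P Q : 0 <= P -> 0 <= Q ->
 (forall l, Rabs (a l) <= P) -> (forall l, Rabs (a l) <= Q / (l.+1 * l.+1)) ->
 Rabs (Series a) <= P + 2 * sqrt (P * Q).
Proof.
move=> P0 Q0 hP hQ.
have [_ tail] := inv_sq_series_tail Q0 hQ.
have gen L : (0 < L)%N -> Rabs (Series a) <= L * P + Q / INR L.
 move=> L0; have := tail L L0.
 have : Rabs (\sum_(0 <= l < L) a l) <= L * P.
  Rsum; rewrite -{2}(subn0 L) -sumR_nat_const.
  by apply: sumR_le => l _ _.
 move=> /Rabs_le_between h1 /Rabs_le_between h2; apply: Rabs_le; lra.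
have [P1|P1] : 0 < P \/ P = 0 by lra.
 have qp : 0 <= Q / P by pos.
 have [L [L1 L2]] := nat_ceil (sqrt_pos (Q / P)).
 have sq := sqrt_pos (Q / P); have sq2 := sqrt_sqrt _ qp.
 have L0 : (0 < L)%N by apply/ltP/INR_lt; rewrite -[INR 0]/0; lra.
 have e1 : sqrt (P * Q) = P * sqrt (Q / P).
  by rewrite -{2}(sqrt_square P) // -sqrt_mult_alt; [congr sqrt; field; lra | nra].
 have LR := INR_gt0 L0.
 have : Q / L <= P * sqrt (Q / P).
  apply: (Rmult_le_reg_r L) => //.
  have -> : Q / L * L = P * (sqrt (Q / P) * sqrt (Q / P)) by rewrite sq2; field; lra.
  rewrite -Rmult_assoc; apply: Rmult_le_compat_l; nra.
 by have := gen L L0; nra.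
rewrite P1 Rmult_0_l sqrt_0.
apply: le_epsilon => eps e0.
have [L [L1 L2]] := @nat_ceil (Q / eps) ltac:(by apply: Rdiv_le_0_compat).
have qe : 0 <= Q / eps by pos.
have LR : 0 < L by lra.
have L0 : (0 < L)%N by apply/ltP/INR_lt.
have := gen L L0; rewrite P1.
suff : Q / L <= eps by lra.
apply: (Rmult_le_reg_r L) => //.
have -> : Q / L * L = eps * (Q / eps) by field; lra.
nra.
Qed.

(** The index [l] stands for the number [l.+1]. Weight and phase are those of [two_square_main] with
    [X = 2 J], the integral being extended down to 0. *)
Definition lterm (X Y : R) (l : nat) : R :=
 / (8 * PI * (INR l.+1 * INR l.+1)) * RInt (rad WW (2 * PI * (INR l.+1 * INR l.+1) * X)) 0 Y.

Definition Mdual (X Y : R) : R := Series (lterm X Y).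

Definition Mmain (X Y : R) : R := X * sqrt Y / 4 + Mdual X Y.

Lemma lterm_bound X Y l : 0 <= Y -> Rabs (lterm X Y l) <= Y * sqrt Y / 8 / (l.+1 * l.+1).
Proof.
move=> Y0; have l0 := INR_S1 l; set q := l.+1 * l.+1; have q0 : 0 < q by pos.
have pi3 : 3 < PI by have := PI2_3_2; lra.
rewrite Rabs_mult Rabs_pos_eq; last by pos.
have := @rad_int_le WW _ 0 Y tame_WW Y0 => h.
apply: (Rle_trans _ _).
 mon.
have -> : / (8 * PI * q) * ((Y - 0) * (3 * sqrt Y)) = Y * sqrt Y / 8 / q * (3 / PI) by field; lra.
rewrite -{2}(Rmult_1_r (Y * sqrt Y / 8 / q)); apply: Rmult_le_compat_l.
 pos.
by apply: (Rmult_le_reg_r PI); [lra | rewrite /Rdiv Rmult_assoc Rinv_l; lra].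
Qed.

Lemma lterm_lipschitz X X' Y l : 0 <= Y -> Rabs (lterm X Y l - lterm X' Y l) <= sqrt Y * Rabs (X - X').
Proof.
move=> Y0; rewrite /lterm; have l0 := INR_S1 l; set q := l.+1 * l.+1; have q0 : 0 < q by pos.
have pi0 := PI_RGT_0.
rewrite -Rmult_minus_distr_l Rabs_mult Rabs_pos_eq; last by pos.
have := @rad_int_diff WW (2 * PI * q * X) (2 * PI * q * X') Y tame_WW Y0.
rewrite -Rmult_minus_distr_l Rabs_mult (Rabs_pos_eq (2 * PI * q)); last by nra.
move=> h; apply: (Rle_trans _ (/ _ * (4 * (2 * PI * q * Rabs (X - X')) * sqrt Y))).
 mon.
by apply: Req_le; field; lra.
Qed.

Lemma Mdual_ex X Y : 0 <= Y -> ex_series (lterm X Y).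
Proof.
move=> Y0; have Q0 : 0 <= Y * sqrt Y / 8 by pos.
by have [] := inv_sq_series_tail Q0 (fun l => lterm_bound X l Y0).
Qed.

Lemma Mdual_lipschitz X X' Y : 0 <= Y ->
 Rabs (Mdual X Y - Mdual X' Y) <= sqrt Y * Rabs (X - X') + Y * sqrt (Rabs (X - X')).
Proof.
move=> Y0; rewrite -Series_minus; try exact: Mdual_ex.
have sY := sqrt_pos Y; have r0 := Rabs_pos (X - X').
have Q0 : 0 <= Y * sqrt Y / 4 by nra.
have P0 : 0 <= sqrt Y * Rabs (X - X') by nra.
have := @series_min_bound _ _ _ P0 Q0.
have -> : sqrt (sqrt Y * Rabs (X - X') * (Y * sqrt Y / 4)) = Y * sqrt (Rabs (X - X')) / 2.
 rewrite (_ : sqrt Y * Rabs _ * _ = (Y / 2) * (Y / 2) * Rabs (X - X')).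
  by rewrite sqrt_mult_alt ?sqrt_square; nra.
 transitivity ((sqrt Y * sqrt Y) * (Y / 4) * Rabs (X - X')); first by lra.
 by rewrite sqrt_sqrt //; field.
move=> h; apply: Rle_trans; first apply: h.
- by move=> l; apply: lterm_lipschitz.
- move=> l; have := @lterm_bound X Y l Y0; have := @lterm_bound X' Y l Y0.
 by move=> /Rabs_le_between h1 /Rabs_le_between h2; apply: Rabs_le; lra.
lra.
Qed.

Lemma Mdual_0 Y : 0 <= Y -> Mdual 0 Y = 0.
Proof.
rewrite /Mdual (Series_ext _ (fun _ => 0)); first by rewrite (Series_ext _ (fun n => 0 * 0)) ?Series_scal_l ?Rmult_0_l.
move=> l; rewrite /lterm (RInt_ext _ (fun _ => 0)).
 by rewrite RInt_const /scal /= /mult /= !Rmult_0_r.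
by move=> x hx; rewrite /rad /WW Rmult_0_r /Rdiv Rmult_0_l sin_0 cos_0; ring_simplify.
Qed.

Lemma Mdual_bound X Y : 0 <= X -> 0 <= Y -> Rabs (Mdual X Y) <= sqrt Y * X + Y * sqrt X.
Proof.
move=> X0 Y0; have := @Mdual_lipschitz X 0 Y Y0; by rewrite Mdual_0 // !Rminus_0_r (Rabs_pos_eq X).
Qed.

Lemma sqrtn_spec Y : (Nat.sqrt Y ^ 2 <= Y < (Nat.sqrt Y).+1 ^ 2)%N.
Proof. by have [h1 h2] := Nat.sqrt_spec Y (Nat.le_0_l Y); apply/andP; split; apply/leP. Qed.

Lemma sqrtn_geq l Y : (l ^ 2 <= Y)%N = (l <= Nat.sqrt Y)%N.
Proof.
have /andP [h1 h2] := sqrtn_spec Y; apply/idP/idP => h.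
 by rewrite -ltnS -(@ltn_exp2r _ _ 2) //; apply: leq_ltn_trans h h2.
by apply: leq_trans h1; rewrite leq_exp2r.
Qed.

Lemma sum_sqrtn F Y :
 \sum_(1 <= l < Y.+1 | (l ^ 2 <= Y)%N) F l = \sum_(1 <= l < (Nat.sqrt Y).+1) F l.
Proof.
have sY : (Nat.sqrt Y <= Y)%N by apply/leP/Nat.sqrt_le_lin.
rewrite (@big_cat_nat _ _ _ (Nat.sqrt Y).+1) //= [X in _ + X]big_nat_cond [X in _ + X]big1.
 rewrite Rplus_0_r big_nat_cond [RHS]big_nat_cond; apply: eq_bigl => l.
 by rewrite sqrtn_geq -[(l <= _)%N]ltnS; case: (l < _)%N; rewrite ?andbF.
by move=> l /andP [/andP [h _]]; rewrite sqrtn_geq leqNgt h.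
Qed.

Lemma sqrtn_real Y : INR (Nat.sqrt Y) <= sqrt Y < INR (Nat.sqrt Y) + 1.
Proof.
have /andP [h1 h2] := sqrtn_spec Y; have s0 := pos_INR _.
have e (n : nat) : INR (n ^ 2) = n * n by rewrite -mulnn INRM.
split.
 by rewrite -(sqrt_square (INR _)) // -e; apply: sqrt_le_1_alt; apply: leqINR.
rewrite -S_INR -(sqrt_square (INR _.+1)); last exact: pos_INR.
by rewrite -e; apply: sqrt_lt_1_alt; split; [exact: pos_INR | apply: ltnINR].
Qed.

Lemma sum_id_sq s : \sum_(1 <= l < s.+1) l <= s * INR s.
Proof.
elim: s => [|s IH]; first by rewrite big_geq // -[INR 0]/0; lra.
rewrite big_nat_recr //= !S_INR.
have := pos_INR s; nra.
Qed.

Lemma sum_inv_sq_le2 s : \sum_(1 <= l < s.+1) / (l * l) <= 2.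
Proof.
case: s => [|s]; first by rewrite big_geq //; lra.
rewrite big_nat_recl //.
have := @inv_sq_tele 1 s isT; rewrite add1n.
have := Rinv_0_lt_compat _ (INR_S1 s); rewrite INR1; lra.
Qed.

Lemma errK_le J l Y k : (0 < l)%N -> k = (l ^ 2)%N \/ k = (2 * l ^ 2)%N ->
 errK J k Y <= 75 * l + 40 * sqrt Y * / (l * l) + 200 * J * / INR l.
Proof.
move=> l0 hk; have lR := INR_gt0 l0.
have e : INR (l ^ 2) = l * l by rewrite -mulnn INRM.
have kb : l * l <= k <= 2 * (l * l).
 by case: hk => ->; rewrite ?(INRM 2) ?INR2; nra.
have k0 : 0 < k by nra.
have s0 := sqrt_lt_R0 _ k0; have s2 : sqrt k * sqrt k = k by apply: sqrt_sqrt; lra.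
have s3 : sqrt k <= 3 / 2 * l by nra.
rewrite /errK -!Rmult_assoc.
mon.
Qed.

Lemma errK_sum J Y s (k : nat -> nat) : (s <= Nat.sqrt Y)%N -> (0 < Y)%N ->
 (forall l, k l = (l ^ 2)%N) \/ (forall l, k l = (2 * l ^ 2)%N) ->
 \sum_(1 <= l < s.+1) (4 * errK J (k l) Y) <= 620 * Y + 800 * (J * harm Y).
Proof.
move=> sY Y0 hk.
have [q1 q2] := sqrtn_real Y; have Y1 : 1 <= Y by have := @leqINR 1 Y Y0.
have sq2 : sqrt Y * sqrt Y = Y by apply: sqrt_sqrt; lra.
have sq1 : sqrt Y <= Y by nra.
have sR := leqINR sY; have s0 := pos_INR s; have J0 := pos_INR J.
apply: (Rle_trans _ (\sum_(1 <= l < s.+1) (300 * l + 160 * sqrt Y * / (l * l) + 800 * J * / l))).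
 apply: sumR_le => l; rewrite mem_index_iota => /andP [l0 _].
 have := @errK_le J l Y (k l) l0; case: hk => ->; move=> h.
  by have := h (or_introl erefl); lra.
 by have := h (or_intror erefl); lra.
rewrite !big_split -!big_distrr /=.
have i1 := sum_id_sq s; have i2 := sum_inv_sq_le2 s.
have i3 : \sum_(1 <= l < s.+1) / l <= harm Y.
 by apply: (@harm_mono s Y); apply: leq_trans sY _; apply/leP/Nat.sqrt_le_lin.
nra.
Qed.

(** The frequencies [l ^ 2] cancel up to [errK]; the frequencies [2 l ^ 2] with [4 l ^ 2 <= Y] give
    the first terms of [Mdual], and its tail is of order [Y]. *)
Lemma Msum_main J Y : (0 < Y)%N ->
 Rabs (Msum (fun _ q => sqind q) J Y - Mdual (2 * J) Y) <= 1250 * Y + 1600 * (J * harm Y).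
Proof.
move=> Y0; have Y1 : 1 <= Y by have := @leqINR 1 Y Y0.
set s := Nat.sqrt Y; pose h := (s %/ 2).
rewrite Msum_sqind (sum_sq_reindex _) sum_sqrtn.
have -> : \big[Rplus/0]_(1 <= l < Y.+1 | (2 * l ^ 2 <= Y)%N) \big[Rplus/0]_(c <- cls) (sgk (2 * l ^ 2) c * Gsum J c (2 * l ^ 2) Y) =
  \big[Rplus/0]_(1 <= l < h.+1) \big[Rplus/0]_(c <- cls) (sgk (2 * l ^ 2) c * Gsum J c (2 * l ^ 2) Y).
 have hY : (h <= Y)%N by apply: leq_trans (leq_div _ _) _; apply/leP/Nat.sqrt_le_lin.
 have hs l : ((2 * l) ^ 2 <= Y)%N = (l <= h)%N by rewrite sqrtn_geq -/s /h; lia.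
 rewrite (@big_cat_nat _ _ _ h.+1) //= [X in _ + X]big_nat_cond [X in _ + X]big1.
  rewrite Rplus_0_r big_nat_cond [RHS]big_nat_cond; apply: eq_bigl => l.
  have := hs l.
  lia.
 move=> l /andP [/andP [hl _]] _; apply: big1 => c _; rewrite Gsum_empty ?Rmult_0_r //.
 by have := hs l; rewrite [RHS]leqNgt hl => /negbT; rewrite -ltnNge expnMn mulnA.
set S1 := \sum_(1 <= l < s.+1) _; set S2 := \sum_(1 <= l < h.+1) _.
have h1 : Rabs S1 <= 620 * Y + 800 * (J * harm Y).
 Rsum.
 apply: Rle_trans (@errK_sum J Y s _ (leqnn _) Y0 (or_introl (fun _ => erefl))).
 by apply: sumR_le => l; rewrite mem_index_iota => /andP [l0 _] _; apply: square_cancel.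
pose I l := / (8 * PI * INR (l ^ 2)) * RInt (rad WW (2 * PI * INR (l ^ 2) * (2 * J))) (4 * INR (l ^ 2)) Y.
have h2 : Rabs (S2 - \sum_(1 <= l < h.+1) I l) <= 620 * Y + 800 * (J * harm Y).
 rewrite -sumRB; Rsum.
 apply: Rle_trans (@errK_sum J Y h _ (leq_div _ _) Y0 (or_intror (fun _ => erefl))).
 apply: sumR_le => l; rewrite mem_index_iota => /andP [l0 hl] _; apply: two_square_main => //.
 have : ((2 * l) ^ 2 <= Y)%N by rewrite sqrtn_geq -/s; lia.
 lia.
have [q1 q2] := sqrtn_real Y; rewrite -/s in q1 q2.
have sq2 : sqrt Y * sqrt Y = Y by apply: sqrt_sqrt; lra.
have sq1 : 1 <= sqrt Y by rewrite -sqrt_1; apply: sqrt_le_1_alt.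
have hs : h <= s / 2.
 have : (2 * h <= s)%N by lia.
 by move/leqINR; rewrite INRM INR2; lra.
have hs2 : s <= 2 * h + 1.
 have : (s <= 2 * h + 1)%N by lia.
 by move/leqINR; rewrite INRD INRM.
have pi3 : 3 < PI by have := PI2_3_2; lra.
(* Extending the integrals down to 0 costs at most [3 / PI] times [l.+1] for each term. *)
have h3 : Rabs (\sum_(0 <= l < h) lterm (2 * J) Y l - \sum_(1 <= l < h.+1) I l) <= INR Y.
 rewrite big_add1 -sumRB; Rsum.
 apply: (Rle_trans _ (\sum_(0 <= l < h) l.+1)); last first.
  have := sum_id_sq h; rewrite big_add1 [h.+1.-1]/= => q; nra.
 apply: sumR_le => l _ _; rewrite /lterm /I.
 have e : INR (l.+1 ^ 2) = l.+1 * l.+1 by rewrite -mulnn INRM.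
 rewrite e; have l0 := INR_S1 l; set a := l.+1 in l0 *.
 set f := rad WW _.
 have -> : RInt f 0 Y = RInt f 0 (4 * (a * a)) + RInt f (4 * (a * a)) Y.
  by rewrite -(RInt_Chasles f 0 (4 * (a * a)) Y) //; apply: rad_ex; exact: tame_WW.
 rewrite Rmult_plus_distr_l /Rminus Rplus_assoc Rplus_opp_r Rplus_0_r Rabs_mult Rabs_pos_eq; last by pos.
 have := @rad_int_le WW (2 * PI * (a * a) * (2 * J)) 0 (4 * (a * a)) tame_WW ltac:(nra).
 rewrite (_ : 4 * _ = (2 * a) * (2 * a)); last by lra.
 rewrite sqrt_square; last by lra.
 move=> hf; apply: (Rle_trans _ (/ _ * ((2 * a * (2 * a) - 0) * (3 * (2 * a))))).
  mon.
 have -> : / (8 * PI * (a * a)) * ((2 * a * (2 * a) - 0) * (3 * (2 * a))) = a * (3 / PI) by field; lra.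
 rewrite -{2}(Rmult_1_r a); lmul.
 by apply: (Rmult_le_reg_r PI); [lra | rewrite /Rdiv Rmult_assoc Rinv_l; lra].
have h4 : Rabs (Mdual (2 * J) Y - \sum_(0 <= l < h) lterm (2 * J) Y l) <= 8 * INR Y.
 have Q0 : 0 <= Y * sqrt Y / 8 by nra.
 have [_ tail] := inv_sq_series_tail Q0 (fun l => @lterm_bound (2 * J) Y l (pos_INR Y)).
 case: (posnP h) => [hz|hp].
  have s1 : s <= 1 by rewrite hz -[INR 0]/0 in hs2; lra.
  rewrite hz big_geq //; have := tail 1%N isT; rewrite big_nat1.
  have := @lterm_bound (2 * J) Y 0 (pos_INR Y); rewrite -[INR 1]/1.
  move=> /Rabs_le_between t1 /Rabs_le_between t2; apply: Rabs_le; rewrite /Mdual; nra.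
 have := tail h hp; have hR := INR_gt0 hp; have h1' : 1 <= h by have := @leqINR 1 h hp.
 move=> t; apply: Rle_trans t _; apply: (Rmult_le_reg_r h) => //.
 rewrite /Rdiv Rmult_assoc Rinv_l; nra.
move: h1 h2 h3 h4 => /Rabs_le_between h1 /Rabs_le_between h2 /Rabs_le_between h3 /Rabs_le_between h4.
apply: Rabs_le; lra.
Qed.

Lemma count_odd s : count odd (index_iota 1 s.+1) = (s.+1)./2.
Proof.
elim: s => [|s IH] //; move: IH; rewrite /index_iota !subn1 [s.+1.-1]/= -{2}(addn1 s) iotaD count_cat => ->.
by rewrite //=; lia.
Qed.

Lemma SQ_count Y : SQ Y = INR ((Nat.sqrt Y).+1)./2.
Proof.
transitivity (\sum_(1 <= n < Y.+1 | odd n && issq n) 1).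
 rewrite big_mkcondr; apply: eq_bigr => n on; by rewrite sqind_issq.
transitivity (\sum_(1 <= b < (Nat.sqrt Y).+1 | odd b) 1); last by rewrite sumR_const count_odd Rmult_1_r.
rewrite -big_filter -[RHS]big_filter -[RHS](big_map (fun b => b ^ 2)%N xpredT (fun _ => 1)).
apply: perm_big; apply: uniq_perm.
- by rewrite filter_uniq // iota_uniq.
- by rewrite map_inj_uniq ?filter_uniq ?iota_uniq // => x y /eqP; rewrite eqn_exp2r // => /eqP.
move=> n; rewrite mem_filter mem_index_iota; apply/idP/mapP.
 move=> /and3P [/andP [on /issqP [b e]] n0 nY]; exists b => //.
 rewrite mem_filter mem_index_iota ltnS -sqrtn_geq -e.
 by have ob : odd b by [move: on; rewrite e oddX]; rewrite ob (odd_gt0' ob).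
move=> [b]; rewrite mem_filter mem_index_iota => /and3P [ob b0]; rewrite ltnS -sqrtn_geq => hb ->.
rewrite oddX ob expn_gt0 b0; apply/andP; split=> //; apply/issqP; by exists b.
Qed.

Lemma SQ_approx Y : Rabs (SQ Y - sqrt Y / 2) <= 1.
Proof.
rewrite SQ_count; have [q1 q2] := sqrtn_real Y; set s := Nat.sqrt Y in q1 q2 *.
have : (s <= 2 * (s.+1)./2)%N by lia.
have : (2 * (s.+1)./2 <= s.+1)%N by lia.
move=> /leqINR; rewrite INRM INR2 (S_INR s) => h1 /leqINR; rewrite INRM INR2 => h2.
by apply: Rabs_le; lra.
Qed.

(** * Real cutoffs and the averaging length *)

Lemma floorn_spec x : 0 <= x -> INR (floorn x) <= x < INR (floorn x) + 1.
Proof.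
move=> x0; have [h1 h2] := base_Int_part x.
have u0 : (0 <= Int_part x)%Z.
 have : (-1 < Int_part x)%Z by apply: lt_IZR; lra.
 lia.
by rewrite INR_IZR_INZ Z2Nat.id //; lra.
Qed.

Lemma floorn_ge x n : 0 <= x -> (n <= floorn x)%N <-> n <= x.
Proof.
move=> x0; have [h1 h2] := floorn_spec x0; split=> h; first by have := leqINR h; lra.
rewrite leqNgt; apply/negP => /leqINR; rewrite S_INR; lra.
Qed.

Lemma floorn_gt0 x : 1 <= x -> (0 < floorn x)%N.
Proof. by move=> x1; apply/floorn_ge; rewrite ?INR1; lra. Qed.

Definition oddcount (X : R) : nat := ((floorn X).+1)./2.

Lemma oddcount_spec X : 1 <= X -> Rabs (2 * INR (oddcount X) - X) <= 1 /\ (0 < oddcount X)%N.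
Proof.
move=> X1; have [h1 h2] := @floorn_spec X ltac:(lra); have f0 := floorn_gt0 X1.
rewrite /oddcount; set f := floorn X in h1 h2 f0 *.
split; last by lia.
have : (f <= 2 * (f.+1)./2)%N by lia.
have : (2 * (f.+1)./2 <= f.+1)%N by lia.
move=> /leqINR; rewrite INRM INR2 (S_INR f) => a1 /leqINR; rewrite INRM INR2 => a2.
by apply: Rabs_le; lra.
Qed.

Definition Treal (X Y : R) : R := Tsum (oddcount X) (floorn Y).

Lemma brkabs_sym m n : (0 < m)%N -> (0 < n)%N -> brkabs m n = brkabs n m.
Proof.
move=> m0 n0; have w x y (h : (0 < x)%N) (h' : (0 < y)%N) : brkabs x y =
 \sum_(1 <= b < (x + y).+1 | (b ^ 2 %| x) && (b ^ 2 %| y)) INR b.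
 rewrite /brkabs (@sumR_widen _ _ 1 y.+1 (x + y).+1) //; first by lia.
 by move=> b /andP [_ /(sq_dvd_le h')] + _.
rewrite !w // addnC; apply: eq_bigl => b; exact: andbC.
Qed.

Lemma brkabs_sum_dual m Y : (0 < m)%N -> \sum_(1 <= n < Y.+1 | odd n) brkabs m n <= Y * harm m.
Proof.
move=> m0; apply: Rle_trans (brkabs_sum_le Y m).
rewrite big_mkcond; apply: sumR_le => n; rewrite mem_index_iota => /andP [n0 _].
by rewrite (brkabs_sym m0 n0); case: (odd n); have := brkabs_ge0 n m; lra.
Qed.

Lemma Tsum_swap J Y : Tsum J Y = \sum_(0 <= j < J) \sum_(1 <= n < Y.+1 | odd n) brk (2 * j + 1) n.
Proof. by rewrite exchange_big. Qed.

(** The price of averaging: each further row is bounded by a sum of [brkabs]. *)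
Lemma Tsum_local J D d Y : (d <= D)%N ->
 Rabs (Tsum (J + d) Y - Tsum J Y) <= D * (Y * harm (2 * (J + D))).
Proof.
move=> dD; rewrite !Tsum_swap (big_nat_split _ (leq0n J) (leq_addr d J)).
rewrite (_ : _ + _ - _ = \sum_(J <= j < J + d) \sum_(1 <= n < Y.+1 | odd n) brk (2 * j + 1) n); last by lra.
Rsum.
have h0 := harm_ge0 (2 * (J + D)); have Y0 := pos_INR Y.
apply: (Rle_trans _ (\sum_(J <= j < J + d) (Y * harm (2 * (J + D))))).
 apply: sumR_le => j; rewrite mem_index_iota => /andP [_ hj] _.
 Rsum.
 apply: (Rle_trans _ _).
  by apply: sumR_le => n _ on; apply: brk_le.
 apply: Rle_trans (@brkabs_sum_dual (2 * j + 1) Y ltac:(lia)) _.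
 by apply: Rmult_le_compat_l => //; apply: harm_mono; lia.
rewrite sumR_nat_const addKn; apply: Rmult_le_compat_r; last exact: leqINR.
nra.
Qed.

Lemma avgR_close D f c E : (0 < D)%N ->
 (forall d, (d < D)%N -> Rabs (f d - c) <= E) -> Rabs (avgR D f - c) <= E.
Proof.
move=> D0 h; have DR := INR_gt0 D0.
have -> : avgR D f - c = / D * \sum_(0 <= d < D) (f d - c).
 by rewrite /avgR sumRB sumR_nat_const subn0; field; lra.
rewrite Rabs_mult Rabs_pos_eq; last by pos.
apply: (Rmult_le_reg_l D) => //; rewrite -Rmult_assoc Rinv_r ?Rmult_1_l; last by lra.
Rsum.
apply: (Rle_trans _ (\sum_(0 <= d < D) E)); last by rewrite sumR_nat_const subn0; lra.
by apply: sumR_le => d; rewrite mem_index_iota => /andP [_ hd] _; apply: h.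
Qed.

Lemma Mdual_Y X Y Y' : 0 <= Y -> Y <= Y' <= Y + 1 -> 1 <= Y' -> Rabs (Mdual X Y' - Mdual X Y) <= Y'.
Proof.
move=> Y0 hY Y1; rewrite -Series_minus; try by apply: Mdual_ex; lra.
have s0 := sqrt_pos Y'.
have Q0 : 0 <= sqrt Y' / 8 by lra.
have b l : Rabs (lterm X Y' l - lterm X Y l) <= sqrt Y' / 8 / (l.+1 * l.+1).
 rewrite /lterm; have l0 := INR_S1 l; set q := l.+1 * l.+1; have q0 : 0 < q by pos.
 have pi3 : 3 < PI by have := PI2_3_2; lra.
 set f := rad WW _.
 rewrite -(RInt_Chasles f 0 Y Y' (rad_ex _ _ _ tame_WW) (rad_ex _ _ _ tame_WW)).
 rewrite -Rmult_minus_distr_l (_ : RInt f 0 Y + RInt f Y Y' - RInt f 0 Y = RInt f Y Y'); last by lra.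
 have ip : 0 <= / (8 * PI * q) by pos.
 rewrite Rabs_mult Rabs_pos_eq //.
 have := @rad_int_le WW (2 * PI * q * X) Y Y' tame_WW ltac:(lra); rewrite -/f => h.
 apply: (Rle_trans _ (/ _ * (3 * sqrt Y'))); first by mon.
 have -> : / (8 * PI * q) * (3 * sqrt Y') = sqrt Y' / 8 / q * (3 / PI) by field; lra.
 rewrite -{2}(Rmult_1_r (sqrt Y' / 8 / q)); apply: Rmult_le_compat_l.
  pos.
 by apply: (Rmult_le_reg_r PI); [lra | rewrite /Rdiv Rmult_assoc Rinv_l; lra].
have [_ tail] := inv_sq_series_tail Q0 b.
have := tail 1%N isT; have := b 0%N; rewrite big_nat1 INR1.
have e : sqrt Y' * sqrt Y' = Y' by apply: sqrt_sqrt; lra.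
move=> /Rabs_le_between b1 /Rabs_le_between b2; apply: Rabs_le; nra.
Qed.

(** In the proof, [e1] introduces the average, [e2] discards the fluctuation, [e3] replaces every
    averaged main term by [Mmain] at [X], and [e5] passes from the integer part of [Y] to [Y]. *)
Lemma Treal_error X Y D I : 1 <= X -> 1 <= Y -> (0 < D)%N -> (floorn Y < 2 ^ I)%N ->
 let J := oddcount X in let H := harm (2 ^ I) in
 Rabs (Treal X Y - Mmain X Y) <=
  D * (Y * harm (2 * (J + D))) +
  52000 * (H * H * H) * (sqrt (INR (J + D)) * INR (2 ^ I) / D + I * INR (J + D) + 4 * INR (2 ^ I)) +
  (INR (J + D) + 1250 * Y + 1600 * (INR (J + D) * H)) + 9 * (Y * D) + (X + Y).
Proof.
move=> X1 Y1 D0 hI J H.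
have [f1 f2] := @floorn_spec Y ltac:(lra); have n0 := floorn_gt0 Y1; have [Jx J0] := oddcount_spec X1.
rewrite -/J in Jx; rewrite /Treal -/J; set n := floorn Y in hI f1 f2 n0 *.
have n1 : 1 <= n by have := @leqINR 1 n n0.
have nR := pos_INR n.
have hh := harm_ge0 _.
have sn2 : sqrt n * sqrt n = n by apply: sqrt_sqrt.
have sn1 : 1 <= sqrt n by rewrite -sqrt_1; apply: sqrt_le_1_alt.
have e1 : Rabs (avgR D (fun d => Tsum (J + d) n) - Tsum J n) <= D * (Y * harm (2 * (J + D))).
 apply: avgR_close => // d hd; apply: Rle_trans (@Tsum_local J D d n (ltnW hd)) _.
 mon.
have e2 := @Tavg_error J D n I J0 D0 hI; rewrite -/H in e2.
have hn : harm n <= H by apply: harm_mono; apply: ltnW.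
have e3 : Rabs (avgR D (fun d => INR (J + d) * SQ n + Msum (fun _ q => sqind q) (J + d) n) - Mmain X n) <=
 INR (J + D) + 1250 * Y + 1600 * (INR (J + D) * H) + 9 * (Y * D).
 apply: avgR_close => // d hd; rewrite /Mmain.
 have dD : INR (J + d) <= INR (J + D) by apply: leqINR; rewrite leq_add2l ltnW.
 have m := @Msum_main (J + d) n n0; have s := SQ_approx n.
 have d0 := pos_INR d; have d1 : d + 1 <= D by rewrite -S_INR; apply: leqINR.
 have := @Mdual_lipschitz (2 * INR (J + d)) X n nR.
 set Delta := Rabs (2 * INR _ - X).
 have dl : Delta <= 2 * INR D.
  rewrite /Delta INRD; move: Jx => /Rabs_le_between Jx; apply: Rabs_le; lra.
 have dl0 : 0 <= Delta by pos.
 have sd := sqrt_pos Delta; have sd2 := sqrt_sqrt _ dl0.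
 have sd3 : sqrt Delta <= 2 * D by nra.
 have hn0 := harm_ge0 n; have jd := pos_INR (J + d).
 move=> l.
 have l' : sqrt n * Delta + n * sqrt Delta <= 4 * (Y * D).
  have : sqrt n * Delta <= Y * (2 * D) by mon.
  nra.
 have e4 : Rabs (INR (J + d) * SQ n - X * sqrt n / 4) <= INR (J + D) + Y * INR D.
  have -> : INR (J + d) * SQ n - X * sqrt n / 4 = INR (J + d) * (SQ n - sqrt n / 2) + sqrt n / 4 * (2 * INR (J + d) - X) by lra.
  Rtri; rewrite (Rabs_mult _) (Rabs_mult _) (Rabs_pos_eq _) // (Rabs_pos_eq (sqrt n / 4)); last by lra.
  rewrite -/Delta; apply: Rplus_le_compat; first by nra.
  nra.
 have m' : 1250 * n + 1600 * (INR (J + d) * harm n) <= 1250 * Y + 1600 * (INR (J + D) * H) by nra.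
 move: m l e4 => /Rabs_le_between m /Rabs_le_between l /Rabs_le_between e4; apply: Rabs_le.
 lra.
have e5 : Rabs (Mmain X Y - Mmain X n) <= X + Y.
 rewrite /Mmain; have := @Mdual_Y X n Y nR ltac:(lra) Y1.
 have sd := @sqrt_diff_le n Y ltac:(lra) f1.
 have sle : sqrt n <= sqrt Y by mon.
 have q : (Y - n) / (2 * sqrt n) <= 1.
  apply: (Rmult_le_reg_r (2 * sqrt n)); first by lra.
  by rewrite Rmult_assoc Rinv_l; lra.
 move=> /Rabs_le_between h; apply: Rabs_le; nra.
move: e1 e2 e3 e5 => /Rabs_le_between e1 /Rabs_le_between e2 /Rabs_le_between e3 /Rabs_le_between e5.
apply: Rabs_le; lra.
Qed.

Lemma ln_le_Rpower x d : 0 < d -> 0 < x -> ln x <= Rpower x d / d.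
Proof.
move=> d0 x0; apply: (Rmult_le_reg_l d) => //.
have -> : d * (Rpower x d / d) = Rpower x d by field; lra.
rewrite /Rpower; have := exp_ineq1_le (d * ln x); lra.
Qed.

Lemma Rpower_ge1 x d : 1 <= x -> 0 <= d -> 1 <= Rpower x d.
Proof.
move=> x1 d0; rewrite -(Rpower_O x); last by lra.
case: (Rle_lt_or_eq_dec _ _ x1) => [h|<-]; first exact: Rle_Rpower.
by rewrite /Rpower ln_1 !Rmult_0_r; lra.
Qed.

Lemma Rpower_monol x y d : 0 < x -> x <= y -> 0 <= d -> Rpower x d <= Rpower y d.
Proof. by move=> x0 xy d0; apply: Rle_Rpower_l. Qed.

Lemma harm_ln N : (0 < N)%N -> harm N <= 1 + ln N.
Proof.
elim: N => // N IH _; case: (posnP N) => [->|N0].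
 by rewrite /harm big_nat1 INR1 ln_1; lra.
have := IH N0; rewrite {2}/harm [in X in _ -> X]big_nat_recr //= -/(harm N) => h.
have a0 := INR_gt0 N0; rewrite S_INR.
suff : / (N + 1) <= ln (N + 1) - ln N by lra.
have -> : ln N = ln (N + 1) + ln (N / (N + 1)).
 rewrite -ln_mult; [congr ln; field; lra | lra | apply: Rdiv_lt_0_compat; lra].
have := exp_ineq1_le (ln (N / (N + 1))); rewrite exp_ln; last by pos.
have -> : N / (N + 1) = 1 - / (N + 1) by field; lra.
lra.
Qed.

Lemma harm_Rpower d : 0 < d -> exists2 K, 0 < K & forall N : nat, (0 < N)%N -> harm N <= K * Rpower N d.
Proof.
move=> d0; exists (1 + / d); first by pos.
move=> N N0; have N1 : 1 <= N by have := @leqINR 1 N N0.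
have := harm_ln N0; have := @ln_le_Rpower N d d0 ltac:(lra).
have := @Rpower_ge1 N d N1 ltac:(lra); nra.
Qed.

(* The unit exponent of X in the second term must not pick up a factor [X ^ d]. *)
Lemma Treal_weak d : 0 < d <= 1 -> exists2 K, 0 < K & forall X Y : R, 1 <= X -> 1 <= Y ->
 Rabs (Treal X Y - Mmain X Y) <= K * (Y * Rpower X (1 / 4) * Rpower (X * Y) d + X * Rpower Y d).
Proof.
move=> d0; have d4 : 0 < d / 4 by lra.
have [K1 K10 hK1] := harm_Rpower d4.
pose K2 := K1 + 1; pose L1 := 64 * (K2 * K2 * K2 * K2) * (1 + 8 / d).
exists (52000 * 12 * L1 + 100 * K2 + 8000 * L1 + 5000).
 have k0 : 0 < K2 by rewrite /K2; lra.
 have k4 : 0 < K2 * K2 * K2 * K2 by repeat apply: Rmult_lt_0_compat.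
 have c8 : 0 < 8 / d by apply: Rdiv_lt_0_compat; lra.
 have : 0 < L1 by apply: Rmult_lt_0_compat; lra.
 lra.
move=> X Y X1 Y1.
have K21 : 1 <= K2 by rewrite /K2; lra.
set x4 := Rpower X (1 / 4).
have x41 : 1 <= x4 by apply: Rpower_ge1; lra.
have x42 : x4 * x4 = sqrt X.
 rewrite /x4 -Rpower_plus -Rpower_sqrt; last by lra.
 by congr Rpower; field.
have sX2 : sqrt X * sqrt X = X by apply: sqrt_sqrt; lra.
have sX1 : 1 <= sqrt X by rewrite -sqrt_1; apply: sqrt_le_1_alt.
have sXX : sqrt X <= X by nra.
have x4s : x4 <= sqrt X by rewrite -x42; nra.
(* Balances the cost [Y D] of averaging with the remainder [Y sqrt X / D]. *)
have [D [D1 D2]] := @nat_ceil x4 ltac:(lra).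
have D0 : (0 < D)%N by apply/ltP/INR_lt; rewrite -[INR 0]/0; lra.
have n0 := floorn_gt0 Y1; have [f1 f2] := @floorn_spec Y ltac:(lra).
have /andP [i1 i2] := @trunc_log_bounds 2 (floorn Y) isT n0.
set I := (trunc_log 2 (floorn Y)).+1 in i2.
have := @Treal_error X Y D I X1 Y1 D0 i2.
have [Jx J0] := oddcount_spec X1.
set J := oddcount X in Jx J0 *; set H := harm (2 ^ I) => /= err.
have P1 : 1 <= INR (2 ^ I) by apply: (@leqINR 1); rewrite expn_gt0.
have P2 : INR (2 ^ I) <= 2 * Y.
 have : (2 ^ I <= 2 * floorn Y)%N by rewrite /I expnS leq_mul2l.
 by move/leqINR; rewrite INRM INR2; lra.
have JD : INR (J + D) <= 4 * X.
 by rewrite INRD; move: Jx => /Rabs_le_between; lra.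
have JD1 : 1 <= INR (J + D) by apply: (@leqINR 1); rewrite addn_gt0 J0.
set Xd := Rpower X d; set Yd := Rpower Y d.
have Xd1 : 1 <= Xd by apply: Rpower_ge1; lra.
have Yd1 : 1 <= Yd by apply: Rpower_ge1; lra.
have eXY : Rpower (X * Y) d = Xd * Yd by rewrite Rpower_mult_distr //; lra.
have pw8 c : 0 <= c <= 8 -> Rpower c (d / 4) <= 8 \/ c <= 0.
 move=> hc; case: (Rlt_le_dec 0 c) => c0; last by right.
 left; apply: (Rle_trans _ (Rpower 8 (d / 4))); first by apply: Rpower_monol; lra.
 rewrite -{2}(Rpower_1 8); last by lra.
 by apply: Rle_Rpower; lra.
have y4 : Rpower Y (d / 4) * Rpower Y (d / 4) * Rpower Y (d / 4) * Rpower Y (d / 4) = Yd.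
 by rewrite -!Rpower_plus; congr Rpower; field.
have yq1 : 1 <= Rpower Y (d / 4) by apply: Rpower_ge1; lra.
set yq := Rpower Y (d / 4) in y4 yq1.
have r2 : Rpower 2 (d / 4) <= 2.
 rewrite -{2}(Rpower_1 2); last by lra.
 by apply: Rle_Rpower; lra.
have PI4 : Rpower (INR (2 ^ I)) (d / 4) <= 2 * yq.
 apply: (Rle_trans _ (Rpower (2 * Y) (d / 4))); first by apply: Rpower_monol; lra.
 rewrite -Rpower_mult_distr; try lra.
 by rewrite -/yq; nra.
have H1 : 1 <= H by apply: harm_ge1; rewrite expn_gt0.
have HK : H <= 2 * K2 * yq.
 have := hK1 (2 ^ I)%N ltac:(by rewrite expn_gt0); rewrite -/H /K2; nra.
have IR1 : 1 <= I by apply: (@leqINR 1).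
have IK : I <= 8 * (1 + 8 / d) * yq.
 have e : ln (INR (2 ^ I)) = I * ln 2.
  elim: (I) => [|i IH]; first by rewrite expn0 INR1 ln_1 -[INR 0]/0; ring.
  rewrite expnS INRM INR2 ln_mult ?IH ?S_INR; [ring | lra | by apply: INR_gt0; rewrite expn_gt0].
 have := @ln_le_Rpower (INR (2 ^ I)) (d / 4) d4 ltac:(lra); rewrite e.
 have l2 := ln_lt_2.
 have -> : Rpower (INR (2 ^ I)) (d / 4) / (d / 4) = Rpower (INR (2 ^ I)) (d / 4) * (4 / d) by field; lra.
 have d40 : 0 < 4 / d by apply: Rdiv_lt_0_compat; lra.
 have -> : 8 / d = 2 * (4 / d) by field; lra.
 move=> h; have : I / 2 <= 2 * yq * (4 / d) by nra.
 nra.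
have LK : H * H * H * I <= L1 * Yd.
 rewrite /L1 -y4.
 have c8 : 0 < 8 / d by apply: Rdiv_lt_0_compat; lra.
 have h2 : H * H <= (2 * K2 * yq) * (2 * K2 * yq) by apply: Rmult_le_compat; lra.
 have h3 : H * H * H <= (2 * K2 * yq) * (2 * K2 * yq) * (2 * K2 * yq) by apply: Rmult_le_compat; try lra; nra.
 apply: (Rle_trans _ ((2 * K2 * yq) * (2 * K2 * yq) * (2 * K2 * yq) * (8 * (1 + 8 / d) * yq))).
  by apply: Rmult_le_compat; try lra; nra.
 have -> : 2 * K2 * yq * (2 * K2 * yq) * (2 * K2 * yq) * (8 * (1 + 8 / d) * yq) = 64 * (K2 * K2 * K2) * (1 + 8 / d) * (yq * yq * yq * yq) by ring.
 apply: Rmult_le_compat_r; first by nra.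
 apply: Rmult_le_compat_r; first by lra.
 have : 0 < K2 * K2 * K2 by repeat apply: Rmult_lt_0_compat; lra.
 nra.
have HX : harm (2 * (J + D)) <= 8 * K2 * Xd.
 have := hK1 (2 * (J + D))%N ltac:(by rewrite muln_gt0 addn_gt0 J0); rewrite INRM INR2.
 have : Rpower (2 * INR (J + D)) (d / 4) <= 8 * Xd.
  apply: (Rle_trans _ (Rpower (8 * X) (d / 4))); first by apply: Rpower_monol; lra.
  rewrite -Rpower_mult_distr; try lra.
  apply: Rmult_le_compat; try (apply/Rlt_le/exp_pos).
   by case: (pw8 8); lra.
  rewrite /Xd; case: (Rle_lt_or_eq_dec _ _ X1) => [h|<-]; first by apply: Rle_Rpower; lra.
  by rewrite /Rpower ln_1 !Rmult_0_r; lra.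
 rewrite /K2; nra.
have c8 : 0 < 8 / d by apply: Rdiv_lt_0_compat; lra.
have L0 : 0 < L1.
 have : 0 < K2 * K2 * K2 * K2 by repeat apply: Rmult_lt_0_compat; lra.
 by move=> k4; apply: Rmult_lt_0_compat; lra.
apply: Rle_trans err _; rewrite eXY.
set L := H * H * H * I in LK.
have HHH : 1 <= H * H * H by have : 1 <= H * H by [nra]; nra.
have HL : H <= L.
 have : H * H * H <= L by rewrite /L; nra.
 have : H * 1 <= H * (H * H) by apply: Rmult_le_compat_l; nra.
 lra.
have q : Y * x4 >= Y by nra.
have t1 : D * (Y * harm (2 * (J + D))) <= 16 * K2 * (Y * x4 * (Xd * Yd)).
 apply: (Rle_trans _ (2 * x4 * (Y * (8 * K2 * Xd)))).
  apply: Rmult_le_compat; try lra; first by apply: Rmult_le_pos; [lra | exact: harm_ge0].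
  by apply: Rmult_le_compat_l; lra.
 have -> : 2 * x4 * (Y * (8 * K2 * Xd)) = 16 * K2 * (Y * x4 * (Xd * 1)) by ring.
 lmul.
 apply: Rmult_le_compat_l; first by nra.
 by apply: Rmult_le_compat_l; lra.
have t2 : sqrt (INR (J + D)) * INR (2 ^ I) / D <= 4 * (Y * x4).
 have s4 : sqrt (INR (J + D)) <= 2 * sqrt X.
  rewrite -(sqrt_square 2); last by lra.
  rewrite -sqrt_mult_alt; last by lra.
  by apply: sqrt_le_1_alt; lra.
 apply: (Rmult_le_reg_r D); first by lra.
 have -> : sqrt (INR (J + D)) * INR (2 ^ I) / D * D = sqrt (INR (J + D)) * INR (2 ^ I) by field; lra.
 apply: (Rle_trans _ (2 * (x4 * x4) * (2 * Y))).
  by apply: Rmult_le_compat; try lra; exact: sqrt_pos.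
 have : 0 <= Y * x4 * (D - x4) by apply: Rmult_le_pos; nra.
 nra.
have t3 : 52000 * (H * H * H) * (sqrt (INR (J + D)) * INR (2 ^ I) / D + I * INR (J + D) + 4 * INR (2 ^ I)) <=
  52000 * (L * (12 * (Y * x4) + 4 * X)).
 rewrite Rmult_assoc; lmul.
 rewrite {1}/L [X in _ <= X]Rmult_assoc; lmul.
 have : I * INR (J + D) <= I * (4 * X) by apply: Rmult_le_compat_l; lra.
 have : 1 * (12 * (Y * x4)) <= I * (12 * (Y * x4)) by apply: Rmult_le_compat_r; lra.
 lra.
have t4 : L * (12 * (Y * x4) + 4 * X) <= L1 * (12 * (Y * x4 * (Xd * Yd)) + 4 * (X * Yd)).
 apply: (Rle_trans _ (L1 * Yd * (12 * (Y * x4) + 4 * X))); first by apply: Rmult_le_compat_r; nra.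
 rewrite Rmult_assoc; lmul.
 have : 0 <= Y * x4 * Yd * (Xd - 1) by apply: Rmult_le_pos; [apply: Rmult_le_pos; nra | lra].
 nra.
have p1 : Y * x4 <= Y * x4 * (Xd * Yd).
 rewrite -{1}(Rmult_1_r (Y * x4)); apply: Rmult_le_compat_l; nra.
have p2 : X <= X * Yd by nra.
have t5 : INR (J + D) * H <= 4 * L1 * (X * Yd).
 apply: (Rle_trans _ (4 * X * (L1 * Yd))); last by lra.
 mon.
have t6 : Y * D <= 2 * (Y * x4) by nra.
have u0 : 0 < Y * x4 * (Xd * Yd) by lra.
have v0 : 0 < X * Yd by lra.
set u := Y * x4 * _ in t1 t4 p1 u0 *; set v := X * Yd in t4 p2 t5 v0 *.
have K2u : 0 <= K2 * v by nra.
have l1u : 0 <= L1 * u by nra.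
have l1v : 0 <= L1 * v by nra.
have K2uu : 0 <= K2 * u by nra.
lra.
Qed.

(** * Large [Y]: periodicity in [n] *)

Lemma brk_total n : odd n -> \sum_(0 <= a < n) brk a n = n * sqind n.
Proof.
move=> on; have := @brk_dft n 0 on; rewrite (eq_bigr (fun a => RtoC (brk a n))); last first.
 by move=> a _; rewrite muln0 /ez /Rdiv Rmult_0_l Rmult_0_r cis0 Cmult_1_r.
rewrite -RtoC_sum; have sn := sqrt_INR_gt0 (odd_gt0' on).
have -> : (eps4 n * (sqrt n) * (brk 0 n) = RtoC (sqrt n * brk 0 n))%C.
 by rewrite (Cmult_comm (eps4 n)) -Cmult_assoc brk0_eps // -RtoC_mult.
move/RtoC_inj => ->; rewrite /sqind -{2}(sqrt_sqrt n); last exact: pos_INR.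
by field; lra.
Qed.

Lemma periodic_sum F m U : (0 < m)%N -> (forall u, F (u + m)%N = F u) ->
 Rabs (\sum_(0 <= u < U) F u - U / m * \sum_(0 <= u < m) F u) <= 2 * \sum_(0 <= u < m) Rabs (F u).
Proof.
move=> m0 pF; have mR := INR_gt0 m0.
have pq q u : F (q * m + u)%N = F u.
 by elim: q => [|q IH] //; rewrite -addnA addnC pF.
have shift q r : \sum_(q * m <= u < q * m + r) F u = \sum_(0 <= u < r) F u.
 rewrite -{1}(add0n (q * m)%N) big_addn addKn; apply: eq_bigr => u _; by rewrite addnC.
have full q : \sum_(0 <= u < q * m) F u = q * \sum_(0 <= u < m) F u.
 elim: q => [|q IH]; first by rewrite big_geq // Rmult_0_l.
 rewrite mulSnr (big_nat_split F (leq0n _) (leq_addr _ _)) IH S_INR shift; ring.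
have r_lt : (U %% m <= m)%N by lia.
have e : \sum_(0 <= u < U) F u = INR (U %/ m) * \sum_(0 <= u < m) F u + \sum_(0 <= u < U %% m) F u.
 by rewrite {1}(divn_eq U m) (big_nat_split F (leq0n _) (leq_addr _ _)) full shift.
have eU : INR U = INR (U %/ m) * m + INR (U %% m) by rewrite -INRM -INRD -divn_eq.
rewrite e eU; set S := \sum_(0 <= u < m) F u; set A := \sum_(0 <= u < m) Rabs (F u).
have hS : Rabs S <= A by apply: Rabs_sum.
have hr : Rabs (\sum_(0 <= u < U %% m) F u) <= A.
 Rsum; rewrite /A (big_nat_split _ (leq0n _) r_lt).
 have : 0 <= \sum_(U %% m <= u < m) Rabs (F u) by apply: sumR_ge0 => u _ _; exact: Rabs_pos.
 lra.
have q1 : 0 <= INR (U %% m) / m <= 1.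
 split; first by pos.
 by apply: (Rmult_le_reg_r m) => //; rewrite Rmult_assoc Rinv_l ?Rmult_1_r ?Rmult_1_l; [exact: leqINR | lra].
have -> : (INR (U %/ m) * m + INR (U %% m)) / m * S = INR (U %/ m) * S + INR (U %% m) / m * S by field; lra.
have : Rabs (INR (U %% m) / m * S) <= A.
 by rewrite Rabs_mult Rabs_pos_eq; [have := Rabs_pos S; nra | lra].
move: hr => /Rabs_le_between hr /Rabs_le_between h; apply: Rabs_le; lra.
Qed.

Lemma class4_sum m c U : odd m ->
 Rabs (\sum_(0 <= u < U) brk (4 * u + c) m - U * sqind m) <= 2 * (m * harm m).
Proof.
move=> om; have m0 := odd_gt0' om; have mR := INR_gt0 m0.
have c4 : coprime 4 m by rewrite (@coprimeXl 2 2 m) // coprime2n.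
have p := @periodic_sum (fun u => brk (4 * u + c) m) m U m0.
have pF u : brk (4 * (u + m) + c) m = brk (4 * u + c) m.
 by apply: brk_modl; rewrite mulnDr addnAC -modnDmr modnMl addn0.
move: (p pF); rewrite (@sumR_affine m 4 c (fun a => brk a m) m0 c4); last by move=> a; apply: brk_modl; rewrite modn_mod.
rewrite brk_total // (_ : U / m * _ = U * sqind m); last by field; lra.
move=> h; apply: Rle_trans h _; lmul.
rewrite (@sumR_affine m 4 c (fun a => Rabs (brk a m)) m0 c4); last by move=> a; congr Rabs; apply: brk_modl; rewrite modn_mod.
apply: (Rle_trans _ _); first by apply: sumR_le => a _ _; apply: brk_le.
rewrite -(@sumR_affine m 1 1 _ m0 (coprime1n _)); last by move=> a; apply: brkabs_eqmod; rewrite modn_mod.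
apply: Rle_trans (brkabs_sum_le m m); rewrite big_add1; apply: Req_le.
by apply: eq_bigr => a _; rewrite mul1n addn1.
Qed.

Lemma sum_odd_recr f N :
 \sum_(1 <= n < N.+2 | odd n) f n = \sum_(1 <= n < N.+1 | odd n) f n + (if odd N.+1 then f N.+1 else 0).
Proof. by rewrite big_mkcond big_nat_recr // -big_mkcond. Qed.

Lemma odd_classes4 f N :
 \sum_(1 <= n < N.+1 | odd n) f n =
 \sum_(0 <= u < (N + 3) %/ 4) f (4 * u + 1)%N + \sum_(0 <= u < (N + 1) %/ 4) f (4 * u + 3)%N.
Proof.
elim: N => [|N IH]; first by rewrite !big_geq // Rplus_0_r.
rewrite sum_odd_recr IH.
have [q [e|[e|[e|e]]]] : exists q, (N = 4 * q \/ N = 4 * q + 1 \/ N = 4 * q + 2 \/ N = 4 * q + 3)%N.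
 by exists (N %/ 4); lia.
- have -> : ((N.+1 + 3) %/ 4 = q.+1) by lia.
 have -> : ((N + 3) %/ 4 = q) by lia.
 have -> : ((N.+1 + 1) %/ 4 = (N + 1) %/ 4) by lia.
 have -> : odd N.+1 by lia.
 by rewrite [X in _ = X + _]big_nat_recr //= e addn1; ring.
- have -> : ((N.+1 + 3) %/ 4 = (N + 3) %/ 4) by lia.
 have -> : ((N.+1 + 1) %/ 4 = (N + 1) %/ 4) by lia.
 by have -> : odd N.+1 = false by [rewrite e; clear; lia]; rewrite Rplus_0_r.
- have -> : ((N.+1 + 3) %/ 4 = (N + 3) %/ 4) by lia.
 have -> : ((N.+1 + 1) %/ 4 = q.+1) by lia.
 have -> : ((N + 1) %/ 4 = q) by lia.
 have -> : odd N.+1 by lia.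
 by rewrite [X in _ = _ + X]big_nat_recr //= e (_ : (4 * q + 2).+1 = 4 * q + 3)%N; [ring | clear; lia].
have -> : ((N.+1 + 3) %/ 4 = (N + 3) %/ 4) by lia.
have -> : ((N.+1 + 1) %/ 4 = (N + 1) %/ 4) by lia.
by have -> : odd N.+1 = false by [rewrite e; clear; lia]; rewrite Rplus_0_r.
Qed.

Lemma sqind_range q : odd q -> 0 <= sqind q <= 1.
Proof. by move=> oq; rewrite sqind_issq //; case: (issq q); lra. Qed.

(** By reciprocity [n] enters through [brk n m], which is periodic modulo [m], with a sign on the
    class 3 modulo 4 when [m] is itself 3 modulo 4. In that case [m] is not a square and the mean
    vanishes, so the sign is harmless. *)
Lemma row_sum m N : odd m ->
 Rabs (\sum_(1 <= n < N.+1 | odd n) brk m n - N / 2 * sqind m) <= 1 + 4 * (m * harm m).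
Proof.
move=> om; set U1 := ((N + 3) %/ 4); set U3 := ((N + 1) %/ 4).
have sq := sqind_range om.
have c1 := @class4_sum m 1 U1 om; have c3 := @class4_sum m 3 U3 om.
have U13 : Rabs (U1 + U3 - N / 2) <= 1.
 have : (2 * (U1 + U3) <= N + 2)%N by lia.
 have : (N <= 2 * (U1 + U3) + 2)%N by lia.
 move=> /leqINR; rewrite INRD INRM INRD INR2 => h1 /leqINR; rewrite INRM !INRD INR2 => h2.
 by apply: Rabs_le; lra.
pose e := if (m %% 4 == 3)%N then (-1) else 1.
have -> : \sum_(1 <= n < N.+1 | odd n) brk m n =
 \sum_(0 <= u < U1) brk (4 * u + 1) m + e * \sum_(0 <= u < U3) brk (4 * u + 3) m.
 rewrite odd_classes4 big_distrr; congr (_ + _); apply: eq_bigr => u _.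
  have o1 : odd (4 * u + 1) by lia.
  rewrite (brk_recip om o1) /rsgn (_ : ((4 * u + 1) %% 4 == 3)%N = false); last by lia.
  by rewrite andbF Rmult_1_l.
 have o3 : odd (4 * u + 3) by lia.
 rewrite (brk_recip om o3) /rsgn (_ : ((4 * u + 3) %% 4 == 3)%N = true); last by lia.
 by rewrite /e; case: (m %% 4 == 3)%N.
move: U13 c1 c3 => /Rabs_le_between U13.
rewrite /e; case h3: (m %% 4 == 3)%N => /Rabs_le_between c1 /Rabs_le_between c3; apply: Rabs_le; last by nra.
have z : sqind m = 0.
 rewrite sqind_issq //; case: issqP => // -[b eb]; move: om h3; rewrite eb oddX => ob.
 lia.
nra.
Qed.

Lemma sum_odd_reindex f J :
 \sum_(1 <= n < (2 * J).+1 | odd n) f n = \sum_(0 <= j < J) f (2 * j + 1)%N.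
Proof.
elim: J => [|J IH]; first by rewrite !big_geq.
rewrite mulnS !sum_odd_recr IH [RHS]big_nat_recr //= oddM /= addn1; ring.
Qed.

Lemma Tsum_periodic J N :
 Rabs (Tsum J N - N / 2 * SQ (2 * J)) <= J * (1 + 8 * (J * harm (2 * J))).
Proof.
rewrite Tsum_swap /SQ sum_odd_reindex big_distrr -sumRB; Rsum.
rewrite -{2}(subn0 J) -sumR_nat_const; apply: sumR_le => j; rewrite mem_index_iota => /andP [_ hj] _.
apply: Rle_trans (@row_sum (2 * j + 1) N ltac:(lia)) _.
have h1 : harm (2 * j + 1) <= harm (2 * J) by apply: harm_mono; lia.
have h2 : INR (2 * j + 1) <= 2 * INR J.
 by rewrite -INR2 -INRM; apply: leqINR; lia.
have := Rmult_le_compat _ _ _ _ (pos_INR _) (harm_ge0 _) h2 h1; lra.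
Qed.

(** A direct evaluation by periods, without any transform; it is sharp when [Y] is much larger than
    [X ^ 2]. *)
Lemma Treal_large X Y : 1 <= X -> 1 <= Y ->
 Rabs (Treal X Y - Y * sqrt X / 4) <= Y + 12 * (X * X * harm (2 * oddcount X)).
Proof.
move=> X1 Y1; have [f1 f2] := @floorn_spec Y ltac:(lra); have [Jx J0] := oddcount_spec X1.
rewrite /Treal; set J := oddcount X in Jx J0 *; set n := floorn Y in f1 f2 *.
have J1 : 1 <= J by apply: (@leqINR 1).
have t := Tsum_periodic J n; have s := SQ_approx (2 * J); rewrite INRM INR2 in s.
have h1 : 1 <= harm (2 * J) by apply: harm_ge1; rewrite muln_gt0.
set h := harm _ in t h1 *.
move: Jx => /Rabs_le_between Jx.
have sX1 : 1 <= sqrt X by rewrite -sqrt_1; apply: sqrt_le_1_alt.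
have sX2 : sqrt X * sqrt X = X by apply: sqrt_sqrt; lra.
set a := sqrt _ in s *; have a2 : a * a = 2 * J by apply: sqrt_sqrt; lra.
have a1 : 1 <= a by rewrite /a -sqrt_1; apply: sqrt_le_1_alt; lra.
have d : Rabs (a - sqrt X) <= 1 / 2.
 by apply: Rabs_le; nra.
have q1 : J * (1 + 8 * (J * h)) <= 9 * (X * X * h).
 have : J * J <= X * X by nra.
 nra.
have Xh : X <= X * X * h by nra.
move: t s d => /Rabs_le_between t /Rabs_le_between s /Rabs_le_between d.
have p1 : Rabs (n / 2 * SQ (2 * J) - n / 4 * a) <= Y / 2.
 have -> : n / 2 * SQ (2 * J) - n / 4 * a = n / 2 * (SQ (2 * J) - a / 2) by lra.
 rewrite Rabs_mult Rabs_pos_eq; last by lra.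
 have : Rabs (SQ (2 * J) - a / 2) <= 1 by apply: Rabs_le.
 nra.
have p2 : Rabs (n / 4 * a - Y * sqrt X / 4) <= Y / 2 + X.
 by apply: Rabs_le; nra.
move: p1 p2 => /Rabs_le_between p1 /Rabs_le_between p2; apply: Rabs_le; lra.
Qed.

Lemma lterm_homogeneous lam X Y l : 0 < lam -> lterm (lam * X) (lam * Y) l = lam * sqrt lam * lterm X Y l.
Proof.
move=> l0; rewrite /lterm; set q := l.+1 * l.+1; set A := 2 * PI * q.
have -> : RInt (rad WW (A * (lam * X))) 0 (lam * Y) = lam * sqrt lam * RInt (rad WW (A * X)) 0 Y; last by lra.
have := RInt_comp_lin _ lam 0 0 Y; rewrite Rmult_0_r !Rplus_0_r => <-; last by apply: rad_ex; exact: tame_WW.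
have -> : lam * sqrt lam * RInt (rad WW (A * X)) 0 Y = scal (lam * sqrt lam) (RInt (rad WW (A * X)) 0 Y) by [].
rewrite -RInt_scal; last by apply: rad_ex; exact: tame_WW.
apply: RInt_ext => y _; rewrite /scal /= /mult /= /rad Rplus_0_r sqrt_mult_alt; last by lra.
case: (Req_dec y 0) => [->|y0]; first by rewrite sqrt_0; ring.
have -> : A * (lam * X) / (lam * y) = A * X / y by field; lra.
lra.
Qed.

Lemma Mmain_homogeneous lam X Y : 0 < lam -> Mmain (lam * X) (lam * Y) = lam * sqrt lam * Mmain X Y.
Proof.
move=> l0; rewrite /Mmain /Mdual (Series_ext _ (fun l => lam * sqrt lam * lterm X Y l)); last by move=> l; apply: lterm_homogeneous.
by rewrite Series_scal_l sqrt_mult_alt; lra.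
Qed.

Lemma Rpower_mono_exp x a b : 1 <= x -> a <= b -> Rpower x a <= Rpower x b.
Proof.
move=> x1 ab; case: (Rle_lt_or_eq_dec _ _ x1) => [h|<-]; first by apply: Rle_Rpower.
by rewrite /Rpower ln_1 !Rmult_0_r; lra.
Qed.

Lemma harm_two K1 Z J : (forall N : nat, (0 < N)%N -> harm N <= K1 * Rpower N (1 / 4)) -> 0 < K1 ->
 1 <= Z -> (0 < J)%N -> Rabs (2 * J - Z) <= 1 -> harm (2 * J) <= 2 * K1 * Rpower Z (1 / 4).
Proof.
move=> hK K0 Z1 J0 /Rabs_le_between h; apply: Rle_trans (hK _ _) _; first by lia.
have JR := INR_gt0 J0; rewrite INRM INR2.
have r2 : Rpower 2 (1 / 4) <= 2.
 rewrite -{2}(Rpower_1 2); last by lra.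
 by apply: Rle_Rpower; lra.
have : Rpower (2 * J) (1 / 4) <= Rpower (2 * Z) (1 / 4) by apply: Rpower_monol; lra.
rewrite -(Rpower_mult_distr 2 Z); try lra.
have := exp_pos (1 / 4 * ln Z); rewrite -/(Rpower Z _) => p h4.
rewrite (Rmult_comm 2 K1) Rmult_assoc; apply: Rmult_le_compat_l; nra.
Qed.

(* For huge [Y] the logarithms of [Y] in the error are removed by homogeneity:
 the same estimate at [(lam X, lam Y)] with [lam = Y ^ (1/8)] is stronger. *)
Lemma Treal_huge : exists2 K, 0 < K & forall X Y : R, 1 <= X -> 1 <= Y -> X * X * X <= Y ->
 Rabs (Treal X Y - Mmain X Y) <= K * (Y * Rpower X (1 / 4)) /\ Rabs (Mmain X Y - Y * sqrt X / 4) <= K * (Y * Rpower X (1 / 4)).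
Proof.
have [K0 K00 hK0] := @Treal_weak (1 / 64) ltac:(lra).
have [K1 K10 hK1] := @harm_Rpower (1 / 4) ltac:(lra).
exists (2 * K0 + 2 + 48 * K1); first by lra.
move=> X Y X1 Y1 XY.
pose y e := Rpower Y e.
have yD a b : y a * y b = y (a + b) by rewrite /y Rpower_plus.
have y1 : y 1 = Y by rewrite /y Rpower_1 //; lra.
have yp a : 0 < y a by pos.
have ym a b : a <= b -> y a <= y b by move=> h; apply: Rpower_mono_exp.
have yge a : 0 <= a -> 1 <= y a by move=> h; apply: Rpower_ge1.
have yY a : a <= 1 -> y a <= Y by move=> h; rewrite -y1; apply: ym.
have Xy : X <= y (1 / 3).
 have y3 : y (1 / 3) * y (1 / 3) * y (1 / 3) = Y by rewrite !yD -[RHS]y1; congr y; field.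
 case: (Rle_lt_dec X (y (1 / 3))) => // h; have := yp (1 / 3) => p.
 have : y (1 / 3) * y (1 / 3) < X * X by nra.
 nra.
(* Scaling multiplies [Mmain] by [lam ^ (3/2) = Y ^ (3/16)], while the errors, measured against
   [Y * x4], grow by at most a constant times [Y ^ (139/768)], a smaller power. For [X ^ 3 <= Y] the
   estimate by periods is still good at the scaled point. *)
set lam := y (1 / 8); have lam1 : 1 <= lam by apply: yge; lra.
have sl : lam * sqrt lam = y (3 / 16).
 by rewrite -Rpower_sqrt; [rewrite /lam /y Rpower_mult -Rpower_plus; congr Rpower; field | lra].
set x4 := Rpower X _; have x41 : 1 <= x4 by apply: Rpower_ge1; lra.
have LX1 : 1 <= lam * X by nra.
have LY1 : 1 <= lam * Y by nra.
have LXy : lam * X <= y (11 / 24).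
 have -> : y (11 / 24) = y (1 / 8) * y (1 / 3) by rewrite yD; congr y; field.
 mon.
have w := hK0 _ _ LX1 LY1; rewrite Mmain_homogeneous in w; last by lra.
have g := Treal_large LX1 LY1; have gX := Treal_large X1 Y1.
have [Jx J0] := oddcount_spec X1; have [Jl Jl0] := oddcount_spec LX1.
have hX := harm_two hK1 K10 X1 J0 Jx; have hL := harm_two hK1 K10 LX1 Jl0 Jl.
have e1 : lam * Y * sqrt (lam * X) / 4 = y (3 / 16) * (Y * sqrt X / 4).
 by rewrite -sl sqrt_mult_alt; lra.
rewrite e1 in g; rewrite sl in w.
have b1 : Rpower (lam * X) (1 / 4) <= y (1 / 32) * x4.
 rewrite -Rpower_mult_distr; try lra.
 by rewrite /y Rpower_mult -/x4 (_ : 1 / 8 * _ = 1 / 32); lra.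
have b2 : Rpower (lam * X * (lam * Y)) (1 / 64) <= y (19 / 768).
 have -> : y (19 / 768) = Rpower (y (19 / 12)) (1 / 64) by rewrite /y Rpower_mult; congr Rpower; field.
 apply: Rpower_monol; [nra | | lra].
 have -> : y (19 / 12) = y (11 / 24) * (lam * Y) by rewrite -{1}y1 /lam !yD; congr y; field.
 nra.
have b3 : Rpower (lam * Y) (1 / 64) <= y (9 / 512).
 have -> : y (9 / 512) = Rpower (y (9 / 8)) (1 / 64) by rewrite /y Rpower_mult; congr Rpower; field.
 by rewrite -{1}y1 yD (_ : 1 / 8 + 1 = 9 / 8); lra.
have c1 : lam * Y * Rpower (lam * X) (1 / 4) * Rpower (lam * X * (lam * Y)) (1 / 64) <= y (3 / 16) * (Y * x4).
 apply: (Rle_trans _ (lam * Y * (y (1 / 32) * x4) * y (19 / 768))).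
  mon.
 have -> : lam * Y * (y (1 / 32) * x4) * y (19 / 768) = (lam * y (1 / 32) * y (19 / 768)) * (Y * x4) by lra.
 rewrite !yD; apply: Rmult_le_compat_r; first by nra.
 by apply: ym; lra.
have c2 : lam * X * Rpower (lam * Y) (1 / 64) <= y (3 / 16) * (Y * x4).
 apply: (Rle_trans _ (y (11 / 24) * y (9 / 512))).
  mon.
 rewrite yD; apply: (Rle_trans _ Y); first by apply: yY; lra.
 have := yge (3 / 16) ltac:(lra); have : Y <= Y * x4 by nra.
 nra.
have c3 : lam * Y <= y (3 / 16) * Y by apply: Rmult_le_compat_r; [lra | apply: ym; lra].
have c4 : lam * X * (lam * X) * harm (2 * oddcount (lam * X)) <= 2 * K1 * (y (3 / 16) * Y).
 apply: (Rle_trans _ (y (11 / 24) * y (11 / 24) * (2 * K1 * y (11 / 96)))).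
  apply: Rmult_le_compat; [nra | exact: harm_ge0 | nra |].
  apply: Rle_trans hL _; lmul.
  have -> : y (11 / 96) = Rpower (y (11 / 24)) (1 / 4) by rewrite /y Rpower_mult; congr Rpower; field.
  by apply: Rpower_monol; lra.
 have -> : y (11 / 24) * y (11 / 24) * (2 * K1 * y (11 / 96)) = 2 * K1 * (y (11 / 24) * y (11 / 24) * y (11 / 96)) by lra.
 lmul.
 by rewrite !yD -{1}y1 yD; apply: ym; lra.
have c5 : X * X * harm (2 * oddcount X) <= 2 * K1 * Y.
 apply: (Rle_trans _ (y (1 / 3) * y (1 / 3) * (2 * K1 * y (1 / 12)))).
  apply: Rmult_le_compat; [nra | exact: harm_ge0 | nra |].
  apply: Rle_trans hX _; lmul.
  have -> : y (1 / 12) = Rpower (y (1 / 3)) (1 / 4) by rewrite /y Rpower_mult; congr Rpower; field.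
  by apply: Rpower_monol; lra.
 have -> : y (1 / 3) * y (1 / 3) * (2 * K1 * y (1 / 12)) = 2 * K1 * (y (1 / 3) * y (1 / 3) * y (1 / 12)) by lra.
 lmul.
 by rewrite !yD; apply: yY; lra.
have yx : Y <= Y * x4 by nra.
have q0 := yp (3 / 16); set q := y _ in w g c1 c2 c3 c4 q0.
have main : Rabs (q * (Mmain X Y - Y * sqrt X / 4)) <= q * ((2 * K0 + 1 + 24 * K1) * (Y * x4)).
 have W : Rabs (Treal (lam * X) (lam * Y) - q * Mmain X Y) <= K0 * (2 * (q * (Y * x4))) by nra.
 have qy : q * Y <= q * (Y * x4) by nra.
 have G : Rabs (Treal (lam * X) (lam * Y) - q * (Y * sqrt X / 4)) <= (1 + 24 * K1) * (q * (Y * x4)) by nra.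
 move: W G => /Rabs_le_between W /Rabs_le_between G; apply: Rabs_le; lra.
have main' : Rabs (Mmain X Y - Y * sqrt X / 4) <= (2 * K0 + 1 + 24 * K1) * (Y * x4).
 apply: (Rmult_le_reg_l q) => //; move: main; rewrite Rabs_mult (Rabs_pos_eq q); lra.
have K1y : K1 * Y <= K1 * (Y * x4) by nra.
split; last by nra.
move: main' gX => /Rabs_le_between a1 /Rabs_le_between a2; apply: Rabs_le; lra.
Qed.

(** For [X ^ 3 <= Y] this follows from [Treal_huge]; otherwise [X Y <= X ^ 4], so [(X Y) ^ (d / 4)]
    is at most [X ^ d]. *)
Lemma Treal_strong d : 0 < d <= 1 -> exists2 K, 0 < K & forall X Y : R, 1 <= X -> 1 <= Y ->
 Rabs (Treal X Y - Mmain X Y) <= K * (Y * Rpower X (1 / 4 + d) + X * Rpower Y d).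
Proof.
move=> d0; have [K0 K00 h0] := @Treal_weak (d / 4) ltac:(lra); have [K1 K10 h1] := Treal_huge.
exists (K0 + K1); first by lra.
move=> X Y X1 Y1.
have p1 : 0 < X * Rpower Y d by pos.
have p2 : 0 < Y * Rpower X (1 / 4 + d) by pos.
case: (Rle_lt_dec (X * X * X) Y) => hXY.
 apply: Rle_trans (proj1 (h1 X Y X1 Y1 hXY)) _.
 have : Y * Rpower X (1 / 4) <= Y * Rpower X (1 / 4 + d) by apply: Rmult_le_compat_l; [lra | apply: Rpower_mono_exp; lra].
 nra.
apply: Rle_trans (h0 X Y X1 Y1) _.
apply: (Rle_trans _ (K0 * (Y * Rpower X (1 / 4 + d) + X * Rpower Y d))); last by nra.
lmul.
apply: Rplus_le_compat.
 rewrite Rmult_assoc; lmul.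
 rewrite Rpower_plus; apply: Rmult_le_compat_l; first by pos.
 have -> : Rpower X d = Rpower (X * X * X * X) (d / 4).
  have -> : X * X * X * X = Rpower X 4.
   by rewrite (_ : 4 = INR 4) ?Rpower_pow; [ring | lra | rewrite /INR; ring].
  by rewrite Rpower_mult; congr Rpower; field.
 by apply: Rpower_monol; nra.
by apply: Rmult_le_compat_l; [lra | apply: Rpower_mono_exp; lra].
Qed.

(** * Moebius inversion *)

Lemma inv_sin2_dup x : sin x <> 0 ->
 / (sin x * sin x) = / 4 * (/ (sin (x / 2) * sin (x / 2)) + / (sin ((x + PI) / 2) * sin ((x + PI) / 2))).
Proof.
have e1 : sin ((x + PI) / 2) = cos (x / 2) by rewrite (_ : _ / 2 = PI / 2 + x / 2); [rewrite -cos_sin | field].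
have e2 : sin x = 2 * sin (x / 2) * cos (x / 2) by rewrite -sin_2a; congr sin; field.
rewrite e1 e2 => h.
have s0 : sin (x / 2) <> 0 by nra.
have c0 : cos (x / 2) <> 0 by nra.
have := sin2_cos2 _; rewrite /Rsqr => p.
have -> : / 4 * (/ (sin (x / 2) * sin (x / 2)) + / (cos (x / 2) * cos (x / 2))) =
 (sin (x / 2) * sin (x / 2) + cos (x / 2) * cos (x / 2)) / (4 * (sin (x / 2) * sin (x / 2)) * (cos (x / 2) * cos (x / 2))) by field.
by rewrite p; field.
Qed.

(** An elementary route to the sum of [1 / (2 j + 1) ^ 2]: the value 1 of [1 / sin ^ 2] at [PI / 2]
    is split repeatedly by the duplication formula [inv_sin2_dup]. *)
Lemma inv_sin2_sum k :
 1 = / INR (4 ^ k) * \sum_(0 <= j < 2 ^ k) / (sin ((PI / 2 + j * PI) / INR (2 ^ k)) * sin ((PI / 2 + j * PI) / INR (2 ^ k))).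
Proof.
have pi0 := PI_RGT_0.
elim: k => [|k IH].
 by rewrite big_nat1 Rmult_0_l Rplus_0_r !Rdiv_1_r sin_PI2 Rmult_1_r !Rinv_1 Rmult_1_r.
have p2 : 0 < INR (2 ^ k) by apply: INR_gt0; rewrite expn_gt0.
rewrite (expnS 2) mul2n -addnn (big_nat_split _ (leq0n _) (leq_addr _ _)).
rewrite -[X in _ + \big[_/_]_(X <= _ < _) _]add0n big_addn addnK -big_split {1}IH.
rewrite expnS INRM Rinv_mult (Rmult_comm (/ INR 4)) Rmult_assoc; congr (_ * _).
rewrite big_distrr; apply: eq_big_nat => j /andP [_ hj].
have hj' : j + 1 <= INR (2 ^ k) by rewrite -S_INR; apply: leqINR.
have j0 := pos_INR j.
set x := _ / INR _.
have -> : (PI / 2 + j * PI) / INR (2 ^ k + 2 ^ k) = x / 2 by rewrite /x INRD; field; lra.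
have -> : (PI / 2 + INR (j + 2 ^ k) * PI) / INR (2 ^ k + 2 ^ k) = (x + PI) / 2 by rewrite /x !INRD; field; lra.
rewrite (_ : INR 4 = 4); last by rewrite /INR; ring.
apply: inv_sin2_dup; apply: Rgt_not_eq; apply: sin_gt_0.
 by apply: Rdiv_lt_0_compat => //; nra.
apply: (Rmult_lt_reg_r (INR (2 ^ k))) => //; rewrite Rmult_assoc Rinv_l; nra.
Qed.

Lemma inv_sin2_approx x : 0 < x <= PI / 2 -> 0 <= / (sin x * sin x) - / (x * x) <= 6.
Proof.
move=> hx; have [h1 h2] := inv_sin_sub hx; have pi4 := PI_4.
have ix := Rinv_0_lt_compat _ (proj1 hx).
rewrite !Rinv_mult; have e : x * / x = 1 by apply: Rinv_r; lra.
nra.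
Qed.

Definition oddsq (J : nat) : R := \big[Rplus/0]_(0 <= j < J) / (INR (2 * j + 1) * INR (2 * j + 1)).

(** The angles are symmetric about [PI / 2], so the lower half is kept twice; there [1 / sin ^ 2] is
    replaced by [1 / x ^ 2] with an error of at most 6 per term. *)
Lemma oddsq_pow2 k : Rabs (oddsq (2 ^ k) - PI * PI / 8) <= 7 / INR (2 ^ k).
Proof.
have pi0 := PI_RGT_0; have pi4 := PI_4.
have p2 : 0 < INR (2 ^ k) by apply: INR_gt0; rewrite expn_gt0.
have e2 : INR (2 ^ k.+1) = 2 * INR (2 ^ k) by rewrite expnS INRM INR2.
have e4 : INR (4 ^ k.+1) = 4 * (INR (2 ^ k) * INR (2 ^ k)).
 by rewrite expnS INRM (_ : 4 ^ k = 2 ^ k * 2 ^ k)%N; [rewrite INRM /INR; ring | rewrite -expnMn].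
have := inv_sin2_sum k.+1.
rewrite {1}(expnS 2) mul2n -addnn (big_nat_split _ (leq0n _) (leq_addr _ _)).
set N := INR _ in p2 e2 e4 *.
pose f j := / (sin ((PI / 2 + j * PI) / (2 * N)) * sin ((PI / 2 + j * PI) / (2 * N))).
have -> : \sum_(2 ^ k <= j < 2 ^ k + 2 ^ k) / (sin ((PI / 2 + j * PI) / INR (2 ^ k.+1)) * sin ((PI / 2 + j * PI) / INR (2 ^ k.+1))) = \sum_(0 <= j < 2 ^ k) f j.
 rewrite big_nat_rev -{1}(add0n (2 ^ k)%N) big_addn addnK; apply: eq_big_nat => j /andP [_ hj].
 rewrite e2.
 have -> : INR (2 ^ k + (2 ^ k + 2 ^ k) - (j + 2 ^ k).+1) = 2 * N - j - 1.
  have : (2 ^ k + (2 ^ k + 2 ^ k) - (j + 2 ^ k).+1 + (j + 1) = 2 * 2 ^ k)%N by lia.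
  by move=> /(f_equal INR); rewrite INRD (INRD j) INRM INR2 INR1 -/N; lra.
 have -> : (PI / 2 + (2 * N - j - 1) * PI) / (2 * N) = PI - (PI / 2 + j * PI) / (2 * N) by field; lra.
 by rewrite sin_PI_x.
rewrite e2 e4.
set S := \sum_(0 <= j < 2 ^ k) f j.
move=> hS.
have hS' : S = 2 * (N * N).
 apply: (Rmult_eq_reg_l (2 * / (4 * (N * N)))); last by nra.
 rewrite -[LHS](_ : / (4 * (N * N)) * (S + S) = _); last by lra.
 by rewrite -hS; field; lra.
have b : Rabs (S - 16 * (N * N) / (PI * PI) * oddsq (2 ^ k)) <= N * 6.
 rewrite big_distrr /= -sumRB; Rsum.
 apply: (Rle_trans _ (\sum_(0 <= j < 2 ^ k) 6)); last by rewrite sumR_nat_const subn0 -/N; lra.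
 apply: sumR_le => j; rewrite mem_index_iota => /andP [_ hj] _.
 have hj' : j + 1 <= N by rewrite -S_INR; apply: leqINR.
 have j0 := pos_INR j.
 rewrite /f; set x := _ / _.
 have x0 : 0 < x by apply: Rdiv_lt_0_compat; nra.
 have x1 : x <= PI / 2 by apply: (Rmult_le_reg_r (2 * N)); [lra | rewrite /x /Rdiv Rmult_assoc Rinv_l; nra].
 have := @inv_sin2_approx x _.
 have -> : 16 * (N * N) / (PI * PI) * / (INR (2 * j + 1) * INR (2 * j + 1)) = / (x * x).
  by rewrite INRD INRM INR2 INR1 /x; field; nra.
 by move=> h; apply: Rabs_le; lra.
have -> : oddsq (2 ^ k) - PI * PI / 8 = - (PI * PI / (16 * (N * N))) * (S - 16 * (N * N) / (PI * PI) * oddsq (2 ^ k)).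
 by rewrite hS'; field; lra.
rewrite Rabs_mult Rabs_Ropp Rabs_pos_eq; last by pos.
apply: (Rle_trans _ (PI * PI / _ * (N * 6))); first by mon.
have -> : PI * PI / (16 * (N * N)) * (N * 6) = (6 * (PI * PI) / 16) / N by field; lra.
mon.
Qed.

Lemma oddsq_tail J m : (0 < J)%N -> 0 <= oddsq (J + m) - oddsq J <= / INR J.
Proof.
move=> J0; rewrite /oddsq (big_nat_split _ (leq0n J) (leq_addr m J)).
rewrite (_ : forall a b, a + b - a = b); last by move=> a b; ring.
split; first by apply: sumR_ge0 => j _ _; apply/Rlt_le/Rinv_0_lt_compat; have := @INR_gt0 (2 * j + 1) ltac:(lia); nra.
apply: (Rle_trans _ (\sum_(J <= l < J + m) (/ (l.+1 * l.+1)))).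
 apply: sumR_le => j _ _; have j0 := INR_S1 j.
 have : j.+1 <= INR (2 * j + 1) by apply: leqINR; lia.
 by move=> h; apply: Rinv_le_contravar; nra.
have := inv_sq_tele m J0; have : 0 < / INR (J + m) by apply/Rinv_0_lt_compat/INR_gt0; rewrite addn_gt0 J0.
lra.
Qed.

Lemma oddsq_limit J : (0 < J)%N -> Rabs (oddsq J - PI * PI / 8) <= / INR J.
Proof.
move=> J0; apply: le_epsilon => eps e0.
have [m [m1 m2]] := @nat_ceil (7 / eps) ltac:(by apply: Rdiv_le_0_compat; lra).
pose k := (J + m)%N; have k2 : (k <= 2 ^ k)%N by apply: ltnW; apply: ltn_expl.
have m0 : 0 < m by have : 0 < 7 / eps by [apply: Rdiv_lt_0_compat; lra]; lra.
have hk : m <= INR (2 ^ k) by apply: leqINR; apply: leq_trans k2; rewrite leq_addl.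
have p2 : 0 < INR (2 ^ k) by lra.
have := oddsq_pow2 k; have := @oddsq_tail J (2 ^ k - J) J0; rewrite subnKC; last by lia.
have : 7 / INR (2 ^ k) <= eps.
 apply: (Rmult_le_reg_r (INR (2 ^ k))) => //; rewrite Rmult_assoc Rinv_l; last by lra.
 have : 7 / eps * eps = 7 by field; lra.
 nra.
move=> h1 h2 /Rabs_le_between h3; apply: Rabs_le; lra.
Qed.

Lemma sum_mob_dvd e B : (0 < e <= B)%N ->
 \sum_(1 <= b < B.+1 | (b %| e)%N) mob b = if (e == 1)%N then 1 else 0.
Proof.
move=> /andP [e0 eB]; rewrite -(sum_mob e0) -big_filter; apply: perm_big; apply: uniq_perm.
- by rewrite filter_uniq // iota_uniq.
- exact: divisors_uniq.
move=> b; rewrite mem_filter mem_index_iota -dvdn_divisors; case: (boolP (b %| e)) => //= hb.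
by rewrite (dvdn_gt0 e0 hb) ltnS (leq_trans (dvdn_leq e0 hb) eB).
Qed.

(** Grouping by [e = b c] leaves a divisor sum of [mob] as the weight of [F e]; since [F] vanishes
    beyond [B], both ranges can be taken up to [B]. *)
Lemma mob_inversion F B : (0 < B)%N -> (forall e, (B < e)%N -> F e = 0) ->
 \sum_(1 <= b < B.+1 | odd b) (mob b * \sum_(1 <= c < B.+1 | odd c) F (b * c)%N) = F 1%N.
Proof.
move=> B0 F0; pose G e := if odd e then F e else 0.
have G0 e : (B < e)%N -> G e = 0 by move=> h; rewrite /G F0; case: (odd e).
transitivity (\sum_(1 <= b < B.+1) \sum_(1 <= e < B.+1 | (b %| e)) (mob b * G e)).
 rewrite big_mkcond; apply: eq_big_nat => b /andP [b0 bB].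
 rewrite -big_distrr /= (sumR_multiples G B b0).
 have -> : \big[Rplus/0]_(1 <= h < (B %/ b).+1) G (b * h)%N = \big[Rplus/0]_(1 <= h < B.+1) G (b * h)%N.
  rewrite [RHS](@big_cat_nat _ _ _ (B %/ b).+1) ?ltnS ?leq_div //= [X in _ = _ + X]big_nat_cond [X in _ = _ + X]big1 ?Rplus_0_r // => h /andP [/andP [hh _] _].
  by apply: G0; rewrite mulnC -ltn_divLR.
 case: ifP => ob; last first.
  by rewrite big1 ?Rmult_0_r // => h; rewrite /G oddM ob.
 congr (_ * _); rewrite big_mkcond; apply: eq_bigr => h _.
 by rewrite /G oddM ob.
rewrite (exchange_big_dep predT) //=.
transitivity (\sum_(1 <= e < B.+1) (G e * (if (e == 1)%N then 1 else 0))).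
 apply: eq_big_nat => e /andP [e0 eB]; rewrite -(@sum_mob_dvd e B) ?e0 //.
 by rewrite big_distrr /=; apply: eq_bigr => b _; ring.
rewrite big_ltn // big_nat_cond big1 ?Rplus_0_r ?Rmult_1_r // => e /andP [/andP [he _] _].
by rewrite gtn_eqF // Rmult_0_r.
Qed.

Lemma sum_odd_half f M :
 \sum_(1 <= m < M.+1 | odd m) f m = \sum_(0 <= j < (M.+1)./2) f (2 * j + 1)%N.
Proof.
have := odd_double_half M; case oM: (odd M) => /=; rewrite -mul2n; set h := (M./2) => e.
 rewrite -e sum_odd_recr sum_odd_reindex [odd _]/= oddM /=.
 have -> : ((2 * h)./2 = h) by lia.
 by rewrite [RHS]big_nat_recr //= addn1.
have -> : (uphalf M = h) by lia.
by rewrite -sum_odd_reindex -e.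
Qed.

(** Inversion applied to [1 / e ^ 2] cut at [B]: every inner sum is [/ (b * b)] times a partial sum
    of the inverse odd squares, close to [PI ^ 2 / 8]. The errors [4 / (b B)] add up to the harmonic
    factor. *)
Lemma mob_density B : (0 < B)%N ->
 Rabs (\sum_(1 <= b < B.+1 | odd b) (mob b / (b * b)) - 8 / PI ^ 2) <= 4 * harm B / INR B.
Proof.
move=> B0; have BR := INR_gt0 B0; have pi3 : 3 < PI by have := PI2_3_2; lra.
pose F (e : nat) := if (e <= B)%N then / (e * e) else 0.
have := @mob_inversion F B B0; rewrite {3}/F B0 Rmult_1_r Rinv_1 => hF.
have {hF} hF := hF ltac:(by move=> e he; rewrite /F leqNgt he).
set Z := \sum_(1 <= b < B.+1 | odd b) _.
have key : Rabs (1 - PI * PI / 8 * Z) <= 4 * harm B / INR B.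
 rewrite -hF big_distrr -sumRB; Rsum.
 rewrite (_ : 4 * harm B / B = harm B * (4 * / B)); last by lra.
 rewrite big_distrl /= big_mkcond.
 apply: sumR_le => b; rewrite mem_index_iota => /andP [b0 bB] _; have bR := INR_gt0 b0; have ib := Rinv_0_lt_compat _ bR; have iB := Rinv_0_lt_compat _ BR.
 case: ifP => ob; last by nra.
 have q0 : (0 < B %/ b)%N by lia.
 have -> : \sum_(1 <= c < B.+1 | odd c) F (b * c)%N = / (b * b) * oddsq ((B %/ b).+1)./2.
  rewrite /oddsq -(sum_odd_half (fun n => / (n * n))) big_distrr.
  rewrite (@big_cat_nat _ _ _ (B %/ b).+1) ?ltnS ?leq_div //= [X in _ + X]big_nat_cond [X in _ + X]big1 ?Rplus_0_r; last first.
   by move=> c /andP [/andP [hc _] _]; rewrite /F leqNgt mulnC -ltn_divLR // hc.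
  rewrite [LHS]big_nat_cond [RHS]big_nat_cond; apply: eq_bigr => c /andP [/andP [c0 hc] _].
  rewrite /F mulnC -leq_divRL // -ltnS hc INRM; have cR := INR_gt0 c0.
  by field; lra.
 set q := (_.+1)./2; have q1 : (0 < q)%N by lia.
 have lim := oddsq_limit q1.
 have -> : mob b * (/ (b * b) * oddsq q) - PI * PI * / 8 * (mob b * / (b * b)) = mob b * / (b * b) * (oddsq q - PI * PI / 8) by lra.
 have m1 := mob_le1 b.
 rewrite !Rabs_mult (Rabs_pos_eq (/ _)); last by pos.
 have hq : B <= 4 * (b * q).
  have h1 : (B < (B %/ b).+1 * b)%N by lia.
  have h2 : ((B %/ b).+1 <= 2 * q + 1)%N by lia.
  have : (B <= 4 * (b * q))%N by move: h1 h2 q1 b0; nia.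
  by move/leqINR; rewrite !INRM (_ : INR 4 = 4); last by rewrite /INR; ring.
 have ibb : / (b * b) = / b * / b by rewrite Rinv_mult.
 apply: (Rle_trans _ (1 * (/ b * / b) * / q)).
  mon.
 rewrite Rmult_1_l Rmult_assoc; lmul.
 rewrite -Rinv_mult -(Rinv_inv 4) -Rinv_mult; apply: Rinv_le_contravar; lra.
have -> : Z - 8 / PI ^ 2 = - (8 / (PI * PI)) * (1 - PI * PI / 8 * Z) by field; lra.
rewrite Rabs_mult Rabs_Ropp Rabs_pos_eq; last by pos.
apply: Rle_trans key; rewrite -{2}(Rmult_1_l (Rabs _)); apply: Rmult_le_compat_r; first exact: Rabs_pos.
apply: (Rmult_le_reg_r (PI * PI)); first by nra.
rewrite Rmult_assoc Rinv_l; nra.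
Qed.

(** * Recovering the sum of Jacobi symbols *)

Definition Snat (M N : nat) : R :=
 \big[Rplus/0]_(1 <= m < M.+1 | odd m) \big[Rplus/0]_(1 <= n < N.+1 | odd n) IZR (jacobi m n).

Lemma S_sum_Snat X Y : IZR (S_sum X Y) = Snat (floorn X) (floorn Y).
Proof.
rewrite (big_morph IZR plus_IZR (erefl _)); apply: eq_bigr => m _.
by rewrite (big_morph IZR plus_IZR (erefl _)).
Qed.

Lemma Snat_small M N d : (M < d)%N || (N < d)%N -> Snat (M %/ d) (N %/ d) = 0.
Proof.
case/orP => h; rewrite /Snat (divn_small h); first by rewrite big_geq.
by apply: big1 => m _; rewrite big_geq.
Qed.

Lemma odd_sq_multiples f M b : odd b ->
 \sum_(1 <= m < M.+1 | odd m && (b ^ 2 %| m)%N) f m = \sum_(1 <= m < (M %/ b ^ 2).+1 | odd m) f (b ^ 2 * m)%N.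
Proof.
move=> ob; have b20 : (0 < b ^ 2)%N by lia.
rewrite big_mkcondl (sumR_multiples _ M b20) [RHS]big_mkcond.
by apply: eq_bigr => m _; rewrite oddM oddX ob.
Qed.

(** The pairs divisible by [b ^ 2], once divided, fill the rectangle of sides [M / b ^ 2] and
    [N / b ^ 2], which is empty for [b ^ 2 > min (M, N)]. *)
Lemma Tsum_Snat M N B : (Nat.sqrt (minn M N) <= B)%N ->
 Tsum ((M.+1)./2) N = \sum_(1 <= b < B.+1 | odd b) (b * Snat (M %/ b ^ 2) (N %/ b ^ 2)).
Proof.
move=> hB; pose C := (maxn B N).
have ext : \sum_(1 <= b < B.+1 | odd b) (b * Snat (M %/ b ^ 2) (N %/ b ^ 2)) = \sum_(1 <= b < C.+1 | odd b) (b * Snat (M %/ b ^ 2) (N %/ b ^ 2)).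
 rewrite [RHS](@big_cat_nat _ _ _ B.+1) ?ltnS ?leq_maxl //= [X in _ = _ + X]big_nat_cond [X in _ = _ + X]big1 ?Rplus_0_r // => b /andP [/andP [hb _] _].
 have : ~~ (b ^ 2 <= minn M N)%N by rewrite sqrtn_geq -ltnNge; apply: leq_ltn_trans hB hb.
 by rewrite leq_min negb_and -!ltnNge => h; rewrite Snat_small // Rmult_0_r.
rewrite ext.
transitivity (\sum_(1 <= n < N.+1 | odd n) \sum_(1 <= m < M.+1 | odd m) \sum_(1 <= b < C.+1 | odd b)
  (if (b ^ 2 %| m) && (b ^ 2 %| n) then b * IZR (jacobi (m %/ b ^ 2) (n %/ b ^ 2)) else 0)).
 rewrite [LHS]big_nat_cond [RHS]big_nat_cond; apply: eq_bigr => n /andP [/andP [n0 nN] on].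
 rewrite -(sum_odd_half (fun m => brk m n)); apply: eq_bigr => m om.
 rewrite (@brk_wide m n C.+1) //; last by lia.
 rewrite [RHS]big_mkcond [LHS]big_mkcond; apply: eq_bigr => b _.
 case: (boolP (odd b)) => // eb; case: ifP => // /andP [_ hbn].
 have := dvdn_trans (dvdn_exp (isT : (0 < 2)%N) (dvdnn b)) hbn => hb.
 by move: on; rewrite -(divnK hb) oddM (negbTE eb) andbF.
rewrite exchange_big.
transitivity (\sum_(1 <= m < M.+1 | odd m) \sum_(1 <= b < C.+1 | odd b) \sum_(1 <= n < N.+1 | odd n)
  (if (b ^ 2 %| m) && (b ^ 2 %| n) then b * IZR (jacobi (m %/ b ^ 2) (n %/ b ^ 2)) else 0)).
 by apply: eq_bigr => m _; rewrite exchange_big.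
rewrite exchange_big; apply: eq_bigr => b ob.
have b20 : (0 < b ^ 2)%N by lia.
rewrite big_distrr.
transitivity (\sum_(1 <= m < M.+1 | odd m && (b ^ 2 %| m)) \sum_(1 <= n < N.+1 | odd n && (b ^ 2 %| n)) (b * IZR (jacobi (m %/ b ^ 2) (n %/ b ^ 2)))).
 rewrite [RHS]big_mkcondr; apply: eq_bigr => m _; case: ifP => hm /=; last by rewrite big1.
 by rewrite [RHS]big_mkcondr.
rewrite (odd_sq_multiples _ M ob).
apply: eq_bigr => m _.
rewrite (odd_sq_multiples _ N ob) big_distrr.
by apply: eq_bigr => n _; rewrite !mulKn.
Qed.

Lemma Snat_mobius M N : (0 < M)%N -> (0 < N)%N -> let B := Nat.sqrt (minn M N) in
 Snat M N = \sum_(1 <= b < B.+1 | odd b) (mob b * (b * Tsum ((M %/ b ^ 2).+1)./2 (N %/ b ^ 2))).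
Proof.
move=> M0 N0 B; have B0 : (0 < B)%N by rewrite /B -sqrtn_geq exp1n leq_min M0.
pose F e := INR e * Snat (M %/ e ^ 2) (N %/ e ^ 2).
have F0 e : (B < e)%N -> F e = 0.
 move=> hb; have : ~~ (e ^ 2 <= minn M N)%N by rewrite sqrtn_geq -ltnNge.
 by rewrite leq_min negb_and -!ltnNge => h; rewrite /F Snat_small // Rmult_0_r.
have := mob_inversion B0 F0; rewrite {2}/F Rmult_1_l !divn1 => <-.
apply: eq_bigr => b ob; congr (_ * _).
rewrite (@Tsum_Snat _ _ B); last first.
 rewrite -ltnS -(@ltn_exp2r _ _ 2) //; have /andP [_ hb] := sqrtn_spec (minn M N).
 apply: leq_ltn_trans hb; have /andP [hc _] := sqrtn_spec (minn (M %/ b ^ 2) (N %/ b ^ 2)).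
 apply: leq_trans hc _; by rewrite leq_min !geq_min !leq_div orbT.
rewrite big_distrr; apply: eq_bigr => c _.
by rewrite /F -!divnMA -!expnMn INRM Rmult_assoc.
Qed.

Lemma floorn_div X d : 0 <= X -> (0 < d)%N -> floorn (X / d) = (floorn X %/ d)%N.
Proof.
move=> X0 d0; have dR := INR_gt0 d0; have q0 : 0 <= X / d by pos.
have e n : (n <= floorn (X / d))%N = (n <= floorn X %/ d)%N.
 rewrite leq_divRL //; apply/idP/idP.
  move/(floorn_ge _ q0) => h; apply/(floorn_ge _ X0); rewrite INRM.
  by have := Rmult_le_compat_r d _ _ ltac:(lra) h; rewrite Rmult_assoc Rinv_l; lra.
 move/(floorn_ge _ X0); rewrite INRM => h; apply/(floorn_ge _ q0).
 by apply: (Rmult_le_reg_r d) => //; rewrite Rmult_assoc Rinv_l; lra.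
by apply/eqP; rewrite eqn_leq -e leqnn /= e.
Qed.

Lemma inv_sqrt3_sum_le B : \sum_(1 <= b < B.+1) (/ (b * sqrt b)) <= 3.
Proof.
case: B => [|B]; first by rewrite big_geq //; lra.
suff : \sum_(1 <= b < B.+2) (/ (b * sqrt b)) <= 3 - 2 / sqrt B.+1.
 by have := Rinv_0_lt_compat _ (sqrt_lt_R0 _ (INR_S1 B)); lra.
elim: B => [|B IH]; first by rewrite big_nat1 INR1 sqrt_1; lra.
rewrite big_nat_recr //=; have b0 := INR_S1 B; have e : INR B.+2 = B.+1 + 1 by pos.
set u := sqrt B.+1 in IH *; set v := sqrt B.+2 in IH *.
have u0 : 0 < u by pos.
have u2 : u * u = B.+1 by apply: sqrt_sqrt; lra.
have v2 : v * v = B.+2 by apply: sqrt_sqrt; lra.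
have uv : u <= v by mon.
suff : / (B.+2 * v) <= 2 / u - 2 / v by lra.
rewrite -v2 (_ : 2 / u - 2 / v = 2 * (v - u) / (u * v)); last by field; lra.
apply: (Rmult_le_reg_r (v * v * v * u)); first by pos.
have -> : / (v * v * v) * (v * v * v * u) = u by field; lra.
have -> : 2 * (v - u) / (u * v) * (v * v * v * u) = 2 * (v - u) * (v * v) by field; lra.
nra.
Qed.

Lemma Mmain_bound X Y : 0 <= X -> 0 <= Y -> Rabs (Mmain X Y) <= 2 * (X * sqrt Y + Y * sqrt X).
Proof.
move=> X0 Y0; rewrite /Mmain; have := Mdual_bound X0 Y0; have sX := sqrt_pos X; have sY := sqrt_pos Y.
move=> /Rabs_le_between h; apply: Rabs_le; nra.
Qed.

Lemma sqrtn_min_lower B a x : 1 <= x -> a <= x < a + 1 -> sqrt a < INR B + 1 -> (0 < B)%N -> sqrt x <= 4 * INR B.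
Proof.
move=> x1 ha hB B0; have B1 : 1 <= B by apply: (@leqINR 1).
have a0 : 0 <= a by lra.
have s0 := sqrt_pos a; have s2 := sqrt_sqrt _ a0.
rewrite -(sqrt_square (4 * B)); last by lra.
mon.
Qed.

(** At [(X / b ^ 2, Y / b ^ 2)] and with the weight [b], the main term scales like [1 / b ^ 2], the
    error [Y X ^ (1/4 + d)] at most like [b ^ (-3/2)], and [X Y ^ d] at most like [1 / b], whose sum
    over [b <= sqrt Y] is absorbed in [Y ^ (1/4)]. Truncating the density costs [Mmain] times
    [harm B / B], which is small enough because [B] is comparable with [sqrt (min (X, Y))]. *)
Lemma S_main eps : 0 < eps <= 1 -> exists2 K, 0 < K & forall X Y : R, 1 <= X -> 1 <= Y ->
 Rabs (IZR (S_sum X Y) - 8 / PI ^ 2 * Mmain X Y) <= K * (X * Rpower Y (1 / 4 + eps) + Y * Rpower X (1 / 4 + eps)).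
Proof.
move=> e0; have [K0 K00 hT] := @Treal_strong (1 / 8 * eps) ltac:(lra).
have [K1 K10 hH] := @harm_Rpower (1 / 8) ltac:(lra).
exists (3 * K0 + K0 * K1 + 96 * K1); first by nra.
move=> X Y X1 Y1; have [X0 Y0] : 0 <= X /\ 0 <= Y by lra.
have M0 := floorn_gt0 X1; have N0 := floorn_gt0 Y1.
rewrite S_sum_Snat; have hS := Snat_mobius M0 N0; cbv zeta in hS; set M := floorn X in M0 hS *; set N := floorn Y in N0 hS *.
set B := Nat.sqrt (minn M N) in hS.
have B0 : (0 < B)%N by rewrite /B -sqrtn_geq exp1n leq_min M0.
have BR : 1 <= B by apply: (@leqINR 1).
have [fx1 fx2] := floorn_spec X0; have [fy1 fy2] := floorn_spec Y0; rewrite -/M in fx1 fx2; rewrite -/N in fy1 fy2.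
have Bm : B <= sqrt (INR (minn M N)) < B + 1 by apply: sqrtn_real.
have BX : B <= sqrt X.
 by apply: Rle_trans (proj1 Bm) _; apply: sqrt_le_1_alt; apply: Rle_trans fx1; apply: leqINR; rewrite geq_minl.
have BY : B <= sqrt Y.
 by apply: Rle_trans (proj1 Bm) _; apply: sqrt_le_1_alt; apply: Rle_trans fy1; apply: leqINR; rewrite geq_minr.
have sX2 := sqrt_sqrt _ X0; have sY2 := sqrt_sqrt _ Y0.
have sX1 : 1 <= sqrt X by rewrite -sqrt_1; apply: sqrt_le_1_alt.
have sY1 : 1 <= sqrt Y by rewrite -sqrt_1; apply: sqrt_le_1_alt.
have hB : harm B <= K1 * Rpower B (1 / 8) by apply: hH.
have hBX : harm B <= K1 * Rpower X (1 / 4).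
 apply: Rle_trans hB _; lmul.
 apply: (Rle_trans _ (Rpower X (1 / 8))); last by apply: Rpower_mono_exp; lra.
 by apply: Rpower_monol; nra.
have hBY : harm B <= K1 * Rpower Y (1 / 8).
 apply: Rle_trans hB _; lmul.
 by apply: Rpower_monol; nra.
pose d := 1 / 8 * eps; pose Pe := Rpower X (1 / 4 + eps); pose Qe := Rpower Y (1 / 4 + eps).
have Pd : Rpower X (1 / 4 + d) <= Pe by apply: Rpower_mono_exp => //; rewrite /d; lra.
have P4 : Rpower X (1 / 4) <= Pe by apply: Rpower_mono_exp => //; lra.
have Q4 : Rpower Y (1 / 4) <= Qe by apply: Rpower_mono_exp => //; lra.
have Qd : Rpower Y (1 / 8) * Rpower Y d <= Qe.
 by rewrite -Rpower_plus; apply: Rpower_mono_exp => //; rewrite /d; lra.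
have Pe1 : 1 <= Pe by apply: Rpower_ge1; lra.
have Qe1 : 1 <= Qe by apply: Rpower_ge1; lra.
have step1 : Rabs (Snat M N - \big[Rplus/0]_(1 <= b < B.+1 | odd b) (mob b / (b * b)) * Mmain X Y) <=
  K0 * (3 * (Y * Pe) + K1 * (X * Qe)).
 rewrite hS big_distrl /= -sumRB; Rsum.
 apply: (Rle_trans _ (\sum_(1 <= b < B.+1) (K0 * (Y * Pe) * / (b * sqrt b) + K0 * (X * Rpower Y d) * / b))); last first.
  rewrite big_split /= -!big_distrr /= -/(harm B).
  have i3 := inv_sqrt3_sum_le B.
  have : K0 * (Y * Pe) * \sum_(1 <= b < B.+1) / (b * sqrt b) <= K0 * (Y * Pe) * 3 by apply: Rmult_le_compat_l => //; apply: Rmult_le_pos; [lra | nra].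
  have yd0 : 0 < Rpower Y d by apply: exp_pos.
  have : K0 * (X * Rpower Y d) * harm B <= K0 * (X * Rpower Y d) * (K1 * Rpower Y (1 / 8)) by apply: Rmult_le_compat_l => //; apply: Rmult_le_pos; nra.
  have : K0 * K1 * X * (Rpower Y (1 / 8) * Rpower Y d) <= K0 * K1 * X * Qe by apply: Rmult_le_compat_l => //; apply: Rmult_le_pos; nra.
  lra.
 rewrite big_mkcond /=; apply: sumR_le => b; rewrite mem_index_iota => /andP [b0 bB] _.
 have bR := INR_gt0 b0; have b1 : 1 <= b by apply: (@leqINR 1).
 have sb := sqrt_lt_R0 _ bR.
 have yd0 : 0 < Rpower Y d by apply: exp_pos.
 have ib := Rinv_0_lt_compat _ bR; have ibs : 0 < / (b * sqrt b) by apply: Rinv_0_lt_compat; nra.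
 have r0 : 0 <= K0 * (Y * Pe) * / (b * sqrt b) by apply: Rmult_le_pos; [apply: Rmult_le_pos; nra | lra].
 have r1 : 0 <= K0 * (X * Rpower Y d) * / b by apply: Rmult_le_pos; [apply: Rmult_le_pos; nra | lra].
 case: ifP => ob; last by lra.
 have b2 : INR (b ^ 2) = b * b by rewrite -mulnn INRM.
 have b20 : (0 < b ^ 2)%N by rewrite expn_gt0 b0.
 have bsq : b <= B by apply: leqINR.
 set lam := / (b * b); have lam0 : 0 < lam by apply: Rinv_0_lt_compat; nra.
 have eX : X / INR (b ^ 2) = lam * X by rewrite b2 /lam /Rdiv; ring.
 have eY : Y / INR (b ^ 2) = lam * Y by rewrite b2 /lam /Rdiv; ring.
 have x1 : 1 <= lam * X by rewrite -eX b2; apply: (Rmult_le_reg_r (b * b)); [nra | rewrite /Rdiv Rmult_assoc Rinv_l; nra].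
 have y1 : 1 <= lam * Y by rewrite -eY b2; apply: (Rmult_le_reg_r (b * b)); [nra | rewrite /Rdiv Rmult_assoc Rinv_l; nra].
 have eT : Tsum ((M %/ b ^ 2).+1)./2 (N %/ b ^ 2) = Treal (lam * X) (lam * Y).
  by rewrite /Treal /oddcount -eX -eY !floorn_div.
 rewrite eT; have t := hT (lam * X) (lam * Y) x1 y1; rewrite Mmain_homogeneous // in t.
 have sl : sqrt lam = / b by rewrite /lam sqrt_inv sqrt_square //; lra.
 rewrite sl in t; set T := Treal _ _ in t *.
 have -> : mob b * (b * T) - mob b / (b * b) * Mmain X Y = mob b * (b * (T - lam * / b * Mmain X Y)) by rewrite /lam; field; lra.
 rewrite !Rabs_mult (Rabs_pos_eq b); last by lra.
 have m1 := mob_le1 b.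
 apply: (Rle_trans _ (1 * (b * (K0 * (lam * Y * Rpower (lam * X) (1 / 4 + d) + lam * X * Rpower (lam * Y) d))))).
  apply: Rmult_le_compat => //; [exact: Rabs_pos | by apply: Rmult_le_pos; [lra | exact: Rabs_pos] |].
  by apply: Rmult_le_compat_l; [lra | exact: t].
 have w1 : Rpower (lam * X) (1 / 4 + d) <= / sqrt b * Pe.
  rewrite -Rpower_mult_distr; try lra.
  apply: Rmult_le_compat => //; try (by apply/Rlt_le/exp_pos).
  apply: (Rle_trans _ (Rpower lam (1 / 4))).
   rewrite Rpower_plus -{2}(Rmult_1_r (Rpower lam _)); apply: Rmult_le_compat_l; first by pos.
   rewrite (_ : 1 = Rpower 1 d); last by rewrite /Rpower ln_1 Rmult_0_r exp_0.
   apply: Rpower_monol => //; last by pos.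
   by rewrite -Rinv_1; apply: Rinv_le_contravar; nra.
  have -> : lam = Rpower (sqrt b) (-4).
   rewrite (Rpower_Ropp _ 4) (_ : 4 = INR 4) ?Rpower_pow //; last by rewrite /INR; ring.
   congr Rinv; rewrite -{1 2}(sqrt_sqrt b); lra.
  by rewrite Rpower_mult (_ : -4 * _ = - 1) ?Rpower_Ropp ?Rpower_1; lra.
 have w2 : Rpower (lam * Y) d <= Rpower Y d.
  apply: Rpower_monol; [nra | | rewrite /d; lra].
  rewrite -{2}(Rmult_1_l Y); apply: Rmult_le_compat_r => //.
  rewrite -Rinv_1; apply: Rinv_le_contravar; nra.
 apply: (Rle_trans _ (b * (K0 * (lam * Y * (/ sqrt b * Pe) + lam * X * Rpower Y d)))).
  rewrite Rmult_1_l; lmul.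
  mon.
 by apply: Req_le; rewrite /lam; field; lra.
have step2 : Rabs (\big[Rplus/0]_(1 <= b < B.+1 | odd b) (mob b / (b * b)) * Mmain X Y - 8 / PI ^ 2 * Mmain X Y) <= 96 * K1 * (X * Qe + Y * Pe).
 rewrite -Rmult_minus_distr_r Rabs_mult.
 have md := mob_density B0; have mb := Mmain_bound X0 Y0; have h0 := harm_ge0 B.
 apply: (Rle_trans _ (4 * harm B / B * (2 * (X * sqrt Y + Y * sqrt X)))); first by mon.
 have hY' : harm B <= K1 * Qe.
  apply: Rle_trans hBY _; lmul.
  by apply: Rpower_mono_exp; lra.
 have hX' : harm B <= K1 * Pe by nra.
 have q : (X * sqrt Y + Y * sqrt X) / B <= 12 * X \/ (X * sqrt Y + Y * sqrt X) / B <= 12 * Y.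
  case: (leqP M N) => hMN.
   right; have l := @sqrtn_min_lower B M X X1 _ ltac:(by move: (proj2 Bm); rewrite (minn_idPl hMN)) B0.
   have sxy : sqrt X <= 2 * sqrt Y.
    rewrite -(sqrt_square 2); last by lra.
    rewrite -sqrt_mult_alt; last by lra.
    by apply: sqrt_le_1_alt; have := leqINR hMN; lra.
   apply: (Rmult_le_reg_r B); first by lra.
   rewrite /Rdiv Rmult_assoc Rinv_l; last by lra.
   have : X * sqrt Y <= sqrt X * (2 * Y).
    have -> : X * sqrt Y = sqrt X * (sqrt X * sqrt Y) by nra.
    by apply: Rmult_le_compat_l; nra.
   nra.
  left; have l := @sqrtn_min_lower B N Y Y1 _ ltac:(by move: (proj2 Bm); rewrite (minn_idPr (ltnW hMN))) B0.
  have sxy : sqrt Y <= 2 * sqrt X.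
   rewrite -(sqrt_square 2); last by lra.
   rewrite -sqrt_mult_alt; last by lra.
   by apply: sqrt_le_1_alt; have := leqINR (ltnW hMN); lra.
  apply: (Rmult_le_reg_r B); first by lra.
  rewrite /Rdiv Rmult_assoc Rinv_l; last by lra.
  have : Y * sqrt X <= sqrt Y * (2 * X).
   have -> : Y * sqrt X = sqrt Y * (sqrt Y * sqrt X) by nra.
   by apply: Rmult_le_compat_l; nra.
  nra.
 nra.
have xq : 0 <= X * Qe by nra.
have z1 : 0 <= K0 * (X * Qe) by nra.
have z2 : 0 <= K0 * K1 * (Y * Pe) by pos.
move: step1 step2 => /Rabs_le_between a1 /Rabs_le_between a2; apply: Rabs_le; rewrite -/Pe -/Qe; lra.
Qed.

(** * Complex-valued improper integrals *)

Definition Cc (f : R -> C) : Prop :=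
 forall x, continuous (fun t => Re (f t)) x /\ continuous (fun t => Im (f t)) x.

(** Taken by components so that the theory of the real integral applies; [CInt_is] ties it to the
    complex integral. *)
Definition CInt (f : R -> C) (a b : R) : C :=
 (RInt (fun t => Re (f t)) a b, RInt (fun t => Im (f t)) a b).

Lemma Cc_real g : (forall x, continuous g x) -> Cc (fun t => RtoC (g t)).
Proof. by move=> h x; split; [exact: h | exact: continuous_const]. Qed.

Lemma Cc_const c : Cc (fun _ => c).
Proof. split; exact: continuous_const. Qed.

Lemma Cc_plus f g : Cc f -> Cc g -> Cc (fun t => f t + g t)%C.
Proof.
move=> hf hg x; have [f1 f2] := hf x; have [g1 g2] := hg x; split.
 exact: (continuous_plus _ _ x f1 g1).
exact: (continuous_plus _ _ x f2 g2).
Qed.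

Lemma Cc_mult f g : Cc f -> Cc g -> Cc (fun t => f t * g t)%C.
Proof.
move=> hf hg x; have [f1 f2] := hf x; have [g1 g2] := hg x; split.
 apply: (continuous_minus _ _).
  exact: (continuous_mult _ _ x f1 g1).
 exact: (continuous_mult _ _ x f2 g2).
apply: (continuous_plus _ _).
 exact: (continuous_mult _ _ x f1 g2).
exact: (continuous_mult _ _ x f2 g1).
Qed.

Lemma Cc_cis g : (forall x, continuous g x) -> Cc (fun t => cis (g t)).
Proof.
split; first by apply: (continuous_comp g cos) => //; exact: continuous_cos.
by apply: (continuous_comp g sin) => //; exact: continuous_sin.
Qed.

Lemma Cc_ext f g : (forall t, f t = g t) -> Cc f -> Cc g.
Proof.
move=> e h x; have [h1 h2] := h x.
by split; [apply: continuous_ext h1 | apply: continuous_ext h2] => t /=; rewrite e.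
Qed.

Lemma Cc_ex f a b : Cc f ->
 ex_RInt (fun t => Re (f t)) a b /\ ex_RInt (fun t => Im (f t)) a b.
Proof. by move=> h; split; RIc => z _; have [] := h z. Qed.

Lemma CInt_is f a b : Cc f -> is_RInt (V := C_R_NormedModule) f a b (CInt f a b).
Proof.
move=> h; have [h1 h2] := Cc_ex a b h.
by apply: is_RInt_fct_extend_pair; apply: RInt_correct.
Qed.

Lemma CInt_ext f g a b : (forall t, Rmin a b < t < Rmax a b -> f t = g t) -> CInt f a b = CInt g a b.
Proof. by move=> h; congr pair; apply: RInt_ext => t ht; rewrite h. Qed.

Lemma CInt_plus f g a b : Cc f -> Cc g -> CInt (fun t => f t + g t)%C a b = (CInt f a b + CInt g a b)%C.
Proof.
move=> hf hg; have [f1 f2] := Cc_ex a b hf; have [g1 g2] := Cc_ex a b hg; congr pair.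
 exact: (RInt_plus _ _ a b f1 g1).
exact: (RInt_plus _ _ a b f2 g2).
Qed.

Lemma CInt_scal c f a b : Cc f -> CInt (fun t => c * f t)%C a b = (c * CInt f a b)%C.
Proof.
move=> hf; have [f1 f2] := Cc_ex a b hf; congr pair.
 rewrite (RInt_minus _ _); first last.
 - exact: (ex_RInt_scal _).
 - exact: (ex_RInt_scal _).
 by rewrite (RInt_scal _) // (RInt_scal _).
rewrite (RInt_plus _ _); first last.
- exact: (ex_RInt_scal _).
- exact: (ex_RInt_scal _).
by rewrite (RInt_scal _) // (RInt_scal _).
Qed.

Lemma CInt_minus f g a b : Cc f -> Cc g -> CInt (fun t => f t - g t)%C a b = (CInt f a b - CInt g a b)%C.
Proof.
move=> hf hg; have hg' : Cc (fun t => RtoC (-1) * g t)%C by apply: Cc_mult => //; exact: Cc_const.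
have m1 z : (- z = RtoC (-1) * z)%C by case: z => u v; rewrite /Copp /Cmult /=; congr pair; ring.
by rewrite {2}/Cminus m1 -CInt_scal // -CInt_plus //; apply: CInt_ext => t _; rewrite /Cminus m1.
Qed.

Lemma CInt_Chasles f a b c : Cc f -> (CInt f a b + CInt f b c)%C = CInt f a c.
Proof.
move=> h; have [a1 a2] := Cc_ex a b h; have [b1 b2] := Cc_ex b c h.
by congr pair; [exact: (RInt_Chasles _ a b c a1 b1) | exact: (RInt_Chasles _ a b c a2 b2)].
Qed.

Lemma Cmod_le_abs z : Cmod z <= Rabs (Re z) + Rabs (Im z).
Proof.
case: z => x y /=; have -> : (x, y) = ((x, 0) + (0, y))%C by rewrite /Cplus /=; congr pair; ring.
Ctri; rewrite /Cmod /=.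
rewrite (_ : x * _ + 0 * _ = Rsqr x); last by rewrite /Rsqr; ring.
rewrite (_ : 0 * _ + y * _ = Rsqr y); last by rewrite /Rsqr; ring.
by rewrite !sqrt_Rsqr_abs; lra.
Qed.

(** The factor 2 comes from bounding real and imaginary parts separately. *)
Lemma CInt_bound f g a b I : Cc f -> a <= b ->
 (forall t, a <= t <= b -> Cmod (f t) <= g t) -> is_RInt g a b I -> Cmod (CInt f a b) <= 2 * I.
Proof.
move=> hf ab hg hI; have [f1 f2] := Cc_ex a b hf.
apply: Rle_trans (Cmod_le_abs _) _.
have : Rabs (RInt (fun t => Re (f t)) a b) <= I.
 apply: (norm_RInt_le (fun t => Re (f t)) g a b) => // [t ht|]; last exact: RInt_correct.
 exact: Rle_trans (Rabs_Re_le _) (hg t ht).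
have : Rabs (RInt (fun t => Im (f t)) a b) <= I.
 apply: (norm_RInt_le (fun t => Im (f t)) g a b) => // [t ht|]; last exact: RInt_correct.
 exact: Rle_trans (Rabs_Im_le _) (hg t ht).
by rewrite /=; lra.
Qed.

Lemma CInt_bound_const f M a b : Cc f -> a <= b ->
 (forall t, a <= t <= b -> Cmod (f t) <= M) -> Cmod (CInt f a b) <= 2 * (M * (b - a)).
Proof.
move=> hf ab hM; apply: (@CInt_bound f (fun _ => M)) => //.
by have := is_RInt_const a b M; rewrite Rmult_comm.
Qed.

Lemma is_RInt_primitive P dP a b : a <= b ->
 (forall x, a <= x <= b -> is_derive P x (dP x)) -> (forall x, a <= x <= b -> continuous dP x) ->
 is_RInt dP a b (P b - P a).
Proof.
move=> ab h1 h2.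
by apply: is_RInt_derive => x; rewrite Rmin_left // Rmax_right // => hx; auto.
Qed.

(** The improper integral over the line, with independent ends as in [is_RInt_gen] ([CIR_gen]); the
    threshold is a natural number so that the truncations form a sequence. *)
Definition CIR (f : R -> C) (l : C) : Prop :=
 forall eps, 0 < eps -> exists n : nat, forall a b, a <= - INR n -> INR n <= b -> Cmod (CInt f a b - l) <= eps.

Lemma CIR_unique f l l' : CIR f l -> CIR f l' -> l = l'.
Proof.
move=> h h'; have : Cmod (l - l') <= 0.
 apply: le_epsilon => eps e0.
 have [n hn] := h (eps / 2) ltac:(lra); have [m hm] := h' (eps / 2) ltac:(lra).
 have nR := pos_INR n; have mR := pos_INR m.
 have := hn (- n - m) (n + m) ltac:(lra) ltac:(lra).
 have := hm (- n - m) (n + m) ltac:(lra) ltac:(lra).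
 set z := CInt _ _ _ => h1 h2.
 have -> : (l - l' = (z - l') - (z - l))%C by ring.
 Ctri; rewrite Cmod_opp; lra.
move=> h0; have : Cmod (l - l') = 0 by have := Cmod_ge_0 (l - l'); lra.
by move/Cmod_eq_0 => e; have -> : l = (l' + (l - l'))%C by [ring]; rewrite e; ring.
Qed.

Lemma CIR_ext f g l : (forall t, f t = g t) -> CIR f l -> CIR g l.
Proof.
move=> e h eps e0; have [n hn] := h eps e0; exists n => a b ha hb.
by rewrite -(CInt_ext (f := f)) // => *; apply: hn.
Qed.

Lemma CIR_scal c f l : Cc f -> CIR f l -> CIR (fun t => c * f t)%C (c * l)%C.
Proof.
move=> cf h eps e0; have c0 := Cmod_ge_0 c.
have [n hn] := h (eps / (Cmod c + 1)) ltac:(by apply: Rdiv_lt_0_compat; lra).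
exists n => a b ha hb; rewrite CInt_scal //.
have -> : (c * CInt f a b - c * l = c * (CInt f a b - l))%C by ring.
rewrite Cmod_mult; have := hn a b ha hb; have := Cmod_ge_0 (CInt f a b - l) => h0 h1.
apply: (Rle_trans _ ((Cmod c + 1) * (eps / (Cmod c + 1)))); first by nra.
by apply: Req_le; field; lra.
Qed.

Lemma CIR_gen f l : Cc f -> CIR f l ->
 is_RInt_gen (V := C_R_NormedModule) f (Rbar_locally m_infty) (Rbar_locally p_infty) l.
Proof.
move=> cf h P [eps hP].
have [n hn] := h (eps / 2) ltac:(have := cond_pos eps; lra).
exists (fun a => a < - n) (fun b => n < b); [by exists (- n) | by exists n |].
move=> a b ha hb; exists (CInt f a b); split; first exact: CInt_is.
apply: hP; have := hn a b ltac:(lra) ltac:(lra) => hc.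
have e0 := cond_pos eps.
split.
 by apply: (Rle_lt_trans _ _); [exact: (Rabs_Re_le (CInt f a b - l)%C) | lra].
by apply: (Rle_lt_trans _ _); [exact: (Rabs_Im_le (CInt f a b - l)%C) | lra].
Qed.

(** One-sided, since such sequences occur as upper bounds of errors. *)
Definition vanish (tau : nat -> R) : Prop :=
 forall eps, 0 < eps -> exists N : nat, forall n, (N <= n)%N -> tau n <= eps.

Lemma C_seq_limit y tau N0 : vanish tau ->
 (forall n m, (N0 <= n)%N -> (n <= m)%N -> Cmod (y m - y n) <= tau n) ->
 exists l, forall n, (N0 <= n)%N -> Cmod (y n - l) <= tau n.
Proof.
move=> small tightn.
have cauchy (p : C -> R) : (forall z, Rabs (p z) <= Cmod z) -> (forall z z', p (z - z')%C = p z - p z') -> ex_finite_lim_seq (fun n => p (y n)).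
 move=> pl pm; apply/ex_lim_seq_cauchy_corr => eps.
 have [N hN] := small (eps / 4) ltac:(have := cond_pos eps; lra).
 exists (N + N0)%N => n m /leP hn /leP hm'; have e0 := cond_pos eps; rewrite -pm.
 apply: Rle_lt_trans (pl _) _; pose M := (N + N0)%N.
 have -> : (y n - y m = (y n - y M) - (y m - y M))%C by ring.
 apply: Rle_lt_trans (Cmod_triangle _ _) _; rewrite Cmod_opp.
 have := tightn M n (leq_addl _ _) hn; have := tightn M m (leq_addl _ _) hm'; have := hN M (leq_addr _ _); lra.
have [lr hr] := cauchy Re Rabs_Re_le ltac:(by []).
have [li hi] := cauchy Im Rabs_Im_le ltac:(by []).
exists (lr, li) => n hn; apply: le_epsilon => eps e0.
have [N1 h1] := (proj2 (is_lim_seq_spec _ _)) hr (mkposreal (eps / 2) ltac:(lra)).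
have [N2 h2] := (proj2 (is_lim_seq_spec _ _)) hi (mkposreal (eps / 2) ltac:(lra)).
pose m := (n + (N1 + N2))%N.
have := h1 m ltac:(rewrite /m; lia); have := h2 m ltac:(rewrite /m; lia) => /= a2 a1.
have a3 := @tightn n m hn ltac:(by rewrite /m leq_addr).
have a4 : Cmod (y m - (lr, li)) <= Rabs (Re (y m) - lr) + Rabs (Im (y m) - li) := Cmod_le_abs _.
have -> : (y n - (lr, li) = (y m - (lr, li)) - (y m - y n))%C by ring.
Ctri; rewrite Cmod_opp; lra.
Qed.

Lemma CIR_tails f tau N0 : Cc f -> vanish tau ->
 (forall n b, (N0 <= n)%N -> n <= b -> Cmod (CInt f n b) <= tau n) ->
 (forall n a, (N0 <= n)%N -> a <= - n -> Cmod (CInt f a (- n)) <= tau n) ->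
 exists2 l, CIR f l & forall n a b, (N0 <= n)%N -> a <= - n -> n <= b -> Cmod (CInt f a b - l) <= 4 * tau n.
Proof.
move=> cf small hp hm.
have tight n a b : (N0 <= n)%N -> a <= - n -> n <= b -> Cmod (CInt f a b - CInt f (- n) n) <= 2 * tau n.
 move=> hn ha hb; rewrite -(CInt_Chasles a (- n) b cf) -(CInt_Chasles (- n) n b cf).
 have -> : (CInt f a (- n) + (CInt f (- n) n + CInt f n b) - CInt f (- n) n = CInt f a (- n) + CInt f n b)%C by ring.
 by Ctri; have := hp n b hn hb; have := hm n a hn ha; lra.
have small2 : vanish (fun n => 2 * tau n).
 move=> eps e0; have [N hN] := small (eps / 2) ltac:(lra).
 by exists N => n hn; have := hN n hn; lra.
have [l lim] := @C_seq_limit _ _ N0 small2 ltac:(by move=> n m hn nm; have := leqINR nm => hh; apply: tight => //; lra).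
have main n a b : (N0 <= n)%N -> a <= - n -> n <= b -> Cmod (CInt f a b - l) <= 4 * tau n.
 move=> hn ha hb; set y := CInt f (- n) n.
 have -> : (CInt f a b - l = (CInt f a b - y) + (y - l))%C by ring.
 by Ctri; have := tight n a b hn ha hb; have := lim n hn; rewrite -/y; lra.
exists l => // eps e0; have [N hN] := small (eps / 4) ltac:(lra).
exists (N + N0)%N => a b ha hb; have := main _ a b (leq_addl N N0) ha hb; have := hN _ (leq_addr N0 N); lra.
Qed.

Lemma CIR_bound f l M : CIR f l ->
 (forall n : nat, Cmod (CInt f (- n) n) <= M) -> Cmod l <= M.
Proof.
move=> h hM; apply: le_epsilon => eps e0; have [n hn] := h eps e0.
have := hn (- n) n ltac:(lra) ltac:(lra); have := hM n; set z := CInt _ _ _ => h1 h2.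
have -> : l = (z - (z - l))%C by ring.
by Ctri; rewrite Cmod_opp; lra.
Qed.

(** * Integrals with a parameter, exchange of integrals, Green's formula *)

Lemma slice1 (f : R -> R -> R) x y : continuity_2d_pt f x y -> continuous (fun z => f z y) x.
Proof.
move=> cf; apply/filterlim_locally => eps; have [d hd] := cf eps; exists d => z hz.
by apply: hd => //; rewrite Rminus_diag_eq // Rabs_R0; exact: cond_pos.
Qed.

Lemma slice2 (f : R -> R -> R) x y : continuity_2d_pt f x y -> continuous (fun z => f x z) y.
Proof.
move=> cf; apply/filterlim_locally => eps; have [d hd] := cf eps; exists d => z hz.
by apply: hd => //; rewrite Rminus_diag_eq // Rabs_R0; exact: cond_pos.
Qed.

Lemma swap_2d (f : R -> R -> R) x y : continuity_2d_pt f y x -> continuity_2d_pt (fun u v => f v u) x y.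
Proof. by move=> cf eps; have [d hd] := cf eps; exists d => u v hu hv; exact: hd. Qed.

Lemma RInt_param_continuous (f : R -> R -> R) a b t : a <= b -> (forall x y, continuity_2d_pt f x y) ->
 continuous (fun s => RInt (fun x => f x s) a b) t.
Proof.
move=> ab cf; apply/filterlim_locally => eps.
have e0 : 0 < eps / (b - a + 1) by apply: Rdiv_lt_0_compat; [exact: cond_pos | lra].
have [d hd] := @uniform_continuity_2d_1d f a b t (fun x _ => cf x t) (mkposreal _ e0).
have exf s : ex_RInt (fun x => f x s) a b.
 by RIc => z _; apply: slice1.
exists d => s; rewrite /ball /= /AbsRing_ball /minus /plus /opp /= => hs.
have -> : RInt (fun x => f x s) a b + - RInt (fun x => f x t) a b = RInt (fun x => minus (f x s) (f x t)) a b by rewrite RInt_minus.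
apply: (Rle_lt_trans _ _).
 apply: abs_RInt_le_const => //; first exact: ex_RInt_minus.
 move=> x hx; apply: Rlt_le; have d0 := cond_pos d; move: hs => /Rabs_lt_between hs.
 by apply: (hd x t x s) => //; try lra; rewrite Rminus_diag_eq // Rabs_R0.
have -> : (b - a) * (eps / (b - a + 1)) = eps - eps / (b - a + 1) by field; lra.
lra.
Qed.

(** As functions of the upper limit [d] both sides vanish at [c] and have the same derivative. *)
Lemma fubini (f : R -> R -> R) a b c d : a <= b -> (forall x y, continuity_2d_pt f x y) ->
 RInt (fun x => RInt (fun t => f x t) c d) a b = RInt (fun t => RInt (fun x => f x t) a b) c d.
Proof.
move=> ab cf.
have c1 x t : continuous (fun s => f x s) t by apply: slice2.
have dI x u : is_derive (fun u => RInt (f x) c u) u (f x u).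
 apply: (is_derive_RInt (f x) _ c); last exact: c1.
 by apply: filter_forall => y; apply: RInt_correct; RIc => z _.
have cJ t : continuous (fun s => RInt (fun x => f x s) a b) t by apply: RInt_param_continuous.
pose g u := RInt (fun x => RInt (f x) c u) a b - RInt (fun t => RInt (fun x => f x t) a b) c u.
have dg u : is_derive g u 0.
 have -> : 0 = minus (RInt (fun x => f x u) a b) (RInt (fun x => f x u) a b) by rewrite minus_eq_zero.
 apply: is_derive_minus; last first.
  apply: (is_derive_RInt (fun t => RInt _ a b) _ c); last exact: cJ.
  by apply: filter_forall => y; apply: RInt_correct; RIc => z _.
 have -> : RInt (fun x => f x u) a b = RInt (fun x => Derive (fun z => RInt (f x) c z) u) a b.
  by apply: RInt_ext => x _; symmetry; apply: is_derive_unique.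
 apply: (is_derive_RInt_param _).
 - by apply: filter_forall => y x _; exists (f x y).
 - move=> x _; apply: (continuity_2d_pt_ext (fun u v => f v u)).
   by move=> y z; symmetry; apply: is_derive_unique.
  by apply: swap_2d.
 apply: filter_forall => y; RIc => z _.
 case: (Rle_dec c y) => cy.
  by apply: (@RInt_param_continuous _ c y z cy) => p q; apply: swap_2d.
 apply: (continuous_ext (fun x => opp (RInt (f x) y c))).
  by move=> x; rewrite opp_RInt_swap //; RIc => w _.
 apply: (continuous_opp _).
 by apply: (@RInt_param_continuous _ y c z ltac:(lra)) => p q; apply: swap_2d.
have := MVT_gen g c d _ (fun x _ => dg x).
case=> [x _|x [_]].
 by apply/continuity_pt_filterlim; apply: ex_derive_continuous; exists 0.
rewrite /g !RInt_point Rmult_0_l.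
rewrite (RInt_ext (fun y => RInt (f y) c c) (fun _ => 0)); last by move=> y _; rewrite RInt_point.
have -> : RInt (fun _ : R => 0) a b = 0 by rewrite RInt_const /scal /= /mult /= Rmult_0_r.
by rewrite !Rminus_0_r => h; apply: Rminus_diag_uniq.
Qed.

(** Cauchy's theorem on a rectangle in real form: for the parts of a holomorphic function, the
    Cauchy-Riemann equations provide the common derivative [g]. It serves to move lines of
    integration. *)
Lemma green (f1 f2 g : R -> R -> R) a b eta : a <= b -> (forall x y, continuity_2d_pt g x y) ->
 (forall x y, is_derive (fun z => f1 z y) x (g x y)) -> (forall x y, is_derive (fun z => f2 x z) y (g x y)) ->
 RInt (fun y => f1 eta y - f1 0 y) a b = RInt (fun x => f2 x b - f2 x a) 0 eta.
Proof.
move=> ab cg d1 d2.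
have c1 y x : continuous (fun z => g z y) x by apply: slice1.
have c2 x y : continuous (fun z => g x z) y by apply: slice2.
rewrite (RInt_ext _ (fun y => RInt (fun x => g x y) 0 eta)); last first.
 move=> y _; symmetry; apply: is_RInt_unique.
 by apply: (is_RInt_derive (fun x => f1 x y)) => x _.
rewrite (fubini (f := fun y x => g x y)) //; last first.
 by move=> x y; apply: swap_2d.
apply: RInt_ext => x _; apply: is_RInt_unique.
by apply: (is_RInt_derive _) => y _.
Qed.

Lemma exp_le_mono x y : x <= y -> exp x <= exp y.
Proof. by case=> [h|->]; [apply/Rlt_le/exp_increasing | lra]. Qed.

Lemma vanish_exp K : vanish (fun n => K * exp (- n / 4)).
Proof.
move=> eps e0; have [N [N1 _]] := @nat_ceil (4 * Rabs K / eps) ltac:(by apply: Rdiv_le_0_compat; have := Rabs_pos K; lra).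
exists N => n /leqINR hn.
have q0 : 0 <= 4 * Rabs K / eps by pos.
apply: (Rle_trans _ _).
 by apply: Rmult_le_compat_r; [apply/Rlt_le/exp_pos | exact: Rle_abs].
rewrite (_ : - n / 4 = - (n / 4)) ?exp_Ropp; last by lra.
have x1 := exp_ineq1_le (n / 4).
apply: (Rmult_le_reg_r (exp (n / 4))); first exact: exp_pos.
rewrite Rmult_assoc Rinv_l; last by lra.
have e1 : 4 * Rabs K / eps * eps = 4 * Rabs K by field; lra.
nra.
Qed.

Lemma le_vanish x y tau : vanish tau -> (forall n, x <= y + tau n) -> x <= y.
Proof.
by move=> v h; apply: le_epsilon => e e0; have [N hN] := v e e0; have := h N; have := hN N (leqnn N); lra.
Qed.

(** * The Fourier transform of the kernel [lor] *)

Definition lor (t : R) : R := / (9 / 16 + t * t).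

Lemma lor_den t : 0 < 9 / 16 + t * t.
Proof. nra. Qed.

Lemma lor_bounds t : 0 < lor t <= 16 / 9.
Proof.
have h := lor_den t; split; first exact: Rinv_0_lt_compat.
by rewrite (_ : 16 / 9 = / (9 / 16)); mon.
Qed.

Lemma lor_continuous t : continuous lor t.
Proof. by apply: ex_derive_continuous; rewrite /lor; auto_derive; have := lor_den t; lra. Qed.

Lemma continuity_2d_of_continuous g (h : R -> R -> R) x y :
 (forall z, continuous g z) -> continuity_2d_pt h x y -> continuity_2d_pt (fun u v => g (h u v)) x y.
Proof. by move=> cg ch; apply: continuity_1d_2d_pt_comp => //; apply/continuity_pt_filterlim; exact: cg. Qed.

Ltac c2d := repeat first [ exact: continuity_2d_pt_const | exact: continuity_2d_pt_id1 | exact: continuity_2d_pt_id2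
 | apply: continuity_2d_pt_mult | apply: continuity_2d_pt_minus | apply: continuity_2d_pt_plus | apply: continuity_2d_pt_opp
 | apply: (@continuity_2d_of_continuous exp); [exact: continuous_exp|]
 | apply: (@continuity_2d_of_continuous cos); [exact: continuous_cos|]
 | apply: (@continuity_2d_of_continuous sin); [exact: continuous_sin|] ].

Section Kernel.
Variable T : R.
Hypothesis T1 : 1 <= T.

(** The truncated transform. Below, [w] is [g' + 3/4 g], which tends to 0 for [y > 0] as [T] grows;
    so [g] approaches a multiple of [exp (- 3/4 y)]. *)
Let g (y : R) : R := RInt (fun t => lor t * cos (t * y)) (- T) T.
Let w (y : R) : R := RInt (fun t => lor t * (3 / 4 * cos (t * y) - t * sin (t * y))) (- T) T.

Lemma RInt_param_derive (f df : R -> R -> R) y :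
 (forall y t, is_derive (fun z => f z t) y (df y t)) -> (forall y t, continuity_2d_pt df y t) ->
 (forall y t, continuous (f y) t) ->
 is_derive (fun z => RInt (f z) (- T) T) y (RInt (df y) (- T) T).
Proof.
move=> d1 c1 c2.
rewrite (RInt_ext _ (fun t => Derive (fun z => f z t) y)); last by move=> t _; symmetry; apply: is_derive_unique.
apply: is_derive_RInt_param.
- by apply: filter_forall => z t _; exists (df z t).
- move=> t _; apply: (continuity_2d_pt_ext df) => // u v.
 by symmetry; apply: is_derive_unique.
by apply: filter_forall => z; RIc => t _.
Qed.

Let dg2 (y t : R) := lor t * (- t * sin (t * y)).

Lemma dg2_2d x y : continuity_2d_pt dg2 x y.
Proof.
apply: continuity_2d_pt_mult; last by c2d.
by apply: (@continuity_2d_of_continuous lor) => ?; [exact: lor_continuous | c2d].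
Qed.

Lemma g_cont y t : continuous (fun t => lor t * cos (t * y)) t.
Proof. by apply: ex_derive_continuous; rewrite /lor; auto_derive; have := lor_den t; lra. Qed.

Lemma w_cont y t : continuous (fun t => lor t * (3 / 4 * cos (t * y) - t * sin (t * y))) t.
Proof. by apply: ex_derive_continuous; rewrite /lor; auto_derive; have := lor_den t; lra. Qed.

Lemma g_derive y : is_derive g y (w y - 3 / 4 * g y).
Proof.
have := @RInt_param_derive _ dg2 y => h.
have -> : w y - 3 / 4 * g y = RInt (dg2 y) (- T) T; last first.
 apply: h; [move=> z t; rewrite /dg2; auto_derive => //; ring | exact: dg2_2d | exact: g_cont].
have eg : ex_RInt (fun t => lor t * cos (t * y)) (- T) T by RIc => z _; exact: g_cont.
have ew : ex_RInt (fun t => lor t * (3 / 4 * cos (t * y) - t * sin (t * y))) (- T) T by RIc => z _; exact: w_cont.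
transitivity (minus (w y) (scal (3 / 4) (g y))) => //.
rewrite -RInt_scal // -RInt_minus //; last exact: (ex_RInt_scal _).
by apply: RInt_ext => t _; rewrite /minus /plus /opp /scal /= /mult /= /dg2; ring.
Qed.

(* The integrand is the real part of [exp (i z y) / (3/4 - i z)], holomorphic in the upper half-plane: the line is lifted to height [H ^ 2]. *)
Lemma w_small y0 y : 0 < y0 <= 1 -> y0 <= y -> Rabs (w y) <= exp (3 / 4 * y) * (10 / (T * (y0 * y0))).
Proof.
move=> hy0 hy.
pose Dw h t := (3 / 4 + h * h) * (3 / 4 + h * h) + t * t.
have D0 h t : 9 / 16 <= Dw h t by rewrite /Dw; nra.
pose E h := exp (- (h * h * y)).
pose N1 h t := (3 / 4 + h * h) * cos (t * y) - t * sin (t * y).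
pose N2 h t := (3 / 4 + h * h) * sin (t * y) + t * cos (t * y).
pose f1 h t := E h * (N1 h t * / Dw h t); pose f2 h t := - (2 * h * E h * (N2 h t * / Dw h t)).
pose gg h t := 2 * h * E h * (- y * N1 h t * / Dw h t + cos (t * y) * / Dw h t - N1 h t * (2 * (3 / 4 + h * h)) * (/ Dw h t * / Dw h t)).
have E0 h : 0 < E h by pos.
have cg h t : continuity_2d_pt gg h t.
 have cD : continuity_2d_pt (fun h t => / Dw h t) h t by apply: continuity_2d_pt_inv; [rewrite /Dw; c2d | have := D0 h t; lra].
 repeat first [exact: cD | progress c2d].
have n1 h t N d : 0 < d -> N * N <= Dw h t -> d * d <= Dw h t -> Rabs (N * / Dw h t) <= / d.
 have := D0 h t; set D := Dw h t => hD d0 hN hd; rewrite Rabs_mult (Rabs_pos_eq (/ D)); last by pos.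
 apply: (Rmult_le_reg_r (D * d)); first by pos.
 rewrite (_ : Rabs N * / D * _ = Rabs N * d); last by field; lra.
 rewrite (_ : / d * _ = D); last by field; lra.
 have aa : Rabs N * Rabs N <= D by rewrite -Rabs_mult Rabs_pos_eq; nra.
 nra.
have sc t : sin (t * y) * sin (t * y) + cos (t * y) * cos (t * y) = 1 by have := sin2_cos2 (t * y).
have nD h t : N1 h t * N1 h t + N2 h t * N2 h t = Dw h t.
 rewrite /Dw -[RHS]Rmult_1_r -(sc t) /N1 /N2; ring.
have dD h t : Dw h t <> 0 by have := D0 h t; lra.
suff : Rabs (w y) <= 2 / (T * y).
 move=> h; apply: Rle_trans h _.
 have e1 : 1 <= exp (3 / 4 * y) by rewrite -exp_0; apply: exp_le_mono; lra.
 have -> : 2 / (T * y) = 1 * (2 / (T * y)) by lra.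
 mon.
apply: (le_vanish (vanish_exp ((T - - T) * (/ (3 / 4))))) => n.
pose H := sqrt (n / 4 / y); have q0 : 0 <= n / 4 / y by pos.
have HH : H * H * y = n / 4 by rewrite /H sqrt_sqrt //; field; lra.
have H0 : 0 <= H by pos.
have := @green f1 f2 gg (- T) T H ltac:(lra) cg.
have c1 h : ex_RInt (f1 h) (- T) T.
 by RIc => t _; apply: ex_derive_continuous; rewrite /f1 /N1 /Dw; auto_derive; have := dD h t.
move=> gr; have {}gr : RInt (fun t => f1 H t - f1 0 t) (- T) T = RInt (fun h => f2 h T - f2 h (- T)) 0 H.
 apply: gr => h t; have := dD h t; rewrite /f1 /f2 /gg /E /N1 /N2 /Dw => d; (auto_derive; first exact: d); field; nra.
have e0 : w y = RInt (f1 0) (- T) T.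
 apply: RInt_ext => t _; rewrite /f1 /E /N1 /Dw !Rmult_0_l Rplus_0_r Ropp_0 exp_0 /lor (_ : 3 / 4 * (3 / 4) = 9 / 16); last by lra.
 lra.
have e1 : RInt (fun t => f1 H t - f1 0 t) (- T) T = RInt (f1 H) (- T) T - RInt (f1 0) (- T) T by exact: (RInt_minus (f1 H) (f1 0)).
have b1 : Rabs (RInt (f1 H) (- T) T) <= (T - - T) * (exp (- n / 4) * / (3 / 4)).
 apply: abs_RInt_le_const => //; first by lra.
 move=> t _; rewrite Rabs_mult (Rabs_pos_eq (E H)); last by pos.
 rewrite {1}/E (_ : - _ = - n / 4); last by lra.
 apply: Rmult_le_compat_l; first by pos.
 by apply: n1; [lra | have := nD H t; nra | have := D0 H t; lra].
have b2 : Rabs (RInt (fun h => f2 h T - f2 h (- T)) 0 H) <= 2 / (T * y).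
 have J : is_RInt (fun h => 2 * / T * (2 * h * E h)) 0 H (2 * / T * (/ y * - E H - / y * - E 0)).
  apply: (is_RInt_scal _); apply: (@is_RInt_primitive (fun h => / y * - E h)) => // h _; rewrite /E.
   by auto_derive => //; field; lra.
  by dcont.
 have cf2 h s : continuous (fun h => f2 h s) h by apply: ex_derive_continuous; rewrite /f2 /E /N2 /Dw; auto_derive; have := dD h s.
 have ef : ex_RInt (fun h => f2 h T - f2 h (- T)) 0 H.
  RIc => h _; exact: (continuous_minus _ _ _ _ _).
 apply: (Rle_trans _ _).
  apply: (norm_RInt_le _ _ 0 H _ _ H0 _ (RInt_correct _ _ _ ef) J) => h hh.
  have bb s : s * s = T * T -> Rabs (f2 h s) <= / T * (2 * h * E h).
   move=> ss; rewrite Rabs_Ropp Rabs_mult (Rabs_pos_eq _); last by pos.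
   rewrite Rmult_comm; apply: Rmult_le_compat_r; first by pos.
   by apply: n1; [lra | have := nD h s; nra | rewrite /Dw ss; nra].
  Rtri; rewrite Rabs_Ropp; have := bb T erefl; have := bb (- T) ltac:(ring); lra.
 have E00 : E 0 = 1 by rewrite /E !Rmult_0_l Ropp_0 exp_0.
 rewrite (_ : 2 / _ = 2 * / T * / y); last by field; lra.
 have := E0 H; have : 0 < / T * / y by pos.
 nra.
rewrite e0 (_ : RInt (f1 0) (- T) T = RInt (f1 H) (- T) T - RInt (fun t => f1 H t - f1 0 t) (- T) T); last by lra.
rewrite gr; Rtri; rewrite Rabs_Ropp; lra.
Qed.

(** The derivative of [exp (3/4 y) * g y] is [exp (3/4 y) * w y]. The bound on [w] degenerates at 0,
    whence the base point [y0]. *)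
Lemma g_decay y0 y : 0 < y0 <= 1 -> y0 <= y ->
 Rabs (exp (3 / 4 * y) * g y - exp (3 / 4 * y0) * g y0) <= (y - y0) * (exp (3 / 2 * y) * (10 / (T * (y0 * y0)))).
Proof.
move=> hy0 hy.
have cw z : continuous w z.
 apply: (@RInt_param_continuous _) => [|x v]; first by lra.
 apply: continuity_2d_pt_mult; last by c2d.
 by apply: (@continuity_2d_of_continuous lor) => ?; [exact: lor_continuous | c2d].
have I : is_RInt (fun z => exp (3 / 4 * z) * w z) y0 y (exp (3 / 4 * y) * g y - exp (3 / 4 * y0) * g y0).
 apply: (@is_RInt_primitive (fun z => exp _ * g z)) => // x hx.
  have de : is_derive (fun y => exp (3 / 4 * y)) x (3 / 4 * exp (3 / 4 * x)) by auto_derive => //; ring.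
  have := is_derive_mult _ _ x _ _ de (g_derive x) (Rmult_comm); rewrite /plus /mult /= => h.
  by move: h; rewrite (_ : _ + _ = exp (3 / 4 * x) * w x) //; ring.
 apply: (continuous_mult _ w) => //.
 by dcont.
rewrite -(is_RInt_unique _ _ _ _ I); apply: abs_RInt_le_const => //; first by exists (exp (3 / 4 * y) * g y - exp (3 / 4 * y0) * g y0).
move=> x hx; rewrite Rabs_mult Rabs_pos_eq; last by pos.
have ws := @w_small y0 x hy0 ltac:(lra).
have T0 : 0 <= 10 / (T * (y0 * y0)) by pos.
apply: (Rle_trans _ (exp (3 / 4 * y) * (exp (3 / 4 * y) * (10 / (T * (y0 * y0)))))).
 have ex : exp (3 / 4 * x) <= exp (3 / 4 * y) by case: (Req_dec x y) => [->|ne]; [lra | apply/Rlt_le/exp_increasing; lra].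
 mon.
rewrite -Rmult_assoc -exp_plus (_ : 3 / 4 * y + 3 / 4 * y = 3 / 2 * y); lra.
Qed.

Lemma g_zero : Rabs (g 0 - 4 / 3 * PI) <= 4 / T.
Proof.
have I : is_RInt (fun t => lor t * cos (t * 0)) (- T) T (4 / 3 * atan (4 / 3 * T) - 4 / 3 * atan (4 / 3 * - T)).
 apply: (@is_RInt_primitive (fun t => 4 / 3 * atan _)) => [|x _|x _]; [lra | | exact: g_cont].
 rewrite Rmult_0_r cos_0 /lor; auto_derive => //; field; nra.
rewrite /g (is_RInt_unique _ _ _ _ I) (_ : 4 / 3 * - T = - (4 / 3 * T)); last by lra.
rewrite atan_opp; set a := 4 / 3 * T; have a0 : 0 < a by pos.
have e : atan a = PI / 2 - atan (/ a) by have := atan_inv a a0; lra.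
have ia := Rinv_0_lt_compat _ a0.
have l1 : 0 <= atan (/ a) by rewrite -atan_0; apply/Rlt_le/atan_increasing.
have l2 : atan (/ a) <= / a.
 case: (MVT_gen atan 0 (/ a) (fun x => / (1 + x * x))) => [x _|x _|x [_]].
 - by auto_derive => //; rewrite Rmult_1_l; congr Rinv; ring.
 - by apply/continuity_pt_filterlim; dcont.
 rewrite atan_0 !Rminus_0_r => ->; rewrite -{2}(Rmult_1_l (/ a)); apply: Rmult_le_compat_r; first by lra.
 by rewrite -Rinv_1; apply: Rinv_le_contravar; nra.
have ea : / a = 3 / 4 * / T by rewrite /a; field; lra.
by apply: Rabs_le; lra.
Qed.

Lemma g_even y : g (- y) = g y.
Proof. by apply: RInt_ext => t _; rewrite (_ : t * - y = - (t * y)) ?cos_neg //; ring. Qed.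

Lemma g_lipschitz y : 0 <= y -> Rabs (g y - g 0) <= y * (2 * T * (16 / 9 * T)).
Proof.
move=> y0; have := MVT_gen g 0 y _ (fun x _ => g_derive x).
case=> [x _|x [_ ->]]; first by apply/continuity_pt_filterlim; apply: ex_derive_continuous; exists (w x - 3 / 4 * g x); exact: g_derive.
rewrite Rminus_0_r Rabs_mult (Rabs_pos_eq y) // Rmult_comm; apply: Rmult_le_compat_l => //.
have -> : w x - 3 / 4 * g x = RInt (dg2 x) (- T) T.
 have := @RInt_param_derive (fun y t => lor t * cos (t * y)) dg2 x => h.
 have h' := h ltac:(move=> z t; rewrite /dg2; auto_derive => //; ring) dg2_2d g_cont.
 by rewrite -(is_derive_unique _ _ _ h') (is_derive_unique _ _ _ (g_derive x)).
have -> : 2 * T = T - - T by lra.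
apply: abs_RInt_le_const; first by lra.
 by RIc => z _; apply: (@slice2 dg2); exact: dg2_2d.
move=> t ht; rewrite Rabs_mult; have [l1 l2] := lor_bounds t; rewrite (Rabs_pos_eq _); last by lra.
apply: Rmult_le_compat; [lra | exact: Rabs_pos | lra |].
have := SIN_bound (t * x) => hs; by apply: Rabs_le; nra.
Qed.

End Kernel.

(** The full Fourier transform of [lor] ([kernel_limit]). *)
Definition kap (y : R) : R := 4 / 3 * PI * exp (- (3 / 4) * Rabs y).

Lemma gT_tail T S y : 1 <= T <= S ->
 Rabs (RInt (fun t => lor t * cos (t * y)) (- S) S - RInt (fun t => lor t * cos (t * y)) (- T) T) <= 2 / T.
Proof.
move=> hT; have ex a b : ex_RInt (fun t => lor t * cos (t * y)) a b by RIc => z _; exact: g_cont.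
rewrite -(RInt_Chasles _ (- S) (- T) S) // -(RInt_Chasles _ (- T) T S) // /plus /=.
have bd t : 0 < t * t -> Rabs (lor t * cos (t * y)) <= / (t * t).
 move=> t0; rewrite Rabs_mult; have [l1 l2] := lor_bounds t; rewrite (Rabs_pos_eq _); last by lra.
 have c1 : Rabs (cos (t * y)) <= 1 by apply: Rabs_le; exact: COS_bound.
 rewrite -(Rmult_1_r (/ _)); apply: Rmult_le_compat => //; [lra | exact: Rabs_pos |].
 mon.
have prim a b : a <= b -> 0 < a * b -> is_RInt (fun t => / (t * t)) a b (- / b - - / a).
 move=> ab h; apply: (@is_RInt_primitive (fun t => - / t)) => // x hx; have x0 : x <> 0 by nra.
  by auto_derive => //; field.
 by dcont; nra.
have p1 : Rabs (RInt (fun t => lor t * cos (t * y)) T S) <= / T.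
 apply: Rle_trans (norm_RInt_le _ _ T S _ _ ltac:(lra) _ (RInt_correct _ _ _ (ex _ _)) (prim T S ltac:(lra) ltac:(nra))) _.
  by move=> x hx; apply: bd; nra.
 by have := Rinv_0_lt_compat S ltac:(lra); lra.
have p2 : Rabs (RInt (fun t => lor t * cos (t * y)) (- S) (- T)) <= / T.
 apply: Rle_trans (norm_RInt_le _ _ (- S) (- T) _ _ ltac:(lra) _ (RInt_correct _ _ _ (ex _ _)) (prim (- S) (- T) ltac:(lra) ltac:(nra))) _.
  by move=> x hx; apply: bd; nra.
 rewrite !Rinv_opp; have := Rinv_0_lt_compat S ltac:(lra); lra.
move: p1 p2 => /Rabs_le_between p1 /Rabs_le_between p2; apply: Rabs_le; lra.
Qed.

Lemma kernel_pos T y : 1 <= T -> 0 < y -> Rabs (RInt (fun t => lor t * cos (t * y)) (- T) T - kap y) <= 2 / T.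
Proof.
move=> T1 y0; apply: le_epsilon => eps eps0.
pose e := Rmin 1 (eps / 64).
have e0 : 0 < e by apply: Rmin_glb_lt; lra.
have e1 : e <= 1 by apply: Rmin_l.
have e2 : 64 * e <= eps by have := Rmin_r 1 (eps / 64); rewrite -/e; lra.
(* The base point [z] replaces 0, where [w] is not controlled. To compare [g z] with [g 0] the
   truncation is lowered to [/ e]: this costs [2 e] at each point, and the Lipschitz constant is
   then of order [/ (e * e)], whence the cube. *)
pose z := Rmin y (e * e * e).
have z0 : 0 < z by apply: Rmin_glb_lt => //; repeat apply: Rmult_lt_0_compat.
have zy : z <= y by apply: Rmin_l.
have ze : z <= e * e * e by apply: Rmin_r.
have z1 : z <= e by nra.
pose A := (y - z) * (exp (3 / 2 * y) * (10 / (z * z))).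
have A0 : 0 <= A by pos.
have ie1 : 1 <= / e by rewrite -Rinv_1; apply: Rinv_le_contravar.
pose S := T + / e + (A + 4) / e.
have Ae : 0 <= (A + 4) / e by nra.
have S1 : 1 <= S by rewrite /S; lra.
pose g y := RInt (fun t => lor t * cos (t * y)) (- S) S.
have dec := @g_decay S S1 z y ltac:(lra) zy; rewrite -/(g y) -/(g z) in dec.
have gz := @g_zero S S1; rewrite -/(g 0) in gz.
have t1 := @gT_tail (/ e) S z ltac:(rewrite /S; lra); have t2 := @gT_tail (/ e) S 0 ltac:(rewrite /S; lra).
have lp := @g_lipschitz (/ e) ie1 z ltac:(lra).
have lp' : z * (2 * / e * (16 / 9 * / e)) <= 4 * e.
 have -> : z * (2 * / e * (16 / 9 * / e)) = z * (32 / 9) / (e * e) by field; lra.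
 apply: (Rmult_le_reg_r (e * e)); first by nra.
 by rewrite /Rdiv Rmult_assoc Rinv_l; nra.
have q1 : 2 / (/ e) = 2 * e by field; lra.
rewrite -/(g z) in t1; rewrite -/(g 0) in t2.
have dz : Rabs (g z - g 0) <= 8 * e.
 move: t1 t2 lp => /Rabs_le_between t1 /Rabs_le_between t2 /Rabs_le_between lp; apply: Rabs_le; lra.
have SA : A / S + 4 / S <= e.
 have -> : A / S + 4 / S = (A + 4) / S by lra.
 apply: (Rmult_le_reg_r S); first by lra.
 rewrite Rmult_assoc Rinv_l; last by lra.
 have : e * ((A + 4) / e) = A + 4 by field; lra.
 have : e * S = e * T + e * / e + e * ((A + 4) / e) by rewrite /S; ring.
 nra.
have dA : (y - z) * (exp (3 / 2 * y) * (10 / (S * (z * z)))) = A / S by rewrite /A; field; lra.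
have ez : 0 <= exp (3 / 4 * z) - 1 <= 3 * z.
 have h1 := exp_ineq1_le (3 / 4 * z); have h2 := exp_ineq1_le (- (3 / 4 * z)); split; first by lra.
 have : exp (3 / 4 * z) * exp (- (3 / 4 * z)) = 1 by rewrite -exp_plus Rplus_opp_r exp_0.
 nra.
have pi4 := PI_4; have pi0 := PI_RGT_0.
have S4 : 0 <= A / S by pos.
have g0 : Rabs (g 0) <= 7 by move: gz => /Rabs_le_between gz; apply: Rabs_le; lra.
have main : Rabs (exp (3 / 4 * y) * g y - 4 / 3 * PI) <= 64 * e.
 have m1 : Rabs ((exp (3 / 4 * z) - 1) * g z) <= 3 * z * 15.
  rewrite Rabs_mult (Rabs_pos_eq _); last by lra.
  apply: Rmult_le_compat; [lra | exact: Rabs_pos | lra |].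
  by move: dz g0 => /Rabs_le_between dz /Rabs_le_between g0; apply: Rabs_le; lra.
 move: dec m1 dz gz => /Rabs_le_between dec /Rabs_le_between m1 /Rabs_le_between dz /Rabs_le_between gz.
 by apply: Rabs_le; lra.
have gk : Rabs (g y - kap y) <= eps.
 have -> : g y - kap y = exp (- (3 / 4) * y) * (exp (3 / 4 * y) * g y - 4 / 3 * PI).
  rewrite /kap Rabs_pos_eq; last by lra.
  by rewrite Rmult_minus_distr_l -Rmult_assoc -exp_plus (_ : - _ * y + 3 / 4 * y = 0) ?exp_0; lra.
 rewrite Rabs_mult Rabs_pos_eq; last by pos.
 have ey : exp (- (3 / 4) * y) <= 1 by rewrite -exp_0; apply/Rlt_le/exp_increasing; lra.
 have := exp_pos (- (3 / 4) * y); nra.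
have := @gT_tail T S y ltac:(rewrite /S; lra); rewrite -/(g y).
move: gk => /Rabs_le_between gk /Rabs_le_between h; apply: Rabs_le; lra.
Qed.

Lemma kernel_limit T y : 1 <= T -> Rabs (RInt (fun t => lor t * cos (t * y)) (- T) T - kap y) <= 4 / T.
Proof.
move=> T1; have iT : 2 / T <= 4 / T by mon.
case: (Rtotal_order y 0) => [h|[->|h]].
- rewrite -(Ropp_involutive y) (g_even T (- y)) /kap Rabs_Ropp.
 by apply: Rle_trans (@kernel_pos T (- y) T1 _) iT; lra.
- by rewrite /kap Rabs_R0 Rmult_0_r exp_0 Rmult_1_r; exact: g_zero.
by apply: Rle_trans (@kernel_pos T y T1 h) iT.
Qed.

Lemma kernel_complex T y : 1 <= T ->
 Cmod (CInt (fun t => RtoC (lor t) * cis (t * y))%C (- T) T - RtoC (kap y)) <= 4 / T.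
Proof.
have -> : CInt (fun t => (lor t) * cis (t * y))%C (- T) T = RtoC (RInt (fun t => lor t * cos (t * y)) (- T) T).
 congr pair; first by apply: RInt_ext => t _ /=; ring.
 have e : RInt (fun t => lor t * sin (t * y)) (- T) T = - RInt (fun t => lor t * sin (t * y)) (- T) T.
  have ex : ex_RInt (fun t => lor t * sin (t * y)) (- T) T.
   by RIc => z _; apply: ex_derive_continuous; rewrite /lor; auto_derive; have := lor_den z; lra.
  have ex2 : ex_RInt (fun t => lor t * sin (t * y)) (-1 * - T + 0) (-1 * T + 0).
   by RIc => z _; apply: ex_derive_continuous; rewrite /lor; auto_derive; have := lor_den z; lra.
  have := RInt_comp_lin _ (-1) 0 (- T) T ex2.
  have -> : -1 * - T + 0 = T by lra.
  have -> : -1 * T + 0 = - T by lra.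
  have sw : RInt (fun t => lor t * sin (t * y)) T (- T) = - RInt (fun t => lor t * sin (t * y)) (- T) T by rewrite -(opp_RInt_swap _ (- T) T ex).
  rewrite sw => h; rewrite -h.
  apply: RInt_ext => t _; rewrite /scal /= /mult /= /lor (_ : (-1 * t + 0) * y = - (t * y)) ?sin_neg; last by lra.
  by rewrite (_ : _ * (-1 * t + 0) = t * t); ring.
 rewrite (RInt_ext _ (fun t => lor t * sin (t * y))); last by move=> t _ /=; ring.
 lra.
by rewrite -RtoC_minus Cmod_R; exact: kernel_limit.
Qed.

(** * The Gamma factor *)

(** Domination by an even function whose primitive on the half-line is [- P] gives the existence of
    the integral, the tail rate [8 P] and a bound for all symmetric truncations. *)
Lemma CIR_dom f g P : Cc f -> (forall t, Cmod (f t) <= g (Rabs t)) ->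
 (forall t, 0 <= t -> [/\ continuous g t, is_derive P t (- g t) & 0 <= P t]) -> vanish (fun n => 2 * P n) ->
 (exists2 l, CIR f l & forall (n : nat) a b, a <= - n -> n <= b -> Cmod (CInt f a b - l) <= 8 * P n) /\
 forall n : nat, Cmod (CInt f (- n) n) <= 4 * P 0.
Proof.
move=> cf hf hg v.
have right a b : 0 <= a -> a <= b -> Cmod (CInt f a b) <= 2 * (P a - P b).
 move=> a0 ab; rewrite (_ : P a - P b = - P b - - P a); last by lra.
 apply: (CInt_bound (g := g)) => //; first by move=> t ht; have := hf t; rewrite Rabs_pos_eq; lra.
 apply: (@is_RInt_primitive (fun t => - P t)) => // t ht; have [c d _] := hg t ltac:(lra) => //.
 by rewrite -(Ropp_involutive (g t)); exact: is_derive_opp.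
have left a b : a <= b -> b <= 0 -> Cmod (CInt f a b) <= 2 * (P (- b) - P (- a)).
 move=> ab b0; apply: (CInt_bound (g := fun t => g (- t))) => //; first by move=> t ht; have := hf t; rewrite Rabs_left1; lra.
 apply: (@is_RInt_primitive (fun t => P (- t))) => // t ht; have [c d _] := hg (- t) ltac:(lra).
  rewrite (_ : g (- t) = scal (- 1) (- g (- t))); last by rewrite /scal /= /mult /=; ring.
  by apply: (is_derive_comp P Ropp) => //; auto_derive.
 by apply: (continuous_comp Ropp g) => //; dcont.
have P0 (t : R) : 0 <= t -> 0 <= P t by move=> /hg [].
split=> [|n]; last first.
 have n0 := pos_INR n; rewrite -(CInt_Chasles _ 0 _ cf); Ctri.
 have := left (- n) 0; have := right 0 n; rewrite Ropp_0 Ropp_involutive; have := P0 n n0; lra.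
have [n b _ hb|n a _ ha|l h1 h2] := @CIR_tails f _ 0 cf v; last first.
- by exists l => // n a b ha hb; have := h2 n a b (leq0n n) ha hb; lra.
- have n0 := pos_INR n; have := left a (- n); rewrite Ropp_involutive; have := P0 (- a); lra.
have n0 := pos_INR n; have := right n b; have := P0 b; lra.
Qed.

Lemma exp_dom f K : Cc f -> (forall v, Cmod (f v) <= K * exp (- Rabs v / 4)) ->
 (exists2 l, CIR f l & forall (n : nat) a b, a <= - n -> n <= b -> Cmod (CInt f a b - l) <= 8 * (4 * K * exp (- n / 4))) /\
 forall n : nat, Cmod (CInt f (- n) n) <= 4 * (4 * K * exp (- 0 / 4)).
Proof.
move=> cf hK; have K0 : 0 <= K by have := hK 0; have := Cmod_ge_0 (f 0); rewrite Rabs_R0 Ropp_0 /Rdiv Rmult_0_l exp_0; lra.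
apply: (CIR_dom (g := fun v => K * exp (- v / 4)) (P := fun v => 4 * K * exp (- v / 4))) => //; last first.
 by move=> e /(vanish_exp (8 * K)) [N h]; exists N => n /h; lra.
split; first by dcont.
 by auto_derive => //; rewrite /Rdiv; field.
pos.
Qed.

Lemma CIR_exp f K : Cc f -> (forall v, Cmod (f v) <= K * exp (- Rabs v / 4)) ->
 exists2 l, CIR f l & forall (n : nat) a b, a <= - n -> n <= b -> Cmod (CInt f a b - l) <= 32 * K * exp (- n / 4).
Proof. by move=> cf /(exp_dom cf) [[l h t] _]; exists l => // n a b ha hb; have := t n a b ha hb; lra. Qed.

Lemma CIR_minus f g l l' : Cc f -> Cc g -> CIR f l -> CIR g l' -> CIR (fun t => f t - g t)%C (l - l')%C.
Proof.
move=> cf cg h h' eps e0; have [n hn] := h (eps / 2) ltac:(lra); have [m hm] := h' (eps / 2) ltac:(lra).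
exists (n + m)%N => a b; rewrite INRD => ha hb; have nR := pos_INR n; have mR := pos_INR m.
have := hn a b ltac:(lra) ltac:(lra); have := hm a b ltac:(lra) ltac:(lra) => h1 h2.
rewrite CInt_minus //.
have -> : (CInt f a b - CInt g a b - (l - l') = (CInt f a b - l) - (CInt g a b - l'))%C by ring.
by Ctri; rewrite Cmod_opp; lra.
Qed.

Lemma Cc_unif f : (forall T eps, 0 < eps -> exists2 g, Cc g & forall t, Rabs t <= T -> Cmod (f t - g t) <= eps) -> Cc f.
Proof.
move=> h x.
have aux (p : C -> R) : (forall z, Rabs (p z) <= Cmod z) -> (forall z z', p (z - z')%C = p z - p z') ->
  (forall g, Cc g -> continuous (fun t => p (g t)) x) -> continuous (fun t => p (f t)) x.
 move=> pl pm pc; apply/filterlim_locally => eps; have e0 := cond_pos eps.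
 have [g cg hg] := h (Rabs x + 1) (eps / 4) ltac:(lra).
 have := (proj1 (filterlim_locally _ _) (pc g cg)) (mkposreal (eps / 4) ltac:(lra)); case=> d hd.
 exists (mkposreal _ (Rmin_stable_in_posreal d (mkposreal 1 Rlt_0_1))) => t; rewrite /ball => ht.
 have t1 : Rabs (t + - x) < d by apply: Rlt_le_trans ht (Rmin_l _ _).
 have t2 : Rabs (t + - x) < 1 by apply: Rlt_le_trans ht (Rmin_r _ _).
 have := hd t t1; rewrite /ball /= /AbsRing_ball /minus /plus /opp /= => h3.
 have tx : Rabs t <= Rabs x + 1.
  by have := Rabs_triang (t + - x) x; rewrite (_ : t + - x + x = t); lra.
 have a1 := pl (f t - g t)%C; have a2 := pl (f x - g x)%C; rewrite pm in a1; rewrite pm in a2.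
 have b1 := hg t tx; have b2 := hg x ltac:(lra).
 move: a1 a2 h3 => /Rabs_le_between a1 /Rabs_le_between a2 /Rabs_lt_between h3; apply: Rabs_def1; lra.
split; apply: (aux _ _ (fun z z' => erefl)); try exact: Rabs_Re_le; try exact: Rabs_Im_le; by move=> g cg; have [] := cg x.
Qed.

(** * Rotation of Euler's integral *)

Definition Aamp (t eta v : R) : R := exp (v * (1 / 4) - t * eta - exp v * cos eta).
Definition Ath (t eta v : R) : R := t * v + eta * (1 / 4) - exp v * sin eta.
(* [exp (p z - exp z)] at [z = v + i eta], with [p = 1/4 + i t] *)
Definition Afun (t eta v : R) : C := (Aamp t eta v * cos (Ath t eta v), Aamp t eta v * sin (Ath t eta v)).

Lemma AfunE t eta v : Afun t eta v = (RtoC (Aamp t eta v) * cis (Ath t eta v))%C.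
Proof. by rewrite /Cmult /=; congr pair; ring. Qed.

Lemma Afun_mod t eta v : Cmod (Afun t eta v) = Aamp t eta v.
Proof. by rewrite AfunE Cmod_mult Cmod_cis Rmult_1_r Cmod_R Rabs_pos_eq //; apply/Rlt_le/exp_pos. Qed.

Lemma Afun_Cc t eta : Cc (Afun t eta).
Proof. by move=> v; split; apply: ex_derive_continuous; rewrite /Afun /Aamp /Ath /=; auto_derive. Qed.

(** In the logarithmic variable, rotation by [eta] is a vertical shift, so [green] bounds the
    difference by the two vertical sides; they are small at [- V], and at [V] because
    [cos eta > 0]. *)
Lemma Afun_rotate t eta V : 0 <= V -> Rabs eta < PI / 2 ->
 Cmod (CInt (Afun t eta) (- V) V - CInt (Afun t 0) (- V) V) <=
 2 * (Rabs eta * (exp (Rabs t * Rabs eta) * (exp (V / 4 - exp V * cos eta) + exp (- V / 4)))).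
Proof.
move=> V0 he.
set a1 := fun eta v => 1 / 4 - exp v * cos eta; set a2 := fun eta v => t - exp v * sin eta.
pose gR eta v := Aamp t eta v * (a1 eta v * cos (Ath t eta v) - a2 eta v * sin (Ath t eta v)).
pose gI eta v := Aamp t eta v * (a1 eta v * sin (Ath t eta v) + a2 eta v * cos (Ath t eta v)).
have cR x y : continuity_2d_pt gR x y by rewrite /gR /Aamp /Ath /a1 /a2; c2d.
have cI x y : continuity_2d_pt (fun eta v => - gI eta v) x y by rewrite /gI /Aamp /Ath /a1 /a2; c2d.
have G1 := @green (fun eta v => Re (Afun t eta v)) (fun eta v => - Im (Afun t eta v)) _ (- V) V eta ltac:(lra) cI.
have G2 := @green (fun eta v => Im (Afun t eta v)) (fun eta v => Re (Afun t eta v)) gR (- V) V eta ltac:(lra) cR.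
have cosb x : Rmin 0 eta <= x <= Rmax 0 eta -> cos eta <= cos x /\ Rabs x <= Rabs eta.
 move=> hx; have xe : Rabs x <= Rabs eta.
  move: hx; rewrite /Rmin /Rmax; case: Rle_dec => h hx; first by rewrite !Rabs_pos_eq; lra.
  by rewrite !Rabs_left1; lra.
 split=> //; have cabs y : cos y = cos (Rabs y) by rewrite /Rabs; case: Rcase_abs => _ //; rewrite cos_neg.
 rewrite (cabs x) (cabs eta); have := Rabs_pos x => x0.
 by apply: cos_decr_1; lra.
pose M := exp (Rabs t * Rabs eta) * (exp (V / 4 - exp V * cos eta) + exp (- V / 4)).
have amp x : Rmin 0 eta <= x <= Rmax 0 eta -> Aamp t x V + Aamp t x (- V) <= M.
 move=> hx; have [c1 c2] := cosb x hx.
 have tx : - (t * x) <= Rabs t * Rabs eta.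
  apply: Rle_trans (Rle_abs _) _; rewrite Rabs_Ropp Rabs_mult; apply: Rmult_le_compat_l => //; exact: Rabs_pos.
 have expm x' y' : x' <= y' -> exp x' <= exp y' by case=> [h|->]; [apply/Rlt_le/exp_increasing | lra].
 have ce : 0 <= cos x.
  by apply: Rle_trans c1; apply: cos_ge_0; have := Rabs_def2 _ _ he; lra.
 rewrite /M Rmult_plus_distr_l -!exp_plus; apply: Rplus_le_compat; apply: expm.
  have := exp_pos V; nra.
 have := exp_pos (- V); nra.
have b1 : Rabs (RInt (fun y => Re (Afun t eta y) - Re (Afun t 0 y)) (- V) V) <= Rabs eta * M.
 rewrite G1; first last.
 - by move=> x y; rewrite /Afun /Aamp /Ath /gI /a1 /a2 /=; auto_derive => //; rewrite /Aamp /Ath /Rminus; ring.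
 - by move=> x y; rewrite /Afun /Aamp /Ath /gI /a1 /a2 /=; auto_derive => //; rewrite /Aamp /Ath /Rminus; ring.
 have exI : ex_RInt (fun x => - Im (Afun t x V) - - Im (Afun t x (- V))) 0 eta.
  by RIc => z _; apply: ex_derive_continuous; rewrite /Afun /Aamp /Ath /=; auto_derive.
 have := norm_RInt_le_const_abs _ 0 eta _ M _ (RInt_correct _ _ _ exI); rewrite Rminus_0_r; apply=> x hx.
 apply: Rle_trans (amp x hx).
 Rtri; rewrite !Rabs_Ropp.
 by have := Rabs_Im_le (Afun t x V); have := Rabs_Im_le (Afun t x (- V)); rewrite !Afun_mod; lra.
have b2 : Rabs (RInt (fun y => Im (Afun t eta y) - Im (Afun t 0 y)) (- V) V) <= Rabs eta * M.
 rewrite G2; first last.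
 - by move=> x y; rewrite /Afun /Aamp /Ath /gR /a1 /a2 /=; auto_derive => //; rewrite /Aamp /Ath /Rminus; ring.
 - by move=> x y; rewrite /Afun /Aamp /Ath /gR /a1 /a2 /=; auto_derive => //; rewrite /Aamp /Ath /Rminus; ring.
 have exI : ex_RInt (fun x => Re (Afun t x V) - Re (Afun t x (- V))) 0 eta.
  by RIc => z _; apply: ex_derive_continuous; rewrite /Afun /Aamp /Ath /=; auto_derive.
 have := norm_RInt_le_const_abs _ 0 eta _ M _ (RInt_correct _ _ _ exI); rewrite Rminus_0_r; apply=> x hx.
 apply: Rle_trans (amp x hx).
 Rtri; rewrite Rabs_Ropp.
 by have := Rabs_Re_le (Afun t x V); have := Rabs_Re_le (Afun t x (- V)); rewrite !Afun_mod; lra.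
rewrite -CInt_minus; try exact: Afun_Cc.
by apply: Rle_trans (Cmod_le_abs _) _; rewrite -/M; move: b1 b2; rewrite /Rminus /=; lra.
Qed.

Lemma exp_decay c v : 0 < c <= 1 -> exp (v * (1 / 4) - exp v * c) <= / c * exp (- Rabs v / 4).
Proof.
move=> hc; have ic : 1 <= / c by rewrite -Rinv_1; apply: Rinv_le_contravar; lra.
have ep := exp_pos v.
case: (Rle_lt_dec 0 v) => hv.
 rewrite Rabs_pos_eq // exp_plus exp_Ropp.
 have h : / exp (exp v * c) <= / c * exp (- v).
  rewrite exp_Ropp -Rinv_mult; apply: Rinv_le_contravar; first by nra.
  by have := exp_ineq1_le (exp v * c); nra.
 apply: (Rle_trans _ (exp _ * (/ c * exp (- v)))); first by mon.
 have -> : exp (v * (1 / 4)) * (/ c * exp (- v)) = / c * (exp (v * (1 / 4)) * exp (- v)) by lra.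
 rewrite -exp_plus; lmul.
 have : v * (1 / 4) + - v <= - v / 4 by lra.
 by case=> [h'|->]; [apply/Rlt_le/exp_increasing | lra].
rewrite Rabs_left // (_ : - - v / 4 = v * (1 / 4)); last by lra.
apply: (Rle_trans _ (1 * exp (v * (1 / 4)))).
 by rewrite Rmult_1_l; apply/Rlt_le/exp_increasing; nra.
mon.
Qed.

Lemma Afun_decay t eta v : 0 < cos eta -> Cmod (Afun t eta v) <= exp (- (t * eta)) * / cos eta * exp (- Rabs v / 4).
Proof.
move=> c0; rewrite Afun_mod /Aamp (_ : v * _ - t * eta - exp v * cos eta = - (t * eta) + (v * (1 / 4) - exp v * cos eta)); last by lra.
rewrite exp_plus Rmult_assoc; apply: Rmult_le_compat_l; first by pos.
by apply: exp_decay; have := COS_bound eta; lra.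
Qed.

(** The substitution [x = exp v] in Euler's integral at [1/4 + i t]. *)
Lemma Gamma_int_CIR t : CIR (Afun t 0) (Gamma_int (1 / 4, t)).
Proof.
have c0 : 0 < cos 0 by rewrite cos_0; lra.
have [l hl _] := CIR_exp (Afun_Cc t 0) (fun v => Afun_decay t v c0).
suff -> : Gamma_int (1 / 4, t) = l by [].
apply: (@is_RInt_gen_unique C_R_CompleteNormedModule (at_right 0) (Rbar_locally p_infty) _ _ _ l).
move=> P [eps hP].
have e0 := cond_pos eps.
have [n hn] := hl (eps / 2) ltac:(lra).
exists (fun a => 0 < a < exp (- n)) (fun b => exp n < b); last first.
- move=> a b ha hb; exists (CInt (Afun t 0) (ln a) (ln b)).
 have n0 := pos_INR n.
 have ab : a <= b.
  have : exp (- n) <= exp n by case: (Req_dec n 0) => [->|ne]; [rewrite Ropp_0; lra | apply/Rlt_le/exp_increasing; lra].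
  lra.
 split=> /=; last first.
  apply: hP; have := hn (ln a) (ln b).
  have la : ln a <= - n by rewrite -(ln_exp (- n)); apply: ln_le; lra.
  have lb : n <= ln b by rewrite -(ln_exp n); apply: ln_le; pos.
  split.
   by apply: (Rle_lt_trans _ _); [exact: (Rabs_Re_le (CInt _ (ln a) (ln b) - l)%C) | lra].
  by apply: (Rle_lt_trans _ _); [exact: (Rabs_Im_le (CInt _ (ln a) (ln b) - l)%C) | lra].
 have sub (f : R -> R) : (forall v, continuous f v) -> is_RInt (fun x => / x * f (ln x)) a b (RInt f (ln a) (ln b)).
  move=> cf; apply: (is_RInt_comp f ln _) => x hx; first exact: cf.
  rewrite Rmin_left // in hx; split; first by auto_derive; lra.
  by apply: continuous_Rinv; lra.
 apply: is_RInt_fct_extend_pair.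
  have := sub _ (fun v => proj1 (Afun_Cc t 0 v)); apply: is_RInt_ext => x; rewrite Rmin_left // => hx.
  have x0 : 0 < x by lra.
  rewrite /Afun /Aamp /Ath /= cos_0 sin_0 exp_ln //.
  rewrite -{1}(exp_ln x) // -exp_Ropp !Rmult_0_r -Rmult_assoc -exp_plus.
  have -> : (1 / 4 + - (1)) * ln x - 0 = - ln x + ln x * (1 / 4) by lra.
  rewrite (_ : - ln x + _ = (- ln x + ln x * (1 / 4)) + - x); last by lra.
  rewrite (exp_plus _ (- x)) (_ : t * ln x + 0 * _ - 0 = 0 + (t + - 0) * ln x); ring.
 have := sub _ (fun v => proj2 (Afun_Cc t 0 v)); apply: is_RInt_ext => x; rewrite Rmin_left // => hx.
 have x0 : 0 < x by lra.
 rewrite /Afun /Aamp /Ath /= cos_0 sin_0 exp_ln //.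
 rewrite -{1}(exp_ln x) // -exp_Ropp !Rmult_0_r -Rmult_assoc -exp_plus.
 have -> : (1 / 4 + - (1)) * ln x - 0 = - ln x + ln x * (1 / 4) by lra.
 rewrite (_ : - ln x + _ = (- ln x + ln x * (1 / 4)) + - x); last by lra.
 by rewrite (exp_plus _ (- x)) (_ : t * ln x + 0 * _ - 0 = 0 + (t + - 0) * ln x); ring.
- by exists (exp n).
exists (mkposreal _ (exp_pos (- n))) => x; rewrite /ball /= /AbsRing_ball /minus /plus /opp /= => hx.
by move: hx => /Rabs_lt_between; lra.
Qed.

Lemma Gamma_rotate t eta : Rabs eta < PI / 2 -> CIR (Afun t eta) (Gamma_int (1 / 4, t)).
Proof.
move=> he; have c0 : 0 < cos eta by apply: cos_gt_0; have := Rabs_def2 _ _ he; lra.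
have [l hl tl] := CIR_exp (Afun_Cc t eta) (fun v => Afun_decay t v c0).
suff -> : Gamma_int (1 / 4, t) = l by [].
have c00 : 0 < cos 0 by rewrite cos_0; lra.
have [l0 hl0 tl0] := CIR_exp (Afun_Cc t 0) (fun v => Afun_decay t v c00).
rewrite (CIR_unique (Gamma_int_CIR t) hl0).
have z : Cmod (l0 - l) <= 0.
 apply: le_epsilon => eps e0.
 pose B := exp (Rabs t * Rabs eta); have B0 : 0 < B by pos.
 have k1 := @vanish_exp (32 * (exp (- (t * eta)) * / cos eta) + 32 * (exp (- (t * 0)) * / cos 0) + 2 * (Rabs eta * (B * (/ cos eta + 1)))) eps e0.
 have [N hN] := k1; have := hN N (leqnn N).
 have := tl N (- N) N ltac:(lra) ltac:(lra); have := tl0 N (- N) N ltac:(lra) ltac:(lra).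
 have := @Afun_rotate t eta N (pos_INR N) he; rewrite -/B.
 set x := CInt _ _ _; set y := CInt _ _ _ => h1 h2 h3 h4.
 have -> : (l0 - l = (x - l) - (x - y) - (y - l0))%C by ring.
 Ctri; rewrite Cmod_opp.
 have t3 := Cmod_triangle (x - l)%C (- (x - y))%C; rewrite Cmod_opp in t3.
 have d := @exp_decay (cos eta) N ltac:(have := COS_bound eta; lra); rewrite Rabs_pos_eq in d; last exact: pos_INR.
 rewrite (_ : N * _ = N / 4) in d; last by lra.
 have h5 : Rabs eta * (B * (exp (N / 4 - exp N * cos eta) + exp (- N / 4))) <= Rabs eta * (B * (/ cos eta + 1)) * exp (- N / 4).
  rewrite !Rmult_assoc; apply: Rmult_le_compat_l; first exact: Rabs_pos.
  nra.
 rewrite -/(Cminus _ _) in t3; lra.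
have : Cmod (l0 - l) = 0 by have := Cmod_ge_0 (l0 - l); lra.
by move/Cmod_eq_0 => e; have -> : l0 = (l + (l0 - l))%C by [ring]; rewrite e; ring.
Qed.

Definition Gm (t : R) : C := Gamma_int (1 / 4, t).

(* [1 / (2 i)] *)
Definition mhi : C := (0, - / 2).

(** At [eta = PI / 2] this is [sin (PI s / 2)] on the line [s = 3/4 + i t] ([Csin_half]). Smaller
    [eta] keep the integrals absolutely convergent: at [PI / 2] the function [Keta] is no longer
    damped as [v] grows. *)
Definition Seta (eta t : R) : C :=
 (mhi * (RtoC (exp (- (t * eta))) * cis (eta * (1 / 4) + PI / 4) - RtoC (exp (t * eta)) * cis (- (eta * (1 / 4) + PI / 4))))%C.

Definition Keta (eta v : R) : R := exp (v * (1 / 4) - exp v * cos eta) * sin (exp v * sin eta + PI / 4).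

Lemma Keta_continuous eta v : continuous (Keta eta) v.
Proof. by apply: ex_derive_continuous; rewrite /Keta; auto_derive. Qed.

Lemma Keta_Cc eta t : Cc (fun v => RtoC (Keta eta v) * cis (t * v))%C.
Proof.
apply: Cc_mult; first by apply: Cc_real => v; exact: Keta_continuous.
by apply: Cc_cis => v; dcont.
Qed.

Lemma sin_as_cis x phi : (RtoC (sin phi) * cis x = mhi * (cis (x + phi) - cis (x - phi)))%C.
Proof.
by rewrite /Cmult /= cos_plus sin_plus cos_minus sin_minus; congr pair; field.
Qed.

(** The sine in [Keta] combines the contours rotated by [eta] and by [- eta], whose integrals both
    equal [Gm t] by [Gamma_rotate]. *)
Lemma Gm_fourier eta t : 0 <= eta < PI / 2 ->
 CIR (fun v => RtoC (Keta eta v) * cis (t * v))%C (Gm t * Seta eta t)%C.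
Proof.
move=> he.
have h1 := @Gamma_rotate t (- eta) ltac:(rewrite Rabs_Ropp Rabs_pos_eq; lra).
have h2 := @Gamma_rotate t eta ltac:(rewrite Rabs_pos_eq; lra).
set c1 := (mhi * (exp (- (t * eta))) * cis (eta * (1 / 4) + PI / 4))%C.
set c2 := (mhi * (exp (t * eta)) * cis (- (eta * (1 / 4) + PI / 4)))%C.
have m1 := @CIR_scal c1 _ _ (Afun_Cc t _) h1; have m2 := @CIR_scal c2 _ _ (Afun_Cc t eta) h2.
have := CIR_minus (Cc_mult (Cc_const c1) (Afun_Cc t _)) (Cc_mult (Cc_const c2) (Afun_Cc t eta)) m1 m2.
rewrite (_ : (c1 * Gm t - c2 * Gm t = Gm t * Seta eta t)%C); last by rewrite /c1 /c2 /Seta; ring.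
apply: CIR_ext => v; rewrite /c1 /c2 !AfunE.
have e1 : RtoC (exp (v * (1 / 4) - exp v * cos eta)) = ((exp (- (t * eta))) * RtoC (Aamp t (- eta) v))%C.
 by rewrite -RtoC_mult -exp_plus cos_neg; congr exp; ring.
have e2 : RtoC (exp (v * (1 / 4) - exp v * cos eta)) = ((exp (t * eta)) * RtoC (Aamp t eta v))%C.
 by rewrite -RtoC_mult -exp_plus; congr exp; ring.
rewrite [in RHS]RtoC_mult -[in RHS]Cmult_assoc sin_as_cis.
set E := RtoC _ in e1 e2 *.
have -> : (E * (mhi * (cis (t * v + (exp v * sin eta + PI / 4)) - cis (t * v - (exp v * sin eta + PI / 4)))) =
 mhi * (E * cis (t * v + (exp v * sin eta + PI / 4))) - mhi * (E * cis (t * v - (exp v * sin eta + PI / 4))))%C by ring.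
rewrite {1}e1 e2 /Ath sin_neg.
have -> : t * v + (exp v * sin eta + PI / 4) = (eta * (1 / 4) + PI / 4) + (t * v + - eta * (1 / 4) - exp v * - sin eta) by lra.
have -> : t * v - (exp v * sin eta + PI / 4) = - (eta * (1 / 4) + PI / 4) + (t * v + eta * (1 / 4) - exp v * sin eta) by lra.
by rewrite !cisD; ring.
Qed.

(** The function [4 (exp v / (1 + c exp v)) ^ (1/4)] is bounded by [4 c ^ (-1/4)]. Its derivative
    [exp (v/4) (1 + c exp v) ^ (-5/4)] dominates [exp (v/4 - exp v cos eta)], because
    [1 + x <= exp x] and [c = 4/5 cos eta]. *)
Lemma Afun_mass t eta a b : 0 < cos eta -> a <= b ->
 Cmod (CInt (Afun t eta) a b) <= 8 * (exp (- (t * eta)) * exp (- (ln (4 / 5 * cos eta) / 4))).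
Proof.
move=> c0 ab; set c := 4 / 5 * cos eta; have cc : 0 < c by pos.
pose P v := 4 * exp ((v - ln (1 + c * exp v)) / 4).
pose dP v := exp ((v - ln (1 + c * exp v)) / 4) * / (1 + c * exp v).
have pos v : 0 < 1 + c * exp v by pos.
have I : is_RInt (fun v => exp (- (t * eta)) * dP v) a b (exp (- (t * eta)) * (P b - P a)).
 apply: (is_RInt_scal dP); apply: is_RInt_primitive => // x _; rewrite /P /dP.
  auto_derive; first exact: pos.
  by rewrite /Rminus /Rdiv; field; have := pos x; lra.
 by dcont; have := pos x; lra.
apply: Rle_trans (CInt_bound (Afun_Cc t eta) ab _ I) _.
 move=> v _; rewrite Afun_mod /Aamp (_ : v * _ - t * eta - exp v * cos eta = - (t * eta) + (v * (1 / 4) - exp v * cos eta)); last by lra.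
 rewrite exp_plus; apply: Rmult_le_compat_l; first by pos.
 rewrite /dP -{2}(exp_ln (1 + c * exp v)) // -exp_Ropp -exp_plus.
 have l : ln (1 + c * exp v) <= c * exp v by have := exp_ineq1_le (ln (1 + c * exp v)); rewrite exp_ln //; lra.
 have : v * (1 / 4) - exp v * cos eta <= (v - ln (1 + c * exp v)) / 4 + - ln (1 + c * exp v) by rewrite /c in l *; lra.
 by case=> [h|->]; [apply/Rlt_le/exp_increasing | lra].
have Pa : 0 < P a by pos.
have Pb : P b <= 4 * exp (- (ln c / 4)).
 lmul.
 have : (b - ln (1 + c * exp b)) / 4 <= - (ln c / 4).
  have : ln (c * exp b) <= ln (1 + c * exp b) by apply: ln_le; have := exp_pos b; nra.
  by rewrite ln_mult ?ln_exp; pos.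
 by case=> [h|->]; [apply/Rlt_le/exp_increasing | lra].
have e0 := exp_pos (- (t * eta)); nra.
Qed.

(** Takes the place of Stirling's formula: rotation by [PI / 2 - / (1 + |t|)] in the direction of
    [t] gains [exp (- PI |t| / 2)] up to a factor 3, and the cosine, of order [/ (1 + |t|)], costs
    the power 1/4. *)
Lemma Gm_bound t : Cmod (Gm t) <= 48 * Rpower (1 + Rabs t) (1 / 4) * exp (- (Rabs t * (PI / 2))).
Proof.
have pi3 : 3 < PI by have := PI2_3_2; lra.
have t0 := Rabs_pos t.
pose d := / (1 + Rabs t); have d0 : 0 < d by pos.
have d1 : d <= 1 by rewrite -Rinv_1; apply: Rinv_le_contravar; lra.
have [sg [ssg st]] : exists sg, (sg = 1 \/ sg = -1) /\ t * sg = Rabs t.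
 case: (Rle_lt_dec 0 t) => h; first by exists 1; split; [left | rewrite Rabs_pos_eq //; ring].
 by exists (-1); split; [right | rewrite Rabs_left //; ring].
pose eta := sg * (PI / 2 - d).
have se : Rabs eta < PI / 2.
 rewrite Rabs_mult (Rabs_pos_eq (PI / 2 - d)); last by lra.
 by case: ssg => ->; rewrite ?Rabs_Ropp Rabs_R1; lra.
have ce : cos eta = sin d.
 rewrite /eta; case: ssg => ->; first by rewrite Rmult_1_l cos_shift.
 by rewrite (_ : -1 * _ = - (PI / 2 - d)) ?cos_neg ?cos_shift; ring.
have sd := @sin_ge_half d ltac:(lra).
have c0 : 0 < cos eta by lra.
have b := CIR_bound (M := 8 * _) (Gamma_rotate t se) (fun n => @Afun_mass t eta (- n) n c0 ltac:(have := pos_INR n; lra)).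
apply: Rle_trans b _.
have e1 : exp (- (t * eta)) <= 3 * exp (- (Rabs t * (PI / 2))).
 rewrite (_ : - _ = Rabs t * d + - (Rabs t * (PI / 2))); last by rewrite /eta -st; ring.
 rewrite exp_plus; apply: Rmult_le_compat_r; first by pos.
 apply: Rle_trans exp_le_3; apply: exp_le_mono.
 by apply: (Rmult_le_reg_r (1 + Rabs t)); [lra | rewrite Rmult_assoc Rinv_l; lra].
have e2 : exp (- (ln (4 / 5 * cos eta) / 4)) <= 2 * Rpower (1 + Rabs t) (1 / 4).
 rewrite -{1}(exp_ln 2); last by lra.
 rewrite -exp_plus; apply: exp_le_mono.
 have : ln (d / 16) <= ln (4 / 5 * cos eta) by apply: ln_le; lra.
 have -> : ln (d / 16) = - ln (1 + Rabs t) - 4 * ln 2.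
  rewrite ln_mult ?ln_Rinv; try by pos.
  by rewrite (_ : 16 = 2 * 2 * (2 * 2)) ?ln_mult; lra.
 lra.
have p1 := exp_pos (- (t * eta)); have p2 := exp_pos (- (ln (4 / 5 * cos eta) / 4)).
nra.
Qed.

Lemma Seta_bound eta t : 0 <= eta <= PI / 2 -> Cmod (Seta eta t) <= exp (Rabs t * (PI / 2)).
Proof.
move=> he; rewrite Cmod_mult.
have -> : Cmod mhi = / 2.
 rewrite /Cmod (_ : 0 * _ + - / 2 * (- / 2 * 1) = / 2 * / 2); last by lra.
 by rewrite sqrt_square; lra.
have t0 := Rabs_pos t.
have b x : Rabs x = Rabs t -> exp (x * eta) <= exp (Rabs t * (PI / 2)).
 move=> hx; apply: exp_le_mono; apply: Rle_trans (Rle_abs _) _; rewrite Rabs_mult (Rabs_pos_eq eta); last by lra.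
 nra.
have := Cmod_triangle ((exp (- (t * eta))) * cis (eta * (1 / 4) + PI / 4))%C (- ((exp (t * eta)) * cis (- (eta * (1 / 4) + PI / 4))))%C.
rewrite Cmod_opp !Cmod_mult !Cmod_cis !Cmod_R !(Rabs_pos_eq (exp _)); try by pos.
have := b t erefl; have := b (- t) (Rabs_Ropp t); rewrite (_ : - t * eta = - (t * eta)); last by lra.
rewrite -/(Cminus _ _); lra.
Qed.

Lemma GmS_bound eta t : 0 <= eta <= PI / 2 -> Cmod (Gm t * Seta eta t) <= 48 * Rpower (1 + Rabs t) (1 / 4).
Proof.
move=> he; rewrite Cmod_mult; have := Gm_bound t; have := Seta_bound t he.
have g0 := Cmod_ge_0 (Gm t); have s0 := Cmod_ge_0 (Seta eta t) => h1 h2.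
have := Rmult_le_compat _ _ _ _ g0 s0 h2 h1.
by rewrite Rmult_assoc -exp_plus Rplus_opp_l exp_0 Rmult_1_r.
Qed.

(** * Complex integrals with a parameter *)

Definition C2 (f : R -> R -> C) : Prop := forall x y,
 continuity_2d_pt (fun u v => Re (f u v)) x y /\ continuity_2d_pt (fun u v => Im (f u v)) x y.

Lemma C2_mult (f g : R -> R -> C) : C2 f -> C2 g -> C2 (fun u v => f u v * g u v)%C.
Proof.
move=> hf hg x y; have [f1 f2] := hf x y; have [g1 g2] := hg x y; split.
 exact: (continuity_2d_pt_minus _ _ _ _ (continuity_2d_pt_mult _ _ _ _ f1 g1) (continuity_2d_pt_mult _ _ _ _ f2 g2)).
exact: (continuity_2d_pt_plus _ _ _ _ (continuity_2d_pt_mult _ _ _ _ f1 g2) (continuity_2d_pt_mult _ _ _ _ f2 g1)).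
Qed.

Lemma C2_fst f : Cc f -> C2 (fun u _ => f u).
Proof.
move=> cf x y; split.
 by apply: (@continuity_2d_of_continuous (fun t => Re (f t)) _) => [z|]; [have [] := cf z | exact: continuity_2d_pt_id1].
by apply: (@continuity_2d_of_continuous (fun t => Im (f t)) _) => [z|]; [have [] := cf z | exact: continuity_2d_pt_id1].
Qed.

Lemma C2_snd f : Cc f -> C2 (fun _ v => f v).
Proof. by move=> cf x y; have [h1 h2] := C2_fst cf y x; split; apply: swap_2d. Qed.

Lemma C2_cis (h : R -> R -> R) : (forall x y, continuity_2d_pt h x y) -> C2 (fun u v => cis (h u v)).
Proof.
move=> ch x y; split; first by apply: (@continuity_2d_of_continuous cos h); [exact: continuous_cos | exact: ch].
by apply: (@continuity_2d_of_continuous sin h); [exact: continuous_sin | exact: ch].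
Qed.

Lemma C2_int (f : R -> R -> C) a b : a <= b -> C2 f -> Cc (fun s => CInt (fun x => f x s) a b).
Proof.
move=> ab cf t; split.
 by apply: (@RInt_param_continuous _) => // x y; have [] := cf x y.
by apply: (@RInt_param_continuous _) => // x y; have [] := cf x y.
Qed.

Lemma C2_fubini (f : R -> R -> C) a b c d : a <= b -> C2 f ->
 CInt (fun x => CInt (f x) c d) a b = CInt (fun t => CInt (fun x => f x t) a b) c d.
Proof.
move=> ab cf; congr pair.
 by apply: (@fubini _) => // x y; have [] := cf x y.
by apply: (@fubini _) => // x y; have [] := cf x y.
Qed.

Lemma Cc_fourier K a b : a <= b -> (forall v, continuous K v) -> Cc (fun t => CInt (fun v => RtoC (K v) * cis (t * v))%C a b).
Proof.
move=> ab cK; apply: (C2_int (f := fun v t => RtoC (K v) * cis _)%C) => //; apply: C2_mult; first exact: (C2_fst (Cc_real cK)).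
by apply: C2_cis => x y; c2d.
Qed.

(** [Gm] is a uniform limit of truncated Fourier integrals. *)
Lemma Gm_Cc : Cc Gm.
Proof.
apply: Cc_unif => T eps e0; have [N hN] := @vanish_exp 32 eps e0.
exists (fun t => CInt (fun v => RtoC (Aamp 0 0 v) * cis (t * v))%C (- N) N).
 apply: Cc_fourier; first by have := pos_INR N; lra.
 by move=> v; apply: ex_derive_continuous; rewrite /Aamp; auto_derive.
move=> t _; have c0 : 0 < cos 0 by rewrite cos_0; lra.
have [l hl tl] := CIR_exp (Afun_Cc t 0) (fun v => Afun_decay t v c0).
rewrite /Gm (CIR_unique (Gamma_int_CIR t) hl) -Cmod_opp.
have -> : (- (l - CInt (fun v => RtoC (Aamp 0 0 v) * cis (t * v)) (- N) N) = CInt (Afun t 0) (- N) N - l)%C.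
 rewrite (CInt_ext (f := Afun t 0) (g := fun v => RtoC (Aamp 0 0 v) * cis (t * v))%C); first by ring.
 move=> v _; rewrite AfunE /Ath sin_0; congr ((exp _) * cis _)%C; ring.
apply: Rle_trans (tl N (- N) N ltac:(lra) ltac:(lra)) _.
by have := hN N (leqnn N); rewrite Rmult_0_r Ropp_0 exp_0 cos_0; lra.
Qed.

Lemma Seta_Cc eta : Cc (Seta eta).
Proof.
apply: Cc_mult; first exact: Cc_const.
apply: (Cc_ext (f := fun t => (exp (- (t * eta))) * cis (eta * (1 / 4) + PI / 4) + RtoC (-1) * ((exp (t * eta)) * cis (- (eta * (1 / 4) + PI / 4))))%C).
 by move=> t; ring.
apply: Cc_plus.
 by apply: Cc_mult; [apply: Cc_real => v; dcont | exact: Cc_const].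
apply: Cc_mult; first exact: Cc_const.
by apply: Cc_mult; [apply: Cc_real => v; dcont | exact: Cc_const].
Qed.

(** * The zeta factor *)

(** The inverse of [1/2 - 2 i t] ([zinvE]), the polar factor of [zeta_approx]. *)
Definition zinv (t : R) : C := (/ 2 / (1 / 4 + 4 * (t * t)), 2 * t / (1 / 4 + 4 * (t * t))).

Lemma zinv_den t : 0 < 1 / 4 + 4 * (t * t).
Proof. nra. Qed.

Lemma zinvE t : (zinv t * (/ 2, - (2 * t))%R)%C = RtoC 1.
Proof. by rewrite /Cmult /=; have h := zinv_den t; congr pair; field; lra. Qed.

Lemma zinv_Cc : Cc zinv.
Proof. by move=> t; split; apply: ex_derive_continuous; rewrite /=; auto_derive; have := zinv_den t; lra. Qed.

Lemma zinv_bound t : Cmod (zinv t) <= 4.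
Proof.
have h := zinv_den t; apply: Rle_trans (Cmod_le_abs _) _.
rewrite Rabs_div; last by lra.
rewrite (Rabs_div _); last by lra.
rewrite (Rabs_pos_eq (/ 2)) ?(Rabs_pos_eq (1 / 4 + _)) ?Rabs_mult; try lra.
rewrite (Rabs_pos_eq 2); last by lra.
have tt : t * t = Rabs t * Rabs t by rewrite -Rabs_mult Rabs_pos_eq //; nra.
apply: (Rmult_le_reg_r (1 / 4 + 4 * (t * t))) => //.
rewrite Rmult_plus_distr_r !Rmult_assoc Rinv_l; last by lra.
nra.
Qed.

(* the integrand [exp (r (1/2 - 2 i t))] *)
Definition pw (t r : R) : C := (RtoC (exp (r * / 2)) * cis (- (2 * t) * r))%C.

Lemma pw_Cc t : Cc (pw t).
Proof.
apply: Cc_mult; first by apply: Cc_real => r; dcont.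
by apply: Cc_cis => r; dcont.
Qed.

Lemma pw_prim t a b : a <= b -> CInt (pw t) a b = (zinv t * (pw t b - pw t a))%C.
Proof.
move=> ab; have h := zinv_den t; rewrite /CInt; have e (p : C -> R) (F : R -> R) : (forall x, a <= x <= b -> is_derive F x (p (pw t x))) -> (forall x, continuous (fun x => p (pw t x)) x) -> RInt (fun x => p (pw t x)) a b = F b - F a.
 by move=> d c; apply: is_RInt_unique; apply: is_RInt_primitive => // x _.
rewrite (e Re (fun r => Re (zinv t * pw t r)%C)); first last.
- by move=> x; have [] := pw_Cc t x.
- by move=> x _; rewrite /=; auto_derive => //; field; lra.
rewrite (e Im (fun r => Im (zinv t * pw t r)%C)); first last.
- by move=> x; have [] := pw_Cc t x.
- by move=> x _; rewrite /=; auto_derive => //; field; lra.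
have -> : (zinv t * (pw t b - pw t a) = zinv t * pw t b - zinv t * pw t a)%C by ring.
pos.
Qed.

(** The argument [2 s - 1] of zeta for [s = 3/4 + i t]; it runs over the critical line. *)
Definition zs (t : R) : C := (1 / 2, 2 * t).

Lemma Rcpow_neg t x : Rcpow x (- zs t)%C = (RtoC (exp (- (ln x * / 2))) * cis (- (2 * t) * ln x))%C.
Proof.
have e1 : - (1 / 2) * ln x - - (2 * t) * 0 = - (ln x * / 2) by lra.
have e2 : - (1 / 2) * 0 + - (2 * t) * ln x = - (2 * t) * ln x by lra.
by rewrite /Rcpow /Cexp /Cmult /= e1 e2; congr pair; ring.
Qed.

Lemma Rcpow_one t x : (Rcpow x (1 - zs t) / (1 - zs t))%C = (zinv t * pw t (ln x))%C.
Proof.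
have -> : Rcpow x (1 - zs t)%C = pw t (ln x).
 rewrite /Rcpow /Cexp /pw /Cmult /=; congr pair.
  rewrite (_ : _ * ln x - _ * 0 = ln x * / 2); last by lra.
  by rewrite (_ : _ * 0 + _ * ln x = - (2 * t) * ln x); ring.
 rewrite (_ : _ * ln x - _ * 0 = ln x * / 2); last by lra.
 by rewrite (_ : _ * 0 + _ * ln x = - (2 * t) * ln x); ring.
have e : (1 - zs t = (/ 2, - (2 * t))%R)%C by rewrite /zs /Cminus /Cplus /Copp /=; congr pair; field.
have nz : (1 - zs t)%C <> RtoC 0 by rewrite e => /(f_equal Re) /=; lra.
have h : (zinv t * (1 - zs t) = RtoC 1)%C by rewrite e zinvE.
rewrite /Cdiv; move: nz h; set w := (1 - zs t)%C => nz h; rewrite -{1}(Cmult_1_l (pw t (ln x))) -h.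
rewrite (_ : (zinv t * w * pw t (ln x) * / w = zinv t * pw t (ln x) * (w * / w))%C); last by ring.
by rewrite Cinv_r //; ring.
Qed.

Lemma zeta_approxE t N : zeta_approx (zs t) N =
 (\big[Cplus/RtoC 0]_(0 <= n < N.+1) (RtoC (exp (- (ln n.+1 * / 2))) * cis (- (2 * t) * ln n.+1)) - zinv t * pw t (ln N.+1))%C.
Proof.
rewrite /zeta_approx Rcpow_one; congr (_ - _)%C.
elim: N => [|N IH]; first by rewrite sum_O big_nat1 Rcpow_neg.
by rewrite sum_Sn IH [RHS]big_nat_recr //= Rcpow_neg.
Qed.

Lemma cis_lip x y : Cmod (cis x - cis y) <= 2 * Rabs (x - y).
Proof.
apply: Rle_trans (Cmod_le_abs _) _; rewrite /=.
by have := cos_lipschitz x y; have := sin_lipschitz x y; rewrite /Rminus; lra.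
Qed.

(** In the variable [r = ln x] the increment is the integral, over one unit step of [x], of the
    difference between the new term and [x ^ (- zs t)]; hence the exponent 3/2. *)
Lemma zeta_step t N :
 Cmod (zeta_approx (zs t) N.+1 - zeta_approx (zs t) N) <= 2 * (1 + 4 * Rabs t) * / (N.+1 * sqrt N.+1).
Proof.
rewrite !zeta_approxE [X in (X - _ - _)%C]big_nat_recr //=.
set S := \big[_/_]_(_ <= _ < _) _; set a := ln N.+1; set b := ln N.+2.
have n1 : 0 < N.+1 by exact: INR_S1.
have e2 : INR N.+2 = N.+1 + 1 by pos.
have ab : a <= b by apply: ln_le; lra.
have ea : exp a = N.+1 by rewrite exp_ln.
have eb : exp b = N.+1 + 1 by rewrite exp_ln; lra.
have dab : b - a <= / INR N.+1.
 rewrite /a /b (_ : ln N.+2 = ln N.+1 + ln (1 + / N.+1)); last first.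
  by rewrite -ln_mult ?e2; [congr ln; field; lra | lra | have := Rinv_0_lt_compat _ n1; lra].
 have p : 0 < 1 + / N.+1 by pos.
 by have := exp_ineq1_le (ln (1 + / N.+1)); rewrite exp_ln; lra.
set u := (RtoC _ * cis _)%C.
have -> : (S + u - zinv t * pw t b - (S - zinv t * pw t a) = u - zinv t * (pw t b - pw t a))%C by ring.
rewrite -pw_prim //.
have cu : Cc (fun r => u * (exp r))%C by apply: Cc_mult; [exact: Cc_const | apply: Cc_real => r; exact: continuous_exp].
have -> : u = CInt (fun r => u * (exp r))%C a b.
 rewrite CInt_scal; last by apply: Cc_real => r; exact: continuous_exp.
 have -> : CInt (fun r => (exp r)) a b = RtoC 1; last by ring.
 congr pair; last by rewrite RInt_const /scal /= /mult /= Rmult_0_r.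
 apply: is_RInt_unique; have -> : 1 = exp b - exp a by lra.
 by apply: is_RInt_primitive => // x _; [exact: is_derive_exp | exact: continuous_exp].
rewrite -CInt_minus //; last exact: pw_Cc.
have sa : exp (- (a * / 2)) = / sqrt N.+1.
 rewrite exp_Ropp; congr Rinv; rewrite -ea.
 rewrite -(sqrt_square (exp _)); last by pos.
 by rewrite -exp_plus; congr sqrt; congr exp; field.
set M := (1 + 4 * Rabs t) * (/ sqrt N.+1 * / N.+1).
have I : is_RInt (fun r => M * exp r) a b (M * (exp b - exp a)).
 by apply: (is_RInt_scal exp); apply: is_RInt_primitive => // x _; [exact: is_derive_exp | exact: continuous_exp].
apply: Rle_trans (CInt_bound (Cc_ext _ (Cc_plus cu (Cc_mult (Cc_const (RtoC (-1))) (pw_Cc t)))) ab _ I) _.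
- by move=> r; ring.
- move=> r hr.
 have -> : pw t r = (((exp (- (r * / 2))) * cis (- (2 * t) * r)) * (exp r))%C.
  rewrite /pw (_ : exp _ = exp (- (r * / 2)) * exp r); last by rewrite -exp_plus; congr exp; field.
  by rewrite RtoC_mult; ring.
 set w := (RtoC _ * cis _)%C.
 have -> : (u * (exp r) - w * (exp r) = (u - w) * (exp r))%C by ring.
 rewrite Cmod_mult Cmod_R (Rabs_pos_eq _); last by pos.
 apply: Rmult_le_compat_r; first by pos.
 have -> : (u - w = (RtoC (exp (- (b * / 2)) - exp (- (r * / 2)))) * cis (- (2 * t) * b) + (exp (- (r * / 2))) * (cis (- (2 * t) * b) - cis (- (2 * t) * r)))%C.
  by rewrite /u /w RtoC_minus; ring.
 Ctri; rewrite !Cmod_mult Cmod_cis !Cmod_R.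
 have er : exp (- (r * / 2)) <= / sqrt N.+1 by rewrite -sa; apply: exp_le_mono; lra.
 have er0 := exp_pos (- (r * / 2)).
 have d1 : Rabs (exp (- (b * / 2)) - exp (- (r * / 2))) <= / sqrt N.+1 * / INR N.+1.
  have h1 : exp (- (b * / 2)) <= exp (- (r * / 2)) by apply: exp_le_mono; lra.
  rewrite Rabs_left1; last by lra.
  have h2 : exp (- (b * / 2)) = exp (- (r * / 2)) * exp (- ((b - r) * / 2)) by rewrite -exp_plus; congr exp; ring.
  have h3 := exp_ineq1_le (- ((b - r) * / 2)).
  nra.
 have d2 : exp (- (r * / 2)) * Cmod (cis (- (2 * t) * b) - cis (- (2 * t) * r)) <= / sqrt N.+1 * (4 * Rabs t * / N.+1).
  apply: Rmult_le_compat; [lra | exact: Cmod_ge_0 | lra |].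
  apply: Rle_trans (cis_lip _ _) _.
  rewrite (_ : - _ * b - - _ * r = - (2 * (t * (b - r)))); last by lra.
  rewrite Rabs_Ropp !Rabs_mult (Rabs_pos_eq 2) ?(Rabs_pos_eq (b - r)); try lra.
  have := Rmult_le_compat_l _ _ _ (Rabs_pos t) (_ : b - r <= / N.+1); lra.
 by rewrite (Rabs_pos_eq (exp (- _))); rewrite /M; lra.
rewrite /M ea eb Rinv_mult; apply: Req_le; ring.
Qed.

Lemma inv_sqrt3_step m : / (m.+2 * sqrt m.+2) <= 2 / sqrt m.+1 - 2 / sqrt m.+2.
Proof.
have b0 := INR_S1 m; have e : INR m.+2 = m.+1 + 1 by pos.
set u := sqrt m.+1; set v := sqrt m.+2.
have u0 : 0 < u by pos.
have u2 : u * u = m.+1 by apply: sqrt_sqrt; lra.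
have v2 : v * v = m.+2 by apply: sqrt_sqrt; lra.
have uv : u <= v by mon.
rewrite -v2 (_ : 2 / u - 2 / v = 2 * (v - u) / (u * v)); last by field; lra.
apply: (Rmult_le_reg_r (v * v * v * u)); first by pos.
have -> : / (v * v * v) * (v * v * v * u) = u by field; lra.
have -> : 2 * (v - u) / (u * v) * (v * v * v * u) = 2 * (v - u) * (v * v) by field; lra.
nra.
Qed.

Lemma vanish_sqrt K : vanish (fun n => K / sqrt n).
Proof.
move=> eps e0; pose x := (Rabs K / eps + 1).
have x0 : 1 <= x by rewrite /x; have : 0 <= Rabs K / eps by [apply: Rdiv_le_0_compat => //; exact: Rabs_pos]; lra.
have [N [N1 _]] := @nat_ceil (x * x) ltac:(nra).
exists N => n /leqINR hn; have sn : x <= sqrt n.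
 by rewrite -(sqrt_square x); mon.
apply: (Rle_trans _ _).
 by apply: Rmult_le_compat_r; [apply/Rlt_le/Rinv_0_lt_compat; lra | exact: Rle_abs].
apply: (Rmult_le_reg_r (sqrt n)); first by lra.
rewrite Rmult_assoc Rinv_l; last by lra.
have : Rabs K / eps * eps = Rabs K by field; lra.
rewrite /x in sn; nra.
Qed.

Lemma zeta_rate t N : (0 < N)%N -> Cmod (zeta_approx (zs t) N - zeta (zs t)) <= 4 * (1 + 4 * Rabs t) / sqrt N.
Proof.
set B := 2 * (1 + 4 * Rabs t); have B0 : 0 < B by rewrite /B; have := Rabs_pos t; lra.
have step n m : (1 <= n)%N -> (n <= m)%N -> Cmod (zeta_approx (zs t) m - zeta_approx (zs t) n) <= 2 * B / sqrt n.
 case: n => // n _ nm.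
 suff : Cmod (zeta_approx (zs t) m - zeta_approx (zs t) n.+1) <= B * (2 / sqrt n.+1 - 2 / sqrt m).
  have m0 : 0 < m by apply: INR_gt0; apply: leq_trans nm.
  have := Rinv_0_lt_compat _ (sqrt_lt_R0 _ m0); nra.
 have := subnKC nm; move: (m - n.+1)%N => k <-; elim: k => [|k IH].
  by rewrite addn0 (_ : (_ - _ = RtoC 0)%C) ?Cmod_0; [lra | ring].
 rewrite addnS; have s := zeta_step t (n.+1 + k); rewrite -/B in s.
 have -> : (zeta_approx (zs t) (n.+1 + k).+1 - zeta_approx (zs t) n.+1 = (zeta_approx (zs t) (n.+1 + k).+1 - zeta_approx (zs t) (n.+1 + k)) + (zeta_approx (zs t) (n.+1 + k) - zeta_approx (zs t) n.+1))%C by ring.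
 Ctri; have := inv_sqrt3_step (n + k); rewrite -addSn => s3.
 nra.
have [l hl] := C_seq_limit (@vanish_sqrt _) step.
have ez : zeta (zs t) = l.
 refine (iota_filterlim_locally (V := C_R_CompleteNormedModule) (F := eventually) _ l _).
 move=> P [eps hP]; have e0 := cond_pos eps; have [M hM] := @vanish_sqrt (2 * B) (eps / 2) ltac:(lra).
 exists (M.+1) => n /leP hn; apply: hP.
 have hc := hl n ltac:(by apply: leq_trans hn); have := hM n (ltnW hn) => hv.
 split.
  by apply: (Rle_lt_trans _ _); [exact: (Rabs_Re_le (zeta_approx (zs t) n - l)%C) | lra].
 by apply: (Rle_lt_trans _ _); [exact: (Rabs_Im_le (zeta_approx (zs t) n - l)%C) | lra].
move=> N0; rewrite ez; apply: Rle_trans (hl N N0) _; rewrite /B; apply: Req_le; rewrite /Rdiv; ring.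
Qed.

Lemma zeta_approx_trivial t N : Cmod (zeta_approx (zs t) N) <= 6 * sqrt N.+1.
Proof.
rewrite zeta_approxE; Ctri; rewrite Cmod_opp Cmod_mult.
have sq x : 0 < x -> exp (ln x * / 2) = sqrt x.
 move=> x0; rewrite -(sqrt_square (exp _)); last by pos.
 by rewrite -exp_plus (_ : ln x * / 2 + ln x * / 2 = ln x) ?exp_ln //; field.
have pwm : Cmod (pw t (ln N.+1)) = sqrt N.+1.
 by rewrite Cmod_mult Cmod_cis Cmod_R Rmult_1_r sq ?Rabs_pos_eq //; [exact: sqrt_pos | exact: INR_S1].
have s0 := sqrt_pos N.+1; have zb := zinv_bound t.
suff : Cmod (\big[Cplus/RtoC 0]_(0 <= n < N.+1) ((exp (- (ln n.+1 * / 2))) * cis (- (2 * t) * ln n.+1))%C) <= 2 * sqrt N.+1 by nra.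
apply: Rle_trans (Cmod_sum _ _ _) _.
elim: N {pwm s0} => [|N IH].
 rewrite big_nat1 Cmod_mult Cmod_cis Cmod_R ln_1 Rmult_0_l Ropp_0 exp_0 Rabs_R1 sqrt_1; lra.
rewrite big_nat_recr //= Cmod_mult Cmod_cis Cmod_R exp_Ropp sq; last exact: INR_S1.
have b0 := INR_S1 N; have e : INR N.+2 = N.+1 + 1 by pos.
have v0 : 0 < sqrt N.+2 by pos.
rewrite Rabs_pos_eq; last by pos.
move: IH v0; set u := sqrt N.+1; set v := sqrt N.+2 => IH v0.
have u2 : u * u = N.+1 by apply: sqrt_sqrt; lra.
have v2 : v * v = N.+2 by apply: sqrt_sqrt; lra.
suff : / v <= 2 * v - 2 * u by lra.
apply: (Rmult_le_reg_r v) => //; rewrite Rinv_l; nra.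
Qed.

(** Beyond [N = 1 + |t|] the rate of convergence gives the bound, before it the trivial estimate
    does. Uniformity in [N] provides the majorant for the passage to the limit in
    [zeta_transform]. *)
Lemma zeta_bounds t : Cmod (zeta (zs t)) <= 40 * sqrt (1 + Rabs t) /\
 forall N : nat, (0 < N)%N -> Cmod (zeta_approx (zs t) N) <= 80 * sqrt (1 + Rabs t).
Proof.
have t0 := Rabs_pos t; set T := 1 + Rabs t; have T1 : 1 <= T by rewrite /T; lra.
set s := sqrt T; have s2 : s * s = T by apply: sqrt_sqrt; lra.
have s1 : 1 <= s by rewrite /s -sqrt_1; apply: sqrt_le_1_alt.
have bz : Cmod (zeta (zs t)) <= 40 * s.
 have [N [N1 N2]] := @nat_ceil T ltac:(lra).
 have N0 : (0 < N)%N by apply/ltP/INR_lt; rewrite -[INR 0]/0; lra.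
 have r := zeta_rate t N0; have tr := zeta_approx_trivial t N.
 have q1 : sqrt N.+1 <= 2 * s.
  by rewrite -(sqrt_square (2 * s)); [apply: sqrt_le_1_alt; rewrite S_INR; nra | lra].
 have q2 : s <= sqrt N by mon.
 have q3 : 4 * (1 + 4 * Rabs t) / sqrt N <= 16 * s.
  apply: (Rmult_le_reg_r (sqrt N)); first by lra.
  rewrite /Rdiv Rmult_assoc Rinv_l; last by lra.
  rewrite /T in s2; nra.
 have -> : zeta (zs t) = (zeta_approx (zs t) N - (zeta_approx (zs t) N - zeta (zs t)))%C by ring.
 by Ctri; rewrite Cmod_opp; lra.
split=> // N N0.
case: (Rle_lt_dec T N) => h.
 have r := zeta_rate t N0.
 have q2 : s <= sqrt N by mon.
 have q3 : 4 * (1 + 4 * Rabs t) / sqrt N <= 16 * s.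
  apply: (Rmult_le_reg_r (sqrt N)); first by lra.
  rewrite /Rdiv Rmult_assoc Rinv_l; last by lra.
  rewrite /T in s2; nra.
 have -> : zeta_approx (zs t) N = (zeta (zs t) + (zeta_approx (zs t) N - zeta (zs t)))%C by ring.
 by Ctri; lra.
apply: Rle_trans (zeta_approx_trivial t N) _.
have : sqrt N.+1 <= 2 * s by rewrite -(sqrt_square (2 * s)); [apply: sqrt_le_1_alt; rewrite S_INR; nra | lra].
lra.
Qed.

Lemma Cc_big N (F : nat -> R -> C) : (forall n, Cc (F n)) -> Cc (fun t => \big[Cplus/RtoC 0]_(0 <= n < N) F n t)%C.
Proof.
move=> h; elim: N => [|N IH].
 by apply: (Cc_ext (f := fun _ => RtoC 0)) => ?; [rewrite big_geq | exact: Cc_const].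
by apply: (Cc_ext (f := fun t => \big[Cplus/RtoC 0]_(0 <= n < N) F n t + F N t)%C) => ?; [rewrite big_nat_recr | apply: Cc_plus].
Qed.

Lemma pw_Cc2 r : Cc (fun t => pw t r).
Proof.
apply: Cc_mult; first exact: Cc_const.
by apply: Cc_cis => t; dcont.
Qed.

Lemma zeta_approx_Cc N : Cc (fun t => zeta_approx (zs t) N).
Proof.
apply: (Cc_ext (f := fun t => \big[Cplus/RtoC 0]_(0 <= n < N.+1) ((exp (- (ln n.+1 * / 2))) * cis (- (2 * t) * ln n.+1)) + RtoC (-1) * (zinv t * pw t (ln N.+1)))%C).
 by move=> t; rewrite zeta_approxE; ring.
apply: Cc_plus.
 apply: Cc_big => n; apply: Cc_mult; first exact: Cc_const.
 by apply: Cc_cis => t; dcont.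
by apply: Cc_mult; [exact: Cc_const | apply: Cc_mult; [exact: zinv_Cc | exact: pw_Cc2]].
Qed.

Lemma zeta_Cc : Cc (fun t => zeta (zs t)).
Proof.
apply: Cc_unif => T eps e0; have [N hN] := @vanish_sqrt (4 * (1 + 4 * Rabs T)) eps e0.
exists (fun t => zeta_approx (zs t) N.+1); first exact: zeta_approx_Cc.
move=> t ht; rewrite -Cmod_opp (_ : (- _ = zeta_approx (zs t) N.+1 - zeta (zs t))%C); last by ring.
apply: Rle_trans (@zeta_rate t N.+1 isT) _; apply: Rle_trans (hN N.+1 (leqnSn N)).
apply: Rmult_le_compat_r; first by apply/Rlt_le/Rinv_0_lt_compat/sqrt_lt_R0; exact: INR_S1.
by have := Rle_abs T; lra.
Qed.

Lemma vanish_add a b : vanish a -> vanish b -> vanish (fun n => a n + b n).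
Proof.
move=> ha hb e e0; have [N hN] := ha (e / 2) ltac:(lra); have [M hM] := hb (e / 2) ltac:(lra).
by exists (N + M)%N => n hn; have := hN n ltac:(lia); have := hM n ltac:(lia); lra.
Qed.

Lemma le_delta x y c : (forall d, 0 < d <= 1 -> x <= y + c * d) -> x <= y.
Proof.
move=> h; apply: le_epsilon => e e0; have c0 := Rabs_pos c; have cc := Rle_abs c.
pose d := Rmin 1 (e / (Rabs c + 1)).
have p : 0 < e / (Rabs c + 1) by pos.
have d0 : 0 < d <= 1 by split; [apply: Rmin_pos; lra | exact: Rmin_l].
have := h d d0; suff : c * d <= e by lra.
apply: (Rle_trans _ ((Rabs c + 1) * (e / (Rabs c + 1)))); last by apply: Req_le; field; lra.
by apply: (Rle_trans _ ((Rabs c + 1) * d)); [nra | apply: Rmult_le_compat_l; [lra | exact: Rmin_r]].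
Qed.

Lemma C_eq_of_small z w : Cmod (z - w) <= 0 -> z = w.
Proof.
move=> h; have e : Cmod (z - w) = 0 by have := Cmod_ge_0 (z - w); lra.
by have := Cmod_eq_0 _ e => e2; rewrite -[w]Cplus_0_l -e2; ring.
Qed.

Lemma Cc_minus f g : Cc f -> Cc g -> Cc (fun t => f t - g t)%C.
Proof.
move=> cf cg; apply: (Cc_ext (f := fun t => f t + RtoC (-1) * g t)%C).
 by move=> t; ring.
by apply: Cc_plus => //; apply: Cc_mult => //; exact: Cc_const.
Qed.

Lemma CIR_close f g l m tf tg d n : Cc f -> Cc g -> 0 <= n ->
 Cmod (CInt f (- n) n - l) <= tf -> Cmod (CInt g (- n) n - m) <= tg ->
 (forall t, - n <= t <= n -> Cmod (f t - g t) <= d) -> Cmod (l - m) <= tf + tg + 4 * d * n.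
Proof.
move=> cf cg n0 hf hg hd.
have := CInt_bound_const (Cc_minus cf cg) _ hd.
rewrite CInt_minus // => h.
have -> : (l - m = - (CInt f (- n) n - l) + (CInt g (- n) n - m) + (CInt f (- n) n - CInt g (- n) n))%C by ring.
Ctri; have := Cmod_triangle (- (CInt f (- n) n - l)) (CInt g (- n) n - m); rewrite Cmod_opp.
lra.
Qed.

Lemma CIR_sym_unique f l m tau N0 : CIR f l -> vanish tau ->
 (forall n, (N0 <= n)%N -> Cmod (CInt f (- n) n - m) <= tau n) -> l = m.
Proof.
move=> h v ht; apply: C_eq_of_small; apply: le_epsilon => e e0.
have [n hn] := h (e / 2) ltac:(lra); have [k hk] := v (e / 2) ltac:(lra).
pose N := (n + k + N0)%N; have nN : n <= N by apply: leqINR; lia.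
have := hn (- N) N ltac:(lra) ltac:(lra); have := ht N ltac:(rewrite /N; lia); have := hk N ltac:(rewrite /N; lia).
set z := CInt f _ _ => h1 h2 h3.
have -> : (l - m = - (z - l) + (z - m))%C by ring.
by Ctri; rewrite Cmod_opp; lra.
Qed.

Lemma Rabs_sin_le_1 x : Rabs (sin x) <= 1.
Proof. by apply: Rabs_le; have := SIN_bound x. Qed.

(** The exponent adds 1/4 from [GmS_bound], -2 from [lor] and 1/2 from [zeta_bounds]; [dtail] is the
    corresponding tail. *)
Definition dm (t : R) : R := Rpower (1 + Rabs t) (- (5 / 4)).
Definition dtail (n : nat) : R := Rpower (1 + INR n) (- (1 / 4)).

Lemma vanish_dtail K : vanish (fun n => K * dtail n).
Proof.
move=> eps e0; have k0 := Rabs_pos K; pose x := Rabs K / eps + 1.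
have x1 : 1 <= x by rewrite /x; have : 0 <= Rabs K / eps by [apply: Rdiv_le_0_compat]; lra.
have [N [N1 _]] := @nat_ceil (x * x * (x * x)) ltac:(nra).
exists N => n /leqINR hn; rewrite /dtail Rpower_Ropp.
have hx : x <= Rpower (1 + n) (1 / 4).
 have {1}-> : x = Rpower (x * x * (x * x)) (1 / 4).
  rewrite -(Rpower_1 x) -?Rpower_plus ?Rpower_mult; try lra.
  by congr Rpower; field.
 have x2 : 1 <= x * x by nra.
 by apply: Rpower_monol; nra.
set r := Rpower _ _ in hx *.
apply: (Rmult_le_reg_r r); first by lra.
rewrite Rmult_assoc Rinv_l; last by lra.
have : Rabs K = Rabs K / eps * eps by field; lra.
have := Rle_abs K; rewrite /x in hx; nra.
Qed.

Lemma exp_mass f K (n : nat) : Cc f -> (forall v, Cmod (f v) <= K * exp (- Rabs v / 4)) -> Cmod (CInt f (- n) n) <= 64 * K.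
Proof. by move=> cf /(exp_dom cf) [_ h]; have := h n; have := Cmod_ge_0 (CInt f (- n) n); rewrite Ropp_0 /Rdiv Rmult_0_l exp_0; lra. Qed.

Lemma pow_dom f K : Cc f -> (forall t, Cmod (f t) <= K * dm t) ->
 (exists2 l, CIR f l & forall (n : nat) a b, a <= - n -> n <= b -> Cmod (CInt f a b - l) <= 8 * (4 * K * dtail n)) /\
 forall n : nat, Cmod (CInt f (- n) n) <= 4 * (4 * K * Rpower (1 + 0) (- (1 / 4))).
Proof.
move=> cf hK; have K0 : 0 <= K by have := hK 0; have := Cmod_ge_0 (f 0); have : 0 < dm 0 by [apply: exp_pos]; nra.
apply: (CIR_dom (g := fun t => K * Rpower (1 + t) (- (5 / 4))) (P := fun t => 4 * K * Rpower (1 + t) (- _))) => //; last first.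
 by move=> e /(vanish_dtail (8 * K)) [N h]; exists N => n /h; rewrite /dtail; lra.
rewrite /Rpower; split; first by dcont; lra.
 have -> : exp (- (5 / 4) * ln (1 + t)) = exp (- (1 / 4) * ln (1 + t)) * / (1 + t).
  by rewrite -{3}(exp_ln (1 + t)) -?exp_Ropp -?exp_plus; [congr exp; field | lra].
 by auto_derive; lra.
pos.
Qed.

Lemma CIR_pow f K : Cc f -> (forall t, Cmod (f t) <= K * dm t) ->
 exists2 l, CIR f l & forall (n : nat) a b, a <= - n -> n <= b -> Cmod (CInt f a b - l) <= 32 * K * dtail n.
Proof. by move=> cf /(pow_dom cf) [[l h t] _]; exists l => // n a b ha hb; have := t n a b ha hb; lra. Qed.

Lemma pow_mass f K (n : nat) : Cc f -> (forall t, Cmod (f t) <= K * dm t) -> Cmod (CInt f (- n) n) <= 64 * K.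
Proof. by move=> cf /(pow_dom cf) [_ h]; have := h n; have := Cmod_ge_0 (CInt f (- n) n); rewrite Rplus_0_r /Rpower ln_1 Rmult_0_r exp_0; lra. Qed.

Lemma Cc_comp f g : Cc f -> (forall x, continuous g x) -> Cc (fun t => f (g t)).
Proof.
move=> cf cg x; have [h1 h2] := cf (g x).
by split; [apply: (continuous_comp g (fun t => Re (f t))) | apply: (continuous_comp g (fun t => Im (f t)))].
Qed.

Definition qq (eta t : R) : C := (Gm t * Seta eta t * RtoC (lor t))%C.

Lemma qq_Cc eta : Cc (qq eta).
Proof.
apply: Cc_mult; last by apply: Cc_real; exact: lor_continuous.
by apply: Cc_mult; [exact: Gm_Cc | exact: Seta_Cc].
Qed.

Lemma cis_lin_Cc y : Cc (fun t => cis (t * y)).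
Proof. by apply: Cc_cis => t; dcont. Qed.

Lemma qq_bound eta t : 0 <= eta <= PI / 2 -> Cmod (qq eta t) <= 144 * Rpower (1 + Rabs t) (- (7 / 4)).
Proof.
move=> he; rewrite Cmod_mult Cmod_R (Rabs_pos_eq _); last by have := lor_bounds t; lra.
have t0 := Rabs_pos t; have h := GmS_bound t he.
have tt : t * t = Rabs t * Rabs t by rewrite -Rabs_mult Rabs_pos_eq //; nra.
have l : lor t <= 3 * Rpower (1 + Rabs t) (- (2)).
 rewrite Rpower_Ropp Rpower_plus Rpower_1; last by lra.
 rewrite /lor tt; apply: (Rmult_le_reg_r ((9 / 16 + Rabs t * Rabs t) * ((1 + Rabs t) * (1 + Rabs t)))); first by nra.
 have -> : / (9 / 16 + Rabs t * Rabs t) * ((9 / 16 + Rabs t * Rabs t) * ((1 + Rabs t) * (1 + Rabs t))) = (1 + Rabs t) * (1 + Rabs t) by field; nra.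
 have -> : 3 * / ((1 + Rabs t) * (1 + Rabs t)) * ((9 / 16 + Rabs t * Rabs t) * ((1 + Rabs t) * (1 + Rabs t))) = 3 * (9 / 16 + Rabs t * Rabs t) by field; nra.
 by have := Rle_0_sqr (4 / 3 * Rabs t - 3 / 4); rewrite /Rsqr; nra.
apply: (Rle_trans _ (48 * Rpower (1 + Rabs t) (1 / 4) * (3 * Rpower (1 + Rabs t) (- (2))))).
 by apply: Rmult_le_compat => //; [exact: Cmod_ge_0 | have := lor_bounds t; lra].
have -> : - (7 / 4) = 1 / 4 + - (2) by lra.
by rewrite Rpower_plus; apply: Req_le; ring.
Qed.

Lemma qq_bound_dm eta t : 0 <= eta <= PI / 2 -> Cmod (qq eta t) <= 144 * dm t.
Proof.
move=> he; apply: Rle_trans (qq_bound t he) _; lmul.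
by apply: Rpower_mono_exp; [have := Rabs_pos t; lra | lra].
Qed.

Lemma cos_eta eta : 0 <= eta < PI / 2 -> 0 < cos eta <= 1.
Proof. split; [apply: cos_gt_0; lra | have := COS_bound eta; lra]. Qed.

Lemma Keta_decay eta v : 0 <= eta < PI / 2 -> Rabs (Keta eta v) <= / cos eta * exp (- Rabs v / 4).
Proof.
move=> he; rewrite Rabs_mult (Rabs_pos_eq _); last by pos.
have := exp_decay v (cos_eta he); have := Rabs_sin_le_1 (exp v * sin eta + PI / 4).
by have := exp_pos (v * (1 / 4) - exp v * cos eta); nra.
Qed.

Definition Ck (y : R) : R := 4 / 3 * PI * exp (3 / 4 * Rabs y).

Lemma Ketakap_decay eta y v : 0 <= eta <= PI / 2 -> Rabs (Keta eta v * kap (v + y)) <= Ck y * exp (- Rabs v / 4).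
Proof.
move=> he; have k0 : 0 <= kap (v + y) by pos.
rewrite Rabs_mult (Rabs_pos_eq (kap _)) // Rabs_mult (Rabs_pos_eq _); last by pos.
have c0 : 0 <= cos eta by apply: cos_ge_0; lra.
have s := Rabs_sin_le_1 (exp v * sin eta + PI / 4); have s0 := Rabs_pos _.
have e : exp (v * (1 / 4) - exp v * cos eta) * exp (- (3 / 4) * Rabs (v + y)) <= exp (3 / 4 * Rabs y) * exp (- Rabs v / 4).
 rewrite -!exp_plus; apply: exp_le_mono; have := exp_pos v => ev.
 have : 0 <= exp v * cos eta by nra.
 have : Rabs v <= Rabs (v + y) + Rabs y by have := Rabs_triang (v + y) (- y); rewrite Rabs_Ropp (_ : v + y + - y = v) //; ring.
 by have := Rle_abs v; have := Rabs_pos v; lra.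
set a := exp _ in e *; set b := exp _ in e *; set c := Rabs _ in s s0 *.
have ab : 0 < a * b by pos.
have -> : a * c * (4 / 3 * PI * b) = (4 / 3 * PI) * (a * b * c) by lra.
by rewrite [X in _ <= X]Rmult_assoc; apply: Rmult_le_compat_l; nra.
Qed.

Lemma kap_continuous y : continuous kap y.
Proof.
apply: (continuous_mult _); first exact: continuous_const.
apply: (continuous_comp _ exp); last exact: continuous_exp.
by apply: (continuous_mult _ Rabs); [exact: continuous_const | exact: continuous_Rabs].
Qed.

Lemma Ketakap_Cc eta y : Cc (fun v => RtoC (Keta eta v * kap (v + y))).
Proof.
apply: Cc_real => v; apply: (continuous_mult _); first exact: Keta_continuous.
apply: (continuous_comp _ kap); last exact: kap_continuous.
by dcont.
Qed.

(** The convolution theorem: the Fourier integral of [Keta] is truncated at [k] and exchanged with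
    the integral over [[- T, T]], whose inner value is near [kap (v + y)] by [kernel_complex]. First
    [k] grows with [T] fixed, then [T] grows. *)
Lemma fourier_eta eta y l m : 0 <= eta < PI / 2 -> CIR (fun t => cis (t * y) * qq eta t)%C l ->
 CIR (fun v => RtoC (Keta eta v * kap (v + y))) m -> l = m.
Proof.
move=> he hl hm; have [c0 c1] := cos_eta he.
set K := / cos eta; have K0 : 0 < K by pos.
have dK v : Cmod (RtoC (Keta eta v)) <= K * exp (- Rabs v / 4) by rewrite Cmod_R; exact: Keta_decay.
have [m' hm' tm] := CIR_exp (Ketakap_Cc eta y) (fun v => ltac:(rewrite Cmod_R; apply: Ketakap_decay; lra) : Cmod (RtoC (Keta eta v * kap _)) <= Ck y * exp _).
have em := CIR_unique hm hm'; rewrite -em in tm.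
apply: (@CIR_sym_unique _ _ _ (fun n => 256 * K * dtail 0 / sqrt n) 1 hl); first exact: vanish_sqrt.
have -> : dtail 0 = 1 by rewrite /dtail (_ : INR 0 = 0) // Rplus_0_r /Rpower ln_1 Rmult_0_r exp_0.
move=> n n1; have nR := INR_gt0 n1; have n1R : 1 <= n by apply: (@leqINR 1).
set T := n in nR n1R *.
pose ker v := CInt (fun t => (lor t) * cis ((v + y) * t))%C (- T) T.
have ck : Cc ker.
 apply: (@Cc_comp (fun s => CInt (fun t => RtoC _ * cis _)%C (- T) T) _) => ?; last by dcont.
 by apply: Cc_fourier; [lra | exact: lor_continuous].
have kerb v : Cmod (ker v - (kap (v + y))) <= 4 / T.
 have := kernel_complex (v + y) n1R.
 have -> // : CInt (fun t => (lor t) * cis (t * (v + y)))%C (- T) T = CInt (fun t => (lor t) * cis ((v + y) * t))%C (- T) T.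
 by apply: CInt_ext => t _; rewrite (Rmult_comm t).
have cK : Cc (fun v => RtoC (Keta eta v)) by apply: Cc_real => v; exact: Keta_continuous.
have cl : Cc (fun t => (lor t) * cis (t * y))%C by apply: Cc_mult; [apply: Cc_real; exact: lor_continuous | exact: cis_lin_Cc].
pose Fo k t := CInt (fun v => RtoC (Keta eta v) * cis (t * v))%C (- INR k) k.
have cFo k : Cc (Fo k) by apply: Cc_fourier => [|v]; [have := pos_INR k; lra | exact: Keta_continuous].
have FoE k t : Cmod (Gm t * Seta eta t - Fo k t) <= 32 * K * exp (- k / 4).
 have b v : Cmod (RtoC (Keta eta v) * cis (t * v)) <= K * exp (- Rabs v / 4) by rewrite Cmod_mult Cmod_cis Rmult_1_r.
 have [g hg tg] := CIR_exp (Keta_Cc eta t) b.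
 rewrite (CIR_unique (Gm_fourier t he) hg) -Cmod_opp (_ : (- _ = Fo k t - g)%C); last by ring.
 by apply: tg; lra.
set X := CInt _ (- T) T.
have bound k : Cmod (X - m) <= 256 * K / T + (256 * K * T + 32 * Ck y) * exp (- INR k / 4).
 have kR := pos_INR k; set V := k in kR *.
 pose Z := CInt (fun t => (lor t) * cis (t * y) * Fo k t)%C (- T) T.
 have XZ : Cmod (X - Z) <= 256 * K * T * exp (- V / 4).
  rewrite -CInt_minus; [|by apply: Cc_mult; [exact: cis_lin_Cc | exact: qq_Cc] |by apply: Cc_mult].
  apply: Rle_trans (CInt_bound_const (M := 16 / 9 * (32 * K * exp (- V / 4))) _ _ _) _.
  - by apply: Cc_minus; apply: Cc_mult => //; [exact: cis_lin_Cc | exact: qq_Cc].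
  - lra.
  - move=> t _; rewrite (_ : (cis _ * (Gm t * Seta eta t * RtoC _) - RtoC _ * cis _ * Fo k t = (lor t) * cis (t * y) * (Gm t * Seta eta t - Fo k t))%C); last by ring.
   rewrite !Cmod_mult Cmod_cis Cmod_R; have lb := lor_bounds t; rewrite Rabs_pos_eq; last by lra.
   mon.
  have : 0 <= K * T * exp (- V / 4) by pos.
  lra.
 have cf : C2 (fun t v => (lor t) * cis (t * y) * (RtoC (Keta eta v) * cis (t * v)))%C.
  apply: C2_mult; first exact: (C2_fst cl).
  by apply: C2_mult; [exact: (C2_snd cK) | apply: C2_cis => x z; c2d].
 have ZE : Z = CInt (fun v => RtoC (Keta eta v) * ker v)%C (- V) V.
  have := C2_fubini (- V) V (ltac:(lra) : - T <= T) cf.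
  rewrite (CInt_ext (g := fun t => (lor t) * cis (t * y) * Fo k t)%C); last first.
   by move=> t _; rewrite CInt_scal //; exact: Keta_Cc.
  rewrite -/Z => ->; apply: CInt_ext => v _; rewrite -CInt_scal; last first.
   by apply: Cc_mult; [apply: Cc_real; exact: lor_continuous | apply: Cc_cis => t; dcont].
  apply: CInt_ext => t _; rewrite (_ : _ * t = t * v + t * y) ?cisD; by ring.
 have ZY : Cmod (Z - CInt (fun v => RtoC (Keta eta v * kap (v + y))) (- V) V) <= 256 * K / T.
  rewrite ZE -CInt_minus; [|exact: Cc_mult | exact: Ketakap_Cc].
  apply: Rle_trans (@exp_mass _ (4 / T * K) k _ _) _.
  - by apply: Cc_minus; [exact: Cc_mult | exact: Ketakap_Cc].
  - move=> v; rewrite RtoC_mult (_ : (RtoC _ * ker v - RtoC _ * RtoC _ = (ker v - (kap (v + y))) * RtoC (Keta eta v))%C); last by ring.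
   by rewrite Cmod_mult Rmult_assoc; apply: Rmult_le_compat => //; exact: Cmod_ge_0.
  lra.
 have Ym := tm k (- V) V ltac:(rewrite /V; lra) ltac:(rewrite /V; lra).
 set Y := CInt _ (- V) V in ZY Ym.
 have -> : (X - m = (X - Z) + (Z - Y) + (Y - m))%C by ring.
 Ctri; have := Cmod_triangle (X - Z) (Z - Y); rewrite -/V in Ym; lra.
apply: (Rle_trans _ _); first by apply: (le_vanish (vanish_exp _)) => k.
rewrite Rmult_1_r; lmul.
apply: Rinv_le_contravar; first by pos.
by rewrite -{2}(sqrt_square T); mon.
Qed.

Lemma exp_diff x y M : x <= M -> y <= M -> Rabs (exp x - exp y) <= Rabs (x - y) * exp M.
Proof.
have w a b : a <= b -> b <= M -> Rabs (exp a - exp b) <= Rabs (a - b) * exp M.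
 move=> ab bM; have h := exp_le_mono ab; rewrite !Rabs_left1; try lra.
 have e : exp a = exp b * exp (a - b) by rewrite -exp_plus; congr exp; ring.
 have := exp_ineq1_le (a - b); have := exp_le_mono bM; have := exp_pos b.
 nra.
by move=> xM yM; case: (Rle_lt_dec x y) => h; [exact: w | rewrite Rabs_minus_sym (Rabs_minus_sym x); apply: w; lra].
Qed.

Lemma eta_trig d : Rabs (sin (PI / 2 - d) - 1) <= Rabs d /\ Rabs (cos (PI / 2 - d)) <= Rabs d.
Proof.
have h1 := sin_lipschitz (PI / 2 - d) (PI / 2); have h2 := cos_lipschitz (PI / 2 - d) (PI / 2).
move: h1 h2; rewrite sin_PI2 cos_PI2 Rminus_0_r (_ : PI / 2 - d - PI / 2 = - d); last by lra.
by rewrite Rabs_Ropp.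
Qed.

Lemma Keta_conv d v n : 0 < d <= 1 -> Rabs v <= n -> Rabs (Keta (PI / 2 - d) v - Keta (PI / 2) v) <= 2 * exp (2 * n) * d.
Proof.
move=> d01 vn; have pi3 : 3 < PI by have := PI2_3_2; lra.
have [e1 e2] := eta_trig d; rewrite /Keta cos_PI2 sin_PI2 Rmult_0_r Rminus_0_r Rmult_1_r.
rewrite (Rabs_pos_eq d) in e1 e2; last by lra.
set c := cos _ in e2 *; set s := sin _ in e1 *.
have c0 : 0 <= c by apply: cos_ge_0; lra.
have ev := exp_pos v; have vn' := Rle_abs v.
have a1 : Rabs (exp (v * (1 / 4) - exp v * c) - exp (v * (1 / 4))) <= exp v * d * exp (v * (1 / 4)).
 apply: Rle_trans (@exp_diff _ _ (v * (1 / 4)) _ _) _; [nra | lra |].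
 apply: Rmult_le_compat_r; first by pos.
 rewrite (_ : v * _ - exp v * c - v * _ = - (exp v * c)); last by lra.
 by rewrite Rabs_Ropp Rabs_mult (Rabs_pos_eq _); nra.
have a2 : Rabs (sin (exp v * s + PI / 4) - sin (exp v + PI / 4)) <= exp v * d.
 apply: Rle_trans (sin_lipschitz _ _) _.
 rewrite (_ : exp v * s + PI / 4 - _ = exp v * (s - 1)); last by lra.
 by rewrite Rabs_mult (Rabs_pos_eq _); nra.
have s1 := Rabs_sin_le_1 (exp v * s + PI / 4).
set x := exp _ in a1 *; set y := exp _ in a1 *; set p := sin _ in a2 s1 *; set q := sin _ in a2 *.
have y0 : 0 < y by pos.
rewrite (_ : x * p - y * q = (x - y) * p + y * (p - q)); last by lra.
Rtri; rewrite !Rabs_mult (Rabs_pos_eq y); last by lra.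
have ee : exp v * y <= exp (2 * n) by rewrite /y -exp_plus; apply: exp_le_mono; have := Rabs_pos v; lra.
have := Rabs_pos (x - y).
nra.
Qed.

Lemma Seta_conv d t : 0 < d <= 1 -> Cmod (Seta (PI / 2 - d) t - Seta (PI / 2) t) <= (1 + Rabs t) * exp (Rabs t * (PI / 2)) * d.
Proof.
move=> d01; have pi3 : 3 < PI by have := PI2_3_2; lra.
set E := exp _; have E0 : 0 < E by pos.
have t0 := Rabs_pos t.
have ex sg : Rabs sg = 1 -> Rabs (exp (sg * (t * (PI / 2 - d))) - exp (sg * (t * (PI / 2)))) <= Rabs t * d * E /\ exp (sg * (t * (PI / 2))) <= E.
 move=> h; have st : sg * t <= Rabs t by rewrite -[Rabs t]Rmult_1_l -h -Rabs_mult; exact: Rle_abs.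
 split; last by apply: exp_le_mono; nra.
 apply: Rle_trans (@exp_diff _ _ (Rabs t * (PI / 2)) _ _) _; [nra | nra |].
 apply: Rmult_le_compat_r; first by pos.
 rewrite (_ : sg * _ - sg * _ = - (sg * (t * d))); last by lra.
 by rewrite Rabs_Ropp !Rabs_mult h (Rabs_pos_eq d); lra.
have [a1 a2] := ex (-1) ltac:(by rewrite Rabs_Ropp Rabs_R1); have [b1 b2] := ex 1 Rabs_R1.
have ci sg : Rabs sg = 1 -> Cmod (cis (sg * ((PI / 2 - d) * (1 / 4) + PI / 4)) - cis (sg * (PI / 2 * (1 / 4) + PI / 4))) <= d / 2.
 move=> h; apply: Rle_trans (cis_lip _ _) _.
 rewrite (_ : _ - _ = sg * (- (d / 4))); last by lra.
 by rewrite Rabs_mult h Rabs_Ropp Rabs_pos_eq; lra.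
have := ci (-1) ltac:(by rewrite Rabs_Ropp Rabs_R1); have := ci 1 Rabs_R1.
rewrite (_ : forall a b c : C, (a * b - a * c = a * (b - c))%C); last by move=> a b c; ring.
rewrite Cmod_mult.
have -> : Cmod mhi = / 2.
 by rewrite /Cmod (_ : 0 * _ + - / 2 * (- / 2 * 1) = / 2 * / 2) ?sqrt_square; lra.
have -> : - (t * (PI / 2 - d)) = -1 * (t * (PI / 2 - d)) by lra.
have -> : - (t * (PI / 2)) = -1 * (t * (PI / 2)) by lra.
have -> : - ((PI / 2 - d) * (1 / 4) + PI / 4) = -1 * ((PI / 2 - d) * (1 / 4) + PI / 4) by lra.
have -> : - (PI / 2 * (1 / 4) + PI / 4) = -1 * (PI / 2 * (1 / 4) + PI / 4) by lra.
rewrite !Rmult_1_l in b1 b2 *.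
set A := exp _ in a1 *; set A' := exp _ in a1 a2 *.
set B := exp _ in b1 *; set B' := exp _ in b1 b2 *.
set c := cis _; set c' := cis _.
set e := cis _; set e' := cis _ => h1 h2.
have -> : (RtoC A * c - RtoC B * e - (RtoC A' * c' - RtoC B' * e') = (RtoC (A - A') * c + RtoC A' * (c - c')) - (RtoC (B - B') * e + RtoC B' * (e - e')))%C.
 by rewrite !RtoC_minus; ring.
have tri z1 z2 z3 z4 : Cmod ((z1 + z2) - (z3 + z4)) <= Cmod z1 + Cmod z2 + (Cmod z3 + Cmod z4).
 Ctri; rewrite Cmod_opp; have := Cmod_triangle z1 z2; have := Cmod_triangle z3 z4; lra.
apply: (Rle_trans _ (/ 2 * (Rabs t * d * E + E * (d / 2) + (Rabs t * d * E + E * (d / 2))))); last by nra.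
lmul.
apply: Rle_trans (tri _ _ _ _) _; rewrite !Cmod_mult !Cmod_R !Cmod_cis.
have A0 : 0 < A' by pos.
have B0 : 0 < B' by pos.
rewrite (Rabs_pos_eq A') ?(Rabs_pos_eq B'); try lra.
nra.
Qed.

Lemma qq_conv d t n : 0 < d <= 1 -> Rabs t <= n -> Cmod (qq (PI / 2 - d) t - qq (PI / 2) t) <= 96 * ((1 + n) * (1 + n)) * d.
Proof.
move=> d01 tn; have t0 := Rabs_pos t.
rewrite (_ : (Gm t * Seta _ t * RtoC _ - Gm t * Seta _ t * RtoC _ = Gm t * (Seta (PI / 2 - d) t - Seta (PI / 2) t) * (lor t))%C); last by ring.
have lb := lor_bounds t; rewrite !Cmod_mult Cmod_R (Rabs_pos_eq _); last by lra.
have g := Gm_bound t; have s := @Seta_conv d t d01.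
have := Rmult_le_compat _ _ _ _ (Cmod_ge_0 _) (Cmod_ge_0 _) g s.
have -> : 48 * Rpower (1 + Rabs t) (1 / 4) * exp (- (Rabs t * (PI / 2))) * ((1 + Rabs t) * exp (Rabs t * (PI / 2)) * d) = 48 * Rpower (1 + Rabs t) (1 / 4) * (1 + Rabs t) * d * (exp (- (Rabs t * (PI / 2))) * exp (Rabs t * (PI / 2))) by lra.
rewrite -exp_plus Rplus_opp_l exp_0.
have r : Rpower (1 + Rabs t) (1 / 4) <= 1 + n.
 apply: (Rle_trans _ (Rpower _ 1)); first by apply: Rpower_mono_exp; lra.
 by rewrite Rpower_1; lra.
have r0 : 0 < Rpower (1 + Rabs t) (1 / 4) by pos.
set P := Rpower _ _ in r r0 *; set u := Cmod (Gm t) * _ => h.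
have h2 : P * (1 + Rabs t) <= (1 + n) * (1 + n) by nra.
have u0 : 0 <= u by pos.
nra.
Qed.

(** Passage to [eta = PI / 2]. Thanks to [lor] on one side and [kap] on the other, both integrals
    converge with tails uniform in [eta]; on [[- n, n]] the integrands differ by at most a multiple
    of [d = PI / 2 - eta]. *)
Lemma fourier_half y l m : CIR (fun t => cis (t * y) * qq (PI / 2) t)%C l ->
 CIR (fun v => RtoC (Keta (PI / 2) v * kap (v + y))) m -> l = m.
Proof.
move=> hl hm; have pi3 : 3 < PI by have := PI2_3_2; lra.
have cq eta : Cc (fun t => cis (t * y) * qq eta t)%C by apply: Cc_mult; [exact: cis_lin_Cc | exact: qq_Cc].
have tq eta : 0 <= eta <= PI / 2 -> exists2 l, CIR (fun t => cis (t * y) * qq eta t)%C l & forall n : nat, Cmod (CInt (fun t => cis (t * y) * qq eta t)%C (- n) n - l) <= 32 * 144 * dtail n.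
 move=> he; have [|z h1 h2] := @CIR_pow _ 144 (cq eta).
  by move=> t; rewrite Cmod_mult Cmod_cis Rmult_1_l; apply: qq_bound_dm.
 by exists z => // n; apply: h2; lra.
have tk eta : 0 <= eta <= PI / 2 -> exists2 m, CIR (fun v => RtoC (Keta eta v * kap (v + y))) m & forall n : nat, Cmod (CInt (fun v => RtoC (Keta eta v * kap (v + y))) (- n) n - m) <= 32 * Ck y * exp (- n / 4).
 move=> he; have [|z h1 h2] := @CIR_exp _ (Ck y) (Ketakap_Cc eta y).
  by move=> v; rewrite Cmod_R; apply: Ketakap_decay.
 by exists z => // n; apply: h2; lra.
have [l' hl' tl] := tq (PI / 2) ltac:(lra); have [m' hm' tm] := tk (PI / 2) ltac:(lra).
rewrite -(CIR_unique hl hl') in tl; rewrite -(CIR_unique hm hm') in tm.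
apply: C_eq_of_small.
apply: (le_vanish (vanish_add (vanish_dtail (64 * 144)) (vanish_exp (64 * Ck y)))) => n.
have nR := pos_INR n.
apply: (@le_delta _ _ (4 * (96 * ((1 + n) * (1 + n))) * n + 4 * (2 * exp (2 * n) * (4 / 3 * PI)) * n)) => d d01.
have [ld hld tld] := tq (PI / 2 - d) ltac:(lra); have [md hmd tmd] := tk (PI / 2 - d) ltac:(lra).
have e := fourier_eta (ltac:(lra) : 0 <= PI / 2 - d < PI / 2) hld hmd.
have c1 := CIR_close (d := 96 * ((1 + n) * (1 + n)) * d) (cq _) (cq _) nR (tld n) (tl n).
have c2 := CIR_close (d := 2 * exp _ * d * _) (Ketakap_Cc _ y) (Ketakap_Cc _ y) nR (tmd n) (tm n).
have {}c1 := c1 ltac:(move=> t ht; rewrite (_ : (cis _ * qq _ t - cis _ * qq _ t = cis (t * y) * (qq (PI / 2 - d) t - qq (PI / 2) t))%C); [rewrite Cmod_mult Cmod_cis Rmult_1_l; apply: qq_conv => //; apply: Rabs_le; lra | ring]).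
have {}c2 : Cmod (md - m) <= 32 * Ck y * exp (- n / 4) + 32 * Ck y * exp (- n / 4) + 4 * (2 * exp (2 * n) * d * (4 / 3 * PI)) * INR n.
 apply: c2 => v hv; rewrite -RtoC_minus Cmod_R -Rmult_minus_distr_r Rabs_mult.
 apply: Rmult_le_compat; [exact: Rabs_pos | exact: Rabs_pos | apply: Keta_conv => //; apply: Rabs_le; lra |].
 have k0 := exp_pos (- (3 / 4) * Rabs (v + y)); have k1 : exp (- (3 / 4) * Rabs (v + y)) <= 1 by rewrite -exp_0; apply: exp_le_mono; have := Rabs_pos (v + y); lra.
 by rewrite /kap Rabs_pos_eq; nra.
have -> : (l - m = - (ld - l) + (md - m))%C by rewrite e; ring.
Ctri; rewrite Cmod_opp; lra.
Qed.

(** * Evaluation of the Mellin integral *)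

(** The first term of [4 * Mdual 1 z]; by homogeneity the other terms, at [alpha], are
    [m * Phi (alpha / m ^ 2)] ([lterm_Phi]). *)
Definition Phi (z : R) : R := 4 * lterm 1 z 0.

Lemma PhiE z : Phi z = / (2 * PI) * RInt (rad WW (2 * PI)) 0 z.
Proof. by have pi0 := PI_RGT_0; rewrite /Phi /lterm !Rmult_1_r; field; lra. Qed.

Lemma Phi_derive z : is_derive Phi z (/ (2 * PI) * rad WW (2 * PI) z).
Proof.
apply: (is_derive_ext _) => [x|]; first by rewrite PhiE.
apply: is_derive_scal; apply: is_derive_RInt; last by apply: rad_continuous_all; exact: tame_WW.
by apply: filter_forall => x; apply: RInt_correct; apply: rad_ex; exact: tame_WW.
Qed.

Lemma Phi_continuous z : continuous Phi z.
Proof. by apply: ex_derive_continuous; eexists; exact: Phi_derive. Qed.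

Lemma WW_small x : Rabs (WW x) <= 2 * Rabs x.
Proof.
have [_ h _] := tame_WW; have := h x 0.
by rewrite [WW 0](_ : _ = 0) ?Rminus_0_r //; rewrite /WW sin_0 cos_0; ring.
Qed.

Lemma WW_le3 x : Rabs (WW x) <= 3.
Proof. by have [h _ _] := tame_WW. Qed.

Lemma Phi_bound3 z : 0 <= z -> Rabs (Phi z) <= z * sqrt z.
Proof.
move=> z0; have := @lterm_bound 1 z 0 z0; rewrite INR1 /Phi Rabs_mult (Rabs_pos_eq 4); last by lra.
have : 0 <= z * sqrt z by [apply: Rmult_le_pos => //; exact: sqrt_pos]; lra.
Qed.

Lemma Phi_bound1 z : 0 <= z -> Rabs (Phi z) <= 4 * sqrt z.
Proof.
move=> z0; have := @lterm_lipschitz 1 0 z 0 z0.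
have -> : lterm 0 z 0 = 0.
 rewrite /lterm (RInt_ext _ (fun _ => 0)) ?RInt_const /scal /= /mult /=; first by lra.
 by move=> x _; rewrite /rad /WW Rmult_0_r /Rdiv Rmult_0_l sin_0 cos_0; ring.
by rewrite !Rminus_0_r Rabs_R1 /Phi Rabs_mult (Rabs_pos_eq 4); lra.
Qed.

Lemma lterm_Phi alpha l : lterm 1 alpha l = l.+1 * Phi (alpha / (l.+1 * l.+1)) / 4.
Proof.
have m0 := INR_S1 l; have pi0 := PI_RGT_0; set m := l.+1 in m0 *; set q := m * m; have q0 : 0 < q by pos.
have e : lterm q alpha 0 = q * sqrt q * lterm 1 (alpha / q) 0.
 by rewrite -lterm_homogeneous //; congr lterm; field; lra.
have s : sqrt q = m by rewrite /q sqrt_square //; lra.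
have -> : lterm 1 alpha l = / q * lterm q alpha 0.
 rewrite /lterm !Rmult_1_r -/q; field; lra.
by rewrite e s /Phi; field; lra.
Qed.

(** The value at [y] of the Fourier integral of the Gamma factor ([fourier_value]). *)
Definition Aval (y : R) : R := sqrt PI * exp (- (3 / 4) * y) * Phi (2 * PI * exp y).

Lemma Phi_exp_derive v : is_derive (fun v => Phi (2 * PI * exp (- v))) v (- (sqrt (2 * PI) * exp (- (3 / 2) * v) * WW (exp v))).
Proof.
have pi0 := PI_RGT_0; have ev := exp_pos (- v); set z := 2 * PI * exp (- v).
have d : is_derive (fun v => 2 * PI * exp (- v)) v (- z) by rewrite /z; auto_derive => //; ring.
have := is_derive_comp Phi (fun v => 2 * PI * exp (- v)) v _ _ (Phi_derive z) d.
have -> // : - (sqrt (2 * PI) * exp (- (3 / 2) * v) * WW (exp v)) = - z * (/ (2 * PI) * rad WW (2 * PI) z).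
rewrite /rad (_ : 2 * PI / z = exp v); last first.
 by rewrite /z (_ : exp v = / exp (- v)); [field; lra | rewrite exp_Ropp Rinv_inv].
have -> : sqrt z = sqrt (2 * PI) * exp (- (v / 2)).
 rewrite /z sqrt_mult_alt; last by lra.
 congr (_ * _); rewrite -[RHS](sqrt_square _); last by pos.
 by rewrite -exp_plus; congr sqrt; congr exp; field.
have -> : exp (- (3 / 2) * v) = exp (- (v / 2)) * exp (- v) by rewrite -exp_plus; congr exp; field.
by rewrite /z; field; lra.
Qed.

Lemma Khalf v : Keta (PI / 2) v = exp (v * (1 / 4)) * ((sin (exp v) + cos (exp v)) / sqrt 2).
Proof.
rewrite /Keta cos_PI2 sin_PI2 Rmult_0_r Rminus_0_r Rmult_1_r sin_plus sin_PI4 cos_PI4.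
lra.
Qed.

(* Both pieces of the kernel [kap] are integrated by parts against [WW (exp v)]; the boundary terms at [v = - y] cancel. *)
Lemma kap_integral y V : Rabs y <= V ->
 Rabs (RInt (fun v => Keta (PI / 2) v * kap (v + y)) (- V) V - Aval y) <= 60 * Ck y * exp (- V / 4).
Proof.
move=> yV; have pi0 := PI_RGT_0; have pi4 := PI_4; have s2 := sqrt_lt_R0 2 ltac:(lra).
have ss : sqrt 2 * sqrt 2 = 2 by apply: sqrt_sqrt; lra.
have [y1 y2] : - V <= y /\ y <= V by split; [have := Rabs_maj2 y | have := Rle_abs y]; lra.
have [c cE] : exists c, c = 4 / 3 * PI / sqrt 2 by eexists.
have rp a x : 0 <= a -> Rabs (a * x) = a * Rabs x by move=> h; rewrite Rabs_mult Rabs_pos_eq.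
pose f v := Keta (PI / 2) v * kap (v + y).
pose P1 v := c * (exp (3 / 4 * y) * WW (exp v)).
pose P2 v := c * (exp (- (3 / 4) * y) * (exp (- (3 / 2) * v) * WW (exp v))) - sqrt PI * exp (- (3 / 4) * y) * Phi (2 * PI * exp (- v)).
have cf v : continuous f v by have [] := @Ketakap_Cc (PI / 2) y v.
have dW v : is_derive (fun v => WW (exp v)) v (exp v * (cos (exp v) + sin (exp v))) by rewrite /WW; auto_derive => //; ring.
have I1 : is_RInt f (- V) (- y) (P1 (- y) - P1 (- V)).
 apply: is_RInt_primitive => [|v hv|v _]; [lra | | exact: cf].
 have := is_derive_scal _ v c _ (is_derive_scal _ v (exp (3 / 4 * y)) _ (dW v)).
 have -> // : c * (exp (3 / 4 * y) * (exp v * (cos (exp v) + sin (exp v)))) = f v.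
 rewrite /f Khalf /kap Rabs_left1; last by lra.
 have -> : exp (- (3 / 4) * - (v + y)) = exp (3 / 4 * y) * exp (3 / 4 * v) by rewrite -exp_plus; congr exp; field.
 have -> : exp v = exp (v * (1 / 4)) * exp (3 / 4 * v) by rewrite -exp_plus; congr exp; field.
 nra.
have sp : sqrt (2 * PI) = sqrt 2 * sqrt PI by rewrite sqrt_mult_alt; lra.
have pp : sqrt PI * sqrt PI = PI by apply: sqrt_sqrt; lra.
have I2 : is_RInt f (- y) V (P2 V - P2 (- y)).
 apply: is_RInt_primitive => [|v hv|v _]; [lra | | exact: cf].
 have dE : is_derive (fun v => exp (- (3 / 2) * v)) v (- (3 / 2) * exp (- (3 / 2) * v)) by auto_derive => //; ring.
 have d1 := is_derive_scal _ v c _ (is_derive_scal _ v (exp (- (3 / 4) * y)) _ (is_derive_mult _ _ v _ _ dE (dW v) Rmult_comm)).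
 have := is_derive_minus _ _ v _ _ d1 (is_derive_scal _ v (sqrt PI * exp (- (3 / 4) * y)) _ (Phi_exp_derive v)).
 rewrite /minus /plus /opp /mult /=; set D := (X in is_derive _ _ X -> _).
 have -> // : D = f v.
 rewrite /D /f Khalf /kap Rabs_pos_eq; last by lra.
 have -> : exp (- (3 / 4) * (v + y)) = exp (- (3 / 4) * y) * exp (- (3 / 4) * v) by rewrite -exp_plus; congr exp; field.
 have e1 : exp (v * (1 / 4)) * exp (- (3 / 4) * v) = exp (- (3 / 2) * v) * exp v by rewrite -!exp_plus; congr exp; field.
 have -> : exp (v * (1 / 4)) * ((sin (exp v) + cos (exp v)) / sqrt 2) * (4 / 3 * PI * (exp (- (3 / 4) * y) * exp (- (3 / 4) * v))) = c * exp (- (3 / 4) * y) * (sin (exp v) + cos (exp v)) * (exp (v * (1 / 4)) * exp (- (3 / 4) * v)) by nra.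
 have c32 : c * (3 / 2) = sqrt PI * sqrt (2 * PI).
  rewrite (_ : sqrt PI * _ = sqrt 2 * PI); last by nra.
  rewrite (_ : sqrt 2 * PI = sqrt 2 * sqrt 2 * PI / sqrt 2); last by field; lra.
  by rewrite ss; lra.
 set E := exp (- (3 / 2) * v) in e1 *; set Ey := exp _; set w := WW _.
 rewrite e1 (_ : sqrt PI * Ey * - _ = - (sqrt PI * sqrt (2 * PI) * Ey * E * w)); last by lra.
 nra.
have I := is_RInt_Chasles _ _ _ _ _ _ I1 I2.
rewrite (is_RInt_unique _ _ _ _ I).
have e0 : P1 (- y) - P2 (- y) = Aval y.
 rewrite /P1 /P2 /Aval Ropp_involutive (_ : exp _ * _ = exp (3 / 4 * y) * WW (exp (- y))); first by lra.
 by rewrite -Rmult_assoc -exp_plus; congr (_ * _); congr exp; field.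
have -> : P1 (- y) - P1 (- V) + (P2 V - P2 (- y)) - Aval y = - P1 (- V) + P2 V by lra.
have ey sg : Rabs sg = 1 -> exp (sg * (3 / 4) * y) <= exp (3 / 4 * Rabs y).
 move=> h; apply: exp_le_mono; have : sg * y <= Rabs y by rewrite -[Rabs y]Rmult_1_l -h -Rabs_mult; exact: Rle_abs.
 lra.
have a1 := ey 1 Rabs_R1; have a2 := ey (-1) ltac:(by rewrite Rabs_Ropp Rabs_R1).
rewrite Rmult_1_l in a1; rewrite (_ : -1 * _ = - (3 / 4)) in a2; last by lra.
set B := exp (3 / 4 * Rabs y) in a1 a2.
have [v1 v2 v3] : [/\ exp (- V) <= exp (- V / 4), exp (- (3 / 2) * V) <= exp (- V / 4) & exp (- V) <= 1].
 by split; [apply: exp_le_mono; lra | apply: exp_le_mono; lra | rewrite -exp_0; apply: exp_le_mono; lra].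
set X := exp (- V / 4) in v1 v2 *.
have c0 : 0 < c <= 4 / 3 * PI.
 have : 1 <= sqrt 2 by nra.
 rewrite cE; split; first by pos.
 by rewrite -[X in _ <= X]Rmult_1_r; apply: Rmult_le_compat_l; [lra | rewrite -Rinv_1; apply: Rinv_le_contravar; lra].
have p0 := exp_pos (3 / 4 * y); have q0 := exp_pos (- (3 / 4) * y).
have b1 : Rabs (P1 (- V)) <= 4 / 3 * PI * (B * (2 * X)).
 rewrite ?rp; try lra.
 have w := WW_small (exp (- V)); rewrite (Rabs_pos_eq (exp (- V))) in w; last by pos.
 mon.
have b2 : Rabs (c * (exp (- (3 / 4) * y) * (exp (- (3 / 2) * V) * WW (exp V)))) <= 4 / 3 * PI * (B * (X * 3)).
 have e3 := exp_pos (- (3 / 2) * V); have w := WW_le3 _.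
 rewrite ?(rp _); try lra.
 mon.
have b3 : Rabs (sqrt PI * exp (- (3 / 4) * y) * Phi (2 * PI * exp (- V))) <= 2 * B * (18 * PI * X).
 have ev := exp_pos (- V); have z0 : 0 <= 2 * PI * exp (- V) by nra.
 have := Phi_bound3 z0; set z := 2 * PI * _ in z0 *.
 have sz : sqrt z <= 3 by rewrite -(sqrt_square 3); [apply: sqrt_le_1_alt; rewrite /z; nra | lra].
 move=> h; have hz : Rabs (Phi z) <= 18 * PI * X.
  apply: (Rle_trans _ (z * 3)); first by nra.
  by rewrite /z; nra.
 have sp0 := sqrt_pos PI.
 rewrite rp; last by nra.
 mon.
Rtri; rewrite Rabs_Ropp.
have t : Rabs (P2 V) <= 4 / 3 * PI * (B * (X * 3)) + 2 * B * (18 * PI * X).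
 Rtri; rewrite Rabs_Ropp; lra.
rewrite /Ck -/B; have : 0 < PI * (B * X) by pos.
lra.
Qed.

Lemma CInt_RtoC f a b : CInt (fun v => RtoC (f v)) a b = RtoC (RInt f a b).
Proof.
congr pair; rewrite RInt_const /scal /= /mult /=; ring.
Qed.

Lemma fourier_value y : CIR (fun t => cis (t * y) * qq (PI / 2) t)%C (RtoC (Aval y)) /\
 forall n : nat, Cmod (CInt (fun t => cis (t * y) * qq (PI / 2) t)%C (- n) n - RtoC (Aval y)) <= 32 * 144 * dtail n.
Proof.
have pi0 := PI_RGT_0.
have [|l hl tl] := @CIR_pow (fun t => cis _ * qq (PI / 2) t)%C 144 ltac:(by apply: Cc_mult; [exact: cis_lin_Cc | exact: qq_Cc]).
 by move=> t; rewrite Cmod_mult Cmod_cis Rmult_1_l; apply: qq_bound_dm; lra.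
have [|m hm _] := @CIR_exp _ (Ck y) (Ketakap_Cc (PI / 2) y).
 by move=> v; rewrite Cmod_R; apply: Ketakap_decay; lra.
have [N0 [hN0 _]] := nat_ceil (Rabs_pos y).
have e : m = RtoC (Aval y).
 apply: (CIR_sym_unique (tau := fun n => 60 * Ck y * exp _) (N0 := N0) hm); first exact: vanish_exp.
 by move=> n /leqINR hn; rewrite CInt_RtoC -RtoC_minus Cmod_R; apply: kap_integral; lra.
have el := fourier_half hl hm; rewrite el e in hl tl; split=> // n; apply: tl; lra.
Qed.

(** The form [x * Phi (alpha / x ^ 2) dx] in the variable [x = exp r]. *)
Definition Ha (alpha r : R) : R := exp (2 * r) * Phi (alpha * exp (- (2) * r)).

Lemma Ha_continuous alpha r : continuous (Ha alpha) r.
Proof.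
apply: (continuous_mult _); first by dcont.
apply: (continuous_comp _ Phi); last exact: Phi_continuous.
by dcont.
Qed.

Lemma sqrt_scaled_exp alpha r : 0 <= alpha -> sqrt (alpha * exp (- (2) * r)) = sqrt alpha * exp (- r).
Proof.
move=> a0; rewrite sqrt_mult_alt //; congr (_ * _); rewrite -[RHS](sqrt_square _); last by pos.
by rewrite -exp_plus; congr sqrt; congr exp; ring.
Qed.

Lemma Ha_bounds alpha r : 0 <= alpha ->
 Rabs (Ha alpha r) <= 4 * sqrt alpha * exp r /\ Rabs (Ha alpha r) <= alpha * sqrt alpha * exp (- r).
Proof.
move=> a0; have e0 := exp_pos (2 * r); have e1 := exp_pos (- (2) * r).
have z0 : 0 <= alpha * exp (- (2) * r) by nra.
rewrite Rabs_mult (Rabs_pos_eq _); last by lra.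
have h1 := Phi_bound1 z0; have h3 := Phi_bound3 z0; rewrite (sqrt_scaled_exp r a0) in h1 h3; split.
 apply: Rle_trans (Rmult_le_compat_l _ _ _ (Rlt_le _ _ e0) h1) _; apply: Req_le.
 by rewrite (_ : exp r = exp (2 * r) * exp (- r)); [ring | rewrite -exp_plus; congr exp; ring].
apply: Rle_trans (Rmult_le_compat_l _ _ _ (Rlt_le _ _ e0) h3) _; apply: Req_le.
have e : exp (2 * r) * exp (- (2) * r) = 1 by rewrite -exp_plus -[RHS]exp_0; congr exp; ring.
by rewrite (_ : exp _ * _ = exp (2 * r) * exp (- (2) * r) * (alpha * sqrt alpha * exp (- r))); [rewrite e; ring | ring].
Qed.

Definition KH (alpha : R) : R := 4 * sqrt alpha + alpha * sqrt alpha.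

Lemma Ha_bound alpha r : 0 <= alpha -> Rabs (Ha alpha r) <= KH alpha * exp (- Rabs r / 4).
Proof.
move=> a0; have [h1 h2] := Ha_bounds r a0; have s0 := sqrt_pos alpha; have p : 0 <= alpha * sqrt alpha by nra.
have ex : exp r <= exp (- Rabs r / 4) \/ exp (- r) <= exp (- Rabs r / 4).
 case: (Rle_lt_dec 0 r) => h; [right | left]; apply: exp_le_mono; [rewrite Rabs_pos_eq | rewrite Rabs_left]; lra.
have e0 := exp_pos (- Rabs r / 4); rewrite /KH; case: ex => ex.
 nra.
nra.
Qed.

Lemma Ha_Cc alpha : Cc (fun r => RtoC (Ha alpha r)).
Proof. by apply: Cc_real => r; exact: Ha_continuous. Qed.

Lemma CInt_big Q (F : nat -> R -> C) N a b : Cc Q -> (forall l, Cc (F l)) ->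
 CInt (fun t => Q t * \big[Cplus/RtoC 0]_(0 <= l < N) F l t)%C a b = \big[Cplus/RtoC 0]_(0 <= l < N) CInt (fun t => Q t * F l t)%C a b.
Proof.
move=> cQ cF; elim: N => [|N IH].
 rewrite big_geq // (CInt_ext (g := fun _ => RtoC 0)); first by rewrite CInt_RtoC RInt_const /scal /= /mult /= Rmult_0_r.
 by move=> t _; rewrite big_geq //; ring.
rewrite [RHS]big_nat_recr //= -IH -CInt_plus; [|by apply: Cc_mult => //; exact: Cc_big | by apply: Cc_mult].
by apply: CInt_ext => t _; rewrite big_nat_recr //=; ring.
Qed.

Lemma Cmod_big_close z w e N : (forall l, Cmod (z l - RtoC (w l)) <= e) ->
 Cmod (\big[Cplus/RtoC 0]_(0 <= l < N) z l - RtoC (\sum_(0 <= l < N) w l)) <= N * e.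
Proof.
move=> h; elim: N => [|N IH].
 rewrite !big_geq // (_ : (RtoC 0 - RtoC 0 = RtoC 0)%C); last by ring.
 by rewrite Cmod_0 (_ : INR 0 = 0) //; lra.
rewrite !big_nat_recr //= RtoC_plus S_INR; set A := \big[_/_]_(_ <= _ < _) _ in IH *; set B := RtoC _ in IH *.
have -> : (A + z N - (B + (w N)) = (A - B) + (z N - (w N)))%C by ring.
by Ctri; have := h N; lra.
Qed.

Definition cy (y : R) : R := sqrt PI * exp (- (3 / 4) * y).

Lemma cy_pos y : 0 < cy y.
Proof. pos. Qed.

Lemma Aval_shift y r : Aval (y - 2 * r) = cy y * (exp (3 / 2 * r) * Phi (2 * PI * exp y * exp (- (2) * r))).
Proof.
rewrite /Aval /cy (_ : exp _ = exp (- (3 / 4) * y) * exp (3 / 2 * r)); last by rewrite -exp_plus; congr exp; field.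
rewrite (_ : 2 * PI * exp _ = 2 * PI * exp y * exp (- (2) * r)); first by lra.
by rewrite [RHS]Rmult_assoc -exp_plus; congr (_ * exp _); ring.
Qed.

Definition Qf (y t : R) : C := (cis (t * y) * qq (PI / 2) t)%C.

Lemma Qf_Cc y : Cc (Qf y).
Proof. by apply: Cc_mult; [exact: cis_lin_Cc | exact: qq_Cc]. Qed.

Lemma Qf_bound y t : Cmod (Qf y t) <= 144 * Rpower (1 + Rabs t) (- (7 / 4)).
Proof. by rewrite Cmod_mult Cmod_cis Rmult_1_l; apply: qq_bound; have := PI_RGT_0; lra. Qed.

Lemma Qf_bound_dm y t : Cmod (Qf y t) <= 144 * dm t.
Proof. by rewrite Cmod_mult Cmod_cis Rmult_1_l; apply: qq_bound_dm; have := PI_RGT_0; lra. Qed.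

Lemma Qf_shift y r t : (Qf y t * cis (- (2 * t) * r) = Qf (y - 2 * r) t)%C.
Proof.
by rewrite /Qf (_ : t * (y - 2 * r) = t * y + - (2 * t) * r) ?cisD; ring.
Qed.

Lemma zeta_part y N n :
 Cmod (CInt (fun t => Qf y t * zeta_approx (zs t) N)%C (- INR n) n
  - RtoC (cy y * (\sum_(0 <= l < N.+1) (4 * lterm 1 (2 * PI * exp y) l) - RInt (Ha (2 * PI * exp y)) (- n) (ln N.+1))))
 <= 5 * 4608 * N.+1 * dtail n + 36864 * exp (- n / 4).
Proof.
have N1 : 1 <= N.+1 by apply: (@leqINR 1).
have n0 := pos_INR n; set b := ln N.+1; have b0 : 0 <= b by rewrite -ln_1; apply: ln_le; lra.
set alpha := 2 * PI * exp y; have d0 : 0 < dtail n by pos.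
have tA r := proj2 (fourier_value (y - 2 * r)) n.
pose a l t := ((exp (- (ln l.+1 * / 2))) * cis (- (2 * t) * ln l.+1))%C.
have ca l : Cc (a l) by apply: Cc_mult; [exact: Cc_const | apply: Cc_cis => t; dcont].
pose zp t := (zinv t * pw t b)%C; have czp : Cc zp by apply: Cc_mult; [exact: zinv_Cc | exact: pw_Cc2].
have -> : CInt (fun t => Qf y t * zeta_approx (zs t) N)%C (- n) n =
  (\big[Cplus/RtoC 0]_(0 <= l < N.+1) CInt (fun t => Qf y t * a l t)%C (- n) n - CInt (fun t => Qf y t * zp t)%C (- n) n)%C.
 rewrite -CInt_big; [|exact: Qf_Cc | exact: ca].
 rewrite -CInt_minus; [|by apply: Cc_mult; [exact: Qf_Cc | exact: Cc_big] | by apply: Cc_mult; [exact: Qf_Cc |]].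
 apply: CInt_ext => t _; rewrite zeta_approxE -/(zp t).
 by set S := \big[_/_]_(_ <= _ < _) _; ring.
have S1 l : Cmod (CInt (fun t => Qf y t * a l t)%C (- n) n - RtoC (cy y * (4 * lterm 1 alpha l))) <= 4608 * dtail n.
 have l0 := INR_S1 l; have l1 : 1 <= l.+1 by apply: (@leqINR 1).
 set r := ln l.+1; have er : exp r = l.+1 by rewrite exp_ln.
 rewrite (CInt_ext (g := fun t => (exp (- (r * / 2))) * Qf (y - 2 * r) t)%C); last by move=> t _; rewrite -Qf_shift /a -/r; ring.
 rewrite CInt_scal; last exact: Qf_Cc.
 have -> : cy y * (4 * lterm 1 alpha l) = exp (- (r * / 2)) * Aval (y - 2 * r).
  rewrite Aval_shift lterm_Phi -er -/alpha.
  have -> : alpha / (exp r * exp r) = alpha * exp (- (2) * r) by rewrite /Rdiv -exp_plus -exp_Ropp; congr (_ * exp _); ring.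
  by rewrite (_ : exp r = exp (- (r * / 2)) * exp (3 / 2 * r)); [field | rewrite -exp_plus; congr exp; field].
 set z := CInt _ _ _; rewrite RtoC_mult (_ : (RtoC _ * z - RtoC _ * RtoC _ = (exp (- (r * / 2))) * (z - RtoC (Aval (y - 2 * r))))%C); last by ring.
 rewrite Cmod_mult Cmod_R (Rabs_pos_eq _); last by pos.
 have e1 : exp (- (r * / 2)) <= 1.
  rewrite -exp_0; apply: exp_le_mono; have : 0 <= r by [rewrite /r -ln_1; apply: ln_le; lra]; lra.
 have := tA r; rewrite -/z => h; have := exp_pos (- (r * / 2)); nra.
have S2 := @Cmod_big_close _ _ _ N.+1 S1; rewrite -(@big_distrr _ 0 Rmult Rplus) in S2.
have S3 : Cmod (CInt (fun t => Qf y t * zp t)%C (- n) n - RtoC (cy y * RInt (Ha alpha) (- n) b)) <= 4 * 4608 * N.+1 * dtail n + 36864 * exp (- n / 4).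
 have nb : - n <= b by lra.
 have cf : C2 (fun t r => Qf y t * pw t r)%C.
  apply: C2_mult; first exact: (C2_fst (Qf_Cc y)).
  apply: C2_mult; last by apply: C2_cis => x z; c2d.
  by apply: (@C2_snd _); apply: Cc_real => r; dcont.
 pose G r := CInt (fun t => Qf y t * pw t r)%C (- n) n.
 have cG : Cc G by apply: C2_int => //; lra.
 pose h t := (Qf y t * (zinv t * pw t (- n)))%C.
 have ch : Cc h by apply: Cc_mult; [exact: Qf_Cc | apply: Cc_mult; [exact: zinv_Cc | exact: pw_Cc2]].
 have -> : CInt (fun t => Qf y t * zp t)%C (- n) n = (CInt h (- n) n + CInt G (- n) b)%C.
  rewrite -(C2_fubini (- n) b (ltac:(lra) : - n <= n) cf).
  rewrite -CInt_plus //; last first.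
   apply: (Cc_ext (f := fun t => Qf y t * (zp t - zinv t * pw t (- n)))%C); last by apply: Cc_mult; [exact: Qf_Cc | apply: Cc_minus => //; apply: Cc_mult; [exact: zinv_Cc | exact: pw_Cc2]].
   by move=> t; rewrite CInt_scal ?pw_prim //; [rewrite /zp; ring | exact: pw_Cc].
  apply: CInt_ext => t _; rewrite CInt_scal ?pw_prim //; [rewrite /h /zp; ring | exact: pw_Cc].
 have hb : Cmod (CInt h (- n) n) <= 64 * (576 * exp (- n / 4)).
  apply: pow_mass => // t; rewrite 2!Cmod_mult [Cmod (RtoC _ * _)]Cmod_mult Cmod_cis Cmod_R (Rabs_pos_eq _); last by pos.
  have e1 : exp (- n * / 2) <= exp (- n / 4) by apply: exp_le_mono; lra.
  have := zinv_bound t; have := Qf_bound_dm y t; have := exp_pos _ => p1 p2 p3.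
  rewrite (_ : 576 * exp _ * dm t = 144 * dm t * (4 * exp (- n / 4))); last by lra.
  mon.
 have cA : Cc (fun r => (cy y * Ha alpha r)) by apply: Cc_real => r; apply: (continuous_mult _); [exact: continuous_const | exact: Ha_continuous].
 have Gb : Cmod (CInt G (- n) b - RtoC (cy y * RInt (Ha alpha) (- n) b)) <= 2 * (4608 * dtail n * (2 * exp (b * / 2) - 2 * exp (- n * / 2))).
  have -> : RtoC (cy y * RInt (Ha alpha) (- n) b) = CInt (fun r => (cy y * Ha alpha r)) (- n) b.
   rewrite CInt_RtoC; congr RtoC; symmetry; apply: (RInt_scal _).
   by RIc => r _; exact: Ha_continuous.
  rewrite -CInt_minus //.
  apply: (@CInt_bound _ (fun r => 4608 * dtail n * exp (r * / 2))) => //; [exact: Cc_minus | | ]; last first.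
   apply: (is_RInt_scal _); apply: (@is_RInt_primitive (fun r => 2 * exp _)) => // r _; first by auto_derive => //; field.
   by dcont.
  move=> r _; rewrite /G (CInt_ext (g := fun t => (exp (r * / 2)) * Qf (y - 2 * r) t)%C); last by move=> t _; rewrite -Qf_shift /pw; ring.
  rewrite CInt_scal; last exact: Qf_Cc.
  have -> : cy y * Ha alpha r = exp (r * / 2) * Aval (y - 2 * r).
   rewrite Aval_shift /Ha -/alpha (_ : exp _ = exp (r * / 2) * exp (3 / 2 * r)); [ring | rewrite -exp_plus; congr exp; field].
  set z := CInt _ _ _; rewrite RtoC_mult (_ : (RtoC _ * z - RtoC _ * RtoC _ = (z - RtoC (Aval (y - 2 * r))) * (exp (r * / 2)))%C); last by ring.
  rewrite Cmod_mult Cmod_R (Rabs_pos_eq _); last by pos.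
  apply: Rmult_le_compat_r; first by pos.
  by have := tA r; rewrite -/z; lra.
 set A1 := CInt h _ _ in hb *; set A2 := CInt G _ _ in Gb *; set A3 := RtoC _ in Gb *.
 have -> : (A1 + A2 - A3 = A1 + (A2 - A3))%C by ring.
 Ctri.
 have eb : exp (b * / 2) <= N.+1 by rewrite -[INR N.+1]exp_ln; [apply: exp_le_mono; rewrite -/b; lra | lra].
 have en := exp_pos (- n * / 2).
 nra.
set A := \big[_/_]_(_ <= _ < _) _ in S2 *; set B := CInt _ _ _ in S3 *; rewrite Rmult_minus_distr_l RtoC_minus.
set A' := RtoC _ in S2 *; set B' := RtoC _ in S3 *.
have -> : (A - B - (A' - B') = (A - A') - (B - B'))%C by ring.
by Ctri; rewrite Cmod_opp; lra.
Qed.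

Lemma vanish_shift tau k : vanish tau -> vanish (fun j => tau (k + j)%N).
Proof. by move=> h e e0; have [N hN] := h e e0; exists N => n hn; apply: hN; lia. Qed.

Lemma nat_exp k : exists N : nat, [/\ (0 < N)%N, INR k <= ln N.+1, / N.+1 <= exp (- k / 4) & / sqrt N <= exp (- k / 4)].
Proof.
have ek := exp_pos k; have k0 := pos_INR k; have [N [h _]] := @nat_ceil (exp k) ltac:(lra); exists N.
have N0 : (0 < N)%N by apply/ltP/INR_lt; rewrite (_ : INR 0 = 0) //; lra.
have eS := S_INR N; split=> //.
- by rewrite -{1}(ln_exp k); apply: ln_le; lra.
- apply: (Rle_trans _ (exp (- k))); last by apply: exp_le_mono; lra.
 by rewrite exp_Ropp; apply: Rinv_le_contravar; lra.
apply: (Rle_trans _ (exp (- (k / 2)))); last by apply: exp_le_mono; lra.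
rewrite exp_Ropp; apply: Rinv_le_contravar; first exact: exp_pos.
rewrite -(sqrt_square (exp _)); last by pos.
by apply: sqrt_le_1_alt; rewrite -exp_plus (_ : k / 2 + k / 2 = k); lra.
Qed.

Lemma Qf_mul_bound y t c z : Cmod z <= c * sqrt (1 + Rabs t) -> Cmod (Qf y t * z) <= 144 * c * dm t.
Proof.
move=> hz; rewrite Cmod_mult; have t0 := Rabs_pos t.
apply: Rle_trans (Rmult_le_compat _ _ _ _ (Cmod_ge_0 _) (Cmod_ge_0 _) (Qf_bound y t) hz) _.
rewrite -Rpower_sqrt; last by lra.
rewrite /dm (_ : - (5 / 4) = - (7 / 4) + / 2) ?Rpower_plus; lra.
Qed.

Lemma dm_le1 t : dm t <= 1.
Proof.
have t0 := Rabs_pos t; rewrite -(Rpower_O (1 + Rabs t)); last by lra.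
by apply: Rpower_mono_exp; lra.
Qed.

Lemma Mdual_partial alpha N : 0 <= alpha ->
 Rabs (4 * Mdual 1 alpha - \sum_(0 <= l < N.+1) (4 * lterm 1 alpha l)) <= alpha * sqrt alpha * / INR N.+1.
Proof.
move=> a0; have s0 := sqrt_pos alpha; have p : 0 <= alpha * sqrt alpha by nra.
have [_ h] := inv_sq_series_tail (ltac:(lra) : 0 <= alpha * sqrt alpha / 8) (fun l => lterm_bound 1 l a0).
rewrite -big_distrr /= -Rmult_minus_distr_l Rabs_mult (Rabs_pos_eq 4); last by lra.
have := h N.+1 isT; rewrite -/(Mdual 1 alpha); have := Rinv_0_lt_compat _ (INR_S1 N); nra.
Qed.

(** Three parameters: [n] cuts the integral in [t], uniformly in [N]; then [N], of order [exp k],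
    makes [zeta_approx] close to zeta on [[- n, n]]; finally a longer cut [n'] evaluates the
    integral for this [N]. *)
Lemma zeta_transform y I : CIR (fun r => RtoC (Ha (2 * PI * exp y) r)) I ->
 CIR (fun t => Qf y t * zeta (zs t))%C (RtoC (cy y) * (RtoC (4 * Mdual 1 (2 * PI * exp y)) - I))%C.
Proof.
set alpha := 2 * PI * exp y; have a0 : 0 < alpha by pos.
move=> hI; have c0 := cy_pos y.
have [I' hI' tI] := CIR_exp (Ha_Cc alpha) (fun r => ltac:(rewrite Cmod_R; apply: Ha_bound; lra) : Cmod (RtoC _) <= KH alpha * exp (- Rabs r / 4)).
rewrite -(CIR_unique hI hI') in tI.
have cz : Cc (fun t => Qf y t * zeta (zs t))%C by apply: Cc_mult; [exact: Qf_Cc | exact: zeta_Cc].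
have cN N : Cc (fun t => Qf y t * zeta_approx (zs t) N)%C by apply: Cc_mult; [exact: Qf_Cc | exact: zeta_approx_Cc].
have [|L hL tL] := @CIR_pow _ (144 * 80) cz.
 by move=> t; apply: Qf_mul_bound; have [h _] := zeta_bounds t; have := sqrt_pos (1 + Rabs t); lra.
have lN N : (0 < N)%N -> exists2 l, CIR (fun t => Qf y t * zeta_approx (zs t) N)%C l & forall n : nat, Cmod (CInt (fun t => Qf y t * zeta_approx (zs t) N)%C (- n) n - l) <= 32 * (144 * 80) * dtail n.
 move=> N0; have [|l h1 h2] := @CIR_pow _ (144 * 80) (cN N).
  by move=> t; apply: Qf_mul_bound; have [_ h] := zeta_bounds t; exact: h.
 by exists l => // n; apply: h2; lra.
suff <- : L = ((cy y) * (RtoC (4 * Mdual 1 alpha) - I))%C by [].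
apply: C_eq_of_small; apply: (le_vanish (vanish_dtail (64 * (144 * 80)))) => n.
have n0 := pos_INR n.
set K := 4 * (144 * (4 * (1 + 4 * n))) * n + cy y * (32 * KH alpha) + cy y * (alpha * sqrt alpha).
apply: (le_vanish (vanish_exp K)) => k; have [N [N0 kN i1 i2]] := nat_exp k; have [l hl tl] := lN N N0.
set Sg := \sum_(0 <= l < N.+1) (4 * lterm 1 alpha l).
have h1 : Cmod (L - l) <= 32 * (144 * 80) * dtail n + 32 * (144 * 80) * dtail n + 4 * (144 * (4 * (1 + 4 * n) / sqrt N)) * INR n.
 apply: (CIR_close cz (cN N) n0 _ (tl n)); first by apply: tL; lra.
 move=> t ht; rewrite (_ : (Qf y t * zeta (zs t) - Qf y t * zeta_approx (zs t) N = - (Qf y t * (zeta_approx (zs t) N - zeta (zs t))))%C); last by ring.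
 rewrite Cmod_opp Cmod_mult; apply: Rmult_le_compat; [exact: Cmod_ge_0 | exact: Cmod_ge_0 | |].
  by apply: Rle_trans (Qf_bound_dm y t) _; have := dm_le1 t; lra.
 apply: Rle_trans (zeta_rate t N0) _; apply: Rmult_le_compat_r; first by apply/Rlt_le/Rinv_0_lt_compat/sqrt_lt_R0/INR_gt0.
 by have : Rabs t <= n by [apply: Rabs_le; lra]; lra.
have h2 : Cmod (l - (cy y) * (RtoC Sg - I)) <= cy y * (32 * KH alpha * exp (- k / 4)).
 have v := vanish_add (vanish_add (vanish_dtail (32 * (144 * 80))) (vanish_dtail (5 * 4608 * N.+1))) (vanish_exp 36864).
 apply: (le_vanish (vanish_shift k v)) => j; set n' := (k + j)%N; have kn : k <= n' by apply: leqINR; lia.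
 have z := zeta_part y N n'; rewrite -/Sg in z; have t1 := tl n'.
 have t2 := tI k (- n') _ ltac:(lra) kN; rewrite CInt_RtoC in t2.
 set X := CInt _ _ _ in z t1; set J := RInt _ _ _ in z t2.
 have -> : (l - (cy y) * (RtoC Sg - I) = - (X - l) + (X - RtoC (cy y * (Sg - J))) - (cy y) * (RtoC J - I))%C by rewrite RtoC_mult RtoC_minus; ring.
 Ctri; have := Cmod_triangle (- (X - l)) (X - RtoC (cy y * (Sg - J))); rewrite !Cmod_opp Cmod_mult Cmod_R (Rabs_pos_eq (cy y)); last by lra.
 nra.
have h3 : Rabs (4 * Mdual 1 alpha - Sg) <= alpha * sqrt alpha * exp (- k / 4).
 apply: Rle_trans (Mdual_partial N (Rlt_le _ _ a0)) _; apply: Rmult_le_compat_l => //.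
 pos.
have -> : (L - (cy y) * (RtoC (4 * Mdual 1 alpha) - I) = (L - l) + (l - (cy y) * (RtoC Sg - I)) - (cy y) * RtoC (4 * Mdual 1 alpha - Sg))%C by rewrite RtoC_minus; ring.
Ctri; have := Cmod_triangle (L - l) (l - (cy y) * (RtoC Sg - I)); rewrite Cmod_opp Cmod_mult !Cmod_R (Rabs_pos_eq (cy y)); last by lra.
have h4 := Rmult_le_compat_l (cy y) _ _ _ h3.
have h5 : 4 * (144 * (4 * (1 + 4 * n) / sqrt N)) * n <= 4 * (144 * (4 * (1 + 4 * n))) * n * exp (- k / 4).
 nra.
rewrite /K; lra.
Qed.

Lemma CIR_shift f l a : Cc f -> CIR f l -> CIR (fun r => f (r - a)) l.
Proof.
move=> cf h eps e0; have [n hn] := h eps e0; have [m [hm _]] := nat_ceil (Rabs_pos a).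
have [a1 a2] : - Rabs a <= a <= Rabs a by split; [have := Rabs_maj2 a; lra | exact: Rle_abs].
exists (n + m)%N => b c; rewrite plus_INR => hb hc.
suff -> : CInt (fun r => f (r - a)) b c = CInt f (b - a) (c - a) by apply: hn; lra.
have e (g : R -> R) : (forall x, continuous g x) -> RInt (fun r => g (r - a)) b c = RInt g (b - a) (c - a).
 move=> cg; have := RInt_comp_lin g 1 (- a) b c; rewrite !Rmult_1_l => <-; last by RIc => x _.
 by apply: RInt_ext => x _; rewrite /scal /= /mult /= !Rmult_1_l.
by rewrite /CInt (e (fun r => Re (f r))) ?(e (fun r => Im (f r))) // => x; have [] := cf x.
Qed.

(** A translation of [r] by [ln alpha / 2] normalizes the argument of [Phi] and brings out a factor
    [alpha]. *)
Lemma Ha_scale alpha I : 0 < alpha -> CIR (fun r => RtoC (Ha 1 r)) I -> CIR (fun r => RtoC (Ha alpha r)) (RtoC alpha * I)%C.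
Proof.
move=> a0 h; pose a := ln alpha / 2.
have h2 := fun cf => @CIR_scal (alpha) _ _ cf (CIR_shift a (Ha_Cc 1) h).
apply: (CIR_ext _ (h2 _)).
 move=> r; rewrite -RtoC_mult; congr RtoC; rewrite /Ha.
 have -> : exp (2 * r) = alpha * exp (2 * (r - a)) by rewrite -{1}(exp_ln alpha) // -exp_plus; congr exp; rewrite /a; field.
 have -> : alpha * exp (- (2) * r) = 1 * exp (- (2) * (r - a)) by rewrite Rmult_1_l -{1}(exp_ln alpha) // -exp_plus; congr exp; rewrite /a; field.
 lra.
by apply: (Cc_comp (f := fun r => RtoC _) (g := fun r => r - a)); [exact: Ha_Cc | move=> x; dcont].
Qed.

Lemma Phi_incr z1 z2 M : 0 < z1 -> z1 <= z2 -> (forall z, z1 <= z <= z2 -> Rabs (rad WW (2 * PI) z) <= M) ->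
 Rabs (Phi z1 - Phi z2) <= / (2 * PI) * ((z2 - z1) * M).
Proof.
move=> p z12 hM; have ex a b := @rad_ex WW _ a b tame_WW.
have -> : Phi z1 - Phi z2 = - (/ (2 * PI) * RInt (rad WW (2 * PI)) z1 z2).
 by rewrite !PhiE -(RInt_Chasles _ 0 z1 z2) //= /plus /=; ring.
have i0 : 0 < / (2 * PI) by pos.
rewrite Rabs_Ropp Rabs_mult (Rabs_pos_eq (/ _)); last by lra.
by apply: Rmult_le_compat_l; [lra | apply: abs_RInt_le_const].
Qed.

(** With [s = S / y] the jump is bounded both by a multiple of [s ^ 3], from [|WW| <= 3], and by a
    multiple of [s], from [|WW x| <= 2 |x|]. The exponent 3/2 lies between the two and makes the sum
    over [y] converge. *)
Lemma weighted_Phi_diff S x y : 0 < S -> 1 <= y -> y <= x -> x <= y + 1 ->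
 Rabs (x * Phi (S * S / (x * x)) - y * Phi (S * S / (y * y))) <= 12 * (S / y * sqrt (S / y)).
Proof.
move=> S0 y1 yx xy; have pi3 : 3 < PI by have := PI2_3_2; lra.
set s := S / y.
set w := S / x; have w0 : 0 < w by pos.
have ws : w <= s by mon.
have sw : s <= 2 * w.
 rewrite (_ : 2 * (S / x) = S * (2 / x)); last by lra.
 lmul.
 by apply: (Rmult_le_reg_r (x * y)); [nra | field_simplify; lra].
have e1 : S * S / (x * x) = w * w by rewrite /w; field; lra.
have e2 : S * S / (y * y) = s * s by rewrite /s; field; lra.
rewrite e1 e2; have q1 : sqrt (w * w) = w by apply: sqrt_square; lra.
have b1 := Phi_bound1 (ltac:(nra) : 0 <= w * w); have b3 := Phi_bound3 (ltac:(nra) : 0 <= w * w).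
have radb z : w * w <= z <= s * s -> Rabs (rad WW (2 * PI) z) <= 3 * s /\ Rabs (rad WW (2 * PI) z) <= 4 * PI / w.
 move=> [z1 z2]; have z0 : 0 < z by nra.
 have szs : sqrt z <= s by rewrite -(sqrt_square s); mon.
 have szw : w <= sqrt z by rewrite -{1}q1; apply: sqrt_le_1_alt.
 rewrite Rabs_mult (Rabs_pos_eq _); last by lra.
 have w3 := WW_le3 (2 * PI / z); have := WW_small (2 * PI / z).
 have p : 0 < 2 * PI / z by pos.
 rewrite (Rabs_pos_eq (2 * PI / z)); last by lra.
 split; first by nra.
 apply: (Rle_trans _ (sqrt z * (2 * (2 * PI / z)))); first by nra.
 have -> : sqrt z * (2 * (2 * PI / z)) = 4 * PI / sqrt z.
  by rewrite -{2}(sqrt_sqrt z); [field | lra]; lra.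
 mon.
have wz : w * w <= s * s by nra.
have ww0 : 0 < w * w by nra.
have i1 := Phi_incr ww0 wz (fun z hz => proj1 (radb z hz)); have i2 := Phi_incr ww0 wz (fun z hz => proj2 (radb z hz)).
have dz : y * (s * s - w * w) <= 2 * (s * s).
 have e : w * x = s * y by rewrite /w /s; field; lra.
 have : (s - w) * x <= s by nra.
 nra.
have P1 : y * Rabs (Phi (w * w) - Phi (s * s)) <= s * (s * s).
 apply: (Rle_trans _ (y * (/ (2 * PI) * ((s * s - w * w) * (3 * s))))); first by nra.
 apply: (Rle_trans _ (/ _ * (2 * (s * s) * _))).
  rewrite (_ : y * _ = / (2 * PI) * (y * (s * s - w * w) * (3 * s))); last by lra.
  mon.
 apply: (Rmult_le_reg_l (2 * PI)); first by lra.
 rewrite -Rmult_assoc Rinv_r; last by lra.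
 by have : 0 < s * (s * s) by [apply: Rmult_lt_0_compat; nra]; nra.
have P2 : y * Rabs (Phi (w * w) - Phi (s * s)) <= 8 * s.
 apply: (Rle_trans _ (y * (/ (2 * PI) * ((s * s - w * w) * (4 * PI / w))))); first by nra.
 rewrite (_ : y * _ = y * (s * s - w * w) * (2 / w)); last by field; lra.
 have p : 0 < 2 / w by pos.
 apply: (Rle_trans _ (2 * (s * s) * (2 / w))); first by nra.
 apply: (Rmult_le_reg_r w) => //; rewrite (_ : 2 * _ * _ * w = 4 * (s * s)); last by field; lra.
 nra.
have r : sqrt s * sqrt s = s by apply: sqrt_sqrt; lra.
have r0 : 0 < sqrt s by pos.
rewrite (_ : x * Phi _ - y * Phi _ = (x - y) * Phi (w * w) + y * (Phi (w * w) - Phi (s * s))); last by lra.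
Rtri; rewrite !(Rabs_mult (x - y)) (Rabs_mult y _) (Rabs_pos_eq _) ?(Rabs_pos_eq y); try lra.
have A := Rabs_pos (Phi (w * w)).
have : (x - y) * Rabs (Phi (w * w)) <= Rabs (Phi (w * w)) by nra.
case: (Rle_lt_dec s 1) => h.
 nra.
nra.
Qed.

Lemma lterm_Ha_step S M : 0 < S ->
 Rabs (4 * lterm 1 (S * S) M.+1 - RInt (Ha (S * S)) (ln M.+1) (ln M.+2)) <= 24 * (S * sqrt S) * / (M.+1 * sqrt M.+1).
Proof.
move=> S0; have m0 := INR_S1 M; have m1 : 1 <= M.+1 by apply: (@leqINR 1).
have eS : INR M.+2 = M.+1 + 1 by pos.
set a := ln M.+1; set b := ln M.+2; have ab : a <= b by apply: ln_le; lra.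
have ea : exp a = M.+1 by rewrite exp_ln.
have eb : exp b = M.+1 + 1 by rewrite exp_ln; lra.
set m := M.+1 in m0 m1 eS ea eb *; set x := m + 1 in eS eb.
set F := 4 * lterm 1 _ M.+1.
have FE : F = x * Phi (S * S / (x * x)) by rewrite /F lterm_Phi eS; field.
have Ie : is_RInt exp a b 1.
 by have -> : 1 = exp b - exp a by [rewrite ea eb /x; ring]; apply: is_RInt_primitive => // r _; [exact: is_derive_exp | exact: continuous_exp].
have sm0 : 0 < sqrt m by pos.
set E := 12 * (S * sqrt S) * / (m * sqrt m).
have ch : Cc (fun r => RtoC (F * exp r - Ha (S * S) r)).
 apply: Cc_real => r; apply: (continuous_minus _ (Ha _)); last exact: Ha_continuous.
 by apply: (continuous_mult _); [exact: continuous_const | exact: continuous_exp].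
have IF : is_RInt (fun r => F * exp r) a b (F * 1) by apply: (is_RInt_scal exp).
have exH : ex_RInt (Ha (S * S)) a b by RIc => r _; exact: Ha_continuous.
have -> : F - RInt (Ha (S * S)) a b = RInt (fun r => F * exp r - Ha (S * S) r) a b.
 symmetry; apply: is_RInt_unique; have := is_RInt_minus _ _ _ _ _ _ IF (RInt_correct _ _ _ exH).
 by rewrite Rmult_1_r.
have := CInt_bound (g := fun r => E * exp r) (I := E * 1) ch ab.
rewrite CInt_RtoC Cmod_R => h; apply: Rle_trans (h _ _) _; last by rewrite /E; apply: Req_le; ring.
 move=> r hr; rewrite Cmod_R.
 have h1 : m <= exp r by rewrite -ea; apply: exp_le_mono; lra.
 have h2 : exp r <= x by rewrite -eb; apply: exp_le_mono; lra.
 have -> : F * exp r - Ha (S * S) r = (x * Phi (S * S / (x * x)) - exp r * Phi (S * S / (exp r * exp r))) * exp r.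
  rewrite FE /Ha (_ : exp (2 * r) = exp r * exp r); last by rewrite -exp_plus; congr exp; ring.
  by rewrite (_ : S * S * exp _ = S * S / (exp r * exp r)); [ring | rewrite /Rdiv -exp_plus -exp_Ropp; congr (_ * exp _); ring].
 rewrite Rabs_mult (Rabs_pos_eq (exp r)); last by lra.
 apply: Rmult_le_compat_r; first by lra.
 have h3 : x <= exp r + 1 by mon.
 apply: Rle_trans (@weighted_Phi_diff S x (exp r) S0 ltac:(lra) h2 h3) _.
 apply: (Rle_trans _ (12 * (S / m * sqrt (S / m)))).
  mon.
 rewrite sqrt_div_alt // /E; apply: Req_le; field; lra.
by have := is_RInt_scal exp a b E 1 Ie.
Qed.

(** The sum differs from the integral by at most a multiple of [alpha ^ (3/4)], where
    [alpha = S ^ 2]. This is of smaller order than [alpha], so the slope of the integral can be read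
    off in [Ha_mass]. *)
Lemma Mdual_integral S I : 1 <= S -> CIR (fun r => RtoC (Ha (S * S) r)) I ->
 Cmod (RtoC (4 * Mdual 1 (S * S)) - I) <= 84 * (S * sqrt S).
Proof.
move=> S1 hI; set al := S * S; have al0 : 0 <= al by pos.
have sal : sqrt al = S by apply: sqrt_square; lra.
have rS : 1 <= sqrt S by rewrite -sqrt_1; apply: sqrt_le_1_alt.
have SS : S <= S * sqrt S by nra.
have [I' hI' tI] := CIR_exp (Ha_Cc al) (fun r => ltac:(rewrite Cmod_R; exact: Ha_bound) : Cmod (RtoC _) <= KH al * exp _).
rewrite -(CIR_unique hI hI') in tI.
have exH a b : ex_RInt (Ha al) a b by RIc => r _; exact: Ha_continuous.
have step M : Rabs (\sum_(0 <= l < M.+1) (4 * lterm 1 al l) - RInt (Ha al) 0 (ln M.+1)) <= 4 * S + 24 * (S * sqrt S) * \sum_(1 <= b < M.+1) (/ (b * sqrt b)).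
 elim: M => [|M IH].
  rewrite big_nat1 big_geq // ln_1 RInt_point Rminus_0_r Rmult_0_r Rplus_0_r.
  by have := Phi_bound1 al0; rewrite sal.
 rewrite big_nat_recr // [X in _ <= _ + _ * X]big_nat_recr //= -(RInt_Chasles _ 0 (ln M.+1) _) //.
 have := @lterm_Ha_step S M ltac:(lra); rewrite /plus /=.
 set A := \big[_/_]_(0 <= _ < _) _ in IH *; set B := RInt _ 0 _ in IH *; set c := 4 * _; set d := RInt _ _ _ => h.
 rewrite (_ : A + c - _ = (A - B) + (c - d)); last by lra.
 by Rtri; lra.
apply: (le_vanish (vanish_exp (al * sqrt al + 32 * KH al))) => k; have [N [_ kN i1 _]] := nat_exp k.
have t1 := Mdual_partial N al0; have t2 := step N; have i3 := inv_sqrt3_sum_le N.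
have k0 := pos_INR k.
have t3 := tI k (- k) _ ltac:(lra) kN.
have t4 : Cmod (CInt (fun r => RtoC (Ha al r)) (- k) 0) <= 2 * (4 * S * (1 - exp (- k))).
 have Ie : is_RInt exp (- k) 0 (1 - exp (- k)) by rewrite -{1}exp_0; apply: is_RInt_primitive => [|r _|r _]; [lra | exact: is_derive_exp | exact: continuous_exp].
 apply: (@CInt_bound _ _); [exact: Ha_Cc | lra | | exact: (is_RInt_scal exp)].
 by move=> r _; rewrite Cmod_R; have [h _] := Ha_bounds r al0; rewrite sal in h.
rewrite -(CInt_Chasles _ 0 _ (Ha_Cc al)) in t3.
set A := CInt _ (- k) 0 in t3 t4; rewrite CInt_RtoC in t3; set J := RInt _ 0 _ in t2 t3.
set Sg := \big[_/_]_(0 <= _ < _) _ in t1 t2.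
have -> : (RtoC (4 * Mdual 1 al) - I = RtoC (4 * Mdual 1 al - Sg) + RtoC (Sg - J) + (A + RtoC J - I) - A)%C by rewrite !RtoC_minus; ring.
have tri z1 z2 z3 z4 : Cmod (z1 + z2 + z3 - z4) <= Cmod z1 + Cmod z2 + Cmod z3 + Cmod z4.
 Ctri; rewrite Cmod_opp; have := Cmod_triangle (z1 + z2) z3; have := Cmod_triangle z1 z2; lra.
apply: Rle_trans (tri _ _ _ _) _; rewrite !Cmod_R.
have ek := exp_pos (- k).
have t5 : al * sqrt al * / N.+1 <= al * sqrt al * exp (- k / 4) by mon.
nra.
Qed.

(* The total mass of [Ha 1] is read off the growth of [Mmain 1 alpha] as [alpha] tends to infinity. *)
Lemma Ha_mass : CIR (fun r => RtoC (Ha 1 r)) (RtoC 1).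
Proof.
have [I hI _] := CIR_exp (Ha_Cc 1) (fun r => ltac:(rewrite Cmod_R; apply: Ha_bound; lra) : Cmod (RtoC _) <= KH 1 * exp (- Rabs r / 4)).
suff <- : I = RtoC 1 by [].
have [K K0 hK] := Treal_huge; apply: C_eq_of_small.
apply: (le_vanish (vanish_dtail (85 + 4 * K))) => n.
set S := 1 + n; have S1 : 1 <= S by rewrite /S; have := pos_INR n; lra.
have SS0 : 0 < S * S by nra.
have h1 := Mdual_integral S1 (Ha_scale SS0 hI).
(* The point [(S, S ^ 3)] is on the edge of the range [X ^ 3 <= Y] and is the dilation by [S] of
   [(1, S ^ 2)]. *)
have [_ h2] := hK S (S * (S * S)) S1 ltac:(nra) ltac:(lra).
rewrite -{1}(Rmult_1_r S) Mmain_homogeneous in h2; last by lra.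
set q := Rpower S _ in h2; have q1 : 1 <= q by apply: Rpower_ge1; lra.
have q2 : q * q = sqrt S by rewrite /q -Rpower_plus -Rpower_sqrt; [congr Rpower; field | lra].
have r1 : 1 <= sqrt S by nra.
have rr : sqrt S * sqrt S = S by apply: sqrt_sqrt; lra.
have h3 : Rabs (4 * Mmain 1 (S * S) - S * S) <= 4 * K * (S * S) / q.
 apply: (Rmult_le_reg_l (S * sqrt S)); first by nra.
 have -> : S * sqrt S * (4 * K * (S * S) / q) = 4 * (K * (S * (S * S) * q)) by rewrite -q2; field; lra.
 rewrite -{1}(Rabs_pos_eq (S * sqrt S)); last by nra.
 rewrite -Rabs_mult (_ : S * sqrt S * _ = 4 * (S * sqrt S * Mmain 1 (S * S) - S * (S * S) * sqrt S / 4)); last by lra.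
 by rewrite Rabs_mult (Rabs_pos_eq 4); lra.
have e4 : 4 * Mmain 1 (S * S) = S + 4 * Mdual 1 (S * S) by rewrite /Mmain sqrt_square; lra.
rewrite e4 in h3; set D := 4 * Mdual 1 _ in h1 h3.
have dt : dtail n = / q by rewrite /dtail Rpower_Ropp.
apply: (Rmult_le_reg_l (S * S)) => //; rewrite -{1}(Rabs_pos_eq (S * S)) -?Cmod_R -?Cmod_mult; last by lra.
have -> : (RtoC (S * S) * (I - RtoC 1) = - (RtoC D - RtoC (S * S) * I) + RtoC (S + D - S * S) - RtoC S)%C by rewrite RtoC_minus RtoC_plus; ring.
Ctri; have := Cmod_triangle (- (RtoC D - RtoC (S * S) * I)) (RtoC (S + D - S * S)); rewrite !Cmod_opp !Cmod_R (Rabs_pos_eq S); last by lra.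
have : S * sqrt S <= S * S / q.
 apply: (Rmult_le_reg_r q); first by lra.
 have -> : S * S / q * q = S * (sqrt S * sqrt S) by rewrite rr; field; lra.
 rewrite Rmult_assoc; lmul.
 nra.
nra.
Qed.

(** * Identification of [Dfun] and conclusion *)

Lemma Gamma_shift t : Gamma (- (3 / 4), t) = (Gm t / (- (3 / 4), t)%R)%C.
Proof.
(* On this line [Re s - 3/2 = - 3/4], so one step of the recurrence leads to Euler's integral. *)
rewrite /Gamma (_ : up (- - _) = 1%Z); last by symmetry; apply: tech_up; lra.
rewrite //= INR1.
congr (_ / _)%C; last by rewrite Cplus_0_r Cmult_1_l.
by rewrite /Cplus /=; congr Gamma_int; congr pair; field.
Qed.

Lemma Csin_half t : Csin (RtoC PI * (3 / 4, t)%R / 2)%C = Seta (PI / 2) t.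
Proof.
have e : (Ci * (RtoC PI * (3 / 4, t)%R / 2))%C = (- (t * (PI / 2)), PI / 2 * (1 / 4) + PI / 4).
 by rewrite /Cmult /=; congr pair; field.
have i2 : (/ (2 * Ci))%C = mhi by rewrite /mhi /Ci /RtoC /Cinv /Cmult /=; congr pair; field.
rewrite /Csin e /Cdiv i2 Cmult_comm; congr (_ * (_ - _))%C.
 by rewrite /Cexp /Cmult /=; congr pair; ring.
by rewrite /Cexp /Cmult /= Ropp_involutive; congr pair; ring.
Qed.

Lemma D_integrandE alpha t :
 D_integrand alpha (3 / 4, t) = (RtoC (- exp (3 / 4 * ln (alpha / (2 * PI)))) * (Qf (ln (alpha / (2 * PI))) t * zeta (zs t)))%C.
Proof.
rewrite /D_integrand; set y := ln _.
have -> : ((3 / 4, t)%R - 3 / 2)%C = (- (3 / 4), t) by rewrite /Cdiv -RtoC_inv // /Cminus /Cplus /Copp /RtoC /Cmult /=; congr pair; field.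
have -> : (2 * (3 / 4, t)%R - 1)%C = zs t by rewrite /zs /Cminus /Cplus /Copp /RtoC /Cmult /=; congr pair; field.
rewrite Gamma_shift Csin_half.
have -> : Rcpow (alpha / (2 * PI)) (3 / 4, t) = ((exp (3 / 4 * y)) * cis (t * y))%C.
 rewrite /Rcpow /Cexp /Cmult /= (_ : 3 / 4 * y - t * 0 = 3 / 4 * y); last by lra.
 by rewrite (_ : 3 / 4 * 0 + t * y = t * y); [congr pair; ring | ring].
have l : (/ (- (3 / 4), t)%R * / (3 / 4, t)%R)%C = RtoC (- lor t).
 rewrite /lor /Cmult /=; congr pair; field; nra.
rewrite /Qf /qq (_ : forall a b c d z : C, (a * (b / c * d * z / _) = a * (b * d * z * (/ c * / (3 / 4, t)%R)))%C); last by move=> a b c d z; rewrite /Cdiv; ring.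
by rewrite l !RtoC_opp; ring.
Qed.

(** The integral contributes [4 * Mdual 1 alpha - alpha]; its second part is the mass of [Ha] and
    cancels the explicit [alpha] of [Dfun]. *)
Lemma DfunE alpha : 0 < alpha -> Dfun alpha = RtoC (4 * Mmain 1 alpha).
Proof.
move=> a0; have pi0 := PI_RGT_0; set y := ln (alpha / (2 * PI)).
have ay : 2 * PI * exp y = alpha by rewrite /y exp_ln; [field; lra | apply: Rdiv_lt_0_compat; lra].
have h := Ha_scale a0 Ha_mass; rewrite -ay in h; have {h} := zeta_transform h; rewrite ay => h.
have cz : Cc (fun t => Qf y t * zeta (zs t))%C by apply: Cc_mult; [exact: Qf_Cc | exact: zeta_Cc].
have h2 := @CIR_scal (RtoC (- exp (3 / 4 * y))) _ _ cz h.
have c2 : Cc (fun t => D_integrand alpha (3 / 4, t)) by apply: (Cc_ext _ (Cc_mult (Cc_const _) cz)) => t; rewrite D_integrandE.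
have h3 : CIR (fun t => D_integrand alpha (3 / 4, t)) (RtoC (- (sqrt PI * (4 * Mdual 1 alpha - alpha)))).
 have e : exp (3 / 4 * y) * exp (- (3 / 4) * y) = 1 by rewrite -exp_plus -[RHS]exp_0; congr exp; ring.
 have -> : RtoC (- (sqrt PI * (4 * Mdual 1 alpha - alpha))) = (RtoC (- exp (3 / 4 * y)) * ((cy y) * (RtoC (4 * Mdual 1 alpha) - alpha * RtoC 1)))%C.
  rewrite Cmult_1_r -RtoC_minus -!RtoC_mult; congr RtoC; rewrite /cy.
  by rewrite -[LHS]Rmult_1_r -e; ring.
 by apply: (CIR_ext _ h2) => t; rewrite D_integrandE.
have g := CIR_gen c2 h3.
rewrite /Dfun /vertical_integral (is_RInt_gen_unique (V := C_R_CompleteNormedModule) _ _ g).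
have s0 : sqrt PI <> 0 by have := sqrt_lt_R0 PI pi0; lra.
have s0c : RtoC (sqrt PI) <> 0 by move=> /(f_equal Re).
have i0 : Ci <> RtoC 0 by move=> /(f_equal Im) /=; lra.
have e5 : 4 * Mmain 1 alpha = sqrt alpha + 4 * Mdual 1 alpha by rewrite /Mmain; field.
rewrite e5 RtoC_opp RtoC_mult RtoC_minus RtoC_plus.
by field.
Qed.

Theorem theorem2 :
  forall eps : R, (0 < eps)%R ->
  exists K X0 : R,
  forall X Y : R, (0 < X)%R -> (0 < Y)%R -> (X0 <= X)%R -> (X0 <= Y)%R ->
  (Cmod (RtoC (IZR (S_sum X Y))
         - RtoC (2 / PI ^ 2 * Rpower X (3 / 2)) * Dfun (Y / X))
   <= K * (X * Rpower Y (1 / 4 + eps) + Y * Rpower X (1 / 4 + eps)))%R.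
Proof.
move=> eps e0.
(* [S_main] asks for an exponent at most 1; for [X] and [Y] at least 1 a smaller exponent gives a
   stronger bound. *)
have [K K0 hK] := @S_main (Rmin eps 1) ltac:(split; [apply: Rmin_pos; lra | exact: Rmin_r]).
exists K, 1 => X Y X0 Y0 X1 Y1.
rewrite DfunE; last exact: Rdiv_lt_0_compat.
(* The power [X ^ (3/2)] is the homogeneity factor of [Mmain] between [(1, Y / X)] and [(X, Y)]. *)
have -> : (RtoC (2 / PI ^ 2 * Rpower X (3 / 2)) * RtoC (4 * Mmain 1 (Y / X)))%C = RtoC (8 / PI ^ 2 * Mmain X Y).
 rewrite -RtoC_mult; congr RtoC.
 have -> : Mmain X Y = Mmain (X * 1) (X * (Y / X)) by congr Mmain; field; lra.
 rewrite Mmain_homogeneous // (_ : 3 / 2 = 1 + / 2); last by lra.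
 by rewrite Rpower_plus Rpower_1 // Rpower_sqrt; lra.
rewrite -RtoC_minus Cmod_R; apply: Rle_trans (hK X Y X1 Y1) _; lmul.
have m := Rmin_l eps 1.
by apply: Rplus_le_compat; apply: Rmult_le_compat_l; try lra; apply: Rpower_mono_exp; lra.
Qed.
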